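(* Let $\mathbb{P}$ be a forcing poset with greatest lower bounds satisfying $*(\mathbb{P},\mathbb{P})$, let $\chi\geq\lambda_{\mathbb{P}}$ be a regular cardinal, and let $N\prec(H(\chi),\in,\mathbb{P})$. Suppose that $\mathbb{P}$ has universal strongly generic conditions on a stationary set, and $q$ is a universal strongly $(N,\mathbb{P})$-generic condition. Then the forcing poset $N\cap\mathbb{P}$ forces that the quotient $(\mathbb{P}/q)/\dot G_{N\cap\mathbb{P}}$ has universal strongly generic conditions on a stationary set. Moreover, whenever $H$ is a $V$-generic filter on $\mathbb{P}$ with $q\in H$, we have $V[H]=V[H\cap N][K]$, where $H\cap N$ is a $V$-generic filter on $N\cap\mathbb{P}$, $K$ is a $V[H\cap N]$-generic filter on $(\mathbb{P}/q)/(H\cap N)$, and the pair $(V[H\cap N],V[H])$ satisfies the $\omega_1$-approximation property.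
   Context: A forcing poset has greatest lower bounds if any two compatible conditions $p,q$ have a greatest lower bound $p\wedge q$. Property $*(\mathbb{P},\mathbb{P})$: for all $x,y,z\in\mathbb{P}$ pairwise compatible, $x$ is compatible with $y\wedge z$. $\lambda_{\mathbb{P}}$ is the least uncountable cardinal $\lambda$ with $\mathbb{P}\subseteq H(\lambda)$. For a set $N$, $q\in\mathbb{P}$ is strongly $(N,\mathbb{P})$-generic if every set dense in the poset $N\cap\mathbb{P}$ (induced order) is predense in $\mathbb{P}$ below $q$; it is universal strongly $(N,\mathbb{P})$-generic if moreover $q$ is compatible with every element of $N\cap\mathbb{P}$. A poset $\mathbb{R}$ has universal strongly generic conditions on a stationary set if there are stationarily many $M\in P_{\omega_1}(H(\lambda_{\mathbb{R}}))$ admitting a universal strongly $(M,\mathbb{R})$-generic condition. $\mathbb{P}/q=\{r\in\mathbb{P}:r\leq q\}$. For a filter $G$ on $N\cap\mathbb{P}$, $(\mathbb{P}/q)/G$ is the poset of conditions in $\mathbb{P}/q$ compatible with every condition in $G$, ordered as in $\mathbb{P}$. For transitive classes $W_1\subseteq W_2$, the pair $(W_1,W_2)$ has the $\omega_1$-approximation property if whenever $d\in W_2$ is a bounded subset of $W_1\cap\mathrm{On}$ such that $b\cap d\in W_1$ for every $b\in W_1$ which is countable in $W_1$, then $d\in W_1$. *)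

(* Defs.v *)
(* Vanilla Rocq: no library beyond Stdlib's lists is needed.

   Forcing is set up over transitive models.  The background universe [zset]
   is the cumulative hierarchy of Aczel sets, and V is a transitive class of
   [zset] satisfying first-order ZFC: it may be a countable transitive model,
   or all of [zset].  Statements made "in V" are satisfied by V; "forces" is
   the forcing relation of V on names; a V-generic filter is a genuine class of
   conditions meeting every dense set that belongs to V. *)

From Stdlib Require Import List.
Import ListNotations.
Set Implicit Arguments.

(** * The background universe of sets *)

Inductive Ens : Type := sup (A : Type) (f : A -> Ens).

Fixpoint Eq (x y : Ens) : Prop :=
  match x, y with
  | sup f, sup g =>
      (forall a, exists b, Eq (f a) (g b)) /\ (forall b, exists a, Eq (f a) (g b))
  end.

Definition In (x y : Ens) : Prop :=
  match y with sup f => exists a, Eq x (f a) end.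

(* The quotient of [Ens] by [Eq], so that extensional equality is [=]. *)
Definition zset : Type := {C : Ens -> Prop | exists x, C = Eq x}.
Definition cls (x : Ens) : zset := exist _ (Eq x) (ex_intro _ x eq_refl).
Definition mem (X Y : zset) : Prop :=
  exists x y, proj1_sig X x /\ proj1_sig Y y /\ In x y.
Definition zempty : zset := cls (sup (fun b : False => match b with end)).

Notation "x ∈ y" := (mem x y) (at level 70) : type_scope.

Definition class := zset -> Prop.

Definition transitive_class (W : class) : Prop :=
  forall x y, W y -> x ∈ y -> W x.

(* z = (x, y), the Kuratowski pair. *)
Definition opair (z x y : zset) : Prop :=
  exists a b, (forall w, w ∈ a <-> w = x) /\
              (forall w, w ∈ b <-> w = x \/ w = y) /\
              (forall w, w ∈ z <-> w = a \/ w = b).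

(* (x, y) ∈ r *)
Definition rel (r : zset) (x y : zset) : Prop := exists z, opair z x y /\ z ∈ r.

(** * First-order formulas *)

(* Formulas over ∈, = and unary predicate symbols taken from L, with variables
   named by numbers.  The other connectives are the classical abbreviations. *)
Inductive fml (L : Type) : Type :=
| Mem (i j : nat)
| Equ (i j : nat)
| Prd (r : L) (i : nat)
| Bot
| Imp (a b : fml L)
| All (i : nat) (a : fml L).
Arguments Mem {L}.
Arguments Equ {L}.
Arguments Bot {L}.

Definition upd (e : nat -> zset) (i : nat) (x : zset) : nat -> zset :=
  fun j => if Nat.eqb j i then x else e j.

Fixpoint sat (L : Type) (I : L -> class) (W : class) (e : nat -> zset)
    (f : fml L) : Prop :=
  match f with
  | Mem i j => e i ∈ e j
  | Equ i j => e i = e j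
  | Prd r i => I r (e i)
  | Bot => False
  | Imp a b => sat I W e a -> sat I W e b
  | All i a => forall x, W x -> sat I W (upd e i x) a
  end.

Definition pure := fml Empty_set.
Definition no_symbol (r : Empty_set) : class := match r with end.
Definition psat (W : class) (e : nat -> zset) (f : pure) : Prop :=
  sat no_symbol W e f.

Definition elementary (L : Type) (I : L -> class) (N M : class) : Prop :=
  (forall x, N x -> M x) /\ (exists x, N x) /\
  forall (f : fml L) (e : nat -> zset), (forall i, N (e i)) ->
    (sat I N e f <-> sat I M e f).

(* N ≺ (M, ∈, P), the order of P being part of the structure:
   [true] names the set P and [false] the set of pairs le. *)
Definition elementary_sub (N M P le : zset) : Prop :=
  elementary (fun (b : bool) x => if b then x ∈ P else x ∈ le)
    (fun x => x ∈ N) (fun x => x ∈ M).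

(** * Models of ZFC *)

Record ZFC (W : class) : Prop := {
  zfc_ext : forall x y, W x -> W y ->
    (forall z, W z -> (z ∈ x <-> z ∈ y)) -> x = y;
  zfc_foundation : forall x, W x -> (exists y, W y /\ y ∈ x) ->
    exists y, W y /\ y ∈ x /\ forall z, W z -> z ∈ y -> ~ z ∈ x;
  zfc_pairing : forall x y, W x -> W y ->
    exists z, W z /\ forall w, W w -> (w ∈ z <-> w = x \/ w = y);
  zfc_union : forall x, W x ->
    exists u, W u /\ forall w, W w -> (w ∈ u <-> exists y, W y /\ y ∈ x /\ w ∈ y);
  zfc_power : forall x, W x ->
    exists p, W p /\
      forall y, W y -> (y ∈ p <-> forall w, W w -> w ∈ y -> w ∈ x);
  zfc_infinity : exists x, W x /\
    (exists o, W o /\ o ∈ x /\ forall w, W w -> ~ w ∈ o) /\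
    forall y, W y -> y ∈ x ->
      exists s, W s /\ s ∈ x /\ forall w, W w -> (w ∈ s <-> w ∈ y \/ w = y);
  zfc_separation : forall (f : pure) (e : nat -> zset) (a : zset),
    (forall i, W (e i)) -> W a ->
    exists b, W b /\
      forall x, W x -> (x ∈ b <-> x ∈ a /\ psat W (upd e 0 x) f);
  zfc_replacement : forall (f : pure) (e : nat -> zset) (a : zset),
    (forall i, W (e i)) -> W a ->
    (forall x y y', W x -> W y -> W y' -> x ∈ a ->
       psat W (upd (upd e 0 x) 1 y) f -> psat W (upd (upd e 0 x) 1 y') f ->
       y = y') ->
    exists b, W b /\
      forall y, W y ->
        (y ∈ b <-> exists x, W x /\ x ∈ a /\ psat W (upd (upd e 0 x) 1 y) f);
  zfc_choice : forall a, W a ->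
    (forall x, W x -> x ∈ a -> exists y, W y /\ y ∈ x) ->
    (forall x x' y, W x -> W x' -> W y ->
       x ∈ a -> x' ∈ a -> y ∈ x -> y ∈ x' -> x = x') ->
    exists c, W c /\ forall x, W x -> x ∈ a ->
      exists y, W y /\ y ∈ c /\ y ∈ x /\
        forall y', W y' -> y' ∈ c -> y' ∈ x -> y' = y
}.

(** * Set-theoretic notions as formulas of the language of set theory *)

(* A formula in context: given the number n of variables in scope (named
   0, ..., n-1), a formula.  A quantifier binds the variable named n. *)
Definition bform := nat -> pure.

Definition fMem (x y : nat) : bform := fun _ => Mem x y.
Definition fEq (x y : nat) : bform := fun _ => Equ x y.
Definition fImp (a b : bform) : bform := fun n => Imp (a n) (b n).
Definition fNot (a : bform) : bform := fun n => Imp (a n) Bot.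
Definition fAnd (a b : bform) : bform := fNot (fImp a (fNot b)).
Definition fOr (a b : bform) : bform := fImp (fNot a) b.
Definition fIff (a b : bform) : bform := fAnd (fImp a b) (fImp b a).
Definition fAll (f : nat -> bform) : bform := fun n => All n (f n (S n)).
Definition fEx (f : nat -> bform) : bform := fNot (fAll (fun x => fNot (f x))).

(* The formula F with its free variables 0, ..., k-1 interpreted by a list of
   k parameters. *)
Definition env (xs : list zset) : nat -> zset := fun i => nth i xs zempty.
Definition Sat (W : class) (xs : list zset) (F : bform) : Prop :=
  psat W (env xs) (F (length xs)).

Declare Scope fml_scope.
Delimit Scope fml_scope with fml.
Bind Scope fml_scope with bform.
Notation "x ∈ y" := (fMem x y) (at level 70) : fml_scope.
Notation "x ≐ y" := (fEq x y) (at level 70) : fml_scope.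
Notation "~ a" := (fNot a) : fml_scope.
Notation "a /\ b" := (fAnd a b) : fml_scope.
Notation "a \/ b" := (fOr a b) : fml_scope.
Notation "a ⇒ b" := (fImp a b) (at level 90, right associativity) : fml_scope.
Notation "a ⇔ b" := (fIff a b) (at level 95) : fml_scope.
Notation "'ALL' x , F" := (fAll (fun x => F%fml))
  (at level 200, x name, right associativity) : fml_scope.
Notation "'EX' x , F" := (fEx (fun x => F%fml))
  (at level 200, x name, right associativity) : fml_scope.
Notation "'ALL' x ∈ y , F" := (fAll (fun x => fImp (fMem x y) F%fml))
  (at level 200, x name, right associativity) : fml_scope.
Notation "'EX' x ∈ y , F" := (fEx (fun x => fAnd (fMem x y) F%fml))
  (at level 200, x name, right associativity) : fml_scope.

Section Formulas.
Local Open Scope fml_scope.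

Definition sub x y : bform := ALL z ∈ x, z ∈ y.
Definition is_empty x : bform := ALL y, ~ y ∈ x.
Definition is_upair z x y : bform := ALL w, (w ∈ z ⇔ (w ≐ x \/ w ≐ y)).
Definition is_opair z x y : bform :=
  EX a, EX b, (is_upair a x x /\ is_upair b x y /\ is_upair z a b).
Definition is_union u x : bform := ALL w, (w ∈ u ⇔ (EX y ∈ x, w ∈ y)).
(* (x, y) ∈ r *)
Definition app r x y : bform := EX z ∈ r, is_opair z x y.

Definition is_function f a b : bform :=
  (ALL z ∈ f, EX x ∈ a, EX y ∈ b, is_opair z x y) /\
  (ALL x ∈ a, EX y, app f x y) /\
  (ALL x, ALL y, ALL y', (app f x y ⇒ app f x y' ⇒ y ≐ y')).
Definition injects a b : bform :=
  EX f, (is_function f a b /\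
         ALL x, ALL x', ALL y, (app f x y ⇒ app f x' y ⇒ x ≐ x')).

Definition transitive x : bform := ALL y ∈ x, sub y x.
Definition ordinal x : bform := transitive x /\ ALL y ∈ x, transitive y.
Definition is_succ y x : bform := ALL z, (z ∈ y ⇔ (z ∈ x \/ z ≐ x)).
Definition is_omega w : bform :=
  ordinal w /\ (EX x ∈ w, is_empty x) /\ (ALL x ∈ w, EX y ∈ w, is_succ y x) /\
  (ALL x ∈ w, (is_empty x \/ EX y ∈ w, is_succ x y)).

Definition countable x : bform := EX w, (is_omega w /\ injects x w).
Definition cardinal k : bform := ordinal k /\ ALL a ∈ k, ~ injects k a.
Definition uncountable_cardinal k : bform := cardinal k /\ ~ countable k.
Definition regular_cardinal k : bform :=
  cardinal k /\ (EX w, (is_omega w /\ sub w k)) /\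
  ALL a ∈ k, ALL f, (is_function f a k ⇒
    EX b ∈ k, ALL x, ALL y, (app f x y ⇒ y ∈ b)).

(* H(k): sets whose transitive closure has size less than the cardinal k *)
Definition is_trcl t x : bform :=
  sub x t /\ transitive t /\ ALL s, (sub x s ⇒ transitive s ⇒ sub t s).
Definition hereditarily_lt x k : bform :=
  EX t, (is_trcl t x /\ EX a ∈ k, injects t a).
Definition is_H h k : bform := ALL x, (x ∈ h ⇔ hereditarily_lt x k).
Definition sub_H P k : bform := ALL x ∈ P, hereditarily_lt x k.

(* l = λ_P *)
Definition is_lambda l P : bform :=
  uncountable_cardinal l /\ sub_H P l /\
  ALL m, (uncountable_cardinal m ⇒ sub_H P m ⇒ sub l m).

(* C is closed and unbounded in P_{ω_1}(A), the set of countable subsets of A *)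
Definition club C A : bform :=
  (ALL c ∈ C, (sub c A /\ countable c)) /\
  (ALL a, (sub a A ⇒ countable a ⇒ EX c ∈ C, sub a c)) /\
  (ALL D, (sub D C ⇒ countable D ⇒ (EX d, d ∈ D) ⇒
     (ALL c ∈ D, ALL d ∈ D, (sub c d \/ sub d c)) ⇒
     ALL u, (is_union u D ⇒ u ∈ C))).

(* A poset is given by its set P of conditions and by its order le, a set of
   pairs; le is only ever evaluated at elements of P, so that a poset "ordered
   as P" is given by the same le. *)
Definition compat P le x y : bform := EX z ∈ P, (app le z x /\ app le z y).

Definition strongly_generic N P le q : bform :=
  q ∈ P /\
  ALL D, ((ALL d ∈ D, (d ∈ N /\ d ∈ P)) ⇒
          (ALL p ∈ P, (p ∈ N ⇒ EX d ∈ D, app le d p)) ⇒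
          ALL r ∈ P, (app le r q ⇒ EX d ∈ D, compat P le r d)).
Definition universal_strongly_generic N P le q : bform :=
  strongly_generic N P le q /\
  ALL p ∈ P, (p ∈ N ⇒ compat P le q p).

Definition has_usg_stationary P le : bform :=
  EX l, EX h, (is_lambda l P /\ is_H h l /\
    ALL C, (club C h ⇒
      EX M ∈ C, EX q, universal_strongly_generic M P le q)).

(* Q is the set of conditions of (P/q)/G *)
Definition is_quotient Q P le q G : bform :=
  ALL r, (r ∈ Q ⇔ (r ∈ P /\ app le r q /\ ALL s ∈ G, compat P le r s)).

End Formulas.

(** * Posets *)

Definition poset (P le : zset) : Prop :=
  (forall z, z ∈ le -> exists x y, x ∈ P /\ y ∈ P /\ opair z x y) /\
  (forall x, x ∈ P -> rel le x x) /\
  (forall x y z, rel le x y -> rel le y z -> rel le x z) /\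
  (forall x y, rel le x y -> rel le y x -> x = y).

Definition compatible (P le x y : zset) : Prop :=
  exists z, z ∈ P /\ rel le z x /\ rel le z y.

Definition is_glb (P le w x y : zset) : Prop :=
  w ∈ P /\ rel le w x /\ rel le w y /\
  forall u, u ∈ P -> rel le u x -> rel le u y -> rel le u w.

Definition has_glbs (P le : zset) : Prop :=
  forall x y, x ∈ P -> y ∈ P -> compatible P le x y -> exists w, is_glb P le w x y.

Definition star (P le : zset) : Prop :=
  forall x y z, x ∈ P -> y ∈ P -> z ∈ P ->
    compatible P le x y -> compatible P le x z -> compatible P le y z ->
    forall w, is_glb P le w y z -> compatible P le x w.

(** * Forcing *)

(* Below, a poset is given by a class A of conditions and a set of pairs le.
   Any set may serve as a name; only its elements (σ, p) with p a condition
   matter. *)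

(* c is the canonical name of x.  No largest condition is assumed, so every
   condition is attached to every element. *)
Inductive check (A : class) : zset -> zset -> Prop :=
| check_intro x c :
    (forall z, z ∈ c -> exists y d p, y ∈ x /\ check A y d /\ A p /\ opair z d p) ->
    (forall y p, y ∈ x -> A p -> exists d, check A y d /\ rel c d p) ->
    check A x c.

(* g is the canonical name of the generic filter. *)
Definition gen_name (A : class) (g : zset) : Prop :=
  forall z, z ∈ g <-> exists p d, A p /\ check A p d /\ opair z d p.

(* p ⊩ τ = σ, by recursion on names: whenever (π, s) ∈ τ, densely many
   conditions below p and s force π to equal some ρ with (ρ, t) ∈ σ and t above
   the condition; and symmetrically. *)
Inductive forces_eq (A : class) (le : zset) : zset -> zset -> zset -> Prop :=
| forces_eq_intro p τ σ :
    (forall π s r, A s -> rel τ π s -> A r -> rel le r p -> rel le r s ->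
       exists r' ρ t, A r' /\ rel le r' r /\ A t /\ rel σ ρ t /\ rel le r' t /\
         forces_eq A le r' π ρ) ->
    (forall ρ t r, A t -> rel σ ρ t -> A r -> rel le r p -> rel le r t ->
       exists r' π s, A r' /\ rel le r' r /\ A s /\ rel τ π s /\ rel le r' s /\
         forces_eq A le r' π ρ) ->
    forces_eq A le p τ σ.

Definition forces_mem (A : class) (le p τ σ : zset) : Prop :=
  forall r, A r -> rel le r p ->
    exists r' ρ t, A r' /\ rel le r' r /\ A t /\ rel σ ρ t /\ rel le r' t /\
      forces_eq A le r' τ ρ.

(* The forcing relation of V; variables stand for names in V. *)
Fixpoint forces (V A : class) (le : zset) (e : nat -> zset) (f : pure)
    (p : zset) : Prop :=
  match f with
  | Mem i j => forces_mem A le p (e i) (e j)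
  | Equ i j => forces_eq A le p (e i) (e j)
  | Prd r _ => match r with end
  | Bot => False
  | Imp a b => forall r, A r -> rel le r p ->
                 forces V A le e a r -> forces V A le e b r
  | All i a => forall τ, V τ -> forces V A le (upd e i τ) a p
  end.

(* Every condition forces F, its free variables interpreted by a list of names. *)
Definition Forced (V A : class) (le : zset) (names : list zset) (F : bform) : Prop :=
  forall p, A p -> forces V A le (env names) (F (length names)) p.

(* G is a V-generic filter on A. *)
Definition generic (V A : class) (le : zset) (G : class) : Prop :=
  (forall p, G p -> A p) /\
  (exists p, G p) /\
  (forall p r, G p -> A r -> rel le p r -> G r) /\
  (forall p r, G p -> G r -> exists s, G s /\ rel le s p /\ rel le s r) /\
  (forall D, V D -> (forall d, d ∈ D -> A d) ->
     (forall p, A p -> exists d, d ∈ D /\ rel le d p) ->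
     exists d, d ∈ D /\ G d).

(* x is the value of the name τ under G: x = {σ^G : (σ, p) ∈ τ, p ∈ G}. *)
Inductive val (G : class) : zset -> zset -> Prop :=
| val_intro τ x :
    (forall y, y ∈ x -> exists σ p, G p /\ rel τ σ p /\ val G σ y) ->
    (forall σ p, G p -> rel τ σ p -> exists y, y ∈ x /\ val G σ y) ->
    val G τ x.

(* V[G] *)
Definition extension (V G : class) : class :=
  fun x => exists τ, V τ /\ val G τ x.

(* N ∩ P *)
Definition restr (N P : zset) : class := fun x => x ∈ N /\ x ∈ P.

(* The conditions of (P/q)/G. *)
Definition quotient (P le q : zset) (G : class) : class :=
  fun r => r ∈ P /\ rel le r q /\ forall s, G s -> compatible P le r s.

Definition omega1_approximation (W1 W2 : class) : Prop :=
  forall d, W2 d ->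
    (forall x, x ∈ d -> W1 x /\ Sat W1 [x] (ordinal 0)) ->
    (exists β, W1 β /\ Sat W1 [β] (ordinal 0) /\ forall x, x ∈ d -> x ∈ β) ->
    (forall b, W1 b -> Sat W1 [b] (countable 0) ->
       exists c, W1 c /\ forall x, x ∈ c <-> x ∈ b /\ x ∈ d) ->
    W1 d.

(* Main.v *)
(** Call u ∈ M a residue of r for M if every extension of u in M is compatible
    with r.  A condition p is strongly M-generic exactly when every r ≤ p has a
    residue for M, and by * and the greatest lower bounds three pairwise
    compatible conditions have a common extension.

    Let G be V-generic on N ∩ P and E a club of V[G].  A density argument in
    N ∩ P yields a countable M ∋ q with a universal strongly M-generic
    condition p such that p ∧ q is in (P/q)/G, where M is so closed that its
    trace on the quotient is that of a member of E.  Residues for M and for N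
    show that p ∧ q is universal strongly M-generic in the quotient.  Since V
    need not have generic filters, the forced statement is proved by
    contradiction: if no extension of some r forces it, collapse a countable
    elementary submodel of V containing r, apply the above to a filter generic
    over the collapse, and conclude by the truth lemma for that filter.

    For the approximation property, suppose d is not in V[H ∩ N] but all its
    countable pieces are.  Some condition s has the property that every
    condition below it can be extended so as to decide any given countable
    piece of d, and also splits: it has two extensions disagreeing on some
    ξ ∈ d.  Take a countable M ∋ s closed under such splittings with a
    universal strongly M-generic condition r, and a common extension of r and s
    which decides d ∩ M to be b.  The conditions in M which are incompatible
    with s or disagree with b are dense in M, hence one of them is compatible
    with that extension, a contradiction. *)

Require Import Defs.
From Stdlib Require Import List Classical ClassicalEpsilon FunctionalExtensionality PropExtensionality Arith Lia Cantor.
Import ListNotations.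
Set Implicit Arguments.

(** * The universe of sets *)

(** The hypothesis supplies models [M] in V, while the club to be met lives in V[G]. The club is
    coded by a function [f] of V[G] on a ground model set of names and numbers, and [M] should be
    closed under [f]. Since [f] is not in V, [M] is closed in V under Skolem functions that find
    conditions deciding values of [f]; strong genericity for [M] then yields closure under [f]
    itself. Residues replace projections: a residue for [N] controls when a condition survives in
    the quotient by G, a residue for [M] handles dense subsets of [M]. Elementarity of [N] gives
    greatest lower bounds in [N], so H ∩ N is directed and residues can be refined. The order is a
    set of pairs, which must lie in H(χ) for this; there regularity of χ enters. The truth lemma is
    proved once, for an elementary submodel [C] of V: [C] = V gives generic extensions, a countable
    hull gives the reflection argument. Definability is a predicate [D] on relations, closed under
    connectives, quantifiers and recursion on sets, so that separation and replacement apply without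
    writing formulas. *)

Lemma Eq_refl x : Eq x x.
Proof. induction x as [A f IH]; split; intro a; exists a; apply IH. Qed.

Lemma Eq_sym x : forall y, Eq x y -> Eq y x.
Proof.
  induction x as [A f IH]; intros [B g] [H1 H2]; split; intro b.
  - destruct (H2 b) as [a Ha]. exists a. now apply IH.
  - destruct (H1 b) as [a Ha]. exists a. now apply IH.
Qed.

Lemma Eq_trans x : forall y z, Eq x y -> Eq y z -> Eq x z.
Proof.
  induction x as [A f IH]; intros [B g] [C h] [H1 H2] [H3 H4]; split.
  - intro a. destruct (H1 a) as [b Hb]. destruct (H3 b) as [c Hc]. exists c. eauto.
  - intro c. destruct (H4 c) as [b Hb]. destruct (H2 b) as [a Ha]. exists a. eauto.
Qed.

Lemma cls_eq x y : cls x = cls y <-> Eq x y.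
Proof.
  split.
  - intro H. apply (f_equal (@proj1_sig _ _)) in H. cbn in H. rewrite H. apply Eq_refl.
  - intro H. apply eq_sig_hprop; [intros; apply proof_irrelevance|]. cbn.
    extensionality z. apply propositional_extensionality. split; intro K.
    + eapply Eq_trans; [apply Eq_sym; eassumption|assumption].
    + eapply Eq_trans; eassumption.
Qed.

Definition rep (X : zset) : Ens :=
  proj1_sig (constructive_indefinite_description _ (proj2_sig X)).

Lemma cls_rep X : cls (rep X) = X.
Proof.
  unfold rep. destruct (constructive_indefinite_description _ (proj2_sig X)) as [x Hx]. cbn.
  apply eq_sig_hprop; [intros; apply proof_irrelevance|]. cbn. now symmetry.
Qed.

Lemma in_eq x : forall x' y y', Eq x x' -> Eq y y' -> Defs.In x y -> Defs.In x' y'.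
Proof.
  intros x' [A f] [B g] H1 [H2 H3] [a Ha]. destruct (H2 a) as [b Hb]. exists b.
  eapply Eq_trans; [apply Eq_sym; eassumption|]. eapply Eq_trans; eassumption.
Qed.

Lemma mem_cls x y : cls x ∈ cls y <-> Defs.In x y.
Proof.
  split.
  - intros (x' & y' & H1 & H2 & H3). cbn in *. eapply in_eq; [| |eassumption]; now apply Eq_sym.
  - intro H. exists x, y. repeat split; auto; apply Eq_refl.
Qed.

Definition mk (A : Type) (f : A -> zset) : zset := cls (sup (fun a => rep (f a))).

Lemma mem_mk (A : Type) (f : A -> zset) z : z ∈ mk f <-> exists a, z = f a.
Proof.
  unfold mk. rewrite <- (cls_rep z). rewrite mem_cls. cbn.
  split; intros [a Ha]; exists a.
  - rewrite <- (cls_rep (f a)). now apply cls_eq.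
  - apply cls_eq. rewrite Ha, !cls_rep. reflexivity.
Qed.

Lemma zset_ext X Y : (forall z, z ∈ X <-> z ∈ Y) -> X = Y.
Proof.
  rewrite <- (cls_rep X), <- (cls_rep Y). destruct (rep X) as [A f], (rep Y) as [B g].
  intro H. apply cls_eq. split.
  - intro a. assert (K : cls (f a) ∈ cls (sup g)).
    { apply H, mem_cls. exists a. apply Eq_refl. }
    apply mem_cls in K. exact K.
  - intro b. assert (K : cls (g b) ∈ cls (sup f)).
    { apply H, mem_cls. exists b. apply Eq_refl. }
    apply mem_cls in K. destruct K as [a Ha]. exists a. now apply Eq_sym.
Qed.

Lemma mem_ind (P : zset -> Prop) : (forall x, (forall y, y ∈ x -> P y) -> P x) -> forall x, P x.
Proof.
  intros H x. rewrite <- (cls_rep x). generalize (rep x). clear x. intro x.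
  induction x as [A f IH]. apply H. intros y Hy. rewrite <- (cls_rep y) in Hy |- *.
  apply mem_cls in Hy. destruct Hy as [a Ha]. apply cls_eq in Ha. rewrite Ha. apply IH.
Qed.

(** Index type of a chosen tree. Separation, union and power set below are families, over subtypes,
    sums and predicates of such index types, that are fed to [mk]. *)
Definition El (X : zset) : Type := match rep X with @sup A _ => A end.
Definition el (X : zset) : El X -> zset :=
  match rep X as r return (match r with @sup A _ => A end -> zset) with
  | sup f => fun a => cls (f a)
  end.

Lemma mem_el X z : z ∈ X <-> exists a : El X, z = el X a.
Proof.
  unfold El, el. rewrite <- (cls_rep X) at 1. destruct (rep X) as [A f].
  rewrite <- (cls_rep z). rewrite mem_cls. cbn.
  split; intros [a Ha]; exists a; now apply cls_eq.
Qed.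

Definition sep (X : zset) (P : zset -> Prop) : zset :=
  mk (fun a : {a : El X | P (el X a)} => el X (proj1_sig a)).
Definition img (X : zset) (f : zset -> zset) : zset := mk (fun a : El X => f (el X a)).
Definition upair (x y : zset) : zset := mk (fun b : bool => if b then x else y).
Definition Un (X : zset) : zset :=
  mk (fun ab : {a : El X & El (el X a)} => el (el X (projT1 ab)) (projT2 ab)).
Definition pow (X : zset) : zset :=
  mk (fun p : El X -> Prop => mk (fun a : {a | p a} => el X (proj1_sig a))).
Definition sing x := upair x x.
Definition union2 x y := Un (upair x y).
Definition suc x := union2 x (sing x).
Definition subset (x y : zset) := forall z, z ∈ x -> z ∈ y.

Lemma mem_sep X P z : z ∈ sep X P <-> z ∈ X /\ P z.
Proof.
  unfold sep. rewrite mem_mk, mem_el. split.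
  - intros [[a Ha] ->]. cbn. eauto.
  - intros [[a ->] H]. now exists (exist _ a H).
Qed.

Lemma mem_img X f z : z ∈ img X f <-> exists x, x ∈ X /\ z = f x.
Proof.
  unfold img. rewrite mem_mk. split.
  - intros [a ->]. exists (el X a). rewrite mem_el. eauto.
  - intros (x & Hx & ->). apply mem_el in Hx. destruct Hx as [a ->]. eauto.
Qed.

Lemma mem_upair x y z : z ∈ upair x y <-> z = x \/ z = y.
Proof.
  unfold upair. rewrite mem_mk. split.
  - intros [[] ->]; auto.
  - intros [-> | ->]; [now exists true|now exists false].
Qed.

Lemma mem_Un X z : z ∈ Un X <-> exists y, y ∈ X /\ z ∈ y.
Proof.
  unfold Un. rewrite mem_mk. split.
  - intros [[a b] ->]. cbn. exists (el X a). rewrite !mem_el. eauto.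
  - intros (y & Hy & Hz). apply mem_el in Hy. destruct Hy as [a ->].
    apply mem_el in Hz. destruct Hz as [b ->]. now exists (existT _ a b).
Qed.

Lemma mem_pow X z : z ∈ pow X <-> subset z X.
Proof.
  unfold pow. rewrite mem_mk. split.
  - intros [p ->] w Hw. apply mem_mk in Hw. destruct Hw as [[a Ha] ->]. cbn. apply mem_el. eauto.
  - intros H. exists (fun a => el X a ∈ z). apply zset_ext. intro w. rewrite mem_mk. split.
    + intro Hw. pose proof (H _ Hw) as K. apply mem_el in K. destruct K as [a ->]. now exists (exist _ a Hw).
    + intros [[a Ha] ->]. exact Ha.
Qed.

Lemma mem_sing x z : z ∈ sing x <-> z = x.
Proof. unfold sing. rewrite mem_upair. tauto. Qed.

Lemma mem_union2 x y z : z ∈ union2 x y <-> z ∈ x \/ z ∈ y.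
Proof.
  unfold union2. rewrite mem_Un. split.
  - intros (w & Hw & Hz). apply mem_upair in Hw. destruct Hw as [-> | ->]; auto.
  - intros [H|H]; [exists x|exists y]; rewrite mem_upair; auto.
Qed.

Lemma mem_suc x z : z ∈ suc x <-> z ∈ x \/ z = x.
Proof. unfold suc. rewrite mem_union2, mem_sing. reflexivity. Qed.

Lemma not_mem_empty z : ~ z ∈ zempty.
Proof.
  unfold zempty. rewrite <- (cls_rep z), mem_cls. intros [[] _].
Qed.

Lemma mem_irrefl x : ~ x ∈ x.
Proof. induction x as [x IH] using mem_ind. intro H. exact (IH _ H H). Qed.

Lemma mem_asym x y : x ∈ y -> ~ y ∈ x.
Proof.
  revert y. induction x as [x IH] using mem_ind. intros y H K. exact (IH _ K _ K H).
Qed.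

Lemma suc_inj x y : suc x = suc y -> x = y.
Proof.
  intro H. assert (Hx : x ∈ suc y) by (rewrite <- H, mem_suc; auto).
  assert (Hy : y ∈ suc x) by (rewrite H, mem_suc; auto).
  rewrite mem_suc in *. destruct Hx as [Hx|]; auto. destruct Hy as [Hy|]; auto.
  exfalso. exact (mem_asym Hx Hy).
Qed.

Lemma inhabited_or_empty x : x = zempty \/ exists y, y ∈ x.
Proof.
  destruct (classic (exists y, y ∈ x)) as [H|H]; auto. left. apply zset_ext. intro z. split.
  - intro Hz. exfalso. eauto.
  - intro Hz. now apply not_mem_empty in Hz.
Qed.

Lemma mem_minimal (P : zset -> Prop) : (exists x, P x) -> exists x, P x /\ forall y, y ∈ x -> ~ P y.
Proof.
  intros [x Hx]. induction x as [x IH] using mem_ind.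
  destruct (classic (exists y, y ∈ x /\ P y)) as [(y & H1 & H2)|H]; eauto.
  exists x. split; auto. intros y Hy K. eauto.
Qed.

Fixpoint num (n : nat) : zset := match n with 0 => zempty | S m => suc (num m) end.
Definition omega : zset := mk num.

Lemma mem_omega z : z ∈ omega <-> exists n, z = num n.
Proof. apply mem_mk. Qed.

Lemma num_inj m : forall n, num m = num n -> m = n.
Proof.
  assert (Z : forall m, suc m <> zempty).
  { intros k H. apply (@not_mem_empty k). rewrite <- H, mem_suc. auto. }
  induction m as [|m IH]; intros [|n] H; cbn in H; auto.
  - now symmetry in H; apply Z in H.
  - now apply Z in H.
  - f_equal. apply IH, suc_inj, H.
Qed.

Lemma mem_num n z : z ∈ num n <-> exists m, m < n /\ z = num m.
Proof.
  induction n as [|n IH]; cbn.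
  - split; [intro H; now apply not_mem_empty in H|intros (m & H & _); lia].
  - rewrite mem_suc, IH. split.
    + intros [(m & H & ->)| ->]; [exists m|exists n]; split; auto; lia.
    + intros (m & H & ->). destruct (Nat.eq_dec m n) as [->|]; auto. left. exists m. split; auto. lia.
Qed.

Lemma num_in_omega n : num n ∈ omega.
Proof. apply mem_omega. eauto. Qed.

Definition opr (x y : zset) : zset := upair (sing x) (upair x y).

Lemma upair_eq a b c d : upair a b = upair c d -> (a = c /\ b = d) \/ (a = d /\ b = c).
Proof.
  intro H.
  assert (E : forall z, (z = a \/ z = b) <-> (z = c \/ z = d)) by (intro; rewrite <- !mem_upair, H; reflexivity).
  pose proof (proj1 (E a) (or_introl eq_refl)). pose proof (proj1 (E b) (or_intror eq_refl)).
  pose proof (proj2 (E c) (or_introl eq_refl)). pose proof (proj2 (E d) (or_intror eq_refl)).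
  intuition congruence.
Qed.

Lemma opr_inj x y x' y' : opr x y = opr x' y' -> x = x' /\ y = y'.
Proof.
  intro H. apply upair_eq in H. destruct H as [[H1 H2]|[H1 H2]];
  apply upair_eq in H1; apply upair_eq in H2; intuition congruence.
Qed.

Lemma opair_opr z x y : opair z x y <-> z = opr x y.
Proof.
  split.
  - intros (a & b & Ha & Hb & Hz). apply zset_ext. intro w. unfold opr. rewrite Hz, mem_upair.
    replace a with (sing x); [replace b with (upair x y); [reflexivity|]|]; apply zset_ext; intro v.
    + rewrite Hb. apply mem_upair.
    + rewrite Ha. apply mem_sing.
  - intros ->. exists (sing x), (upair x y). repeat split; unfold opr; rewrite ?mem_sing, ?mem_upair; auto.
Qed.

Lemma rel_opr r x y : rel r x y <-> opr x y ∈ r.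
Proof.
  unfold rel. split.
  - intros (z & H & K). apply opair_opr in H. now subst.
  - intro H. exists (opr x y). split; auto. now apply opair_opr.
Qed.

Definition prod (x y : zset) : zset := Un (img x (fun a => img y (opr a))).

Lemma mem_prod x y z : z ∈ prod x y <-> exists a b, a ∈ x /\ b ∈ y /\ z = opr a b.
Proof.
  unfold prod. rewrite mem_Un. split.
  - intros (w & H & K). apply mem_img in H. destruct H as (a & Ha & ->).
    apply mem_img in K. destruct K as (b & Hb & ->). eauto.
  - intros (a & b & Ha & Hb & ->). exists (img y (opr a)). split; apply mem_img; eauto.
Qed.

Lemma opr_in_prod x y a b : opr a b ∈ prod x y <-> a ∈ x /\ b ∈ y.
Proof.
  rewrite mem_prod. split.
  - intros (a' & b' & H1 & H2 & H). apply opr_inj in H. destruct H; subst. auto.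
  - intros [H1 H2]. eauto.
Qed.

(** * Recursion on membership *)

Lemma mem_wf : well_founded mem.
Proof. intro x. induction x as [x IH] using mem_ind. now constructor. Qed.

(** Makes a recursive call total: [Fix] offers it only with a proof of membership, while [img] wants
    a function on all sets. *)
Definition guard (P : Prop) (f : P -> zset) : zset :=
  match excluded_middle_informative P with left h => f h | right _ => zempty end.

Definition tc : zset -> zset :=
  Fix mem_wf (fun _ => zset)
    (fun x rec => union2 x (Un (img x (fun y => guard (rec y))))).

Lemma tc_eq x : tc x = union2 x (Un (img x tc)).
Proof.
  unfold tc. rewrite Fix_eq.
  - f_equal. f_equal. apply zset_ext. intro z. rewrite !mem_img.
    split; intros (y & Hy & ->); exists y; split; auto; unfold guard;
    destruct (excluded_middle_informative _) as [h|h]; auto; contradiction.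
  - intros y f g H. do 3 f_equal. extensionality w. f_equal. extensionality h. apply H.
Qed.

Lemma mem_tc x z : z ∈ tc x <-> z ∈ x \/ exists y, y ∈ x /\ z ∈ tc y.
Proof.
  rewrite tc_eq at 1. rewrite mem_union2, mem_Un. split.
  - intros [H|(y & Hy & Hz)]; auto. apply mem_img in Hy. destruct Hy as (w & Hw & ->). eauto.
  - intros [H|(y & Hy & Hz)]; auto. right. exists (tc y). rewrite mem_img. eauto.
Qed.

Definition trans (x : zset) := forall y, y ∈ x -> subset y x.

Lemma tc_trans x : trans (tc x).
Proof.
  induction x as [x IH] using mem_ind. intros y Hy z Hz. apply mem_tc in Hy.
  apply mem_tc. right. destruct Hy as [Hy|(w & Hw & Hy)].
  - exists y. split; auto. apply mem_tc. auto.
  - exists w. split; auto. eapply IH; eauto.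
Qed.

Lemma tc_sub x : subset x (tc x).
Proof. intros y Hy. apply mem_tc. auto. Qed.

Lemma tc_least x t : subset x t -> trans t -> subset (tc x) t.
Proof.
  induction x as [x IH] using mem_ind. intros H T z Hz. apply mem_tc in Hz.
  destruct Hz as [Hz|(y & Hy & Hz)]; auto. apply (IH y); auto.
Qed.

(** Induction along the transitive closure suits names: a name occurring in τ sits inside a pair,
    hence several levels below τ. *)
Lemma tc_ind (P : zset -> Prop) : (forall x, (forall y, y ∈ tc x -> P y) -> P x) -> forall x, P x.
Proof.
  intros H x. assert (K : forall y, y ∈ tc x \/ y = x -> P y).
  { induction x as [x IH] using mem_ind. 
    assert (K : forall y, y ∈ tc x -> P y).
    { intros y Hy. apply mem_tc in Hy. destruct Hy as [Hy|(z & Hz & Hy)]; eauto. }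
    intros y [Hy| ->]; auto. }
  apply K. auto.
Qed.

Lemma tc_mono x y : y ∈ tc x -> subset (tc y) (tc x).
Proof. intros H. apply tc_least; [|apply tc_trans]. apply tc_trans, H. Qed.

Lemma tc_wf : well_founded (fun y x => y ∈ tc x).
Proof. intro x. induction x as [x IH] using tc_ind. now constructor. Qed.

Definition graph (f : zset -> zset) (x : zset) : zset := img x (fun y => opr y (f y)).

(** The step receives the earlier values as a set of pairs, not as a function, so that the recursion
    can be expressed by a first-order formula and carried out inside a model. *)
Definition trec (F : zset -> zset -> zset) : zset -> zset :=
  Fix tc_wf (fun _ => zset)
    (fun x rec => F x (img (tc x) (fun y => opr y (guard (rec y))))).

Lemma trec_eq F x : trec F x = F x (graph (trec F) (tc x)).
Proof.
  unfold trec, graph. rewrite Fix_eq.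
  - f_equal. apply zset_ext. intro z. rewrite !mem_img.
    split; intros (y & Hy & ->); exists y; split; auto; unfold guard;
    destruct (excluded_middle_informative _) as [h|h]; auto; contradiction.
  - intros y f g H. do 2 f_equal. extensionality w. do 2 f_equal. extensionality h. apply H.
Qed.

Lemma mem_graph f x y v : opr y v ∈ graph f x <-> y ∈ x /\ v = f y.
Proof.
  unfold graph. rewrite mem_img. split.
  - intros (y' & H & E). apply opr_inj in E. destruct E; subst. auto.
  - intros [H ->]. eauto.
Qed.

(** * Renaming of variables *)

Section Renaming.
Variable L : Type.

Fixpoint bound (f : fml L) : nat :=
  match f with
  | Mem i j | Equ i j => S (Nat.max i j)
  | Prd _ i => S i
  | Bot => 0
  | Imp a b => Nat.max (bound a) (bound b)
  | All i a => Nat.max (S i) (bound a)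
  end.

Fixpoint sup_below (r : nat -> nat) (n : nat) : nat :=
  match n with 0 => 0 | S m => Nat.max (r m) (sup_below r m) end.

Lemma le_sup_below r n k : k < n -> r k <= sup_below r n.
Proof.
  induction n as [|n IH]; intro H; [lia|]. cbn. destruct (Nat.eq_dec k n) as [->|]; [lia|].
  specialize (IH ltac:(lia)). lia.
Qed.

(** The bound variable is moved above all [r k] for the variables [k] of the body, so nothing is
    captured even if [r] is not injective. *)
Fixpoint ren (r : nat -> nat) (f : fml L) : fml L :=
  match f with
  | Mem i j => Mem (r i) (r j)
  | Equ i j => Equ (r i) (r j)
  | Prd s i => Prd s (r i)
  | Bot => Bot
  | Imp a b => Imp (ren r a) (ren r b)
  | All i a =>
      let j := S (sup_below r (bound a)) in
      All j (ren (fun k => if Nat.eqb k i then j else r k) a)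
  end.

Lemma sat_ext (I : L -> class) W f : forall e e',
  (forall k, k < bound f -> e k = e' k) -> (sat I W e f <-> sat I W e' f).
Proof.
  induction f as [i j|i j|s i| |a IHa b IHb|i a IHa]; cbn -[Nat.max]; intros e e' H.
  - rewrite (H i), (H j) by lia. reflexivity.
  - rewrite (H i), (H j) by lia. reflexivity.
  - rewrite (H i) by lia. reflexivity.
  - reflexivity.
  - rewrite (IHa e e'), (IHb e e'); [reflexivity| |]; intros; apply H; lia.
  - split; intros K x Hx; specialize (K x Hx); [rewrite <- (IHa (upd e i x))|rewrite (IHa (upd e i x) (upd e' i x))];
    auto; intros k Hk; unfold upd; destruct (Nat.eqb k i); auto; apply H; lia.
Qed.

Lemma sat_ren (I : L -> class) W f : forall r e,
  sat I W e (ren r f) <-> sat I W (fun k => e (r k)) f.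
Proof.
  induction f as [i j|i j|s i| |a IHa b IHb|i a IHa]; cbn -[Nat.max]; intros r e; try reflexivity.
  - rewrite IHa, IHb. reflexivity.
  - set (j := S (sup_below r (bound a))).
    assert (K : forall x, sat I W (upd e j x) (ren (fun k => if Nat.eqb k i then j else r k) a)
                          <-> sat I W (upd (fun k => e (r k)) i x) a).
    { intro x. rewrite IHa. apply sat_ext. intros k Hk. unfold upd at 2.
      destruct (Nat.eqb k i); unfold upd.
      - now rewrite Nat.eqb_refl.
      - destruct (Nat.eqb_spec (r k) j) as [E|E]; auto.
        pose proof (le_sup_below r Hk). unfold j in E. lia. }
    split; intros H x Hx; apply K; auto.
Qed.
End Renaming.

(** * Definable predicates *)

Definition assignment := nat -> zset.
Definition scons (x : zset) (e : assignment) : assignment :=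
  fun k => match k with 0 => x | S k => e k end.

(* Variables at even places, parameters at odd places. *)
Definition mix (e c : assignment) : assignment :=
  fun k => if Nat.even k then e (Nat.div2 k) else c (Nat.div2 k).

Lemma mix_even e c k : mix e c (2 * k) = e k.
Proof. unfold mix. rewrite Nat.even_mul. cbn [Nat.even orb]. now rewrite Nat.div2_double. Qed.
Lemma mix_odd e c k : mix e c (S (2 * k)) = c k.
Proof.
  unfold mix. rewrite Nat.even_succ, Nat.odd_mul. cbn [Nat.odd Nat.even negb andb].
  now rewrite Nat.div2_succ_double.
Qed.

Lemma even_odd_ind (P : nat -> Prop) : (forall k, P (2 * k)) -> (forall k, P (S (2 * k))) -> forall n, P n.
Proof.
  intros H1 H2 n. destruct (Nat.Even_or_Odd n) as [[k ->]|[k ->]]; auto. rewrite Nat.add_1_r. auto.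
Qed.

Definition split_ren (r s : nat -> nat) (k : nat) : nat :=
  if Nat.even k then r (Nat.div2 k) else s (Nat.div2 k).

Lemma split_ren_even r s k : split_ren r s (2 * k) = r k.
Proof. unfold split_ren. rewrite Nat.even_mul. cbn [Nat.even orb]. now rewrite Nat.div2_double. Qed.
Lemma split_ren_odd r s k : split_ren r s (S (2 * k)) = s k.
Proof.
  unfold split_ren. rewrite Nat.even_succ, Nat.odd_mul. cbn [Nat.odd Nat.even negb andb].
  now rewrite Nat.div2_succ_double.
Qed.

Definition in_class (W : class) (e : assignment) : Prop := forall i, W (e i).

(* The parameter class [C] is kept apart from [W] so that definability can be
   applied to an elementary submodel [C] of [W]. *)
Definition D (W C : class) (Phi : assignment -> Prop) : Prop :=
  exists (f : pure) (c : assignment), in_class C c /\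
    forall e, in_class W e -> (Phi e <-> psat W (mix e c) f).

(** Variable 0 holds the value and the arguments are shifted by one. This is the shape that
    quantification produces, so a term is substituted by quantifying over its value. *)
Definition TD (W C : class) (t : assignment -> zset) : Prop :=
  (forall e, in_class W e -> W (t e)) /\
  D W C (fun e => e 0 = t (fun k => e (S k))).

Record dctx (W C : class) : Prop := {
  dctx_tr : transitive_class W;
  dctx_sub : forall x, C x -> W x;
  dctx_inh : exists x, C x }.

Lemma in_class_scons (W : class) x e : W x -> in_class W e -> in_class W (scons x e).
Proof. intros H K [|k]; cbn; auto. Qed.

Lemma in_class_upd (W : class) e i x : W x -> in_class W e -> in_class W (upd e i x).
Proof. intros H K k. unfold upd. destruct (Nat.eqb k i); auto. Qed.

Arguments in_class_scons {W x e}.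
Arguments in_class_upd {W e i x}.

Section Definable.
Variables W C : class.
Hypothesis X : dctx W C.

#[local] Set Default Proof Using "All".

Lemma D_ext Phi Psi : (forall e, in_class W e -> (Phi e <-> Psi e)) -> D W C Psi -> D W C Phi.
Proof. intros H (f & c & Hc & K). exists f, c. split; auto. intros e He. rewrite H; auto. Qed.

Lemma D_ren (r : nat -> nat) Phi : D W C Phi -> D W C (fun e => Phi (fun k => e (r k))).
Proof.
  intros (f & c & Hc & K).
  exists (ren (split_ren (fun k => 2 * r k) (fun k => S (2 * k))) f), c. split; auto.
  intros e He. unfold psat. rewrite sat_ren. rewrite K; [|intro; apply He].
  unfold psat. apply sat_ext. intros k _. induction k as [k|k] using even_odd_ind.
  - now rewrite split_ren_even, !mix_even.
  - now rewrite split_ren_odd, !mix_odd.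
Qed.

Lemma D_psat (f : pure) (t : nat -> nat + zset) : (forall i c, t i = inr c -> C c) ->
  D W C (fun e => psat W (fun i => match t i with inl k => e k | inr c => c end) f).
Proof.
  intro H. destruct (dctx_inh X) as [c0 Hc0].
  exists (ren (fun i => match t i with inl k => 2 * k | inr _ => S (2 * i) end) f),
    (fun i => match t i with inl _ => c0 | inr c => c end).
  split.
  - intro i. destruct (t i) eqn:E; eauto.
  - intros e He. unfold psat. rewrite sat_ren. apply sat_ext. intros k _.
    destruct (t k) eqn:E; [now rewrite mix_even|rewrite mix_odd]. now rewrite E.
Qed.

Lemma D_const (Q : Prop) : D W C (fun _ => Q).
Proof.
  destruct (dctx_inh X) as [c0 Hc0]. destruct (classic Q) as [H|H].
  - exists (Imp Bot Bot), (fun _ => c0). split; [intro; auto|]. cbn. tauto.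
  - exists Bot, (fun _ => c0). split; [intro; auto|]. cbn. tauto.
Qed.

Lemma D_imp Phi Psi : D W C Phi -> D W C Psi -> D W C (fun e => Phi e -> Psi e).
Proof.
  intros (f & c & Hc & H) (g & d & Hd & K).
  (* The parameters [c] and [d] are interleaved: the first formula finds its own at the even places
     of the new parameter sequence, the second at the odd places. *)
  exists (Imp (ren (split_ren (fun k => 2 * k) (fun k => S (2 * (2 * k)))) f)
          (ren (split_ren (fun k => 2 * k) (fun k => S (2 * S (2 * k)))) g)), (mix c d). split.
  - intro k. induction k as [k|k] using even_odd_ind; [rewrite mix_even|rewrite mix_odd]; auto.
  - intros e He. unfold psat. cbn [sat]. rewrite !sat_ren, H, K by auto. unfold psat.
    assert (A : forall f e e', (forall k, e k = e' k) -> (sat no_symbol W e f <-> sat no_symbol W e' f))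
      by (intros; apply sat_ext; auto).
    assert (B1 : forall k, mix e c k = mix e (mix c d) (split_ren (fun k => 2 * k) (fun k => S (2 * (2 * k))) k)).
    { intro k. induction k as [k|k] using even_odd_ind.
      - now rewrite split_ren_even, !mix_even.
      - now rewrite split_ren_odd, !mix_odd, mix_even. }
    assert (B2 : forall k, mix e d k = mix e (mix c d) (split_ren (fun k => 2 * k) (fun k => S (2 * S (2 * k))) k)).
    { intro k. induction k as [k|k] using even_odd_ind.
      - now rewrite split_ren_even, !mix_even.
      - now rewrite split_ren_odd, !mix_odd. }
    rewrite (A _ _ _ B1), (A _ _ _ B2). reflexivity.
Qed.

Lemma D_not Phi : D W C Phi -> D W C (fun e => ~ Phi e).
Proof. intro H. apply D_imp; auto. apply D_const. Qed.

Lemma D_and Phi Psi : D W C Phi -> D W C Psi -> D W C (fun e => Phi e /\ Psi e).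
Proof.
  intros H K. eapply D_ext; [|apply D_not, D_imp; [exact H|apply D_not; exact K]]. intros. cbn. tauto.
Qed.

Lemma D_or Phi Psi : D W C Phi -> D W C Psi -> D W C (fun e => Phi e \/ Psi e).
Proof.
  intros H K. eapply D_ext; [|apply D_imp; [apply D_not; exact H|exact K]]. intros. cbn. tauto.
Qed.

Lemma D_iff Phi Psi : D W C Phi -> D W C Psi -> D W C (fun e => Phi e <-> Psi e).
Proof. intros H K. apply D_and; apply D_imp; auto. Qed.

Lemma D_all (Phi : zset -> assignment -> Prop) :
  D W C (fun e => Phi (e 0) (fun k => e (S k))) -> D W C (fun e => forall x, W x -> Phi x e).
Proof.
  (* The quantified variable goes to the fresh even place [j], the other even places move down by
     two and the parameters at odd places stay. Every place used by [f] is below [j]. *)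
  intros (f & c & Hc & H). set (j := 2 * bound f).
  exists (All j (ren (fun k => if Nat.eqb k 0 then j else if Nat.even k then Nat.pred (Nat.pred k) else k) f)), c.
  split; auto. intros e He. unfold psat. cbn [sat].
  assert (K : forall x, W x -> (Phi x e <->
    sat no_symbol W (upd (mix e c) j x)
      (ren (fun k => if Nat.eqb k 0 then j else if Nat.even k then Nat.pred (Nat.pred k) else k) f))).
  { intros x Hx. rewrite sat_ren. pose proof (H (scons x e) (in_class_scons Hx He)) as K. cbn in K.
    change (fun k => e k) with e in K. rewrite K. apply sat_ext. intros k Hk.
    assert (Hj : k < j) by (unfold j; lia). revert Hj. clear Hk.
    induction k as [k|k] using even_odd_ind; intro Hj.
    - rewrite mix_even. destruct k as [|k].
      + cbn. unfold upd. now rewrite Nat.eqb_refl.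
      + replace (Nat.eqb (2 * S k) 0) with false by (symmetry; apply Nat.eqb_neq; lia).
        rewrite Nat.even_mul. cbn [Nat.even orb scons].
        replace (Nat.pred (Nat.pred (2 * S k))) with (2 * k) by lia.
        unfold upd. replace (Nat.eqb (2 * k) j) with false by (symmetry; apply Nat.eqb_neq; lia).
        now rewrite mix_even.
    - rewrite mix_odd. replace (Nat.eqb (S (2 * k)) 0) with false by reflexivity.
      rewrite Nat.even_succ, Nat.odd_mul. cbn [Nat.odd Nat.even negb andb].
      unfold upd. replace (Nat.eqb (S (2 * k)) j) with false by (symmetry; apply Nat.eqb_neq; lia).
      now rewrite mix_odd. }
  split; intros A x Hx; apply K; auto.
Qed.

Lemma D_ex (Phi : zset -> assignment -> Prop) :
  D W C (fun e => Phi (e 0) (fun k => e (S k))) -> D W C (fun e => exists x, W x /\ Phi x e).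
Proof.
  intro H. eapply D_ext; [|apply D_not, (@D_all (fun x e => ~ Phi x e)), D_not; exact H].
  intros e He. cbn. split.
  - intros (x & Hx & K) A. exact (A x Hx K).
  - intro A. apply NNPP. intro B. apply A. intros x Hx K. apply B. eauto.
Qed.

Lemma D_sub t (Phi : zset -> assignment -> Prop) :
  TD W C t -> D W C (fun e => Phi (e 0) (fun k => e (S k))) -> D W C (fun e => Phi (t e) e).
Proof.
  intros [Ht Hd] H. eapply D_ext; [|apply (@D_ex (fun x e => x = t e /\ Phi x e)), D_and; [exact Hd|exact H]].
  intros e He. cbn. split; [eauto|]. intros (x & _ & -> & K). exact K.
Qed.

Lemma D_mem_base i j : D W C (fun e => e i ∈ e j).
Proof.
  destruct (dctx_inh X) as [c0 Hc0]. exists (Mem (2 * i) (2 * j)), (fun _ => c0). split; [intro; auto|].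
  intros e _. unfold psat. cbn [sat]. now rewrite !mix_even.
Qed.
Lemma D_eq_base i j : D W C (fun e => e i = e j).
Proof.
  destruct (dctx_inh X) as [c0 Hc0]. exists (Equ (2 * i) (2 * j)), (fun _ => c0). split; [intro; auto|].
  intros e _. unfold psat. cbn [sat]. now rewrite !mix_even.
Qed.

Lemma TD_var i : TD W C (fun e => e i).
Proof. split; [intros e He; apply He|apply D_eq_base]. Qed.

Lemma TD_const c : C c -> TD W C (fun _ => c).
Proof.
  intro H. split; [intros; now apply (dctx_sub X)|].
  exists (Equ 0 1), (fun _ => c). split; [intro; auto|]. intros e _. reflexivity.
Qed.

Lemma D_rel1 (R : zset -> Prop) t : D W C (fun e => R (e 0)) -> TD W C t -> D W C (fun e => R (t e)).
Proof. intros H Ht. exact (D_sub (fun x _ => R x) Ht H). Qed.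

Lemma TD_ren (r : nat -> nat) t : TD W C t -> TD W C (fun e => t (fun k => e (r k))).
Proof.
  intros [H K]. split; [intros e He; apply H; intro; apply He|].
  exact (@D_ren (fun k => match k with 0 => 0 | S k => S (r k) end) _ K).
Qed.

(** Reduces definability to the case of variables: the terms are substituted one after the other,
    each under the variables already introduced. *)
Lemma D_rel2 (R : zset -> zset -> Prop) t u :
  D W C (fun e => R (e 0) (e 1)) -> TD W C t -> TD W C u -> D W C (fun e => R (t e) (u e)).
Proof.
  intros H Ht Hu. apply (D_sub (fun x e => R x (u e)) Ht).
  apply (D_sub (fun y e => R (e 0) y) (TD_ren S Hu)).
  exact (@D_ren (fun k => match k with 0 => 1 | _ => 0 end) _ H).
Qed.

Lemma D_rel3 (R : zset -> zset -> zset -> Prop) t u v :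
  D W C (fun e => R (e 0) (e 1) (e 2)) -> TD W C t -> TD W C u -> TD W C v ->
  D W C (fun e => R (t e) (u e) (v e)).
Proof.
  intros H Ht Hu Hv. apply (D_sub (fun x e => R x (u e) (v e)) Ht).
  apply (D_sub (fun y e => R (e 0) y (v (fun k => e (S k)))) (TD_ren S Hu)).
  apply (D_sub (fun z e => R (e 1) (e 0) z) (TD_ren (fun k => S (S k)) Hv)).
  exact (@D_ren (fun k => match k with 0 => 2 | 1 => 1 | _ => 0 end) _ H).
Qed.

Lemma D_rel4 (R : zset -> zset -> zset -> zset -> Prop) t u v w :
  D W C (fun e => R (e 0) (e 1) (e 2) (e 3)) -> TD W C t -> TD W C u -> TD W C v -> TD W C w ->
  D W C (fun e => R (t e) (u e) (v e) (w e)).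
Proof.
  intros H Ht Hu Hv Hw. apply (D_sub (fun x e => R x (u e) (v e) (w e)) Ht).
  apply (D_sub (fun y e => R (e 0) y (v (fun k => e (S k))) (w (fun k => e (S k)))) (TD_ren S Hu)).
  apply (D_sub (fun z e => R (e 1) (e 0) z (w (fun k => e (S (S k))))) (TD_ren (fun k => S (S k)) Hv)).
  apply (D_sub (fun z e => R (e 2) (e 1) (e 0) z) (TD_ren (fun k => S (S (S k))) Hw)).
  exact (@D_ren (fun k => match k with 0 => 3 | 1 => 2 | 2 => 1 | _ => 0 end) _ H).
Qed.

Lemma D_mem t u : TD W C t -> TD W C u -> D W C (fun e => t e ∈ u e).
Proof. apply (D_rel2 mem (D_mem_base 0 1)). Qed.
Lemma D_eq t u : TD W C t -> TD W C u -> D W C (fun e => t e = u e).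
Proof. apply (D_rel2 (fun x y => x = y) (D_eq_base 0 1)). Qed.

(** Elements of a set in W are in W by transitivity, so a bounded quantifier agrees with one over
    W. *)
Lemma D_allb t (Phi : zset -> assignment -> Prop) :
  TD W C t -> D W C (fun e => Phi (e 0) (fun k => e (S k))) ->
  D W C (fun e => forall x, x ∈ t e -> Phi x e).
Proof.
  intros Ht H.
  apply D_ext with (Psi := fun e => forall x, W x -> x ∈ t e -> Phi x e).
  - intros e He. split; [auto|]. intros K x Hx. apply K; auto. 
    eapply (dctx_tr X); [|exact Hx]. now apply Ht.
  - apply (@D_all (fun x e => x ∈ t e -> Phi x e)), D_imp; auto.
    apply D_mem; [apply TD_var|now apply (TD_ren S)].
Qed.

Lemma D_exb t (Phi : zset -> assignment -> Prop) :
  TD W C t -> D W C (fun e => Phi (e 0) (fun k => e (S k))) ->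
  D W C (fun e => exists x, x ∈ t e /\ Phi x e).
Proof.
  intros Ht H. eapply D_ext; [|apply D_not, (@D_allb t (fun x e => ~ Phi x e)); [auto|apply D_not; exact H]].
  intros e He. cbn. split.
  - intros (x & Hx & K) A. exact (A x Hx K).
  - intro A. apply NNPP. intro B. apply A. intros x Hx K. apply B. eauto.
Qed.

Lemma TD_ap1 (F : zset -> zset) t :
  TD W C (fun e => F (e 0)) -> TD W C t -> TD W C (fun e => F (t e)).
Proof.
  intros [H K] Ht. split.
  - intros e He. exact (H (fun _ => t e) (fun _ => proj1 Ht e He)).
  - apply (D_rel2 (fun x y => x = F y) K (TD_var 0) (TD_ren S Ht)).
Qed.

Lemma TD_ap2 (F : zset -> zset -> zset) t u :
  TD W C (fun e => F (e 0) (e 1)) -> TD W C t -> TD W C u -> TD W C (fun e => F (t e) (u e)).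
Proof.
  intros [H K] Ht Hu. split.
  - intros e He. refine (H (scons (t e) (fun _ => u e)) _). intros [|k]; cbn; [now apply Ht|now apply Hu].
  - apply (D_rel3 (fun x y z => x = F y z) K (TD_var 0) (TD_ren S Ht) (TD_ren S Hu)).
Qed.


Lemma TD_ap3 (F : zset -> zset -> zset -> zset) t u v :
  TD W C (fun e => F (e 0) (e 1) (e 2)) -> TD W C t -> TD W C u -> TD W C v ->
  TD W C (fun e => F (t e) (u e) (v e)).
Proof.
  intros [H K] Ht Hu Hv. split.
  - intros e He. refine (H (scons (t e) (scons (u e) (fun _ => v e))) _).
    intros [|[|k]]; cbn; [now apply Ht|now apply Hu|now apply Hv].
  - apply (D_rel4 (fun x y z w => x = F y z w) K (TD_var 0) (TD_ren S Ht) (TD_ren S Hu) (TD_ren S Hv)).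
Qed.

Lemma D_weaken Phi : D W C Phi -> D W W Phi.
Proof.
  intros (f & c & Hc & H). exists f, c. split; auto. intro i. now apply (dctx_sub X).
Qed.

Lemma TD_weaken t : TD W C t -> TD W W t.
Proof. intros [H K]. split; auto. now apply D_weaken. Qed.

End Definable.

(** By extensionality a value is pinned down by its elements, all of which lie in the transitive
    class W. *)
Lemma TD_intro W C (X : dctx W C) (t : assignment -> zset) (Phi : zset -> assignment -> Prop) :
  (forall e, in_class W e -> W (t e)) ->
  (forall e z, in_class W e -> W z -> (z ∈ t e <-> Phi z e)) ->
  D W C (fun e => Phi (e 0) (fun k => e (S k))) -> TD W C t.
Proof.
  intros H K HD. split; auto.
  eapply (D_ext X); [|apply (@D_all _ _ X (fun z e => z ∈ e 0 <-> Phi z (fun k => e (S k))))].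
  - intros e He. cbn. assert (He' : in_class W (fun k => e (S k))) by (intro; apply He). split.
    + intros E z Hz. rewrite E. auto.
    + intro A. apply zset_ext. intro z. split; intro Hz.
      * assert (W z) by (eapply (dctx_tr X); [apply (He 0)|]; auto). apply K; auto. now apply A.
      * assert (W z) by (eapply (dctx_tr X); [apply (H _ He')|]; auto). apply A; auto. now apply K.
  - apply D_iff; auto; [apply (D_mem_base X 0 1)|].
    exact (D_ren X (fun k => match k with 0 => 0 | S k => S (S k) end) HD).
Qed.

Lemma D_inhabited W C (X : dctx W C) t : TD W C t -> D W C (fun e => exists x, x ∈ t e).
Proof.
  intro H. apply (D_ext X) with (Psi := fun e => exists x, x ∈ t e /\ True).
  - intros. split; intros [x Hx]; exists x; tauto.
  - apply (D_exb X (fun _ _ => True) H), (D_const X).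
Qed.

(** [dsolve] proves definability by following the syntax of the predicate; [dhook] is redefined as
    more operations are shown definable. *)
Ltac dconst := first [assumption | solve [eauto 2]].
Ltac dhook := fail.
Ltac dstep :=
  cbn beta; first [assumption |
  lazymatch goal with
  | |- D _ _ (fun e => _ /\ _) => eapply D_and; [eassumption| |]
  | |- D _ _ (fun e => _ \/ _) => eapply D_or; [eassumption| |]
  | |- D _ _ (fun e => ~ _) => eapply D_not; [eassumption|]
  | |- D _ _ (fun e => _ <-> _) => eapply D_iff; [eassumption| |]
  | |- D _ _ (fun e => forall x, x ∈ @?t e -> _) => eapply D_allb; [eassumption| |]
  | |- D ?W _ (fun e => forall x, ?W x -> _) => eapply D_all; [eassumption|]
  | |- D _ _ (fun e => exists x, x ∈ @?t e /\ _) => eapply D_exb; [eassumption| |]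
  | |- D ?W _ (fun e => exists x, ?W x /\ _) => eapply D_ex; [eassumption|]
  | |- D _ _ (fun e => exists x, x ∈ @?t e) => eapply D_inhabited; [eassumption|]
  | |- D _ _ (fun e => _ ∈ _) => eapply D_mem; [eassumption| |]
  | |- D _ _ (fun e => @eq zset _ _) => eapply D_eq; [eassumption| |]
  | |- TD _ _ (fun e => e _) => eapply TD_var; eassumption
  | |- _ => first
     [ dhook
     | lazymatch goal with
       | |- TD _ _ (fun _ => ?c) => eapply TD_const; [eassumption|dconst]
       | |- D _ _ (fun _ => ?Q) => eapply D_const; eassumption
       | |- D _ _ (fun e => _ -> _) => eapply D_imp; [eassumption| |]
       end ]
  end].
Ltac dsolve := repeat dstep.

(** * Transitive models of ZF *)

(** In a transitive class the operations of the universe replace the existence axioms; among them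
    the power set is relative to W. Extensionality and foundation are inherited from the
    universe. *)
Record zf (W : class) : Prop := {
  zf_tr : transitive_class W;
  zf_empty : W zempty;
  zf_upair : forall x y, W x -> W y -> W (upair x y);
  zf_Un : forall x, W x -> W (Un x);
  zf_pow : forall x, W x -> W (sep (pow x) W);
  zf_omega : W omega;
  zf_sep : forall (f : pure) e a, in_class W e -> W a -> W (sep a (fun x => psat W (upd e 0 x) f));
  zf_repl : forall (f : pure) e a, in_class W e -> W a ->
    (forall x y y', W x -> W y -> W y' -> x ∈ a ->
       psat W (upd (upd e 0 x) 1 y) f -> psat W (upd (upd e 0 x) 1 y') f -> y = y') ->
    exists b, W b /\ forall y, W y ->
        (y ∈ b <-> exists x, W x /\ x ∈ a /\ psat W (upd (upd e 0 x) 1 y) f) }.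

Lemma sep_definable W (tr : transitive_class W) (inh : exists x, W x) (P : zset -> Prop) a :
  (forall (f : pure) e a, in_class W e -> W a -> W (sep a (fun x => psat W (upd e 0 x) f))) ->
  D W W (fun e => P (e 0)) -> W a -> W (sep a P).
Proof.
  intros HS (f & c & Hc & H) Ha. destruct inh as [x0 Hx0].
  replace (sep a P) with (sep a (fun x => psat W (upd (mix (fun _ => x0) c) 0 x) f)).
  - apply HS; auto. intro k. unfold mix. destruct (Nat.even k); auto.
  - assert (E : forall z, W z -> (psat W (upd (mix (fun _ => x0) c) 0 z) f <-> P z)).
    { intros z Hz. rewrite (H (upd (fun _ => x0) 0 z)) by (apply in_class_upd; auto; intro; auto).
      apply sat_ext. intros k _.
      induction k as [k|k] using even_odd_ind; unfold upd; [rewrite !mix_even|rewrite !mix_odd; reflexivity].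
      destruct k; reflexivity. }
    apply zset_ext. intro z. rewrite !mem_sep. split; intros [K L]; split; auto; apply E; eauto.
Qed.

Section ZF.
Variable W : class.
Hypothesis Z : zf W.

Lemma zf_ctx : dctx W W.
Proof. split; [apply Z|auto|exists zempty; apply Z]. Qed.

Lemma W_mem x y : W y -> x ∈ y -> W x.
Proof. apply Z. Qed.

Lemma W_sep P a : D W W (fun e => P (e 0)) -> W a -> W (sep a P).
Proof. apply (@sep_definable W); [apply Z|exists zempty; apply Z|apply Z]. Qed.

Lemma W_repl (R : zset -> zset -> Prop) a : D W W (fun e => R (e 0) (e 1)) -> W a ->
  (forall x y y', x ∈ a -> W y -> W y' -> R x y -> R x y' -> y = y') ->
  exists b, W b /\ forall y, y ∈ b <-> W y /\ exists x, x ∈ a /\ R x y.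
Proof.
  intros (f & c & Hc & H) Ha F.
  (* The axiom wants the two arguments in variables 0 and 1, so the parameters are moved to the
     variables from 2 on. *)
  set (g := ren (split_ren (fun k => match k with 0 => 0 | _ => 1 end) (fun k => S (S k))) f).
  set (d := fun k => c (Nat.pred (Nat.pred k))).
  assert (Hd : in_class W d) by (intro; apply Hc).
  assert (E : forall x y, W x -> W y -> (psat W (upd (upd d 0 x) 1 y) g <-> R x y)).
  { intros x y Hx Hy. rewrite (H (scons x (fun _ => y))) by (apply in_class_scons; auto; intro; auto).
    unfold psat, g. rewrite sat_ren. apply sat_ext. intros k _.
    induction k as [k|k] using even_odd_ind.
    - rewrite split_ren_even, mix_even. now destruct k.
    - rewrite split_ren_odd, mix_odd. reflexivity. }
  destruct (zf_repl Z g Hd Ha) as (b & Hb & Hb').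
  - intros x y y' Hx Hy Hy' Hxa. rewrite !E by auto. eauto.
  - exists b. split; auto. intro y. split.
    + intro Hy. assert (Wy : W y) by exact (W_mem Hb Hy). split; auto.
      apply Hb' in Hy; auto. destruct Hy as (x & Wx & Hx & K). exists x. split; auto. now apply E.
    + intros (Wy & x & Hx & K). apply Hb'; auto. exists x. assert (Wx : W x) by exact (W_mem Ha Hx).
      split; auto. split; auto. now apply E.
Qed.

Lemma W_img F a : D W W (fun e => e 1 = F (e 0)) -> W a -> (forall x, x ∈ a -> W (F x)) -> W (img a F).
Proof.
  intros HD Ha HF. destruct (W_repl (fun x y => y = F x) HD Ha) as (b & Hb & K).
  - intros. congruence.
  - replace (img a F) with b; auto. apply zset_ext. intro y. rewrite K, mem_img. split.
    + intros (_ & x & Hx & ->). eauto.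
    + intros (x & Hx & ->). eauto.
Qed.

Lemma W_img_TD F a : TD W W (fun e => F (e 0)) -> W a -> W (img a F).
Proof.
  intros [H K] Ha. apply W_img; auto.
  - exact (D_ren zf_ctx (fun k => match k with 0 => 1 | _ => 0 end) K).
  - intros x Hx. apply (H (fun _ => x)). intro. exact (W_mem Ha Hx).
Qed.

Lemma W_upair x y : W x -> W y -> W (upair x y).
Proof. apply Z. Qed.
Lemma W_sing x : W x -> W (sing x).
Proof. intro. now apply W_upair. Qed.
Lemma W_union2 x y : W x -> W y -> W (union2 x y).
Proof. intros. apply Z. now apply W_upair. Qed.
Lemma W_opr x y : W x -> W y -> W (opr x y).
Proof. intros. apply W_upair; [apply W_sing|apply W_upair]; auto. Qed.
Lemma W_opr_inv x y : W (opr x y) -> W x /\ W y.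
Proof.
  intro H. assert (K : W (upair x y)) by (eapply W_mem; [exact H|]; apply mem_upair; auto).
  split; (eapply W_mem; [exact K|]); apply mem_upair; auto.
Qed.
Lemma W_num n : W (num n).
Proof. exact (W_mem (zf_omega Z) (num_in_omega n)). Qed.
Lemma W_prod x y : W x -> W y -> W (prod x y).
Proof.
  intros Hx Hy. set (u := union2 x y). assert (Hu : W u) by now apply W_union2.
  set (p := fun z => sep (pow z) W). assert (Hp : W (p (p u))) by now apply Z, Z.
  (* Kuratowski pairs lie in the double power set of the union. The pair is spelled out in terms of
     ∈, since definability of [opr] comes later. *)
  replace (prod x y) with (sep (p (p u)) (fun z => exists a, a ∈ x /\ exists b, b ∈ y /\
    exists s, W s /\ (forall w, W w -> (w ∈ s <-> w = a)) /\
    exists d, W d /\ (forall w, W w -> (w ∈ d <-> w = a \/ w = b)) /\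
    forall w, W w -> (w ∈ z <-> w = s \/ w = d))).
  - apply W_sep; auto. pose proof zf_ctx. dsolve.
  - apply zset_ext. intro z. rewrite mem_sep, mem_prod. split.
    + intros (Hz & a & Ha & b & Hb & s & Ws & Hs & d & Wd & Hd & K).
      assert (Wz : W z) by exact (W_mem Hp Hz).
      exists a, b. split; auto. split; auto.
      assert (Es : s = sing a).
      { apply zset_ext. intro w. rewrite mem_sing. split; intro Hw.
        - apply Hs; auto. exact (W_mem Ws Hw).
        - apply Hs; auto. rewrite Hw. exact (W_mem Hx Ha). }
      assert (Ed : d = upair a b).
      { apply zset_ext. intro w. rewrite mem_upair. split; intro Hw.
        - apply Hd; auto. exact (W_mem Wd Hw).
        - apply Hd; auto. destruct Hw as [-> | ->]; eauto using W_mem. }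
      subst s d. apply zset_ext. intro w. unfold opr. rewrite mem_upair. split; intro Hw.
      * apply K; auto. exact (W_mem Wz Hw).
      * apply K; auto. destruct Hw as [-> | ->]; auto.
    + intros (a & b & Ha & Hb & ->).
      assert (Wa : W a) by exact (W_mem Hx Ha). assert (Wb : W b) by exact (W_mem Hy Hb). split.
      * unfold p. rewrite mem_sep, mem_pow. split; [|now apply W_opr]. intros w Hw.
        apply mem_upair in Hw. rewrite mem_sep, mem_pow.
        destruct Hw as [-> | ->]; split; auto using W_sing, W_upair; intros v Hv; apply mem_union2.
        -- apply mem_sing in Hv. subst. auto.
        -- apply mem_upair in Hv. destruct Hv as [-> | ->]; auto.
      * exists a. split; auto. exists b. split; auto. exists (sing a). split; [now apply W_sing|].
        split; [intros; apply mem_sing|]. exists (upair a b). split; [now apply W_upair|].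
        split; intros; apply mem_upair.
Qed.
End ZF.
Arguments W_opr_inv {W} Z {x y}.
Arguments W_mem {W} Z {x y}.

Section ZFDef.
Variables W C : class.
Hypothesis Z : zf W.
Hypothesis X : dctx W C.
#[local] Set Default Proof Using "All".

Lemma TD_empty : TD W C (fun _ => zempty).
Proof.
  apply (TD_intro X) with (Phi := fun _ _ => False).
  - intros. apply Z.
  - intros e z _ _. split; [apply not_mem_empty|tauto].
  - dsolve.
Qed.
Lemma TD_upair : TD W C (fun e => upair (e 0) (e 1)).
Proof.
  apply (TD_intro X) with (Phi := fun z e => z = e 0 \/ z = e 1).
  - intros. now apply Z.
  - intros e z _ _. apply mem_upair.
  - dsolve.
Qed.
Lemma TD_sing : TD W C (fun e => sing (e 0)).
Proof. exact (TD_ap2 X upair TD_upair (TD_var X 0) (TD_var X 0)). Qed.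
Lemma TD_opr : TD W C (fun e => opr (e 0) (e 1)).
Proof. exact (TD_ap2 X upair TD_upair TD_sing TD_upair). Qed.
Lemma TD_Un : TD W C (fun e => Un (e 0)).
Proof.
  apply (TD_intro X) with (Phi := fun z e => exists y, y ∈ e 0 /\ z ∈ y).
  - intros. now apply Z.
  - intros e z _ _. apply mem_Un.
  - dsolve.
Qed.
Lemma TD_union2 : TD W C (fun e => union2 (e 0) (e 1)).
Proof. exact (TD_ap1 X Un TD_Un TD_upair). Qed.
Lemma TD_suc : TD W C (fun e => suc (e 0)).
Proof. exact (TD_ap2 X union2 TD_union2 (TD_var X 0) TD_sing). Qed.
Lemma TD_prod : TD W C (fun e => prod (e 0) (e 1)).
Proof.
  apply (TD_intro X) with (Phi := fun z e => exists a, a ∈ e 0 /\ exists b, b ∈ e 1 /\ z = opr a b).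
  - intros. now apply W_prod.
  - intros e z _ _. rewrite mem_prod. split; [intros (a & b & ? & ? & ?)|intros (a & ? & b & ? & ?)]; eauto.
  - dsolve. apply (TD_ap2 X opr TD_opr); dsolve.
Qed.
Lemma TD_powW : TD W C (fun e => sep (pow (e 0)) W).
Proof.
  apply (TD_intro X) with (Phi := fun z e => forall y, y ∈ z -> y ∈ e 0).
  - intros. now apply Z.
  - intros e z He Hz. rewrite mem_sep, mem_pow. unfold subset. tauto.
  - dsolve.
Qed.
Lemma TD_omega : TD W C (fun _ => omega).
Proof.
  (* [omega] is described as the intersection of the inductive sets of W, being one of them
     itself. *)
  apply (TD_intro X) with (Phi := fun z _ =>
    forall i, W i -> (zempty ∈ i /\ forall y, y ∈ i -> suc y ∈ i) -> z ∈ i).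
  - intros. apply Z.
  - intros e z He Hz. rewrite mem_omega. split.
    + intros [n ->] i _ [H K]. clear Hz. induction n as [|n IH]; [exact H|exact (K _ IH)].
    + intro H. apply mem_omega. apply H; [apply Z|]. split; [apply (num_in_omega 0)|].
      intros y Hy. apply mem_omega in Hy. destruct Hy as [n ->]. apply (num_in_omega (S n)).
  - dsolve; [apply TD_empty|]. apply (TD_ap1 X suc TD_suc). dsolve.
Qed.
End ZFDef.

Ltac dhook ::=
  lazymatch goal with
  | |- TD _ _ (fun _ => zempty) => eapply TD_empty; eassumption
  | |- TD _ _ (fun _ => omega) => eapply TD_omega; eassumption
  | |- TD _ _ (fun e => opr _ _) => eapply (TD_ap2 ltac:(eassumption) opr); [eapply TD_opr; eassumption| |]
  | |- TD _ _ (fun e => upair _ _) => eapply (TD_ap2 ltac:(eassumption) upair); [eapply TD_upair; eassumption| |]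
  | |- TD _ _ (fun e => union2 _ _) => eapply (TD_ap2 ltac:(eassumption) union2); [eapply TD_union2; eassumption| |]
  | |- TD _ _ (fun e => prod _ _) => eapply (TD_ap2 ltac:(eassumption) prod); [eapply TD_prod; eassumption| |]
  | |- TD _ _ (fun e => sing _) => eapply (TD_ap1 ltac:(eassumption) sing); [eapply TD_sing; eassumption|]
  | |- TD _ _ (fun e => suc _) => eapply (TD_ap1 ltac:(eassumption) suc); [eapply TD_suc; eassumption|]
  | |- TD _ _ (fun e => Un _) => eapply (TD_ap1 ltac:(eassumption) Un); [eapply TD_Un; eassumption|]
  | |- TD _ _ (fun e => sep (pow _) ?W) =>
      eapply (TD_ap1 ltac:(eassumption) (fun x => sep (pow x) W)); [eapply TD_powW; eassumption|]
  | |- D _ _ (fun e => subset _ _) => unfold subset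
  | |- D _ _ (fun e => trans _) => unfold trans
  end.

Lemma zfc_zf W : transitive_class W -> ZFC W -> zf W.
Proof.
  intros tr ZC. destruct (zfc_infinity ZC) as (x & Wx & (o & Wo & Hox & Ho) & Hs).
  assert (X : dctx W W) by (split; eauto).
  assert (Eo : o = zempty).
  { destruct (inhabited_or_empty o) as [|[y Hy]]; auto. exfalso. apply (Ho y); eauto. }
  subst o.
  assert (HS : forall (f : pure) e a, in_class W e -> W a -> W (sep a (fun x => psat W (upd e 0 x) f))).
  { intros f e a He Ha. destruct (zfc_separation ZC f e a He Ha) as (b & Hb & K).
    replace (sep a _) with b; auto. apply zset_ext. intro z. rewrite mem_sep. split; intro Hz.
    - apply K; eauto.
    - apply K; eauto. destruct Hz. eauto. }
  split; auto.
  - intros y z Wy Wz. destruct (zfc_pairing ZC y z Wy Wz) as (p & Wp & Hp).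
    replace (upair y z) with p; auto. apply zset_ext. intro w. rewrite mem_upair. split; intro Hw.
    + apply Hp; eauto.
    + apply Hp; auto. destruct Hw as [-> | ->]; auto.
  - intros y Wy. destruct (zfc_union ZC y Wy) as (p & Wp & Hp).
    replace (Un y) with p; auto. apply zset_ext. intro w. rewrite mem_Un. split; intro Hw.
    + apply Hp in Hw; eauto. destruct Hw as (v & _ & ? & ?). eauto.
    + destruct Hw as (v & Hv & Hw). assert (W v) by eauto. apply Hp; eauto.
  - intros y Wy. destruct (zfc_power ZC y Wy) as (p & Wp & Hp).
    replace (sep (pow y) W) with p; auto. apply zset_ext. intro w. rewrite mem_sep, mem_pow. split; intro Hw.
    + assert (W w) by eauto. split; auto. intros v Hv. apply (proj1 (Hp w H) Hw); eauto.
    + destruct Hw as [Hw Ww]. apply Hp; auto.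
  (* Inside any inductive set the numerals are the transitive [n] such that [n] and each of its
     elements is empty or a successor. *)
  - replace omega with (sep x (fun n => (forall y, y ∈ n -> forall z, z ∈ y -> z ∈ n) /\
      forall m, W m -> (m = n \/ m ∈ n) -> (forall w, w ∈ m -> False) \/
        exists k, k ∈ m /\ (forall w, w ∈ m -> w ∈ k \/ w = k) /\ forall w, w ∈ k -> w ∈ m)).
    + apply (@sep_definable W); eauto. dsolve.
    + apply zset_ext. intro n. rewrite mem_sep, mem_omega. split.
      * intros (Hn & T & K).
        enough (Q : forall m, (m = n \/ m ∈ n) -> exists i, m = num i) by auto.
        intro m. induction m as [m IH] using mem_ind. intro Hm.
        assert (Wm : W m) by (destruct Hm; subst; eauto).
        destruct (K m Wm Hm) as [E|(k & Hk & K1 & K2)].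
        -- exists 0. destruct (inhabited_or_empty m) as [|[y Hy]]; auto. exfalso; eauto.
        -- destruct (IH k Hk) as [i Hi].
           { right. destruct Hm as [->|Hm]; eauto. }
           exists (S i). cbn. rewrite <- Hi. apply zset_ext. intro w. rewrite mem_suc. split; auto.
           intros [Hw| ->]; auto.
      * intros [i ->]. split; [|split].
        -- induction i as [|i IH]; auto. cbn. destruct (Hs (num i)) as (s & Ws & Hsx & E); eauto.
           replace (suc (num i)) with s; auto. apply zset_ext. intro w. rewrite mem_suc. split; intro Hw.
           ++ apply E; eauto.
           ++ apply E; auto. destruct Hw as [Hw| ->]; [|eauto]. eapply tr; [|exact Hw]; eauto.
        -- intros y Hy z Hz. apply mem_num in Hy. destruct Hy as (j & Hj & ->).
           apply mem_num in Hz. destruct Hz as (k & Hk & ->). apply mem_num. exists k. split; auto. lia.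
        -- intros m _ Hm.
           assert (Q : exists j, m = num j).
           { destruct Hm as [->|Hm]; [eauto|]. apply mem_num in Hm. destruct Hm as (j & _ & ->). eauto. }
           destruct Q as [[|j] ->].
           ++ left. intros w Hw. now apply not_mem_empty in Hw.
           ++ right. exists (num j). cbn. split; [apply mem_suc; auto|].
              split; intros w; rewrite mem_suc; auto.
  - intros f e a He Ha Hf. exact (@zfc_replacement W ZC f e a He Ha Hf).
Qed.

(** * Definability by recursion *)

Section Recursion.
Variables W C : class.
Hypothesis Z : zf W.
Hypothesis X : dctx W C.
Variable F : zset -> zset -> zset -> zset.
Hypothesis HF : TD W C (fun e => F (e 0) (e 1) (e 2)).
Hypothesis Hloc : forall u x g g',
  (forall y v, y ∈ tc x -> (opr y v ∈ g <-> opr y v ∈ g')) -> F u x g = F u x g'.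

Let R u := trec (F u).
Let ctc x := union2 (tc x) (sing x).
Let gam u x := graph (R u) (ctc x).

(** An approximation to the recursion: pairs satisfying the recursion equation, over a transitive
    domain. *)
Let isapp u g := forall w, w ∈ g -> exists y, W y /\ exists v, W v /\ w = opr y v /\ v = F u y g /\
  forall y', y' ∈ y -> exists v', W v' /\ opr y' v' ∈ g.

(** By induction along [tc y]: the domain of [g] is transitive, so [g] has the correct values on all
    of [tc y], and locality of [F] does the rest. *)
Lemma isapp_value u g : W u -> W g -> isapp u g -> forall y v, opr y v ∈ g -> v = R u y /\ subset (gam u y) g.
Proof.
  intros Wu Wg A y. induction y as [y IH] using tc_ind. intros v Hv.
  assert (S : forall t, t ∈ tc y -> exists w, opr t w ∈ g).
  { assert (S0 : forall z, (exists v, opr z v ∈ g) -> forall t, t ∈ tc z -> exists w, opr t w ∈ g).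
    { intro z. induction z as [z IHz] using mem_ind. intros [v' Hz] t Ht.
      assert (S1 : forall t, t ∈ z -> exists w, opr t w ∈ g).
      { intros s Hs. destruct (A _ Hz) as (z0 & _ & v0 & _ & E & _ & K).
        apply opr_inj in E. destruct E as [-> ->]. destruct (K _ Hs) as (w & _ & Hw). eauto. }
      apply mem_tc in Ht. destruct Ht as [Ht|(s & Hs & Ht)]; eauto. }
    apply S0. eauto. }
  destruct (A _ Hv) as (y0 & Wy & v0 & Wv & E & Ev & K).
  apply opr_inj in E. destruct E as [<- <-].
  assert (G : forall t w, t ∈ tc y -> (opr t w ∈ g <-> w = R u t)).
  { intros t w Ht. split; intro H.
    - now apply IH.
    - destruct (S _ Ht) as [w' Hw']. destruct (IH _ Ht _ Hw') as [E _]. congruence. }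
  assert (Ev' : v = R u y).
  { rewrite Ev. unfold R. rewrite trec_eq. apply Hloc. intros t w Ht. rewrite G, mem_graph by auto. tauto. }
  split; auto. intros p Hp. unfold gam, graph in Hp. apply mem_img in Hp. destruct Hp as (t & Ht & ->).
  unfold ctc in Ht. rewrite mem_union2, mem_sing in Ht. destruct Ht as [Ht| ->].
  - now apply G.
  - congruence.
Qed.

Lemma gam_mem u x y v : opr y v ∈ gam u x <-> (y ∈ tc x \/ y = x) /\ v = R u y.
Proof. unfold gam. rewrite mem_graph. unfold ctc. rewrite mem_union2, mem_sing. reflexivity. Qed.

Lemma gam_isapp u x : W u -> W (gam u x) -> isapp u (gam u x).
Proof.
  intros Wu Wg p Hp. pose proof Hp as Hp0. unfold gam, graph in Hp. apply mem_img in Hp.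
  destruct Hp as (y & Hy & ->). destruct (W_opr_inv Z (W_mem Z Wg Hp0)) as [Wy Wv].
  assert (Ty : subset (tc y) (tc x)).
  { unfold ctc in Hy. rewrite mem_union2, mem_sing in Hy. destruct Hy as [Hy| ->]; [now apply tc_mono|].
    intro; auto. }
  exists y. split; auto. exists (R u y). split; auto. split; auto. split.
  - unfold R at 1. rewrite trec_eq. apply Hloc. intros t w Ht. rewrite mem_graph, gam_mem.
    split; [intros [_ ->]; auto|]. intros [_ ->]. auto.
  - intros t Ht. exists (R u t). assert (Q : opr t (R u t) ∈ gam u x).
    { apply gam_mem. split; auto. left. apply Ty, tc_sub, Ht. }
    split; auto. apply (W_opr_inv Z (W_mem Z Wg Q)).
Qed.

(** The segment of the recursion up to [x], described inside W as the least approximation defined at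
    [x]; being unique, it can be collected by replacement. *)
Let isgam g u x := isapp u g /\ (exists v, W v /\ opr x v ∈ g) /\
  forall h, W h -> isapp u h -> (exists v, W v /\ opr x v ∈ h) -> forall p, p ∈ g -> p ∈ h.

Lemma isgam_spec g u x : W u -> W g -> W (gam u x) -> (isgam g u x <-> g = gam u x).
Proof.
  intros Wu Wg Wh.
  assert (K : exists v, W v /\ opr x v ∈ gam u x).
  { exists (R u x). assert (Q : opr x (R u x) ∈ gam u x) by (apply gam_mem; auto).
    split; auto. apply (W_opr_inv Z (W_mem Z Wh Q)). }
  split.
  - intros (A & (v & _ & Hv) & B). apply zset_ext. intro p. split.
    + apply B; auto. now apply gam_isapp.
    + apply (isapp_value Wu Wg A Hv).
  - intros ->. split; [now apply gam_isapp|]. split; auto.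
    intros h Wh' A (v & _ & Hv). apply (isapp_value Wu Wh' A Hv).
Qed.

Lemma D_isapp : D W C (fun e => isapp (e 0) (e 1)).
Proof. unfold isapp. dsolve. exact (TD_ap3 X F HF (TD_var X 3) (TD_var X 1) (TD_var X 4)). Qed.

Lemma D_isgam : D W C (fun e => isgam (e 0) (e 1) (e 2)).
Proof.
  unfold isgam. dsolve; apply (D_rel2 X isapp D_isapp); dsolve.
Qed.

(** Replacement collects the segments of the elements of [x]; their union is the recursion on
    [tc x], and one more pair reaches [x]. *)
Lemma W_gam u x : W u -> W x -> W (gam u x) /\ W (R u x).
Proof.
  intros Wu Wx. induction x as [x IH] using mem_ind.
  destruct (@W_repl W Z (fun y g => isgam g u y) x) as (b & Wb & Hb); auto.
  - apply (D_rel3 (zf_ctx Z) isgam); [exact (D_weaken X D_isgam)| | |];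
    pose proof (zf_ctx Z); dsolve.
  - intros y g g' Hy Wg Wg' H H'. apply isgam_spec in H, H'; auto; try congruence;
    apply IH; auto; exact (W_mem Z Wx Hy).
  - set (U := Un b). assert (WU : W U) by now apply Z.
    assert (EU : forall y v, opr y v ∈ U <-> y ∈ tc x /\ v = R u y).
    { intros y v. unfold U. rewrite mem_Un. split.
      - intros (g & Hg & H). apply Hb in Hg. destruct Hg as (Wg & z & Hz & K).
        apply isgam_spec in K; auto; [|apply IH; auto; exact (W_mem Z Wx Hz)]. subst g.
        apply gam_mem in H. destruct H as [H ->]. split; auto.
        destruct H as [H| ->]; [|now apply tc_sub]. apply mem_tc. eauto.
      - intros [Hy ->]. apply mem_tc in Hy.
        assert (Q : exists z, z ∈ x /\ (y ∈ tc z \/ y = z)) by (destruct Hy as [|(z & ? & ?)]; eauto).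
        destruct Q as (z & Hz & Hy'). assert (Wz : W z) by exact (W_mem Z Wx Hz).
        exists (gam u z). destruct (IH z Hz Wz) as [Wg _]. split.
        + apply Hb. split; auto. exists z. split; auto. now apply isgam_spec.
        + now apply gam_mem. }
    assert (ER : R u x = F u x U).
    { unfold R. rewrite trec_eq. apply Hloc. intros y v Hy. rewrite mem_graph, EU. reflexivity. }
    assert (WR : W (R u x)).
    { rewrite ER. apply (proj1 HF (scons u (scons x (fun _ => U)))). repeat apply in_class_scons; auto. intro; auto. }
    split; auto. replace (gam u x) with (union2 U (sing (opr x (R u x)))).
    + apply W_union2, W_sing, W_opr; auto.
    + apply zset_ext. intro p. rewrite mem_union2, mem_sing. unfold gam, graph. rewrite mem_img.
      split.
      * intros [Hp | ->].
        -- assert (Wp := W_mem Z WU Hp). unfold U in Hp. apply mem_Un in Hp. destruct Hp as (g & Hg & Hp).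
           apply Hb in Hg. destruct Hg as (Wg & z & Hz & K).
           apply isgam_spec in K; auto; [|apply IH; auto; exact (W_mem Z Wx Hz)]. subst g.
           unfold gam, graph in Hp. apply mem_img in Hp. destruct Hp as (y & Hy & ->).
           exists y. split; auto. unfold ctc in *. rewrite mem_union2, mem_sing in *. left. apply mem_tc.
           destruct Hy as [Hy| ->]; eauto.
        -- exists x. split; auto. unfold ctc. rewrite mem_union2, mem_sing. auto.
      * intros (y & Hy & ->). unfold ctc in Hy. rewrite mem_union2, mem_sing in Hy.
        destruct Hy as [Hy| ->]; auto. left. now apply EU.
Qed.

Lemma TD_trec : TD W C (fun e => trec (F (e 0)) (e 1)).
Proof.
  split.
  - intros e He. apply (W_gam (He 0) (He 1)).
  - apply (D_ext X) with (Psi := fun e => exists g, W g /\ isgam g (e 1) (e 2) /\ opr (e 2) (e 0) ∈ g); auto.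
    + intros e He. destruct (W_gam (He 1) (He 2)) as [Wg WR]. split.
      * intro E. exists (gam (e 1) (e 2)). split; auto. split; [now apply isgam_spec|].
        apply gam_mem. rewrite E. auto.
      * intros (g & Wg' & H & K). apply isgam_spec in H; auto. subst g. apply gam_mem in K. tauto.
    + dsolve. apply (D_rel3 X isgam D_isgam); dsolve.
Qed.
End Recursion.

Definition gim (g x : zset) : zset := sep (Un (Un g)) (fun v => exists y, y ∈ x /\ opr y v ∈ g).

Lemma opr_left g y v : opr y v ∈ g -> y ∈ Un (Un g).
Proof.
  intro H. apply mem_Un. exists (sing y). rewrite mem_sing. split; auto.
  apply mem_Un. exists (opr y v). split; auto. apply mem_upair. auto.
Qed.
Lemma opr_right g y v : opr y v ∈ g -> v ∈ Un (Un g).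
Proof.
  intro H. apply mem_Un. exists (upair y v). rewrite mem_upair. split; auto.
  apply mem_Un. exists (opr y v). split; auto. apply mem_upair. auto.
Qed.

Lemma mem_gim g x v : v ∈ gim g x <-> exists y, y ∈ x /\ opr y v ∈ g.
Proof.
  unfold gim. rewrite mem_sep. split; [tauto|]. intros (y & Hy & H). split; eauto using opr_right.
Qed.

Lemma gim_local x g g' : (forall y v, y ∈ x -> (opr y v ∈ g <-> opr y v ∈ g')) -> gim g x = gim g' x.
Proof.
  intro H. apply zset_ext. intro v. rewrite !mem_gim.
  split; intros (y & Hy & K); exists y; split; auto; now apply H.
Qed.

Lemma gim_graph f t x : subset x t -> gim (graph f t) x = img x f.
Proof.
  intro H. apply zset_ext. intro v. rewrite mem_gim, mem_img.
  split; intros (y & Hy & K); exists y; split; auto; rewrite mem_graph in *; intuition.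
Qed.

(** The names in [s] that the filter [g] makes active. *)
Definition acts (g s : zset) : zset := sep (Un (Un s)) (fun r => exists p, p ∈ g /\ opr r p ∈ s).

Lemma mem_acts g s r : r ∈ acts g s <-> exists p, p ∈ g /\ opr r p ∈ s.
Proof.
  unfold acts. rewrite mem_sep. split; [tauto|]. intros (y & Hy & H). split; eauto using opr_left.
Qed.

Lemma opr_left_tc g y v : opr y v ∈ g -> y ∈ tc g.
Proof.
  intro H. apply (@tc_trans g (sing y)); [|now apply mem_sing].
  apply (@tc_trans g (opr y v)); [now apply tc_sub|]. apply mem_upair. auto.
Qed.

(** * Transitive closure, rank, hierarchy, values and canonical names *)

(** All four are written with [trec] and [gim], so that [TD_trec] makes them available in every
    transitive model. [Vl W] is the cumulative hierarchy of W, indexed by arbitrary sets; [vl g]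
    evaluates names by the filter [g], and [chk a] gives canonical names. *)
Definition rank : zset -> zset := trec (fun x g => union2 (Un (gim g x)) (gim g x)).
Definition Vl (W : class) : zset -> zset :=
  trec (fun x g => sep (sep (pow (Un (gim g x))) W) (fun z => exists v, v ∈ gim g x /\ subset z v)).
Definition vl (g : zset) : zset -> zset := trec (fun s h => gim h (acts g s)).
Definition chk (a : zset) : zset -> zset := trec (fun x h => prod (gim h x) a).

Lemma tc_trec x : trec (fun x g => union2 x (Un (gim g x))) x = tc x.
Proof.
  induction x as [x IH] using mem_ind. rewrite trec_eq, gim_graph by apply tc_sub. rewrite tc_eq.
  do 2 f_equal. apply zset_ext. intro z. rewrite !mem_img.
  split; intros (y & Hy & ->); exists y; split; auto; rewrite IH; auto.
Qed.

Lemma mem_rank x z : z ∈ rank x <-> exists y, y ∈ x /\ (z ∈ rank y \/ z = rank y).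
Proof.
  unfold rank at 1. rewrite trec_eq, gim_graph by apply tc_sub. rewrite mem_union2, mem_Un, mem_img.
  fold rank. split.
  - intros [(v & Hv & Hz)|(y & Hy & ->)]; eauto. apply mem_img in Hv. destruct Hv as (y & Hy & ->). eauto.
  - intros (y & Hy & [Hz| ->]); eauto. left. exists (rank y). rewrite mem_img. eauto.
Qed.

Lemma mem_Vl W x z : z ∈ Vl W x <-> W z /\ exists y, y ∈ x /\ subset z (Vl W y).
Proof.
  unfold Vl at 1. rewrite trec_eq, gim_graph by apply tc_sub. rewrite !mem_sep, mem_pow. fold (Vl W). split.
  - intros ((_ & Hw) & v & Hv & Hz). apply mem_img in Hv. destruct Hv as (y & Hy & ->). eauto.
  - intros (Hw & y & Hy & Hz). assert (K : Vl W y ∈ img x (Vl W)) by (apply mem_img; eauto).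
    repeat split; eauto. intros w Hw'. apply mem_Un. eauto.
Qed.

Lemma mem_vl g s z : z ∈ vl g s <-> exists r p, p ∈ g /\ opr r p ∈ s /\ z = vl g r.
Proof.
  unfold vl at 1. rewrite trec_eq, gim_graph; fold (vl g).
  - rewrite mem_img. split.
    + intros (r & Hr & ->). apply mem_acts in Hr. destruct Hr as (p & ? & ?). eauto.
    + intros (r & p & Hp & Hr & ->). exists r. rewrite mem_acts. eauto.
  - intros r Hr. apply mem_acts in Hr. destruct Hr as (p & _ & Hr). eapply opr_left_tc; eauto.
Qed.

Lemma chk_eq a x : chk a x = prod (img x (chk a)) a.
Proof. unfold chk at 1. rewrite trec_eq, gim_graph by apply tc_sub. reflexivity. Qed.

Lemma opr_chk a x s p : opr s p ∈ chk a x <-> p ∈ a /\ exists y, y ∈ x /\ s = chk a y.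
Proof. rewrite chk_eq, opr_in_prod, mem_img. tauto. Qed.

Lemma val_vl g s x : val (fun p => p ∈ g) s x <-> x = vl g s.
Proof.
  revert x. induction s as [s IH] using tc_ind. intro x. split.
  - intro H. inversion H as [s' x' H1 H2]; subst. apply zset_ext. intro z. rewrite mem_vl. split.
    + intro Hz. destruct (H1 z Hz) as (r & p & Hp & Hr & K). apply rel_opr in Hr.
      apply IH in K; eauto using opr_left_tc.
    + intros (r & p & Hp & Hr & ->). destruct (H2 r p Hp) as (y & Hy & K); [now apply rel_opr|].
      apply IH in K; eauto using opr_left_tc. now subst.
  - intros ->. constructor.
    + intros y Hy. apply mem_vl in Hy. destruct Hy as (r & p & Hp & Hr & ->).
      exists r, p. rewrite rel_opr. split; auto. split; auto. apply IH; eauto using opr_left_tc.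
    + intros r p Hp Hr. apply rel_opr in Hr. exists (vl g r). split; [apply mem_vl; eauto|].
      apply IH; eauto using opr_left_tc.
Qed.

Lemma check_chk a x c : check (fun p => p ∈ a) x c <-> c = chk a x.
Proof.
  revert c. induction x as [x IH] using mem_ind. intro c. split.
  - intro H. inversion H as [x' c' H1 H2]; subst. apply zset_ext. intro z.
    rewrite chk_eq, mem_prod. split.
    + intro Hz. destruct (H1 z Hz) as (y & d & p & Hy & K & Hp & E).
      apply opair_opr in E. apply IH in K; auto. subst. exists (chk a y), p. rewrite mem_img. eauto 10.
    + intros (s & p & Hs & Hp & ->). apply mem_img in Hs. destruct Hs as (y & Hy & ->).
      destruct (H2 y p Hy Hp) as (d & K & L). apply IH in K; auto. subst. now apply rel_opr.
  - intros ->. constructor.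
    + intros z Hz. rewrite chk_eq, mem_prod in Hz. destruct Hz as (s & p & Hs & Hp & ->).
      apply mem_img in Hs. destruct Hs as (y & Hy & ->). exists y, (chk a y), p.
      split; auto. split; [now apply IH|]. split; auto. now apply opair_opr.
    + intros y p Hy Hp. exists (chk a y). split; [now apply IH|]. apply rel_opr, opr_chk. eauto.
Qed.

Lemma vl_chk g a x : (exists p, p ∈ g) -> (forall p, p ∈ g -> p ∈ a) -> vl g (chk a x) = x.
Proof.
  intros [p0 Hp0] H. induction x as [x IH] using mem_ind. apply zset_ext. intro z. rewrite mem_vl. split.
  - intros (r & p & Hp & K & ->). apply opr_chk in K. destruct K as (_ & y & Hy & ->). rewrite IH; auto.
  - intro Hz. exists (chk a z), p0. split; auto. rewrite opr_chk. split; [eauto|]. now rewrite IH.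
Qed.

Definition gname (a : zset) : zset := img a (fun p => opr (chk a p) p).

Lemma gen_name_gname a g : gen_name (fun p => p ∈ a) g <-> g = gname a.
Proof.
  unfold gname. split.
  - intro H. apply zset_ext. intro z. rewrite mem_img. rewrite (H z). split.
    + intros (p & d & Hp & K & E). apply check_chk in K. apply opair_opr in E. subst. eauto.
    + intros (p & Hp & ->). exists p, (chk a p). rewrite check_chk, opair_opr. auto.
  - intros -> z. rewrite mem_img. split.
    + intros (p & Hp & ->). exists p, (chk a p). rewrite check_chk, opair_opr. auto.
    + intros (p & d & Hp & K & E). apply check_chk in K. apply opair_opr in E. subst. eauto.
Qed.

Lemma vl_gname g a : (exists p, p ∈ g) -> (forall p, p ∈ g -> p ∈ a) -> vl g (gname a) = g.
Proof.
  intros H K. apply zset_ext. intro z. rewrite mem_vl. unfold gname. split.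
  - intros (r & p & Hp & L & ->). apply mem_img in L. destruct L as (q & Hq & E).
    apply opr_inj in E. destruct E as [-> ->]. now rewrite vl_chk.
  - intro Hz. exists (chk a z), z. rewrite vl_chk by auto. split; auto. split; auto. apply mem_img. eauto.
Qed.

Section Operations.
Variables W C : class.
Hypothesis Z : zf W.
Hypothesis X : dctx W C.
#[local] Set Default Proof Using "All".

Lemma TD_gim : TD W C (fun e => gim (e 0) (e 1)).
Proof.
  apply (TD_intro X) with (Phi := fun v e => exists y, y ∈ e 1 /\ opr y v ∈ e 0).
  - intros e He. unfold gim. pose proof (zf_ctx Z).
    assert (W (e 0)) by apply He. assert (W (e 1)) by apply He.
    apply (W_sep Z); [dsolve|]. apply Z, Z. apply He.
  - intros. apply mem_gim.
  - dsolve.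
Qed.

Lemma TD_acts : TD W C (fun e => acts (e 0) (e 1)).
Proof.
  apply (TD_intro X) with (Phi := fun r e => exists p, p ∈ e 0 /\ opr r p ∈ e 1).
  - intros e He. unfold acts. pose proof (zf_ctx Z).
    assert (W (e 0)) by apply He. assert (W (e 1)) by apply He.
    apply (W_sep Z); [dsolve|]. apply Z, Z. apply He.
  - intros. apply mem_acts.
  - dsolve.
Qed.

Lemma TD_gim' t u : TD W C t -> TD W C u -> TD W C (fun e => gim (t e) (u e)).
Proof. intros Ht Hu. exact (TD_ap2 X gim TD_gim Ht Hu). Qed.

Lemma TD_trec0 (F : zset -> zset -> zset) : TD W C (fun e => F (e 0) (e 1)) ->
  (forall x g g', (forall y v, y ∈ tc x -> (opr y v ∈ g <-> opr y v ∈ g')) -> F x g = F x g') ->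
  TD W C (fun e => trec F (e 0)).
Proof.
  intros H K. refine (TD_ap2 X (fun _ x => trec F x) _ (TD_var X 0) (TD_var X 0)).
  apply (TD_trec Z X (fun _ => F)); auto. exact (TD_ren X S H).
Qed.

Lemma TD_tc : TD W C (fun e => tc (e 0)).
Proof.
  replace (fun e : assignment => tc (e 0)) with
    (fun e : assignment => trec (fun x g => union2 x (Un (gim g x))) (e 0))
    by (extensionality e; apply tc_trec).
  apply TD_trec0.
  - dsolve. apply TD_gim'; dsolve.
  - intros x g g' H. do 2 f_equal. apply gim_local. intros y v Hy. apply H. now apply tc_sub.
Qed.

Lemma TD_rank : TD W C (fun e => rank (e 0)).
Proof.
  apply TD_trec0.
  - dsolve; apply TD_gim'; dsolve.
  - intros x g g' H. replace (gim g' x) with (gim g x); auto.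
    apply gim_local. intros y v Hy. apply H. now apply tc_sub.
Qed.

Lemma TD_Vl : TD W C (fun e => Vl W (e 0)).
Proof.
  apply TD_trec0.
  - apply (TD_intro X) with (Phi := fun z e => exists v, v ∈ gim (e 1) (e 0) /\ subset z v).
    + intros e He. assert (K := TD_weaken X TD_gim).
      assert (Wg : W (gim (e 1) (e 0))) by (apply (proj1 K (scons (e 1) e)); now apply in_class_scons).
      pose proof (zf_ctx Z). apply (W_sep Z); [dsolve|]. now apply Z, Z.
    + intros e z He Hz. rewrite !mem_sep, mem_pow. split; [tauto|].
      intros (v & Hv & K). repeat split; eauto. intros w Hw. apply mem_Un. eauto.
    + dsolve. apply TD_gim'; dsolve.
  - intros x g g' H. replace (gim g' x) with (gim g x); auto.
    apply gim_local. intros y v Hy. apply H. now apply tc_sub.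
Qed.

Lemma TD_vl : TD W C (fun e => vl (e 0) (e 1)).
Proof.
  apply (TD_trec Z X (fun g s h => gim h (acts g s))).
  - apply TD_gim'; dsolve. apply (TD_ap2 X acts TD_acts); dsolve.
  - intros u x g g' H. apply gim_local. intros y v Hy. apply H.
    apply mem_acts in Hy. destruct Hy as (p & _ & Hy). eapply opr_left_tc; eauto.
Qed.

Lemma TD_chk : TD W C (fun e => chk (e 0) (e 1)).
Proof.
  apply (TD_trec Z X (fun a x h => prod (gim h x) a)).
  - dsolve. apply TD_gim'; dsolve.
  - intros u x g g' H. f_equal. apply gim_local. intros y v Hy. apply H. now apply tc_sub.
Qed.
End Operations.

Ltac dhook ::=
  lazymatch goal with
  | |- TD _ _ (fun _ => zempty) => eapply TD_empty; eassumption
  | |- TD _ _ (fun _ => omega) => eapply TD_omega; eassumption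
  | |- TD _ _ (fun e => opr _ _) => eapply (TD_ap2 ltac:(eassumption) opr); [eapply TD_opr; eassumption| |]
  | |- TD _ _ (fun e => upair _ _) => eapply (TD_ap2 ltac:(eassumption) upair); [eapply TD_upair; eassumption| |]
  | |- TD _ _ (fun e => union2 _ _) => eapply (TD_ap2 ltac:(eassumption) union2); [eapply TD_union2; eassumption| |]
  | |- TD _ _ (fun e => prod _ _) => eapply (TD_ap2 ltac:(eassumption) prod); [eapply TD_prod; eassumption| |]
  | |- TD _ _ (fun e => sing _) => eapply (TD_ap1 ltac:(eassumption) sing); [eapply TD_sing; eassumption|]
  | |- TD _ _ (fun e => suc _) => eapply (TD_ap1 ltac:(eassumption) suc); [eapply TD_suc; eassumption|]
  | |- TD _ _ (fun e => Un _) => eapply (TD_ap1 ltac:(eassumption) Un); [eapply TD_Un; eassumption|]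
  | |- TD _ _ (fun e => sep (pow _) ?W) =>
      eapply (TD_ap1 ltac:(eassumption) (fun x => sep (pow x) W)); [eapply TD_powW; eassumption|]
  | |- TD _ _ (fun e => gim _ _) => eapply (TD_ap2 ltac:(eassumption) gim); [eapply TD_gim; eassumption| |]
  | |- TD _ _ (fun e => acts _ _) => eapply (TD_ap2 ltac:(eassumption) acts); [eapply TD_acts; eassumption| |]
  | |- TD _ _ (fun e => vl _ _) => eapply (TD_ap2 ltac:(eassumption) vl); [eapply TD_vl; eassumption| |]
  | |- TD _ _ (fun e => chk _ _) => eapply (TD_ap2 ltac:(eassumption) chk); [eapply TD_chk; eassumption| |]
  | |- TD _ _ (fun e => tc _) => eapply (TD_ap1 ltac:(eassumption) tc); [eapply TD_tc; eassumption|]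
  | |- TD _ _ (fun e => rank _) => eapply (TD_ap1 ltac:(eassumption) rank); [eapply TD_rank; eassumption|]
  | |- TD _ _ (fun e => Vl ?W _) => eapply (TD_ap1 ltac:(eassumption) (Vl W)); [eapply TD_Vl; eassumption|]
  | |- D _ _ (fun e => subset _ _) => unfold subset
  | |- D _ _ (fun e => trans _) => unfold trans
  end.

Section Values.
Variable W : class.
Hypothesis Z : zf W.

Lemma W_tc x : W x -> W (tc x).
Proof. intro H. apply (proj1 (TD_tc Z (zf_ctx Z)) (fun _ => x)). intro; auto. Qed.
Lemma W_rank x : W x -> W (rank x).
Proof. intro H. apply (proj1 (TD_rank Z (zf_ctx Z)) (fun _ => x)). intro; auto. Qed.
Lemma W_Vl x : W x -> W (Vl W x).
Proof. intro H. apply (proj1 (TD_Vl Z (zf_ctx Z)) (fun _ => x)). intro; auto. Qed.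
Lemma W_vl g x : W g -> W x -> W (vl g x).
Proof.
  intros H K. apply (proj1 (TD_vl Z (zf_ctx Z)) (scons g (fun _ => x))). apply in_class_scons; auto. intro; auto.
Qed.
Lemma W_chk a x : W a -> W x -> W (chk a x).
Proof.
  intros H K. apply (proj1 (TD_chk Z (zf_ctx Z)) (scons a (fun _ => x))). apply in_class_scons; auto. intro; auto.
Qed.
Lemma W_gim a x : W a -> W x -> W (gim a x).
Proof.
  intros H K. apply (proj1 (TD_gim Z (zf_ctx Z)) (scons a (fun _ => x))). apply in_class_scons; auto. intro; auto.
Qed.
Lemma W_gname a : W a -> W (gname a).
Proof.
  intro Ha. unfold gname. pose proof (zf_ctx Z). apply W_img; auto; [dsolve|].
  intros x Hx. apply W_opr; auto; [apply W_chk; auto|]; exact (W_mem Z Ha Hx).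
Qed.
End Values.

(** * Ordinals, collection and choice *)

Definition ord (x : zset) := trans x /\ forall y, y ∈ x -> trans y.

Lemma ord_mem a b : ord a -> b ∈ a -> ord b.
Proof. intros [T H] Hb. split; auto. intros y Hy. apply H. eapply T; eauto. Qed.

Lemma ord_trans a b c : ord a -> b ∈ a -> c ∈ b -> c ∈ a.
Proof. intros [T _] H K. exact (T b H c K). Qed.

Lemma ord_cmp a : ord a -> forall b, ord b -> a ∈ b \/ a = b \/ b ∈ a.
Proof.
  induction a as [a IHa] using mem_ind. intros Oa b. induction b as [b IHb] using mem_ind. intro Ob.
  destruct (classic (a ∈ b)) as [|H1]; auto. destruct (classic (b ∈ a)) as [|H2]; auto.
  right; left. apply zset_ext. intro z. split; intro Hz.
  - destruct (IHa z Hz (ord_mem Oa Hz) b Ob) as [K|[K|K]]; auto; exfalso; apply H2.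
    + now subst.
    + exact (ord_trans Oa Hz K).
  - destruct (IHb z Hz (ord_mem Ob Hz)) as [K|[K|K]]; auto; exfalso; apply H1.
    + exact (ord_trans Ob Hz K).
    + now subst.
Qed.

Lemma ord_le a b : ord a -> ord b -> ~ b ∈ a -> subset a b.
Proof.
  intros Oa Ob H z Hz. destruct (ord_cmp Oa Ob) as [K|[->|K]]; auto; [|tauto]. exact (ord_trans Ob K Hz).
Qed.

Lemma ord_suc a : ord a -> ord (suc a).
Proof.
  intros [T H]. split.
  - intros y Hy z Hz. rewrite mem_suc in *. destruct Hy as [Hy| ->]; auto. left. eapply T; eauto.
  - intros y Hy. rewrite mem_suc in Hy. destruct Hy as [Hy| ->]; auto.
Qed.

Lemma ord_intro a : trans a -> (forall b, b ∈ a -> ord b) -> ord a.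
Proof. intros T H. split; auto. intros y Hy. apply H, Hy. Qed.

Lemma rank_ord x : ord (rank x).
Proof.
  induction x as [x IH] using mem_ind. apply ord_intro.
  - intros y Hy z Hz. rewrite mem_rank in *. destruct Hy as (w & Hw & [Hy| ->]).
    + exists w. split; auto. left. exact (ord_trans (IH w Hw) Hy Hz).
    + exists w. auto.
  - intros y Hy. rewrite mem_rank in Hy. destruct Hy as (w & Hw & [Hy| ->]); auto.
    eapply ord_mem; [apply (IH w)|]; auto.
Qed.

Lemma rank_mem x y : y ∈ x -> rank y ∈ rank x.
Proof. intro H. apply mem_rank. eauto. Qed.

Lemma num_ord n : ord (num n).
Proof.
  induction n; cbn; [|now apply ord_suc]. split; intros y Hy; now apply not_mem_empty in Hy.
Qed.

Lemma omega_ord : ord omega.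
Proof.
  apply ord_intro.
  - intros y Hy z Hz. apply mem_omega in Hy. destruct Hy as [n ->]. apply mem_num in Hz.
    destruct Hz as (m & _ & ->). apply num_in_omega.
  - intros b Hb. apply mem_omega in Hb. destruct Hb as [n ->]. apply num_ord.
Qed.

Lemma sub_Vl_rank W : transitive_class W -> forall x, W x -> subset x (Vl W (rank x)).
Proof.
  intros tr x. induction x as [x IH] using mem_ind. intros Wx y Hy.
  assert (W y) by eauto. apply mem_Vl. split; auto. exists (rank y). split; auto. now apply rank_mem.
Qed.

Lemma D_ord W C (X : dctx W C) t : TD W C t -> D W C (fun e => ord (t e)).
Proof. intro H. apply (D_rel1 X ord); auto. unfold ord, trans, subset. dsolve. Qed.

(** Scott's trick: replacement is applied to the least rank of a witness, and the hierarchy over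
    these ranks contains witnesses. *)
Lemma collection W : zf W -> forall (R : zset -> zset -> Prop) a, D W W (fun e => R (e 0) (e 1)) -> W a ->
  (forall x, x ∈ a -> exists y, W y /\ R x y) ->
  exists b, W b /\ forall x, x ∈ a -> exists y, y ∈ b /\ R x y.
Proof.
  intros Z R a HD Wa H. pose proof (zf_ctx Z) as X.
  destruct (@W_repl W Z (fun x r => exists y, W y /\ R x y /\ r = rank y /\
     forall z, W z -> R x z -> ~ rank z ∈ r) a) as (b & Wb & Hb); auto.
  - dsolve; apply (D_rel2 X R HD); dsolve.
  - intros x r r' Hx _ _ (y & Wy & Ry & Er & K) (y' & Wy' & Ry' & Er' & K'). subst r r'.
    destruct (ord_cmp (rank_ord y) (rank_ord y')) as [L|[L|L]]; auto; exfalso; [exact (K' y Wy Ry L)|exact (K y' Wy' Ry' L)].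
  - exists (Vl W b). split; [apply (W_Vl Z), Wb|]. intros x Hx.
    destruct (@mem_minimal (fun r => exists y, W y /\ R x y /\ r = rank y)) as (r & (y & Wy & Ry & Er) & K).
    { destruct (H x Hx) as (y & ? & ?). exists (rank y). eauto. }
    exists y. split; auto. apply mem_Vl. split; auto. exists r. split.
    + apply Hb. subst r. split; [now apply W_rank|]. exists x. split; auto. exists y. split; auto.
      split; auto. split; auto. intros z Wz Rz Hz. apply (K _ Hz). eauto.
    + subst r. apply sub_Vl_rank; auto. apply Z.
Qed.

Definition zchoice (W : class) := forall a, W a ->
    (forall x, W x -> x ∈ a -> exists y, W y /\ y ∈ x) ->
    (forall x x' y, W x -> W x' -> W y -> x ∈ a -> x' ∈ a -> y ∈ x -> y ∈ x' -> x = x') ->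
    exists c, W c /\ forall x, W x -> x ∈ a ->
      exists y, W y /\ y ∈ c /\ y ∈ x /\ forall y', W y' -> y' ∈ c -> y' ∈ x -> y' = y.

Definition func (f a : zset) : Prop :=
  (forall p, p ∈ f -> exists x, x ∈ a /\ exists y, p = opr x y) /\
  forall x, x ∈ a -> exists y, opr x y ∈ f /\ forall y', opr x y' ∈ f -> y' = y.
(** The union removes the braces around the single value. *)
Definition ap (f x : zset) : zset := Un (gim f (sing x)).

Lemma ap_eq f a x y : func f a -> opr x y ∈ f -> ap f x = y.
Proof.
  intros [H1 H2] H. destruct (H1 _ H) as (x' & Hx & y' & E). apply opr_inj in E. destruct E as [<- <-].
  destruct (H2 x Hx) as (z & _ & K). assert (forall y', opr x y' ∈ f -> y' = y).
  { intros y' Hy'. rewrite (K _ Hy'). symmetry. now apply K. }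
  apply zset_ext. intro w. unfold ap. rewrite mem_Un. split.
  - intros (v & Hv & Hw). apply mem_gim in Hv. destruct Hv as (x' & Hx' & Hv). apply mem_sing in Hx'.
    subst x'. now rewrite <- (H0 _ Hv).
  - intro Hw. exists y. split; auto. apply mem_gim. exists x. rewrite mem_sing. auto.
Qed.

Lemma ap_mem f a x : func f a -> x ∈ a -> opr x (ap f x) ∈ f.
Proof.
  intros F Hx. destruct (proj2 F x Hx) as (y & Hy & _). now rewrite (ap_eq F Hy).
Qed.

Lemma func_graph F a : func (graph F a) a.
Proof.
  split.
  - intros p Hp. apply mem_img in Hp. destruct Hp as (x & Hx & ->). eauto.
  - intros x Hx. exists (F x). split; [now apply mem_graph|]. intros y' H. now apply mem_graph in H.
Qed.

Lemma ap_graph F a x : x ∈ a -> ap (graph F a) x = F x.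
Proof. intro H. apply (ap_eq (func_graph F a)). now apply mem_graph. Qed.

Section Choice.
Variable W : class.
Hypothesis Z : zf W.
Hypothesis AC : zchoice W.

Lemma W_ap f x : W f -> W x -> W (ap f x).
Proof. intros. apply Z, W_gim; auto. now apply W_sing. Qed.

Lemma W_graph_TD F a : TD W W (fun e => F (e 0)) -> W a -> W (graph F a).
Proof.
  intros H Wa. pose proof (zf_ctx Z) as X. unfold graph. apply W_img_TD; auto. dsolve.
Qed.

Lemma choice_function (R : zset -> zset -> Prop) a : D W W (fun e => R (e 0) (e 1)) -> W a ->
  (forall x, x ∈ a -> exists y, W y /\ R x y) ->
  exists f, W f /\ func f a /\ forall x, x ∈ a -> R x (ap f x).
Proof.
  intros HD Wa H. pose proof (zf_ctx Z) as X.
  destruct (collection Z R HD Wa H) as (b & Wb & Hb).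
  (* The witnesses for [x] are tagged with [x], which makes the sets disjoint as the axiom of choice
     requires. *)
  set (F := fun x => sep (prod (sing x) b) (fun p => exists y, y ∈ b /\ p = opr x y /\ R x y)).
  assert (mF : forall x p, p ∈ F x <-> exists y, y ∈ b /\ p = opr x y /\ R x y).
  { intros x p. unfold F. rewrite mem_sep. split; [tauto|]. intros (y & Hy & -> & K). split; eauto.
    apply opr_in_prod. rewrite mem_sing. auto. }
  assert (WF : forall x, W x -> W (F x)).
  { intros x Wx. unfold F. apply W_sep; auto; [|apply W_prod; auto; now apply W_sing].
    dsolve. apply (D_rel2 X R HD); dsolve. }
  destruct (@AC (img a F)) as (c & Wc & Hc).
  - apply W_img_TD; auto. apply (TD_intro X) with (t := fun e => F (e 0)) (Phi := fun p e => exists y, y ∈ b /\ p = opr (e 0) y /\ R (e 0) y).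
    + intros e He. apply WF, He.
    + intros. apply mF.
    + dsolve. apply (D_rel2 X R HD); dsolve.
  - intros S _ HS. apply mem_img in HS. destruct HS as (x & Hx & ->).
    destruct (Hb x Hx) as (y & Hy & K). exists (opr x y). split; [|apply mF; eauto].
    apply W_opr; auto; [exact (W_mem Z Wa Hx)|exact (W_mem Z Wb Hy)].
  - intros S S' p _ _ _ HS HS' H1 H2. apply mem_img in HS, HS'.
    destruct HS as (x & Hx & ->), HS' as (x' & Hx' & ->). apply mF in H1, H2.
    destruct H1 as (y & _ & -> & _), H2 as (y' & _ & E & _). apply opr_inj in E. now destruct E as [-> _].
  (* The set given by the axiom may contain stray elements, so only pairs of the right kind are
     kept. *)
  - exists (sep c (fun p => exists x, x ∈ a /\ exists y, y ∈ b /\ p = opr x y /\ R x y)).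
    set (f := sep c _).
    assert (mf : forall x, x ∈ a -> exists y, opr x y ∈ f /\ R x y /\ forall y', opr x y' ∈ f -> y' = y).
    { intros x Hx. assert (Wx := W_mem Z Wa Hx). destruct (Hc (F x)) as (p & Wp & Hpc & Hp & U).
      - now apply WF.
      - apply mem_img. eauto.
      - apply mF in Hp. destruct Hp as (y & Hy & -> & K). exists y. repeat split; auto.
        + unfold f. apply mem_sep. split; auto. exists x. split; auto. exists y. auto.
        + intros y' Hy'. unfold f in Hy'. apply mem_sep in Hy'.
          destruct Hy' as (Hy'c & x' & _ & y1 & Hy1 & E & K1). apply opr_inj in E. destruct E as [<- <-].
          assert (Q : opr x y' = opr x y).
          { apply U; auto; [exact (W_mem Z Wc Hy'c)|]. apply mF. eauto. }
          now apply opr_inj in Q. }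
    assert (Ff : func f a).
    { split.
      - intros p Hp. apply mem_sep in Hp. destruct Hp as (_ & x & Hx & y & _ & -> & _). eauto.
      - intros x Hx. destruct (mf x Hx) as (y & ? & _ & ?). eauto. }
    split; [|split; auto].
    + apply W_sep; auto. dsolve. apply (D_rel2 X R HD); dsolve.
    + intros x Hx. destruct (mf x Hx) as (y & Hy & K & _). now rewrite (ap_eq Ff Hy).
Qed.
End Choice.

(** * Definability of forcing *)

Lemma rel_eq : rel = fun r x y => opr x y ∈ r.
Proof. extensionality r. extensionality x. extensionality y. apply propositional_extensionality, rel_opr. Qed.

Section Forcing.
Variables V C : class.
Hypothesis Z : zf V.
Hypothesis X : dctx V C.
Variables a le : zset.
Hypothesis Ca : C a.
Hypothesis Cle : C le.

Let A : class := fun p => p ∈ a.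

(* One half of the recursive clause for [p ⊩ τ = σ]; [h] is the relation
   "[r' ⊩ π = ρ]" restricted to the names already treated. *)
Let half (h : zset -> zset -> zset -> Prop) p s1 s2 :=
  forall π, π ∈ Un (Un s1) -> forall s, s ∈ a -> opr π s ∈ s1 -> forall r, r ∈ a ->
    opr r p ∈ le -> opr r s ∈ le ->
    exists r', r' ∈ a /\ exists ρ, ρ ∈ Un (Un s2) /\ exists t, t ∈ a /\
      opr r' r ∈ le /\ opr ρ t ∈ s2 /\ opr r' t ∈ le /\ h π ρ r'.

(** Forcing of equality as a recursion on the left name: the value at [s] is the set of pairs of a
    name σ in [t] and a condition forcing [s] and σ to be equal. The bound [t] on the right name
    keeps this a set. *)
Let step t s h :=
  sep (prod t a) (fun w => exists σ, σ ∈ t /\ exists p, p ∈ a /\ w = opr σ p /\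
    half (fun π ρ r => exists v, v ∈ gim h (sing π) /\ opr ρ r ∈ v) p s σ /\
    half (fun ρ π r => exists v, v ∈ gim h (sing π) /\ opr ρ r ∈ v) p σ s).

Lemma forces_eq_half p s1 s2 : forces_eq A le p s1 s2 <->
  half (fun π ρ r => forces_eq A le r π ρ) p s1 s2 /\ half (fun ρ π r => forces_eq A le r π ρ) p s2 s1.
Proof.
  split.
  - intro H. inversion H as [p' s1' s2' H1 H2]; subst. split.
    + intros π _ s Hs Hπ r Hr Hrp Hrs.
      destruct (H1 π s r) as (r' & ρ & t & ? & ? & ? & K & ? & ?); auto; try now apply rel_opr.
      rewrite rel_opr in *. exists r'. split; auto. exists ρ. split; [eapply opr_left; eauto|]. eauto 10.
    + intros π _ s Hs Hπ r Hr Hrp Hrs.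
      destruct (H2 π s r) as (r' & ρ & t & ? & ? & ? & K & ? & ?); auto; try now apply rel_opr.
      rewrite rel_opr in *. exists r'. split; auto. exists ρ. split; [eapply opr_left; eauto|]. eauto 10.
  - intros [H1 H2]. constructor.
    + intros π s r Hs Hπ Hr Hrp Hrs. rewrite rel_opr in Hπ, Hrp, Hrs.
      destruct (H1 π (opr_left Hπ) s Hs Hπ r Hr Hrp Hrs) as (r' & ? & ρ & _ & t & ? & ? & ? & ? & ?).
      exists r', ρ, t. rewrite !rel_opr. auto 10.
    + intros π s r Hs Hπ Hr Hrp Hrs. rewrite rel_opr in Hπ, Hrp, Hrs.
      destruct (H2 π (opr_left Hπ) s Hs Hπ r Hr Hrp Hrs) as (r' & ? & ρ & _ & t & ? & ? & ? & ? & ?).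
      exists r', ρ, t. rewrite !rel_opr. auto 10.
Qed.

Lemma half_mono (h h' : zset -> zset -> zset -> Prop) p s1 s2 :
  (forall π ρ r, π ∈ Un (Un s1) -> ρ ∈ Un (Un s2) -> r ∈ a -> h π ρ r -> h' π ρ r) ->
  half h p s1 s2 -> half h' p s1 s2.
Proof.
  intros H K π Hπ s Hs Hπs r Hr Hrp Hrs.
  destruct (K π Hπ s Hs Hπs r Hr Hrp Hrs) as (r' & ? & ρ & ? & t & ? & ? & ? & ? & ?).
  exists r'. split; auto. exists ρ. split; auto. exists t. auto 10.
Qed.

Lemma Un2_tc s x : x ∈ Un (Un s) -> x ∈ tc s.
Proof.
  intro H. apply mem_Un in H. destruct H as (y & Hy & Hx). apply mem_Un in Hy. destruct Hy as (w & Hw & Hy).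
  apply (@tc_trans s y); auto. apply (@tc_trans s w); auto. now apply tc_sub.
Qed.

(** Transitivity of [t] keeps the names occurring in σ within the bound during the induction. *)
Lemma step_spec t : trans t -> forall s σ p, σ ∈ t -> p ∈ a ->
  (opr σ p ∈ trec (step t) s <-> forces_eq A le p s σ).
Proof.
  intros T s. induction s as [s IH] using tc_ind. intros σ p Hσ Hp.
  assert (B : forall ρ, ρ ∈ Un (Un σ) -> ρ ∈ t).
  { intros ρ Hρ. apply (@tc_least σ t); [apply T; auto|auto|now apply Un2_tc]. }
  assert (E : forall π ρ r, π ∈ Un (Un s) -> ρ ∈ Un (Un σ) -> r ∈ a ->
    ((exists v, v ∈ gim (graph (trec (step t)) (tc s)) (sing π) /\ opr ρ r ∈ v) <-> forces_eq A le r π ρ)).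
  { intros π ρ r Hπ Hρ Hr. assert (Q := Un2_tc Hπ). split.
    - intros (v & Hv & K). apply mem_gim in Hv. destruct Hv as (y & Hy & Hv). apply mem_sing in Hy. subst y.
      apply mem_graph in Hv. destruct Hv as [_ ->]. apply IH in K; auto.
    - intro K. exists (trec (step t) π). split; [|apply IH; auto]. apply mem_gim. exists π.
      rewrite mem_sing, mem_graph. auto. }
  rewrite trec_eq. unfold step at 1. rewrite mem_sep, opr_in_prod, forces_eq_half. split.
  - intros (_ & σ' & _ & p' & _ & Ew & H1 & H2). apply opr_inj in Ew. destruct Ew as [<- <-]. split.
    + revert H1. apply half_mono. intros. apply E; auto.
    + revert H2. apply half_mono. intros. apply E; auto.
  - intros [H1 H2]. split; auto. exists σ. split; auto. exists p. split; auto. split; auto. split.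
    + revert H1. apply half_mono. intros. apply E; auto.
    + revert H2. apply half_mono. intros. apply E; auto.
Qed.

Lemma TD_step : TD V C (fun e => step (e 0) (e 1) (e 2)).
Proof.
  assert (HD : forall W, dctx V W -> W a -> W le -> D V W (fun e => exists σ, σ ∈ e 1 /\ exists p, p ∈ a /\ e 0 = opr σ p /\
    half (fun π ρ r => exists v, v ∈ gim (e 3) (sing π) /\ opr ρ r ∈ v) p (e 2) σ /\
    half (fun ρ π r => exists v, v ∈ gim (e 3) (sing π) /\ opr ρ r ∈ v) p σ (e 2))).
  { intros W XW Wa Wl. unfold half. dsolve. }
  apply (TD_intro X) with (Phi := fun w e => exists σ, σ ∈ e 0 /\ exists p, p ∈ a /\ w = opr σ p /\
    half (fun π ρ r => exists v, v ∈ gim (e 2) (sing π) /\ opr ρ r ∈ v) p (e 1) σ /\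
    half (fun ρ π r => exists v, v ∈ gim (e 2) (sing π) /\ opr ρ r ∈ v) p σ (e 1)).
  - intros e He. assert (XV := zf_ctx Z). assert (Va : V a) by now apply (dctx_sub X).
    assert (Vl : V le) by now apply (dctx_sub X).
    pose proof (He 0) as H0; pose proof (He 1) as H1; pose proof (He 2) as H2. cbn beta in *.
    unfold step. apply (W_sep Z); [|now apply W_prod]. unfold half. dsolve.
  - intros e w _ _. unfold step. rewrite mem_sep. split; [tauto|].
    intros (σ & Hσ & p & Hp & -> & K). split; eauto 10. now apply opr_in_prod.
  - apply HD; auto.
Qed.

Lemma step_local t s g g' : (forall y v, y ∈ tc s -> (opr y v ∈ g <-> opr y v ∈ g')) -> step t s g = step t s g'.
Proof.
  intro H. apply zset_ext. intro w. unfold step. rewrite !mem_sep.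
  assert (E : forall π, π ∈ Un (Un s) -> gim g (sing π) = gim g' (sing π)).
  { intros π Hπ. apply gim_local. intros y v Hy. apply mem_sing in Hy. subst y. apply H, Un2_tc, Hπ. }
  split; intros (Hw & σ & Hσ & p & Hp & Ew & H1 & H2); (split; auto); exists σ; (split; auto); exists p;
    (split; auto); (split; auto); split;
    ((revert H1; apply half_mono) || (revert H2; apply half_mono)); cbn;
    intros π ρ r Hπ Hρ Hr (v & Hv & K); exists v; split; auto;
    rewrite E in * by auto; auto.
Qed.

Definition feq p s1 s2 := p ∈ a /\ forces_eq (fun p => p ∈ a) le p s1 s2.
Definition fmem p s1 s2 := p ∈ a /\ forces_mem (fun p => p ∈ a) le p s1 s2.

Lemma D_feq_base : D V C (fun e => feq (e 0) (e 1) (e 2)).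
Proof.
  apply (D_ext X) with (Psi := fun e => e 0 ∈ a /\ opr (e 2) (e 0) ∈ trec (step (tc (sing (e 2)))) (e 1)).
  - intros e He. unfold feq. split; intros [H K]; split; auto.
    + apply step_spec; auto; [apply tc_trans|]. apply tc_sub. now apply mem_sing.
    + apply step_spec in K; auto; [apply tc_trans|]. apply tc_sub. now apply mem_sing.
  - dsolve. apply (TD_ap2 X (fun t s => trec (step t) s)); [|dsolve..].
    apply (TD_trec Z X step TD_step). intros. now apply step_local.
Qed.

Lemma D_feq t u v : TD V C t -> TD V C u -> TD V C v -> D V C (fun e => feq (t e) (u e) (v e)).
Proof. intros. apply (D_rel3 X feq D_feq_base); auto. Qed.

Lemma fmem_iff p s1 s2 : fmem p s1 s2 <-> p ∈ a /\ forall r, r ∈ a -> opr r p ∈ le ->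
  exists r', r' ∈ a /\ exists ρ, ρ ∈ Un (Un s2) /\ exists t, t ∈ a /\
      opr r' r ∈ le /\ opr ρ t ∈ s2 /\ opr r' t ∈ le /\ feq r' s1 ρ.
Proof.
  unfold fmem, forces_mem, feq. rewrite rel_eq. split; intros [Hp H]; split; auto; intros r Hr Hrp.
  - destruct (H r Hr Hrp) as (r' & ρ & t & ? & ? & ? & K & ? & ?). exists r'. split; auto. exists ρ.
    split; [eapply opr_left; eauto|]. exists t. auto 10.
  - destruct (H r Hr Hrp) as (r' & ? & ρ & ? & t & ? & ? & K & ? & ? & ?). exists r', ρ, t. auto 10.
Qed.

Lemma D_fmem t u v : TD V C t -> TD V C u -> TD V C v -> D V C (fun e => fmem (t e) (u e) (v e)).
Proof.
  intros. apply (D_rel3 X fmem); auto. eapply (D_ext X); [intros e _; apply fmem_iff|]. dsolve.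
  apply D_feq; dsolve.
Qed.

Definition frc (e : assignment) (f : pure) (p : zset) := p ∈ a /\ forces V (fun p => p ∈ a) le e f p.

Definition tm (T : nat + zset) (e : assignment) : zset := match T with inl k => e k | inr c => c end.

Lemma TD_tm T : (forall c, T = inr c -> C c) -> TD V C (tm T).
Proof. destruct T as [k|c]; intro H; [apply (TD_var X)|]. apply (TD_const X). auto. Qed.

Lemma upd_tm (T : nat -> nat + zset) i x e :
  (fun j => tm (if Nat.eqb j i then inl 0 else match T j with inl k => inl (S k) | inr c => inr c end) (scons x e))
  = upd (fun j => tm (T j) e) i x.
Proof.
  extensionality j. unfold upd, tm. destruct (Nat.eqb j i); auto. now destruct (T j).
Qed.

(** [T] says which variables of the formula are object variables and which are parameters. Under a
    quantifier the bound variable becomes object variable 0 and the others shift, so the induction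
    ranges over all [T]. *)
Lemma D_frc (f : pure) : forall (T : nat -> nat + zset) k, (forall i c, T i = inr c -> C c) ->
  D V C (fun e => frc (fun i => tm (T i) e) f (e k)).
Proof.
  induction f as [i j|i j|s| |f1 IH1 f2 IH2|i f IH]; intros T k HT.
  - apply D_fmem; [apply (TD_var X)|apply TD_tm; eauto..].
  - apply D_feq; [apply (TD_var X)|apply TD_tm; eauto..].
  - destruct s.
  - unfold frc. cbn. dsolve.
  - set (T' := fun i => match T i with inl k => inl (S k) | inr c => inr c end : nat + zset).
    assert (HT' : forall i c, T' i = inr c -> C c).
    { intros i c. unfold T'. destruct (T i) eqn:E; intro Q; inversion Q; subst; eauto. }
    assert (ET : forall x e, (fun i => tm (T' i) (scons x e)) = (fun i => tm (T i) e)).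
    { intros x e. extensionality i. unfold T', tm. now destruct (T i). }
    apply (D_ext X) with (Psi := fun e => e k ∈ a /\ forall r, r ∈ a -> opr r (e k) ∈ le ->
      frc (fun i => tm (T i) e) f1 r -> frc (fun i => tm (T i) e) f2 r).
    + intros e He. unfold frc. cbn [forces]. rewrite rel_eq. split; intros [H K]; split; auto.
      * intros r Hr Hrk [_ L]. auto.
      * intros r Hr Hrk L. apply K; auto.
    + dsolve.
      * apply (D_ext X) with (Psi := fun e => frc (fun i => tm (T' i) e) f1 (e 0)); [|now apply IH1].
        intros e He. assert (Q := ET (e 0) (fun k => e (S k))).
        replace (scons (e 0) (fun k => e (S k))) with e in Q by (extensionality j; now destruct j).
        rewrite Q. reflexivity.
      * apply (D_ext X) with (Psi := fun e => frc (fun i => tm (T' i) e) f2 (e 0)); [|now apply IH2].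
        intros e He. assert (Q := ET (e 0) (fun k => e (S k))).
        replace (scons (e 0) (fun k => e (S k))) with e in Q by (extensionality j; now destruct j).
        rewrite Q. reflexivity.
  - set (T' := fun j => if Nat.eqb j i then inl 0 else match T j with inl k => inl (S k) | inr c => inr c end : nat + zset).
    assert (HT' : forall i c, T' i = inr c -> C c).
    { intros j c. unfold T'. destruct (Nat.eqb j i); [discriminate|].
      destruct (T j) eqn:E; intro Q; inversion Q; subst; eauto. }
    apply (D_ext X) with (Psi := fun e => e k ∈ a /\ forall x, V x -> frc (upd (fun i => tm (T i) e) i x) f (e k)).
    + intros e He. unfold frc. cbn [forces]. split; intros [H K]; split; auto; intros x Hx; apply K; auto.
    + dsolve.
      apply (D_ext X) with (Psi := fun e => frc (fun i => tm (T' i) e) f (e (S k))); [|now apply IH].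
      intros e He. assert (Q := upd_tm T i (e 0) (fun k => e (S k))).
      replace (scons (e 0) (fun k => e (S k))) with e in Q by (extensionality j; now destruct j).
      fold (T') in Q. rewrite <- Q. reflexivity.
Qed.
End Forcing.

(** * The truth lemma *)

Definition preorder (a le : zset) : Prop :=
  (forall p, p ∈ a -> opr p p ∈ le) /\
  (forall p q r, p ∈ a -> q ∈ a -> r ∈ a -> opr p q ∈ le -> opr q r ∈ le -> opr p r ∈ le).

Section Truth.
Variables V C : class.
Hypothesis Z : zf V.
Hypothesis X : dctx V C.
(* [C] is an elementary submodel of [V], possibly [V] itself. *)
Hypothesis elem : forall P : zset -> Prop, D V C (fun e => P (e 0)) -> (exists x, V x /\ P x) -> exists x, C x /\ P x.
Variables a le : zset.
Hypothesis Ca : C a.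
Hypothesis Cle : C le.
Hypothesis Hpre : preorder a le.

Notation "p ⪯ q" := (opr p q ∈ le) (at level 70).
Notation feq := (feq a le).
Notation fmem := (fmem a le).
Notation frc := (frc V a le).

Let refl p : p ∈ a -> p ⪯ p.
Proof. apply Hpre. Qed.
Let ltrans p q r : p ∈ a -> q ∈ a -> r ∈ a -> p ⪯ q -> q ⪯ r -> p ⪯ r.
Proof. apply Hpre. Qed.

Lemma feq_mono p q s1 s2 : q ∈ a -> q ⪯ p -> feq p s1 s2 -> feq q s1 s2.
Proof.
  unfold feq. intros Hq Hqp [Hp H]. split; auto. inversion H as [p' s1' s2' H1 H2]; subst. constructor.
  - intros π s r Hs Hπ Hr Hrq Hrs. apply rel_opr in Hrq. apply (H1 π s); auto. apply rel_opr. eapply ltrans; [| | |exact Hrq|]; auto.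
  - intros π s r Hs Hπ Hr Hrq Hrs. apply rel_opr in Hrq. apply (H2 π s); auto. apply rel_opr. eapply ltrans; [| | |exact Hrq|]; auto.
Qed.

Lemma fmem_mono p q s1 s2 : q ∈ a -> q ⪯ p -> fmem p s1 s2 -> fmem q s1 s2.
Proof.
  rewrite !fmem_iff. intros Hq Hqp [Hp H]. split; auto. intros r Hr Hrq. apply H; auto.
  eapply ltrans; [| | |exact Hrq|]; auto.
Qed.

Lemma frc_mono f : forall e p q, q ∈ a -> q ⪯ p -> frc e f p -> frc e f q.
Proof.
  induction f as [i j|i j|s| |f1 IH1 f2 IH2|i f IH]; intros e p q Hq Hqp [Hp H].
  - apply (@fmem_mono p); auto. split; auto.
  - apply (@feq_mono p); auto. split; auto.
  - destruct s.
  - destruct H.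
  - split; auto. cbn in *. intros r Hr Hrq K. apply H; auto. rewrite rel_opr in *.
    eapply ltrans; [| | |exact Hrq|]; auto.
  - split; auto. cbn in *. intros x Hx. apply (IH _ p q Hq Hqp). split; auto.
Qed.

Lemma feq_dense p s1 s2 : p ∈ a ->
  (forall r, r ∈ a -> r ⪯ p -> exists r', r' ∈ a /\ r' ⪯ r /\ feq r' s1 s2) -> feq p s1 s2.
Proof.
  intros Hp H. split; auto. constructor; intros π s r Hs Hπ Hr Hrp Hrs; rewrite rel_opr in Hrp, Hrs;
  destruct (H r Hr Hrp) as (q & Hq & Hqr & _ & K); inversion K as [p' s1' s2' H1 H2]; subst.
  - destruct (H1 π s q) as (r' & ρ & t & H3 & H4 & K'); auto; try (rewrite rel_opr; eauto).
    exists r', ρ, t. split; auto. split; auto. rewrite rel_opr in *. eauto.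
  - destruct (H2 π s q) as (r' & ρ & t & H3 & H4 & K'); auto; try (rewrite rel_opr; eauto).
    exists r', ρ, t. split; auto. split; auto. rewrite rel_opr in *. eauto.
Qed.

Lemma fmem_dense p s1 s2 : p ∈ a ->
  (forall r, r ∈ a -> r ⪯ p -> exists r', r' ∈ a /\ r' ⪯ r /\ fmem r' s1 s2) -> fmem p s1 s2.
Proof.
  intros Hp H. apply fmem_iff. split; auto. intros r Hr Hrp.
  destruct (H r Hr Hrp) as (q & Hq & Hqr & K). apply fmem_iff in K. destruct K as [_ K].
  destruct (K q Hq (refl Hq)) as (r' & Hr' & ρ & ? & t & ? & Hrq & K').
  exists r'. split; auto. exists ρ. split; auto. exists t. split; auto. split; [|auto].
  exact (ltrans Hr' Hq Hr Hrq Hqr).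
Qed.

(** The clauses for equality and membership speak of densely many extensions, and the other clauses
    inherit this locality. A failure to force is therefore witnessed by a condition none of whose
    extensions forces. *)
Lemma frc_dense f : forall e p, p ∈ a ->
  (forall r, r ∈ a -> r ⪯ p -> exists r', r' ∈ a /\ r' ⪯ r /\ frc e f r') -> frc e f p.
Proof.
  induction f as [i j|i j|s| |f1 IH1 f2 IH2|i f IH]; intros e p Hp H.
  - now apply fmem_dense.
  - now apply feq_dense.
  - destruct s.
  - destruct (H p Hp (refl Hp)) as (r & _ & _ & _ & []).
  - split; auto. cbn. intros r Hr Hrp K. rewrite rel_opr in Hrp. apply IH2; auto. intros r1 Hr1 Hr1r.
    destruct (H r1 Hr1) as (r2 & Hr2 & H21 & _ & L); [exact (ltrans Hr1 Hr Hp Hr1r Hrp)|].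
    exists r2. split; auto. split; auto. split; auto. apply L; auto; [apply rel_opr; auto|].
    apply (@frc_mono f1 e r r2); auto; [|split; auto]. exact (ltrans Hr2 Hr1 Hr H21 Hr1r).
  - split; auto. cbn. intros x Hx. apply IH; auto. intros r Hr Hrp.
    destruct (H r Hr Hrp) as (r' & Hr' & ? & _ & K). exists r'. split; auto. split; auto. split; auto.
Qed.

Variable g : zset.
Hypothesis g_sub : forall p, p ∈ g -> p ∈ a /\ C p.
Hypothesis g_inh : exists p, p ∈ g.
Hypothesis g_up : forall p q, p ∈ g -> q ∈ a -> C q -> p ⪯ q -> q ∈ g.
Hypothesis g_dir : forall p q, p ∈ g -> q ∈ g -> exists r, r ∈ g /\ r ⪯ p /\ r ⪯ q.
Hypothesis g_gen : forall d, C d -> (forall p, p ∈ d -> p ∈ a) ->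
  (forall p, p ∈ a -> exists q, q ∈ d /\ q ⪯ p) -> exists p, p ∈ d /\ p ∈ g.

(** [c] is the only solution in V of its defining formula, and elementarity provides a solution in
    [C]. *)
Lemma C_TD c : TD V C (fun _ => c) -> C c.
Proof.
  intros [H K]. destruct (dctx_inh X) as [x0 Hx0].
  assert (Vc : V c) by (apply (H (fun _ => x0)); intro; now apply (dctx_sub X)).
  destruct (@elem (fun x => x = c) K (ex_intro _ c (conj Vc eq_refl))) as (x & Hx & ->). exact Hx.
Qed.

Lemma C_sep P x : D V C (fun e => P (e 0)) -> C x -> C (sep x P).
Proof.
  intros H Cx. apply C_TD. apply (TD_intro X) with (Phi := fun z _ => z ∈ x /\ P z).
  - intros _ _. apply (W_sep Z); [exact (D_weaken X H)|]. now apply (dctx_sub X).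
  - intros. apply mem_sep.
  - dsolve.
Qed.

Lemma generic_below E r0 : r0 ∈ g -> D V C (fun e => E (e 0)) ->
  (forall r, r ∈ a -> r ⪯ r0 -> exists r', r' ∈ a /\ r' ⪯ r /\ E r') -> exists r, r ∈ g /\ E r.
Proof.
  intros Hr0 HD H. destruct (g_sub Hr0) as [Ar0 Cr0].
  (* Conditions incompatible with [r0] are added to make the set dense; directedness keeps them out
     of [g]. *)
  destruct (@g_gen (sep a (fun r => E r \/ forall r', r' ∈ a -> r' ⪯ r -> ~ r' ⪯ r0))) as (r & Hr & Hg).
  - apply C_sep; auto. dsolve.
  - intros p Hp. apply mem_sep in Hp. tauto.
  - intros p Hp. destruct (classic (exists r', r' ∈ a /\ r' ⪯ p /\ r' ⪯ r0)) as [(r & Hr & H1 & H2)|N].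
    + destruct (H r Hr H2) as (r' & Hr' & H3 & K). exists r'. rewrite mem_sep. split; auto.
      exact (ltrans Hr' Hr Hp H3 H1).
    + exists p. split; auto. rewrite mem_sep. split; auto. right. intros r' ? ? ?. eauto.
  - apply mem_sep in Hr. destruct Hr as [_ [Hr|Hr]]; eauto. exfalso.
    destruct (g_dir Hg Hr0) as (q & Hq & H1 & H2). apply (Hr q); auto. now apply g_sub.
Qed.

Lemma generic_dense E : D V C (fun e => E (e 0)) ->
  (forall r, r ∈ a -> exists r', r' ∈ a /\ r' ⪯ r /\ E r') -> exists r, r ∈ g /\ E r.
Proof. intros HD H. destruct g_inh as [r0 Hr0]. apply (generic_below E Hr0); auto. Qed.

(** The form in which genericity is mostly used below: the conditions satisfying [E], together with
    those having no extension that does, are dense. *)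
Lemma generic_decide E : D V C (fun e => E (e 0)) ->
  (exists r, r ∈ g /\ E r) \/ exists r, r ∈ g /\ forall r', r' ∈ a -> r' ⪯ r -> ~ E r'.
Proof.
  intro HD. destruct (@generic_dense (fun r => E r \/ forall r', r' ∈ a -> r' ⪯ r -> ~ E r')) as (r & Hr & [K|K]); eauto.
  - dsolve.
  - intros r Hr. destruct (classic (exists r', r' ∈ a /\ r' ⪯ r /\ E r')) as [(r' & ? & ? & ?)|N]; [eauto 10|].
    exists r. split; auto. split; auto. right. intros r' ? ? ?. apply N. eauto.
Qed.

(* Only the elements of [s] in [C] are evaluated: this is the value of the image of [s] under the collapse of [C]. *)
Definition vlc : zset -> zset := trec (fun s h => gim h (sep (acts g s) C)).

Lemma mem_vlc s z : z ∈ vlc s <-> exists r p, p ∈ g /\ opr r p ∈ s /\ C r /\ z = vlc r.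
Proof.
  unfold vlc at 1. rewrite trec_eq, gim_graph; fold vlc.
  - rewrite mem_img. split.
    + intros (r & Hr & ->). apply mem_sep in Hr. destruct Hr as [Hr Cr].
      apply mem_acts in Hr. destruct Hr as (p & ? & ?). eauto 10.
    + intros (r & p & Hp & Hr & Cr & ->). exists r. rewrite mem_sep, mem_acts. eauto.
  - intros r Hr. apply mem_sep in Hr. destruct Hr as [Hr _]. apply mem_acts in Hr.
    destruct Hr as (p & _ & Hr). eapply opr_left_tc; eauto.
Qed.

Let g3 p q r : p ∈ g -> q ∈ g -> r ∈ g -> exists s, s ∈ g /\ s ⪯ p /\ s ⪯ q /\ s ⪯ r.
Proof.
  intros Hp Hq Hr. destruct (g_dir Hp Hq) as (s & Hs & H1 & H2). destruct (g_dir Hs Hr) as (t & Ht & H3 & H4).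
  destruct (g_sub Hp), (g_sub Hq), (g_sub Hs), (g_sub Ht). exists t. split; auto. split; [|split; auto].
  - apply (@ltrans t s p); auto.
  - apply (@ltrans t s q); auto.
Qed.

Let half_true s1 s2 p :
  C s1 -> C s2 ->
  (forall π ρ, π ∈ tc s1 -> C π -> C ρ -> forall q, q ∈ g -> forces_eq (fun p => p ∈ a) le q π ρ -> vlc π = vlc ρ) ->
  p ∈ g -> forces_eq (fun p => p ∈ a) le p s1 s2 -> vlc s1 = vlc s2.
Proof.
  intros C1 C2 IH Hp H. inversion H as [p' s1' s2' H1 H2]; subst. apply zset_ext. intro z. rewrite !mem_vlc. split.
  - intros (π & s & Hs & Hπ & Cπ & ->). destruct (g_sub Hs) as [As Cs].
    destruct (g_dir Hp Hs) as (r0 & Hr0 & L1 & L2). destruct (g_sub Hr0) as [Ar0 Cr0].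
    destruct (@generic_below (fun r => exists ρ, ρ ∈ Un (Un s2) /\ exists t, t ∈ a /\ opr ρ t ∈ s2 /\ r ⪯ t /\ feq r π ρ) r0)
      as (r & Hr & Hex); auto.
    + dsolve. apply D_feq; dsolve.
    + intros r Ar Hr. destruct (H1 π s r) as (r' & ρ & t & K); auto; try rewrite rel_opr; eauto.
      { exact (ltrans Ar Ar0 (proj1 (g_sub Hp)) Hr L1). }
      rewrite !rel_opr in K. destruct K as (K1 & K2 & K3 & K4 & K5 & K6). exists r'. split; auto. split; auto.
      exists ρ. split; [eapply opr_left; eauto|]. exists t. split; auto. split; auto. split; auto. split; auto.
    + destruct (g_sub Hr) as [Ar Cr].
      (* The matching name and its condition exist in V; elementarity moves first ρ and then [t]
         into [C], where upward closure puts [t] into [g]. *)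
      destruct elem with (P := fun ρ => exists t, t ∈ a /\ opr ρ t ∈ s2 /\ r ⪯ t /\ feq r π ρ) as (ρ & Cρ & Ht).
      { dsolve. apply D_feq; dsolve. }
      { destruct Hex as (ρ & Hρ & K). exists ρ. split; auto. 
        apply (W_mem Z (y := Un (Un s2))); auto. apply Z, Z. now apply (dctx_sub X). }
      destruct elem with (P := fun t => t ∈ a /\ opr ρ t ∈ s2 /\ r ⪯ t /\ feq r π ρ) as (t & Ct & At & Hρ & Hrt & _ & K).
      { dsolve. }
      { destruct Ht as (t & At & K). exists t. split; auto. apply (W_mem Z (y := a)); auto. now apply (dctx_sub X). }
      exists ρ, t. split; [apply (g_up Hr); auto|]. split; auto. split; auto.
      apply (IH π ρ) with (q := r); auto. eapply opr_left_tc; eauto.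
  - intros (ρ & s & Hs & Hρ & Cρ & ->). destruct (g_sub Hs) as [As Cs].
    destruct (g_dir Hp Hs) as (r0 & Hr0 & L1 & L2). destruct (g_sub Hr0) as [Ar0 Cr0].
    destruct (@generic_below (fun r => exists π, π ∈ Un (Un s1) /\ exists t, t ∈ a /\ opr π t ∈ s1 /\ r ⪯ t /\ feq r π ρ) r0)
      as (r & Hr & Hex); auto.
    + dsolve. apply D_feq; dsolve.
    + intros r Ar Hr. destruct (H2 ρ s r) as (r' & π & t & K); auto; try rewrite rel_opr; eauto.
      { exact (ltrans Ar Ar0 (proj1 (g_sub Hp)) Hr L1). }
      rewrite !rel_opr in K. destruct K as (K1 & K2 & K3 & K4 & K5 & K6). exists r'. split; auto. split; auto.
      exists π. split; [eapply opr_left; eauto|]. exists t. split; auto. split; auto. split; auto. split; auto.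
    + destruct (g_sub Hr) as [Ar Cr].
      destruct elem with (P := fun π => exists t, t ∈ a /\ opr π t ∈ s1 /\ r ⪯ t /\ feq r π ρ) as (π & Cπ & Ht).
      { dsolve. apply D_feq; dsolve. }
      { destruct Hex as (π & Hπ & K). exists π. split; auto. 
        apply (W_mem Z (y := Un (Un s1))); auto. apply Z, Z. now apply (dctx_sub X). }
      destruct elem with (P := fun t => t ∈ a /\ opr π t ∈ s1 /\ r ⪯ t /\ feq r π ρ) as (t & Ct & At & Hπ & Hrt & _ & K).
      { dsolve. }
      { destruct Ht as (t & At & K). exists t. split; auto. apply (W_mem Z (y := a)); auto. now apply (dctx_sub X). }
      exists π, t. split; [apply (g_up Hr); auto|]. split; auto. split; auto.
      symmetry. apply (IH π ρ) with (q := r); auto. eapply opr_left_tc; eauto.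
Qed.

Lemma truth_eq s1 s2 : C s1 -> C s2 -> (vlc s1 = vlc s2 <-> exists p, p ∈ g /\ feq p s1 s2).
Proof.
  revert s2. induction s1 as [s1 IH] using tc_ind. intros s2 C1 C2. split.
  - intro E.
    (* If a condition does not force the equality, some extension of it lies below the condition of
       a pair in one of the names that the other name can never match further down. *)
    destruct (@generic_dense (fun r => feq r s1 s2 \/
      (exists π, V π /\ exists s, s ∈ a /\ opr π s ∈ s1 /\ r ⪯ s /\
         forall r', r' ∈ a -> r' ⪯ r -> forall ρ, V ρ -> forall t, t ∈ a -> opr ρ t ∈ s2 -> r' ⪯ t -> ~ feq r' π ρ) \/
      (exists ρ, V ρ /\ exists s, s ∈ a /\ opr ρ s ∈ s2 /\ r ⪯ s /\
         forall r', r' ∈ a -> r' ⪯ r -> forall π, V π -> forall t, t ∈ a -> opr π t ∈ s1 -> r' ⪯ t -> ~ feq r' π ρ)))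
      as (r & Hr & [K|[Hex|Hex]]).
    + dsolve; apply D_feq; dsolve.
    + intros r Ar. destruct (classic (feq r s1 s2)) as [|N]; [eauto 10|].
      assert (V1 := dctx_sub X _ C1). assert (V2 := dctx_sub X _ C2).
      apply NNPP. intro B. apply N. split; auto. constructor.
      * intros π s r1 As Hπ Ar1 L1 L2. rewrite rel_opr in *. apply NNPP. intro M. apply B.
        exists r1. split; auto. split; auto. right. left. exists π. split.
        { apply (W_mem Z (y := Un (Un s1))); [now apply Z, Z|eapply opr_left; eauto]. }
        exists s. split; auto. split; auto. split; auto. intros r' Ar' L ρ _ t At Hρ L' [_ K]. apply M.
        exists r', ρ, t. rewrite !rel_opr. auto 10.
      * intros ρ s r1 As Hρ Ar1 L1 L2. rewrite rel_opr in *. apply NNPP. intro M. apply B.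
        exists r1. split; auto. split; auto. right. right. exists ρ. split.
        { apply (W_mem Z (y := Un (Un s2))); [now apply Z, Z|eapply opr_left; eauto]. }
        exists s. split; auto. split; auto. split; auto. intros r' Ar' L π _ t At Hπ L' [_ K]. apply M.
        exists r', π, t. rewrite !rel_opr. auto 10.
    + eauto.
    + exfalso. destruct (g_sub Hr) as [Ar Cr]. apply elem in Hex; [|dsolve; apply D_feq; dsolve].
      destruct Hex as (π & Cπ & Hex). 
      assert (Hex' : exists s, V s /\ (s ∈ a /\ opr π s ∈ s1 /\ r ⪯ s) /\
         forall r', r' ∈ a -> r' ⪯ r -> forall ρ, V ρ -> forall t, t ∈ a -> opr ρ t ∈ s2 -> r' ⪯ t -> ~ feq r' π ρ).
      { destruct Hex as (s & ? & ? & ? & ?). exists s. split; auto. apply (W_mem Z (y := a)); auto. now apply (dctx_sub X). }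
      apply elem in Hex'; [|dsolve; apply D_feq; dsolve]. destruct Hex' as (s & Cs & (As & Hπ & Hrs) & K).
      assert (Hs : s ∈ g) by exact (g_up Hr As Cs Hrs).
      assert (M : vlc π ∈ vlc s2) by (rewrite <- E; apply mem_vlc; eauto 10).
      apply mem_vlc in M. destruct M as (ρ & t & Ht & Hρ & Cρ & M).
      apply IH in M; auto; [|eapply opr_left_tc; eauto]. destruct M as (q & Hq & M).
      destruct (g3 Hr Hq Ht) as (r' & Hr' & L1 & L2 & L3). destruct (g_sub Hr') as [Ar' _].
      apply (K r' Ar' L1 ρ (dctx_sub X _ Cρ) t (proj1 (g_sub Ht)) Hρ L3). now apply (@feq_mono q).
    + exfalso. destruct (g_sub Hr) as [Ar Cr]. apply elem in Hex; [|dsolve; apply D_feq; dsolve].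
      destruct Hex as (ρ & Cρ & Hex). 
      assert (Hex' : exists s, V s /\ (s ∈ a /\ opr ρ s ∈ s2 /\ r ⪯ s) /\
         forall r', r' ∈ a -> r' ⪯ r -> forall π, V π -> forall t, t ∈ a -> opr π t ∈ s1 -> r' ⪯ t -> ~ feq r' π ρ).
      { destruct Hex as (s & ? & ? & ? & ?). exists s. split; auto. apply (W_mem Z (y := a)); auto. now apply (dctx_sub X). }
      apply elem in Hex'; [|dsolve; apply D_feq; dsolve]. destruct Hex' as (s & Cs & (As & Hρ & Hrs) & K).
      assert (Hs : s ∈ g) by exact (g_up Hr As Cs Hrs).
      assert (M : vlc ρ ∈ vlc s1) by (rewrite E; apply mem_vlc; eauto 10).
      apply mem_vlc in M. destruct M as (π & t & Ht & Hπ & Cπ & M). symmetry in M.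
      apply IH in M; auto; [|eapply opr_left_tc; eauto]. destruct M as (q & Hq & M).
      destruct (g3 Hr Hq Ht) as (r' & Hr' & L1 & L2 & L3). destruct (g_sub Hr') as [Ar' _].
      apply (K r' Ar' L1 π (dctx_sub X _ Cπ) t (proj1 (g_sub Ht)) Hπ L3). now apply (@feq_mono q).
  - intros (p & Hp & _ & H). refine (half_true C1 C2 _ Hp H).
    intros π ρ Hπ Cπ Cρ q Hq K. apply IH; auto. exists q. split; auto. split; auto. now apply g_sub.
Qed.

Lemma truth_mem s1 s2 : C s1 -> C s2 -> (vlc s1 ∈ vlc s2 <-> exists p, p ∈ g /\ fmem p s1 s2).
Proof.
  intros C1 C2. split.
  - intro H. apply mem_vlc in H. destruct H as (ρ & t & Ht & Hρ & Cρ & E).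
    apply truth_eq in E; auto. destruct E as (q & Hq & K). destruct (g_dir Hq Ht) as (p & Hp & L1 & L2).
    exists p. split; auto. destruct (g_sub Hp) as [Ap _]. apply fmem_iff. split; auto.
    intros r Ar L. exists r. split; auto. exists ρ. split; [eapply opr_left; eauto|]. exists t.
    destruct (g_sub Hq) as [Aq _], (g_sub Ht) as [At _].
    split; auto. split; auto. split; auto. split; [eapply ltrans; [| | |exact L|]; auto|].
    apply (@feq_mono q); auto. eapply ltrans; [| | |exact L|]; auto.
  - intros (p & Hp & H). apply fmem_iff in H. destruct H as [Ap H].
    destruct (@generic_below (fun r => exists ρ, ρ ∈ Un (Un s2) /\ exists t, t ∈ a /\ opr ρ t ∈ s2 /\ r ⪯ t /\ feq r s1 ρ) p)
      as (r & Hr & Hex); auto.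
    + dsolve. apply D_feq; dsolve.
    + intros r Ar Lr. destruct (H r Ar Lr) as (r' & Ar' & ρ & Hρ & t & At & L & K).
      exists r'. split; auto. split; auto. exists ρ. split; auto. exists t. auto.
    + destruct (g_sub Hr) as [Ar Cr].
      destruct elem with (P := fun ρ => exists t, t ∈ a /\ opr ρ t ∈ s2 /\ r ⪯ t /\ feq r s1 ρ) as (ρ & Cρ & Ht).
      { dsolve. apply D_feq; dsolve. }
      { destruct Hex as (ρ & Hρ & K). exists ρ. split; auto. 
        apply (W_mem Z (y := Un (Un s2))); auto. apply Z, Z. now apply (dctx_sub X). }
      destruct elem with (P := fun t => t ∈ a /\ opr ρ t ∈ s2 /\ r ⪯ t /\ feq r s1 ρ) as (t & Ct & At & Hρ & Hrt & K).
      { dsolve. }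
      { destruct Ht as (t & At & K). exists t. split; auto. apply (W_mem Z (y := a)); auto. now apply (dctx_sub X). }
      apply mem_vlc. exists ρ, t. split; [apply (g_up Hr); auto|]. split; auto. split; auto.
      apply truth_eq; auto. eauto.
Qed.

Definition gext : class := fun x => exists s, C s /\ x = vlc s.

Lemma D_frc_at f e : in_class C e -> D V C (fun e' => frc e f (e' 0)).
Proof.
  intro He. apply (@D_frc V C Z X a le Ca Cle f (fun i => inr (e i)) 0). intros i c E. inversion E; subst; auto.
Qed.

Lemma D_frc_upd f e i : in_class C e -> D V C (fun e' => frc (upd e i (e' 0)) f (e' 1)).
Proof.
  intro He. apply (D_ext X) with (Psi := fun e' => frc (fun j => tm (if Nat.eqb j i then inl 0 else inr (e j)) e') f (e' 1)).
  - intros e' _. replace (upd e i (e' 0)) with (fun j => tm (if Nat.eqb j i then inl 0 else inr (e j)) e'); [reflexivity|].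
    extensionality j. unfold upd. now destruct (Nat.eqb j i).
  - apply (@D_frc V C Z X a le Ca Cle f (fun j => if Nat.eqb j i then inl 0 else inr (e j)) 1). intros j c. destruct (Nat.eqb j i); intro E; inversion E; subst; auto.
Qed.

(** The forcing theorem for the values of the names in [C]. With [C] = V the class [gext] is V[G];
    with a countable hull it turns out to be the extension of the collapse. *)
Theorem truth f : forall e, in_class C e ->
  (psat gext (fun i => vlc (e i)) f <-> exists p, p ∈ g /\ frc e f p).
Proof.
  induction f as [i j|i j|s| |f1 IH1 f2 IH2|i f IH]; intros e He.
  - exact (truth_mem (He i) (He j)).
  - exact (truth_eq (He i) (He j)).
  - destruct s.
  - split; [intros []|]. intros (p & _ & _ & []).
  - unfold psat in *. cbn [sat]. rewrite (IH1 e He), (IH2 e He). split.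
    + intro H. destruct (@generic_dense (fun r => frc e (Imp f1 f2) r \/
         (frc e f1 r /\ forall r', r' ∈ a -> r' ⪯ r -> ~ frc e f2 r'))) as (r & Hr & [K|[K1 K2]]).
      * pose proof (D_frc_at f1 He). pose proof (D_frc_at f2 He). pose proof (D_frc_at (Imp f1 f2) He).
        dsolve.
      * intros r Ar. destruct (classic (frc e (Imp f1 f2) r)) as [|N]; [eauto 10|].
        apply NNPP. intro B. apply N. split; auto. cbn. intros r1 Ar1 L1 K1. rewrite rel_opr in L1.
        apply (@frc_dense f2 e r1); auto. intros r2 Ar2 L2. apply NNPP. intro M. apply B.
        exists r2. split; auto. split; [exact (ltrans Ar2 Ar1 Ar L2 L1)|]. right. split.
        -- apply (@frc_mono f1 e r1); auto. split; auto.
        -- intros r' Ar' L' K'. apply M. eauto.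
      * eauto.
      * exfalso. destruct H as (q & Hq & K); eauto. destruct (g_dir Hr Hq) as (r' & Hr' & L1 & L2).
        destruct (g_sub Hr') as [Ar' _]. apply (K2 r' Ar' L1). now apply (@frc_mono f2 e q).
    + intros (p & Hp & H) (q & Hq & K). destruct (g_dir Hp Hq) as (r & Hr & L1 & L2).
      destruct (g_sub Hr) as [Ar _]. exists r. split; auto. split; auto. apply H; auto; [now apply rel_opr|].
      now apply (@frc_mono f1 e q).
  - unfold psat in *. cbn [sat].
    assert (U : forall τ, upd (fun j => vlc (e j)) i (vlc τ) = fun j => vlc (upd e i τ j)).
    { intro τ. extensionality j. unfold upd. now destruct (Nat.eqb j i). }
    split.
    + intro H. destruct (@generic_dense (fun r => frc e (All i f) r \/
         (exists τ, V τ /\ forall r', r' ∈ a -> r' ⪯ r -> ~ frc (upd e i τ) f r'))) as (r & Hr & [K|K]).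
      * pose proof (D_frc_at (All i f) He). dsolve. exact (D_ren X (fun k => match k with 0 => 1 | _ => 0 end) (D_frc_upd f i He)).
      * intros r Ar. destruct (classic (frc e (All i f) r)) as [|N]; [eauto 10|].
        apply NNPP. intro B. apply N. split; auto. cbn. intros τ Vτ.
        apply (@frc_dense f (upd e i τ) r); auto. intros r2 Ar2 L2. apply NNPP. intro M. apply B.
        exists r2. split; auto. split; auto. right. exists τ. split; auto. intros r' Ar' L' K'. apply M. eauto.
      * eauto.
      * exfalso. destruct (g_sub Hr) as [Ar Cr]. apply elem in K.
        2: { dsolve. exact (D_ren X (fun k => match k with 0 => 1 | _ => 0 end) (D_frc_upd f i He)). }
        destruct K as (τ & Cτ & K). destruct (IH (upd e i τ)) as [IHτ _]; [now apply in_class_upd|].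
        rewrite <- U in IHτ. destruct IHτ as (q & Hq & L); [apply H; exists τ; auto|].
        destruct (g_dir Hr Hq) as (r' & Hr' & L1 & L2). destruct (g_sub Hr') as [Ar' _].
        apply (K r' Ar' L1). now apply (@frc_mono f (upd e i τ) q).
    + intros (p & Hp & Ap & H) x (τ & Cτ & ->). rewrite U. apply IH; [now apply in_class_upd|].
      exists p. split; auto. split; auto. apply H. now apply (dctx_sub X).
Qed.
End Truth.

Definition diff x y := sep x (fun z => ~ z ∈ y).

Lemma mem_diff x y z : z ∈ diff x y <-> z ∈ x /\ ~ z ∈ y.
Proof. apply mem_sep. Qed.

Lemma TD_diff W C : zf W -> dctx W C -> TD W C (fun e => diff (e 0) (e 1)).
Proof.
  intros Z X. apply (TD_intro X) with (Phi := fun z e => z ∈ e 0 /\ ~ z ∈ e 1).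
  - intros e He. pose proof (zf_ctx Z). pose proof (He 0). pose proof (He 1). apply (W_sep Z); [dsolve|auto].
  - intros. apply mem_diff.
  - dsolve.
Qed.

Lemma TD_ap W C : zf W -> dctx W C -> TD W C (fun e => ap (e 0) (e 1)).
Proof. intros Z X. unfold ap. dsolve. Qed.

Ltac dhook2 :=
  lazymatch goal with
  | |- TD _ _ (fun e => diff _ _) => eapply (TD_ap2 ltac:(eassumption) diff); [eapply TD_diff; eassumption| |]
  | |- TD _ _ (fun e => ap _ _) => eapply (TD_ap2 ltac:(eassumption) ap); [eapply TD_ap; eassumption| |]
  | |- D _ _ (fun e => ord _) => eapply D_ord; [eassumption|]
  | |- D _ _ (fun e => feq _ _ _ _ _) => eapply D_feq; [eassumption|eassumption|dconst|dconst| | |]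
  | |- D _ _ (fun e => fmem _ _ _ _ _) => eapply D_fmem; [eassumption|eassumption|dconst|dconst| | |]
  end.
Ltac dsolve2 := repeat first [dstep | dhook2].

(** * Well-orderings *)

Section WellOrder.
Variable W : class.
Hypothesis Z : zf W.
Hypothesis AC : zchoice W.

(** Zermelo's recursion: elements are chosen from what is left of [d] until nothing is, and α is the
    first stage at which this happens. *)
Lemma well_order d : W d -> exists α h, W α /\ ord α /\ W h /\ func h d /\
  (forall x, x ∈ d -> ap h x ∈ α) /\ (forall x y, x ∈ d -> y ∈ d -> ap h x = ap h y -> x = y) /\
  (forall β, β ∈ α -> exists x, x ∈ d /\ ap h x = β).
Proof.
  intro Wd. pose proof (zf_ctx Z) as X.
  destruct (@choice_function W Z AC (fun x y => y ∈ x) (sep (sep (pow d) W) (fun x => exists y, y ∈ x)))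
    as (c & Wc & Fc & Hc).
  { dsolve. }
  { apply (W_sep Z); [dsolve|]. now apply Z. }
  { intros x Hx. rewrite !mem_sep in Hx. destruct Hx as [[_ Wx] [y Hy]]. exists y. split; auto.
    exact (W_mem Z Wx Hy). }
  (* [d] itself, which is not an element of [d], signals exhaustion. *)
  set (cc := fun S => if excluded_middle_informative (exists y, y ∈ S) then ap c S else d).
  assert (cc1 : forall S, W S -> subset S d -> (exists y, y ∈ S) -> cc S ∈ S).
  { intros S WS HS HI. unfold cc. destruct (excluded_middle_informative _); [|tauto].
    apply Hc. rewrite !mem_sep, mem_pow. auto. }
  assert (cc2 : forall S, ~ (exists y, y ∈ S) -> cc S = d).
  { intros S HS. unfold cc. destruct (excluded_middle_informative _); tauto. }
  assert (Tcc : TD W W (fun e => cc (e 0))).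
  { split.
    - intros e He. unfold cc. destruct (excluded_middle_informative _); auto. apply W_ap; auto.
    - apply (D_ext X) with (Psi := fun e => ((exists y, y ∈ e 1) /\ e 0 = ap c (e 1)) \/ (~ (exists y, y ∈ e 1) /\ e 0 = d)).
      + intros e He. unfold cc. destruct (excluded_middle_informative _); tauto.
      + dsolve2. }
  set (F := fun α g => cc (diff d (gim g α))). set (R := trec F).
  assert (ER : forall α, R α = cc (diff d (img α R))).
  { intro α. unfold R at 1. rewrite trec_eq. unfold F at 1. rewrite gim_graph by apply tc_sub. reflexivity. }
  assert (TR : TD W W (fun e => R (e 0))).
  { apply (TD_trec0 Z X).
    - apply (TD_ap1 X cc Tcc). dsolve2.
    - intros x g g' H. unfold F. do 2 f_equal. apply gim_local. intros. apply H. now apply tc_sub. }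
  assert (WR : forall x, W x -> W (R x)) by (intros x Wx; apply (proj1 TR (fun _ => x)); intro; auto).
  assert (WS : forall α, W α -> W (diff d (img α R))).
  { intros α Wα. assert (W (img α R)) by now apply W_img_TD. unfold diff. apply W_sep; auto. dsolve. }
  assert (R1 : forall α, W α -> (R α = d /\ ~ exists y, y ∈ diff d (img α R)) \/ (R α ∈ d /\ forall β, β ∈ α -> R β <> R α)).
  { intros α Wα. destruct (classic (exists y, y ∈ diff d (img α R))) as [N|N]; [right|left].
    - apply cc1 in N; auto; [|intros z Hz; now apply mem_diff in Hz]. rewrite <- ER in N. apply mem_diff in N.
      destruct N as [N1 N2]. split; auto. intros β Hβ E. apply N2. apply mem_img. eauto.
    - split; auto. rewrite ER. auto. }
  assert (E : exists α, W α /\ ord α /\ R α = d).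
  { apply NNPP. intro N.
    assert (R2 : forall α, W α -> ord α -> R α ∈ d /\ forall β, β ∈ α -> R β <> R α).
    { intros α Wα Oα. destruct (R1 α Wα) as [[K _]|]; auto. exfalso. eauto. }
    (* Without exhaustion [R] is injective on all ordinals of W, and replacement along its inverse
       makes them a set of W: the Burali-Forti paradox. *)
    destruct (@W_repl W Z (fun y α => ord α /\ y = R α) d) as (b & Wb & Hb); auto.
    - dsolve2. apply (TD_ap1 X R TR). dsolve.
    - intros y α β _ Wα Wβ [Oα Eα] [Oβ Eβ]. destruct (ord_cmp Oα Oβ) as [K|[K|K]]; auto; exfalso.
      + apply (proj2 (R2 β Wβ Oβ) α K). congruence.
      + apply (proj2 (R2 α Wα Oα) β K). congruence.
    - assert (Hb' : forall α, α ∈ b <-> W α /\ ord α).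
      { intro α. rewrite Hb. split; [intros (? & x & _ & ? & _); auto|]. intros [Wα Oα]. split; auto.
        exists (R α). split; auto. now apply R2. }
      apply (@mem_irrefl b). apply Hb'. split; auto. apply ord_intro.
      + intros α Hα β Hβ. apply Hb' in Hα. destruct Hα as [Wα Oα]. apply Hb'. split; [exact (W_mem Z Wα Hβ)|].
        eapply ord_mem; eauto.
      + intros α Hα. now apply Hb' in Hα. }
  apply mem_minimal in E. destruct E as (α & (Wα & Oα & Eα) & Min).
  assert (Rβ : forall β, β ∈ α -> R β ∈ d /\ forall γ, γ ∈ β -> R γ <> R β).
  { intros β Hβ. assert (Wβ := W_mem Z Wα Hβ). destruct (R1 β Wβ) as [[K _]|]; auto. exfalso.
    apply (Min β Hβ). split; auto. split; auto. eapply ord_mem; eauto. }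
  assert (Inj : forall β γ, β ∈ α -> γ ∈ α -> R β = R γ -> β = γ).
  { intros β γ Hβ Hγ K. destruct (ord_cmp (ord_mem Oα Hβ) (ord_mem Oα Hγ)) as [L|[L|L]]; auto; exfalso.
    - now apply (proj2 (Rβ γ Hγ) β L).
    - now apply (proj2 (Rβ β Hβ) γ L). }
  assert (Sur : forall x, x ∈ d -> exists β, β ∈ α /\ x = R β).
  { intros x Hx. apply NNPP. intro N. destruct (R1 α Wα) as [[_ K]|[K _]].
    - apply K. exists x. apply mem_diff. split; auto. rewrite mem_img. exact N.
    - rewrite Eα in K. now apply mem_irrefl in K. }
  set (h := img α (fun β => opr (R β) β)).
  assert (mh : forall x β, opr x β ∈ h <-> β ∈ α /\ x = R β).
  { intros x β. unfold h. rewrite mem_img. split.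
    - intros (γ & Hγ & K). apply opr_inj in K. destruct K as [-> ->]. auto.
    - intros [Hβ ->]. eauto. }
  assert (Fh : func h d).
  { split.
    - intros p Hp. apply mem_img in Hp. destruct Hp as (β & Hβ & ->). exists (R β). split; eauto. now apply Rβ.
    - intros x Hx. destruct (Sur x Hx) as (β & Hβ & ->). exists β. split; [now apply mh|].
      intros γ Hγ. apply mh in Hγ. destruct Hγ as [Hγ K]. symmetry. now apply Inj. }
  assert (Ap : forall β, β ∈ α -> ap h (R β) = β) by (intros; apply (ap_eq Fh), mh; auto).
  exists α, h. split; auto. split; auto. split; [|split; auto; split; [|split]].
  - apply W_img_TD; auto. dsolve.
  - intros x Hx. destruct (Sur x Hx) as (β & Hβ & ->). now rewrite Ap.
  - intros x y Hx Hy. destruct (Sur x Hx) as (β & Hβ & ->), (Sur y Hy) as (γ & Hγ & ->). rewrite !Ap by auto. congruence.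
  - intros β Hβ. exists (R β). split; auto. now apply Rβ.
Qed.
End WellOrder.

(** * Generic extensions *)

Section Extension.
Variable V : class.
Hypothesis Z : zf V.
Variables a le : zset.
Hypothesis Va : V a.
Hypothesis Vle : V le.
Hypothesis Hpre : preorder a le.
Variable G : class.
Hypothesis HG : generic V (fun p => p ∈ a) le G.

(** A set of the background universe, in general outside V; as a set it can serve as parameter in
    the recursions for values. *)
Let g := sep a G.
Let X := zf_ctx Z.

Lemma mem_g p : p ∈ g <-> G p.
Proof. unfold g. rewrite mem_sep. split; [tauto|]. intro H. split; auto. now apply HG. Qed.

Lemma G_eq : G = fun p => p ∈ g.
Proof. extensionality p. apply propositional_extensionality. symmetry. apply mem_g. Qed.

Lemma g_sub p : p ∈ g -> p ∈ a /\ V p.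
Proof. intro H. apply mem_sep in H. destruct H as [H _]. split; auto. exact (W_mem Z Va H). Qed.
Lemma g_inh : exists p, p ∈ g.
Proof. destruct HG as (_ & (p & Hp) & _). exists p. now apply mem_g. Qed.
Lemma g_up p q : p ∈ g -> q ∈ a -> V q -> opr p q ∈ le -> q ∈ g.
Proof. rewrite !mem_g. intros. destruct HG as (_ & _ & H' & _). apply (H' p); auto. now apply rel_opr. Qed.
Lemma g_dir p q : p ∈ g -> q ∈ g -> exists r, r ∈ g /\ opr r p ∈ le /\ opr r q ∈ le.
Proof.
  rewrite !mem_g. intros H K. destruct HG as (_ & _ & _ & H' & _). destruct (H' p q H K) as (r & Hr & ? & ?).
  exists r. rewrite mem_g, <- !rel_opr. auto.
Qed.
Lemma g_gen d : V d -> (forall p, p ∈ d -> p ∈ a) ->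
  (forall p, p ∈ a -> exists q, q ∈ d /\ opr q p ∈ le) -> exists p, p ∈ d /\ p ∈ g.
Proof.
  intros Vd H K. destruct HG as (_ & _ & _ & _ & H'). destruct (H' d Vd H) as (p & ? & ?).
  - intros p Hp. destruct (K p Hp) as (q & ? & ?). exists q. rewrite rel_opr. auto.
  - exists p. rewrite mem_g. auto.
Qed.
Lemma elem_self (P : zset -> Prop) : D V V (fun e => P (e 0)) -> (exists x, V x /\ P x) -> exists x, V x /\ P x.
Proof. auto. Qed.

Lemma vlc_vl s : V s -> vlc V g s = vl g s.
Proof.
  induction s as [s IH] using tc_ind. intro Vs. apply zset_ext. intro z. rewrite mem_vlc, mem_vl. split.
  - intros (r & p & Hp & Hr & Vr & ->). exists r, p. split; auto. split; auto. apply IH; auto. eapply opr_left_tc; eauto.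
  - intros (r & p & Hp & Hr & ->). assert (Vr : V r) by (apply (W_opr_inv Z (W_mem Z Vs Hr))).
    exists r, p. split; auto. split; auto. split; auto. symmetry. apply IH; auto. eapply opr_left_tc; eauto.
Qed.

Let M := extension V G.

Lemma ext_iff x : M x <-> exists s, V s /\ x = vl g s.
Proof.
  unfold M, extension. rewrite G_eq. split; intros (s & Vs & H); exists s; split; auto; now apply val_vl.
Qed.

Lemma M_eq : M = gext V g.
Proof.
  extensionality x. apply propositional_extensionality. rewrite ext_iff. unfold gext.
  split; intros (s & Vs & ->); exists s; rewrite vlc_vl; auto.
Qed.

Lemma truth_ext f e : in_class V e -> (psat M (fun i => vl g (e i)) f <-> exists p, p ∈ g /\ frc V a le e f p).
Proof.
  intro He. rewrite M_eq, <- (@truth V V Z X elem_self a le Va Vle Hpre g g_sub g_inh g_up g_dir g_gen f e He).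
  replace (fun i => vlc V g (e i)) with (fun i => vl g (e i)); [reflexivity|].
  extensionality i. symmetry. now apply vlc_vl.
Qed.

Lemma truth_mem_ext s1 s2 : V s1 -> V s2 -> (vl g s1 ∈ vl g s2 <-> exists p, p ∈ g /\ fmem a le p s1 s2).
Proof.
  intros H1 H2. rewrite <- !vlc_vl by auto.
  exact (@truth_mem V V Z X elem_self a le Va Vle Hpre g g_sub g_inh g_up g_dir g_gen s1 s2 H1 H2).
Qed.

Lemma decide_ext E : D V V (fun e => E (e 0)) ->
  (exists r, r ∈ g /\ E r) \/ exists r, r ∈ g /\ forall r', r' ∈ a -> opr r' r ∈ le -> ~ E r'.
Proof. exact (@generic_decide V V Z X elem_self a le Va Vle Hpre g g_sub g_inh g_dir g_gen E). Qed.

Lemma below_ext E r0 : r0 ∈ g -> D V V (fun e => E (e 0)) ->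
  (forall r, r ∈ a -> opr r r0 ∈ le -> exists r', r' ∈ a /\ opr r' r ∈ le /\ E r') -> exists r, r ∈ g /\ E r.
Proof. exact (@generic_below V V Z X elem_self a le Va Vle Hpre g g_sub g_dir g_gen E r0). Qed.

Lemma M_vl s : V s -> M (vl g s).
Proof. intro H. apply ext_iff. eauto. Qed.

Lemma ground_sub x : V x -> M x.
Proof.
  intro H. rewrite <- (@vl_chk g a x).
  - apply M_vl. now apply (W_chk Z).
  - apply g_inh.
  - intros p Hp. now apply g_sub.
Qed.

Lemma M_g : M g.
Proof.
  rewrite <- (@vl_gname g a).
  - apply M_vl. now apply (W_gname Z).
  - apply g_inh.
  - intros p Hp. now apply g_sub.
Qed.

Lemma M_tr : transitive_class M.
Proof.
  intros x y Hy Hx. apply ext_iff in Hy. destruct Hy as (s & Vs & ->). apply mem_vl in Hx.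
  destruct Hx as (r & p & _ & Hr & ->). apply M_vl. apply (W_opr_inv Z (W_mem Z Vs Hr)).
Qed.

(** Attaching all conditions to each name in [t] gives a name for the set of their values. *)
Lemma M_img t : V t -> M (img t (vl g)).
Proof.
  intro Vt. replace (img t (vl g)) with (vl g (prod t a)).
  - apply M_vl, W_prod; auto.
  - apply zset_ext. intro z. rewrite mem_vl, mem_img. split.
    + intros (r & p & _ & H & ->). apply opr_in_prod in H. destruct H. eauto.
    + intros (r & Hr & ->). destruct g_inh as [p Hp]. exists r, p. rewrite opr_in_prod.
      split; auto. split; auto. split; auto. now apply g_sub.
Qed.

Lemma M_names e : in_class M e -> exists ε, in_class V ε /\ e = fun i => vl g (ε i).
Proof.
  intro He. assert (H : forall i, exists s, V s /\ e i = vl g s) by (intro i; apply ext_iff, He).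
  exists (fun i => proj1_sig (constructive_indefinite_description _ (H i))). split.
  - intro i. destruct (constructive_indefinite_description _ (H i)) as (s & ? & ?). auto.
  - extensionality i. destruct (constructive_indefinite_description _ (H i)) as (s & ? & ?). auto.
Qed.

Lemma upd_vl e i s : upd (fun j => vl g (e j)) i (vl g s) = fun j => vl g (upd e i s j).
Proof. extensionality j. unfold upd. now destruct (Nat.eqb j i). Qed.

(** The name for the subset pairs each π with the conditions forcing both π into [s] and the
    formula; the truth lemma computes its value. *)
Lemma M_sep (f : pure) e x : in_class M e -> M x -> M (sep x (fun y => psat M (upd e 0 y) f)).
Proof.
  intros He Hx. destruct (M_names He) as (ε & Vε & ->). apply ext_iff in Hx. destruct Hx as (s & Vs & ->).
  set (t := sep (prod (Un (Un s)) a) (fun w => exists π, π ∈ Un (Un s) /\ exists p, p ∈ a /\ w = opr π p /\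
    fmem a le p π s /\ frc V a le (upd ε 0 π) f p)).
  assert (Vt : V t).
  { apply W_sep; auto; [|apply W_prod; auto; now apply Z, Z]. pose proof X.
    assert (V (Un (Un s))) by now apply Z, Z.
    dsolve2. exact (D_ren X (fun k => match k with 0 => 1 | _ => 0 end) (@D_frc_upd V V Z X a le Va Vle f ε 0 Vε)). }
  replace (sep _ _) with (vl g t); [now apply M_vl|]. apply zset_ext. intro z.
  rewrite mem_vl, mem_sep. split.
  - intros (r & p & Hp & Hr & ->). apply mem_sep in Hr.
    destruct Hr as (_ & π & Hπ & p' & _ & E & K1 & K2). apply opr_inj in E. destruct E as [<- <-].
    assert (Vr : V r) by (apply (W_mem Z (y := Un (Un s))); auto; now apply Z, Z).
    rewrite upd_vl, truth_ext by now apply in_class_upd. split; [apply truth_mem_ext; eauto|eauto].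
  - intros [H K]. pose proof H as H'. apply mem_vl in H'. destruct H' as (r & p0 & _ & Hr & ->).
    assert (Vr : V r) by apply (W_opr_inv Z (W_mem Z Vs Hr)).
    apply truth_mem_ext in H; auto. destruct H as (p & Hp & H).
    rewrite upd_vl, truth_ext in K by now apply in_class_upd. destruct K as (q & Hq & K).
    destruct (g_dir Hp Hq) as (u & Hu & L1 & L2). destruct (g_sub Hu) as [Au _].
    exists r, u. split; auto. split; auto. unfold t. rewrite mem_sep, opr_in_prod.
    split; [split; auto; eapply opr_left; eauto|]. exists r. split; [eapply opr_left; eauto|].
    exists u. split; auto. split; auto. split.
    + apply fmem_mono with (p := p); auto.
    + apply frc_mono with (p := q); auto.
Qed.

Lemma X_M : dctx M M.
Proof. split; [apply M_tr|auto|exists g; apply M_g]. Qed.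

Lemma M_sep_def P x : D M M (fun e => P (e 0)) -> M x -> M (sep x P).
Proof. apply sep_definable; [apply M_tr|exists g; apply M_g|apply M_sep]. Qed.

(** Every subset of [x] in the extension has a name contained in the product of [Un (Un s)] with
    [a], and such names form a set of V. *)
Lemma M_pow x : M x -> M (sep (pow x) M).
Proof.
  intro Hx. pose proof X_M. pose proof Hx as Hx'. apply ext_iff in Hx'. destruct Hx' as (s & Vs & E).
  set (T := sep (pow (prod (Un (Un s)) a)) V).
  assert (VT : V T) by (apply Z, W_prod; auto; now apply Z, Z).
  replace (sep (pow x) M) with (sep (img T (vl g)) (fun y => forall z, z ∈ y -> z ∈ x)).
  - apply M_sep_def; [dsolve|now apply M_img].
  - apply zset_ext. intro y. rewrite !mem_sep, mem_pow. split.
    + intros [Hy K]. split; auto. exact (M_tr (M_img VT) Hy).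
    + intros [K My]. split; auto. apply ext_iff in My. destruct My as (u & Vu & Ey).
      set (u' := sep (prod (Un (Un s)) a) (fun w => exists π, π ∈ Un (Un s) /\ exists p, p ∈ a /\ w = opr π p /\
        fmem a le p π u)).
      assert (Vu' : V u').
      { apply W_sep; auto; [|apply W_prod; auto; now apply Z, Z]. pose proof X.
        assert (V (Un (Un s))) by now apply Z, Z. dsolve2. }
      apply mem_img. exists u'. split.
      * unfold T. rewrite mem_sep, mem_pow. split; auto. intros w Hw. now apply mem_sep in Hw.
      * subst y. apply zset_ext. intro z. rewrite (mem_vl g u'). split.
        -- intro Hz. pose proof (K z Hz) as Hz'. rewrite E in Hz'. apply mem_vl in Hz'.
           destruct Hz' as (r & p0 & Hp0 & Hr & ->).
           assert (Vr : V r) by apply (W_opr_inv Z (W_mem Z Vs Hr)).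
           apply truth_mem_ext in Hz; auto. destruct Hz as (p & Hp & Hz). exists r, p. split; auto. split; auto.
           destruct (g_sub Hp) as [Ap _]. unfold u'. rewrite mem_sep, opr_in_prod.
           assert (r ∈ Un (Un s)) by (eapply opr_left; eauto). eauto 10.
        -- intros (r & p & Hp & Hr & ->). apply mem_sep in Hr.
           destruct Hr as (_ & π & Hπ & p' & _ & E' & K'). apply opr_inj in E'. destruct E' as [<- <-].
           assert (Vr : V r) by (apply (W_mem Z (y := Un (Un s))); auto; now apply Z, Z).
           apply truth_mem_ext; eauto.
Qed.

Lemma ext_zf : zf M.
Proof.
  pose proof X_M as XM. split.
  - apply M_tr.
  - apply ground_sub, Z.
  - intros x y Hx Hy. apply ext_iff in Hx, Hy. destruct Hx as (s & Vs & ->), Hy as (t & Vt & ->).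
    replace (upair _ _) with (img (upair s t) (vl g)); [apply M_img; now apply Z|].
    apply zset_ext. intro z. rewrite mem_img, mem_upair. split.
    + intros (r & Hr & ->). apply mem_upair in Hr. destruct Hr as [-> | ->]; auto.
    + intros [-> | ->]; [exists s|exists t]; rewrite mem_upair; auto.
  - intros x Hx. pose proof Hx as Hx'. apply ext_iff in Hx'. destruct Hx' as (s & Vs & E).
    replace (Un x) with (sep (img (tc s) (vl g)) (fun z => exists y, y ∈ x /\ z ∈ y)).
    + apply M_sep_def; [dsolve|]. apply M_img, W_tc; auto.
    + apply zset_ext. intro z. rewrite mem_sep, mem_Un. split; [tauto|]. intros (y & Hy & Hz). split; eauto.
      rewrite E in Hy. apply mem_vl in Hy. destruct Hy as (r & p & Hp & Hr & ->). apply mem_vl in Hz.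
      destruct Hz as (r' & p' & Hp' & Hr' & ->). apply mem_img. exists r'. split; auto.
      apply (@tc_mono s r (opr_left_tc Hr)). eapply opr_left_tc; eauto.
  - apply M_pow.
  - apply ground_sub, Z.
  - apply M_sep.
  - intros f e x He Hx HF. pose proof He as He'. apply M_names in He'. destruct He' as (ε & Vε & Ee).
    pose proof Hx as Hx'. apply ext_iff in Hx'. destruct Hx' as (s & Vs & E).
    set (R := fun w t => exists π, V π /\ exists p, p ∈ a /\ w = opr π p /\ frc V a le (upd (upd ε 0 π) 1 t) f p).
    assert (HR : D V V (fun e => R (e 0) (e 1))).
    { unfold R. pose proof X as XV. dsolve.
      apply (D_ext XV) with (Psi := fun e => frc V a le (fun j => tm (match j with 0 => inl 1 | 1 => inl 3 | _ => inr (ε j) end) e) f (e 0)).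
      - intros e0 _. match goal with |- frc _ _ _ ?u _ _ <-> frc _ _ _ ?v _ _ => replace u with v; [reflexivity|] end.
        extensionality j. destruct j as [|[|j]]; reflexivity.
      - apply (@D_frc V V Z XV a le Va Vle f (fun j => match j with 0 => inl 1 | 1 => inl 3 | _ => inr (ε j) end) 0).
        intros [|[|j]] c Q; inversion Q; subst; auto. }
    (* For every pair of a name π and a condition [p], some name forced by [p] to be a value at π is
       collected if there is one; the implication makes the relation total. *)
    destruct (@collection V Z (fun w t => (exists t', V t' /\ R w t') -> R w t) (prod (tc s) a)) as (b & Vb & Hb).
    + pose proof X as XV. dsolve. apply (D_rel2 XV R HR); dsolve.
    + apply W_prod; auto. now apply W_tc.
    + intros w _. destruct (classic (exists t', V t' /\ R w t')) as [(t & Vt & Ht)|N]; [eauto|].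
      exists s. split; auto. tauto.
    + exists (sep (img b (vl g)) (fun y => exists x0, x0 ∈ x /\ psat M (upd (upd e 0 x0) 1 y) f)). split.
      * apply M_sep_def; [|now apply M_img]. dsolve.
        apply (D_ext XM) with (Psi := fun e' => psat M (fun i => match (match i with 0 => inl 0 | 1 => inl 1 | _ => inr (e i) end) with inl k => e' k | inr c => c end) f).
        -- intros e' _. match goal with |- psat _ ?u _ <-> psat _ ?v _ => replace u with v; [reflexivity|] end.
           extensionality j. destruct j as [|[|j]]; reflexivity.
        -- apply (D_psat XM). intros [|[|j]] c Q; inversion Q; subst; auto.
      * intros y My. rewrite mem_sep. split.
        -- intros (_ & x0 & Hx0 & K). exists x0. split; auto. exact (M_tr Hx Hx0).
        -- intros (x0 & Mx0 & Hx0 & K). split; eauto.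
           rewrite E in Hx0. pose proof Hx0 as Hx0'. apply mem_vl in Hx0'. destruct Hx0' as (π & p0 & Hp0 & Hπ & Ex0).
           assert (Vπ : V π) by apply (W_opr_inv Z (W_mem Z Vs Hπ)).
           apply ext_iff in My. destruct My as (t & Vt & Ey).
           pose proof K as K0. rewrite Ee, Ex0, Ey, !upd_vl, truth_ext in K by (now repeat apply in_class_upd).
           destruct K as (p & Hp & K). destruct (g_sub Hp) as [Ap _].
           destruct (Hb (opr π p)) as (t' & Ht' & Q).
           { apply opr_in_prod. split; auto. eapply opr_left_tc; eauto. }
           destruct Q as (π' & _ & p' & _ & Eq & K'); [exists t; split; auto; exists π; eauto 10|].
           apply opr_inj in Eq. destruct Eq as [<- <-]. assert (Vt' := W_mem Z Vb Ht').
           apply mem_img. exists t'. split; auto. apply (HF x0); auto.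
           ++ subst y. now apply M_vl.
           ++ now apply M_vl.
           ++ now rewrite E.
           ++ rewrite Ee, Ex0, !upd_vl, truth_ext by (now repeat apply in_class_upd). eauto.
Qed.

(** From each member of the family the element with the least name is chosen, in a well-order of
    [tc s] taken from the ground model. *)
Lemma ext_choice : zchoice V -> zchoice M.
Proof.
  intros AC x Hx HI HD. pose proof X_M as XM. pose proof ext_zf as ZM.
  pose proof Hx as Hx'. apply ext_iff in Hx'. destruct Hx' as (s & Vs & E).
  set (d := tc s). assert (Vd : V d) by now apply W_tc.
  destruct (@well_order V Z AC d Vd) as (α & h & Vα & Oα & Vh & Fh & h1 & h2 & _).
  assert (Md : M d) by now apply ground_sub. assert (Mh : M h) by now apply ground_sub. pose proof M_g as Mg.
  assert (Hn : forall u y, u ∈ x -> y ∈ u -> exists σ, σ ∈ d /\ y = vl g σ).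
  { intros u y Hu Hy. rewrite E in Hu. apply mem_vl in Hu. destruct Hu as (r & p & Hp & Hr & ->). apply mem_vl in Hy.
      destruct Hy as (r' & p' & Hp' & Hr' & ->). exists r'. split; auto.
      apply (@tc_mono s r (opr_left_tc Hr)). eapply opr_left_tc; eauto. }
  exists (sep (Un x) (fun y => exists u, u ∈ x /\ y ∈ u /\ exists σ, σ ∈ d /\ y = vl g σ /\
    forall σ', σ' ∈ d -> vl g σ' ∈ u -> ~ ap h σ' ∈ ap h σ)). split.
  - apply W_sep; auto; [dsolve2|now apply ZM].
  - intros u Mu Hu. destruct (HI u Mu Hu) as (y0 & _ & Hy0).
    destruct (@mem_minimal (fun β => exists σ, σ ∈ d /\ vl g σ ∈ u /\ β = ap h σ)) as (β & (σ & Hσ & Hσu & Eβ) & Min).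
    { destruct (Hn u y0 Hu Hy0) as (σ & Hσ & ->). exists (ap h σ). eauto. }
    assert (My : M (vl g σ)) by exact (M_tr Mu Hσu).
    assert (Min' : forall σ', σ' ∈ d -> vl g σ' ∈ u -> ~ ap h σ' ∈ ap h σ).
    { intros σ' H1 H2 H3. rewrite <- Eβ in H3. apply (Min _ H3). eauto. }
    exists (vl g σ). split; auto. split; [|split; auto].
    + apply mem_sep. split; [apply mem_Un; eauto|]. exists u. split; auto. split; auto. exists σ. auto.
    + intros y' My' Hy' Hy'u. apply mem_sep in Hy'. destruct Hy' as (_ & u' & Hu' & Hyu' & σ' & Hσ' & Ey & Min2).
      assert (u' = u).
      { apply (HD u' u y'); auto. exact (M_tr Hx Hu'). }
      subst u' y'. f_equal. apply h2; auto.
      destruct (ord_cmp (ord_mem Oα (h1 σ' Hσ')) (ord_mem Oα (h1 σ Hσ))) as [K|[K|K]]; auto; exfalso.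
      * now apply (Min' σ').
      * now apply (Min2 σ).
Qed.

Lemma ext_least W : zf W -> (forall x, V x -> W x) -> W g -> forall x, M x -> W x.
Proof. intros ZW HV Wg x Hx. apply ext_iff in Hx. destruct Hx as (s & Vs & ->). apply W_vl; auto. Qed.
End Extension.

(** * Meaning of the formulas in transitive models *)

Definition isfun (f a b : zset) : Prop :=
  (forall z, z ∈ f -> exists x, x ∈ a /\ exists y, y ∈ b /\ z = opr x y) /\
  (forall x, x ∈ a -> exists y, opr x y ∈ f) /\
  (forall x y y', opr x y ∈ f -> opr x y' ∈ f -> y = y').

Section Semantics.
Variable W : class.

(** Injectability and the notions built on it are not absolute: the quantifiers over functions,
    chains and dense sets stay in W. *)
Definition Inj (a b : zset) : Prop :=
  exists f, W f /\ isfun f a b /\ forall x x' y, opr x y ∈ f -> opr x' y ∈ f -> x = x'.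
Definition Ctbl (x : zset) : Prop := Inj x omega.
Definition Card (k : zset) : Prop := ord k /\ forall α, α ∈ k -> ~ Inj k α.
Definition UCard (k : zset) : Prop := Card k /\ ~ Ctbl k.
Definition Regular (k : zset) : Prop := Card k /\ subset omega k /\
  forall α, α ∈ k -> forall f, W f -> isfun f α k -> exists β, β ∈ k /\ forall x y, opr x y ∈ f -> y ∈ β.
Definition Hlt (x k : zset) : Prop := exists α, α ∈ k /\ Inj (tc x) α.
Definition IsH (h k : zset) : Prop := forall x, W x -> (x ∈ h <-> Hlt x k).
Definition SubH (P k : zset) : Prop := forall x, x ∈ P -> Hlt x k.
Definition Lambda (l P : zset) : Prop :=
  UCard l /\ SubH P l /\ forall m, W m -> UCard m -> SubH P m -> subset l m.
Definition Club (E A : zset) : Prop :=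
  (forall c, c ∈ E -> subset c A /\ Ctbl c) /\
  (forall x, W x -> subset x A -> Ctbl x -> exists c, c ∈ E /\ subset x c) /\
  (forall F, W F -> subset F E -> Ctbl F -> (exists d, d ∈ F) ->
     (forall c, c ∈ F -> forall d, d ∈ F -> subset c d \/ subset d c) -> Un F ∈ E).
Definition Cmp (P le x y : zset) : Prop := exists z, z ∈ P /\ opr z x ∈ le /\ opr z y ∈ le.
Definition SG (N P le q : zset) : Prop := q ∈ P /\
  forall F, W F -> (forall d, d ∈ F -> d ∈ N /\ d ∈ P) ->
    (forall p, p ∈ P -> p ∈ N -> exists d, d ∈ F /\ opr d p ∈ le) ->
    forall r, r ∈ P -> opr r q ∈ le -> exists d, d ∈ F /\ Cmp P le r d.
Definition USG (N P le q : zset) : Prop :=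
  SG N P le q /\ forall p, p ∈ P -> p ∈ N -> Cmp P le q p.
Definition HasUSG (P le : zset) : Prop :=
  exists l, W l /\ exists h, W h /\ Lambda l P /\ IsH h l /\
    forall E, W E -> Club E h -> exists M, M ∈ E /\ exists q, W q /\ USG M P le q.
Definition IsQuot (Q P le q G : zset) : Prop :=
  forall r, W r -> (r ∈ Q <-> r ∈ P /\ opr r q ∈ le /\ forall s, s ∈ G -> Cmp P le r s).
End Semantics.

Lemma upd_same e i x : upd e i x i = x.
Proof. unfold upd. now rewrite Nat.eqb_refl. Qed.
Lemma upd_lt e i x j : j < i -> upd e i x j = e j.
Proof. intro H. unfold upd. replace (Nat.eqb j i) with false by (symmetry; apply Nat.eqb_neq; lia). reflexivity. Qed.

Section Translation.
Variable W : class.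
Hypothesis Z : zf W.
Implicit Types (e : assignment) (n i j k : nat).

Lemma psat_imp e n F H (P Q : Prop) : (psat W e (F n) <-> P) -> (psat W e (H n) <-> Q) ->
  (psat W e (fImp F H n) <-> (P -> Q)).
Proof. unfold psat. cbn. tauto. Qed.
Lemma psat_not e n F (P : Prop) : (psat W e (F n) <-> P) -> (psat W e (fNot F n) <-> ~ P).
Proof. unfold psat. cbn. tauto. Qed.
Lemma psat_and e n F H (P Q : Prop) : (psat W e (F n) <-> P) -> (psat W e (H n) <-> Q) ->
  (psat W e (fAnd F H n) <-> P /\ Q).
Proof. unfold psat. cbn. tauto. Qed.
Lemma psat_or e n F H (P Q : Prop) : (psat W e (F n) <-> P) -> (psat W e (H n) <-> Q) ->
  (psat W e (fOr F H n) <-> P \/ Q).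
Proof. unfold psat. cbn. tauto. Qed.
Lemma psat_iff e n F H (P Q : Prop) : (psat W e (F n) <-> P) -> (psat W e (H n) <-> Q) ->
  (psat W e (fIff F H n) <-> (P <-> Q)).
Proof. unfold psat. cbn. tauto. Qed.
Lemma psat_all e n F (P : zset -> Prop) :
  (forall x, W x -> (psat W (upd e n x) (F n (S n)) <-> P x)) ->
  (psat W e (fAll F n) <-> forall x, W x -> P x).
Proof. unfold psat. cbn. intro H. split; intros K x Hx; apply H; auto. Qed.
Lemma psat_ex e n F (P : zset -> Prop) :
  (forall x, W x -> (psat W (upd e n x) (F n (S n)) <-> P x)) ->
  (psat W e (fEx F n) <-> exists x, W x /\ P x).
Proof.
  unfold psat. cbn. intro H. split.
  - intro K. apply NNPP. intro B. apply K. intros x Hx L. apply B. exists x. split; auto. now apply H.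
  - intros (x & Hx & K) L. apply (L x Hx). now apply H.
Qed.
Lemma psat_mem e n i j x y : e i = x -> e j = y -> (psat W e (fMem i j n) <-> x ∈ y).
Proof. intros <- <-. reflexivity. Qed.
Lemma psat_eq e n i j x y : e i = x -> e j = y -> (psat W e (fEq i j n) <-> x = y).
Proof. intros <- <-. reflexivity. Qed.
Lemma psat_allb e n j y F (P : zset -> Prop) : e j = y -> W y -> j < n ->
  (forall x, W x -> x ∈ y -> (psat W (upd e n x) (F n (S n)) <-> P x)) ->
  (psat W e (fAll (fun x => fImp (fMem x j) (F x)) n) <-> forall x, x ∈ y -> P x).
Proof.
  intros <- Wj Hj H. unfold psat. cbn.
  split.
  - intros K x Hx. apply H; auto; [exact (W_mem Z Wj Hx)|]. apply K; [exact (W_mem Z Wj Hx)|].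
    now rewrite upd_same, upd_lt.
  - intros K x Wx Hx. rewrite upd_same, upd_lt in Hx by auto. apply H; auto.
Qed.
Lemma psat_exb e n j y F (P : zset -> Prop) : e j = y -> W y -> j < n ->
  (forall x, W x -> x ∈ y -> (psat W (upd e n x) (F n (S n)) <-> P x)) ->
  (psat W e (fEx (fun x => fAnd (fMem x j) (F x)) n) <-> exists x, x ∈ y /\ P x).
Proof.
  intros <- Wj Hj H. rewrite psat_ex with (P := fun x => x ∈ e j /\ psat W (upd e n x) (F n (S n))).
  - split; intros (x & K).
    + destruct K as (Wx & Hx & K). exists x. split; auto. now apply H.
    + destruct K as (Hx & K). assert (Wx := W_mem Z Wj Hx). exists x. split; auto. split; auto. now apply H.
  - intros x Wx. apply psat_and; [|reflexivity]. apply psat_mem; [apply upd_same|now apply upd_lt].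
Qed.
End Translation.

Ltac upds := repeat (rewrite upd_same || (rewrite upd_lt by lia)).
Ltac wclass := repeat first [assumption | apply in_class_upd | lia |
  match goal with H : in_class ?W ?e |- ?W (?e _) => apply H end | (progress upds) ].
Ltac pshook := fail.
Ltac psstep :=
  match goal with
  | |- psat _ _ (fAll (fun x => fImp (fMem x _) _) _) <-> _ => eapply psat_allb; [eassumption|upds; reflexivity|solve [wclass]|solve [wclass]|intros]
  | |- psat _ _ (fEx (fun x => fAnd (fMem x _) _) _) <-> _ => eapply psat_exb; [eassumption|upds; reflexivity|solve [wclass]|solve [wclass]|intros]
  | |- psat _ _ (fAll _ _) <-> _ => eapply psat_all; intros
  | |- psat _ _ (fEx _ _) <-> _ => eapply psat_ex; intros
  | |- psat _ _ (fImp _ _ _) <-> _ => eapply psat_imp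
  | |- psat _ _ (fNot _ _) <-> _ => eapply psat_not
  | |- psat _ _ (fAnd _ _ _) <-> _ => eapply psat_and
  | |- psat _ _ (fOr _ _ _) <-> _ => eapply psat_or
  | |- psat _ _ (fIff _ _ _) <-> _ => eapply psat_iff
  | |- psat _ _ (fMem _ _ _) <-> _ => eapply psat_mem; upds; reflexivity
  | |- psat _ _ (fEq _ _ _) <-> _ => eapply psat_eq; upds; reflexivity
  | |- _ => pshook
  end.
Ltac psby L := etransitivity; [apply L; solve [wclass]|upds; first [apply iff_refl|idtac]].
Ltac ps := cbv beta; repeat (psstep; cbv beta).

Lemma psat_sub W (Z : zf W) e (He : in_class W e) n i j : i < n -> j < n ->
  (psat W e (sub i j n) <-> subset (e i) (e j)).
Proof.
  intros Hi Hj. unfold sub, subset. ps. Qed.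
Lemma psat_is_empty W (Z : zf W) e (He : in_class W e) n i : i < n ->
  (psat W e (is_empty i n) <-> e i = zempty).
Proof.
  intros Hi.
  etransitivity. { unfold is_empty. ps. }
  split.
  - intro H. destruct (inhabited_or_empty (e i)) as [|[y Hy]]; auto. exfalso. apply (H y); auto. exact (W_mem Z (He i) Hy).
  - intros H y _. rewrite H. apply not_mem_empty.
Qed.
Lemma psat_is_upair W (Z : zf W) e (He : in_class W e) n i j k : i < n -> j < n -> k < n ->
  (psat W e (is_upair i j k n) <-> e i = upair (e j) (e k)).
Proof.
  intros Hi Hj Hk.
  etransitivity. { unfold is_upair. ps. }
  split.
  - intro H. apply zset_ext. intro z. rewrite mem_upair. split; intro Hz.
    + apply H; auto. exact (W_mem Z (He i) Hz).
    + apply H; auto. destruct Hz as [-> | ->]; apply He.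
  - intros H w _. rewrite H. apply mem_upair.
Qed.

Ltac pshook ::=
  match goal with
  | |- psat _ _ (sub _ _ _) <-> _ => psby psat_sub
  | |- psat _ _ (is_empty _ _) <-> _ => psby psat_is_empty
  | |- psat _ _ (is_upair _ _ _ _) <-> _ => psby psat_is_upair
  end.

Lemma psat_is_opair W (Z : zf W) e (He : in_class W e) n i j k : i < n -> j < n -> k < n ->
  (psat W e (is_opair i j k n) <-> e i = opr (e j) (e k)).
Proof.
  intros Hi Hj Hk.
  etransitivity. { unfold is_opair. ps. }
  split.
  - intros (x & _ & y & _ & -> & -> & ->). reflexivity.
  - intro H. exists (sing (e j)). split; [apply W_sing; auto|]. exists (upair (e j) (e k)).
    split; [apply W_upair; auto|]. auto.
Qed.
Lemma psat_is_union W (Z : zf W) e (He : in_class W e) n i j : i < n -> j < n ->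
  (psat W e (is_union i j n) <-> e i = Un (e j)).
Proof.
  intros Hi Hj.
  etransitivity. { unfold is_union. ps. }
  split.
  - intro H. apply zset_ext. intro z. rewrite mem_Un. split; intro Hz.
    + apply H; auto. exact (W_mem Z (He i) Hz).
    + apply H; auto. destruct Hz as (y & Hy & Hz). exact (W_mem Z (W_mem Z (He j) Hy) Hz).
  - intros H w _. rewrite H. apply mem_Un.
Qed.
Lemma psat_transitive W (Z : zf W) e (He : in_class W e) n i : i < n ->
  (psat W e (transitive i n) <-> trans (e i)).
Proof.
  intros Hi. unfold transitive, trans. ps. Qed.
Lemma psat_is_succ W (Z : zf W) e (He : in_class W e) n i j : i < n -> j < n ->
  (psat W e (is_succ i j n) <-> e i = suc (e j)).
Proof.
  intros Hi Hj.
  etransitivity. { unfold is_succ. ps. }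
  split.
  - intro H. apply zset_ext. intro z. rewrite mem_suc. split; intro Hz.
    + apply H; auto. exact (W_mem Z (He i) Hz).
    + apply H; auto. destruct Hz as [Hz| ->]; [exact (W_mem Z (He j) Hz)|apply He].
  - intros H w _. rewrite H. apply mem_suc.
Qed.

Ltac pshook ::=
  match goal with
  | |- psat _ _ (sub _ _ _) <-> _ => psby psat_sub
  | |- psat _ _ (is_empty _ _) <-> _ => psby psat_is_empty
  | |- psat _ _ (is_upair _ _ _ _) <-> _ => psby psat_is_upair
  | |- psat _ _ (is_opair _ _ _ _) <-> _ => psby psat_is_opair
  | |- psat _ _ (is_union _ _ _) <-> _ => psby psat_is_union
  | |- psat _ _ (transitive _ _) <-> _ => psby psat_transitive
  | |- psat _ _ (is_succ _ _ _) <-> _ => psby psat_is_succ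
  end.

Lemma psat_app W (Z : zf W) e (He : in_class W e) n i j k : i < n -> j < n -> k < n ->
  (psat W e (Defs.app i j k n) <-> opr (e j) (e k) ∈ e i).
Proof.
  intros Hi Hj Hk.
  etransitivity. { unfold Defs.app. ps. }
  split; [intros (z & Hz & ->); auto|eauto].
Qed.
Lemma psat_ordinal W (Z : zf W) e (He : in_class W e) n i : i < n ->
  (psat W e (ordinal i n) <-> ord (e i)).
Proof.
  intros Hi. unfold ordinal, ord. ps. Qed.

Ltac pshook ::=
  match goal with
  | |- psat _ _ (sub _ _ _) <-> _ => psby psat_sub
  | |- psat _ _ (is_empty _ _) <-> _ => psby psat_is_empty
  | |- psat _ _ (is_upair _ _ _ _) <-> _ => psby psat_is_upair
  | |- psat _ _ (is_opair _ _ _ _) <-> _ => psby psat_is_opair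
  | |- psat _ _ (is_union _ _ _) <-> _ => psby psat_is_union
  | |- psat _ _ (transitive _ _) <-> _ => psby psat_transitive
  | |- psat _ _ (is_succ _ _ _) <-> _ => psby psat_is_succ
  | |- psat _ _ (Defs.app _ _ _ _) <-> _ => psby psat_app
  | |- psat _ _ (ordinal _ _) <-> _ => psby psat_ordinal
  end.

Lemma psat_is_function W (Z : zf W) e (He : in_class W e) n i j k : i < n -> j < n -> k < n ->
  (psat W e (is_function i j k n) <-> isfun (e i) (e j) (e k)).
Proof.
  intros Hi Hj Hk.
  etransitivity. { unfold is_function. ps. }
  unfold isfun. split.
  - intros (H1 & H2 & H3). split; [auto|split].
    + intros x Hx. destruct (H2 x Hx) as (y & _ & Hy). eauto.
    + intros x y y' Hy Hy'. destruct (W_opr_inv Z (W_mem Z (He i) Hy)), (W_opr_inv Z (W_mem Z (He i) Hy')).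
      apply (H3 x); auto.
  - intros (H1 & H2 & H3). split; [auto|split].
    + intros x Hx. destruct (H2 x Hx) as (y & Hy). exists y. split; auto. apply (W_opr_inv Z (W_mem Z (He i) Hy)).
    + intros. eapply H3; eauto.
Qed.
Lemma psat_is_omega W (Z : zf W) e (He : in_class W e) n i : i < n ->
  (psat W e (is_omega i n) <-> e i = omega).
Proof.
  intros Hi.
  etransitivity. { unfold is_omega. ps. }
  split.
  - intros (O & (x0 & H0 & ->) & Hs & Hp). apply zset_ext. intro z. rewrite mem_omega. split.
    + induction z as [z IH] using mem_ind. intro Hz. destruct (Hp z Hz) as [->|(y & Hy & ->)].
      * now exists 0.
      * destruct (IH y) as [m ->]; auto; [apply mem_suc; auto|]. now exists (S m).
    + intros [m ->]. induction m as [|m IH]; auto. destruct (Hs _ IH) as (y & Hy & ->). exact Hy.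
  - intros ->. split; [apply omega_ord|]. split; [|split].
    + exists zempty. split; auto. apply (num_in_omega 0).
    + intros x Hx. exists (suc x). split; auto. apply mem_omega in Hx. destruct Hx as [m ->]. apply (num_in_omega (S m)).
    + intros x Hx. apply mem_omega in Hx. destruct Hx as [[|m] ->]; [auto|]. right. exists (num m).
      split; [apply num_in_omega|reflexivity].
Qed.
Lemma psat_is_trcl W (Z : zf W) e (He : in_class W e) n i j : i < n -> j < n ->
  (psat W e (is_trcl i j n) <-> e i = tc (e j)).
Proof.
  intros Hi Hj.
  etransitivity. { unfold is_trcl. ps. }
  split.
  - intros (H1 & H2 & H3). apply zset_ext. intro z. split.
    + apply H3; [apply W_tc; auto|apply tc_sub|apply tc_trans].
    + apply tc_least; auto.
  - intros ->. split; [apply tc_sub|]. split; [apply tc_trans|]. intros. now apply tc_least.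
Qed.

Ltac pshook ::=
  match goal with
  | |- psat _ _ (sub _ _ _) <-> _ => psby psat_sub
  | |- psat _ _ (is_empty _ _) <-> _ => psby psat_is_empty
  | |- psat _ _ (is_upair _ _ _ _) <-> _ => psby psat_is_upair
  | |- psat _ _ (is_opair _ _ _ _) <-> _ => psby psat_is_opair
  | |- psat _ _ (is_union _ _ _) <-> _ => psby psat_is_union
  | |- psat _ _ (transitive _ _) <-> _ => psby psat_transitive
  | |- psat _ _ (is_succ _ _ _) <-> _ => psby psat_is_succ
  | |- psat _ _ (Defs.app _ _ _ _) <-> _ => psby psat_app
  | |- psat _ _ (ordinal _ _) <-> _ => psby psat_ordinal
  | |- psat _ _ (is_function _ _ _ _) <-> _ => psby psat_is_function
  | |- psat _ _ (is_omega _ _) <-> _ => psby psat_is_omega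
  | |- psat _ _ (is_trcl _ _ _) <-> _ => psby psat_is_trcl
  end.

Lemma psat_injects W (Z : zf W) e (He : in_class W e) n i j : i < n -> j < n ->
  (psat W e (injects i j n) <-> Inj W (e i) (e j)).
Proof.
  intros Hi Hj.
  etransitivity. { unfold injects. ps. }
  unfold Inj. split; intros (f & Wf & Ff & K); exists f; split; auto; split; auto.
  - intros x x' y H H'. destruct (W_opr_inv Z (W_mem Z Wf H)), (W_opr_inv Z (W_mem Z Wf H')). eauto.
  - intros x _ x' _ y _. apply K.
Qed.
Lemma psat_compat W (Z : zf W) e (He : in_class W e) n i j k l : i < n -> j < n -> k < n -> l < n ->
  (psat W e (compat i j k l n) <-> Cmp (e i) (e j) (e k) (e l)).
Proof.
  intros Hi Hj Hk Hl. unfold compat, Cmp. ps. Qed.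

Ltac pshook ::=
  match goal with
  | |- psat _ _ (sub _ _ _) <-> _ => psby psat_sub
  | |- psat _ _ (is_union _ _ _) <-> _ => psby psat_is_union
  | |- psat _ _ (Defs.app _ _ _ _) <-> _ => psby psat_app
  | |- psat _ _ (ordinal _ _) <-> _ => psby psat_ordinal
  | |- psat _ _ (is_function _ _ _ _) <-> _ => psby psat_is_function
  | |- psat _ _ (is_omega _ _) <-> _ => psby psat_is_omega
  | |- psat _ _ (is_trcl _ _ _) <-> _ => psby psat_is_trcl
  | |- psat _ _ (injects _ _ _) <-> _ => psby psat_injects
  | |- psat _ _ (compat _ _ _ _ _) <-> _ => psby psat_compat
  end.

Lemma psat_countable W (Z : zf W) e (He : in_class W e) n i : i < n ->
  (psat W e (countable i n) <-> Ctbl W (e i)).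
Proof.
  intros Hi.
  etransitivity. { unfold countable. ps. }
  unfold Ctbl. split; [intros (w & _ & -> & H); auto|]. intro H. exists omega. split; auto. apply Z.
Qed.
Lemma psat_cardinal W (Z : zf W) e (He : in_class W e) n i : i < n ->
  (psat W e (cardinal i n) <-> Card W (e i)).
Proof.
  intros Hi. unfold cardinal, Card. ps. Qed.
Lemma psat_hereditarily_lt W (Z : zf W) e (He : in_class W e) n i j : i < n -> j < n ->
  (psat W e (hereditarily_lt i j n) <-> Hlt W (e i) (e j)).
Proof.
  intros Hi Hj.
  etransitivity. { unfold hereditarily_lt. ps. }
  unfold Hlt. split; [intros (w & _ & -> & H); auto|]. intro H. exists (tc (e i)). split; auto. apply W_tc; auto.
Qed.
Lemma psat_strongly_generic W (Z : zf W) e (He : in_class W e) n i j k l : i < n -> j < n -> k < n -> l < n ->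
  (psat W e (strongly_generic i j k l n) <-> SG W (e i) (e j) (e k) (e l)).
Proof.
  intros Hi Hj Hk Hl. unfold strongly_generic, SG. ps. Qed.

Ltac pshook ::=
  match goal with
  | |- psat _ _ (sub _ _ _) <-> _ => psby psat_sub
  | |- psat _ _ (is_union _ _ _) <-> _ => psby psat_is_union
  | |- psat _ _ (Defs.app _ _ _ _) <-> _ => psby psat_app
  | |- psat _ _ (is_function _ _ _ _) <-> _ => psby psat_is_function
  | |- psat _ _ (is_omega _ _) <-> _ => psby psat_is_omega
  | |- psat _ _ (compat _ _ _ _ _) <-> _ => psby psat_compat
  | |- psat _ _ (countable _ _) <-> _ => psby psat_countable
  | |- psat _ _ (cardinal _ _) <-> _ => psby psat_cardinal
  | |- psat _ _ (hereditarily_lt _ _ _) <-> _ => psby psat_hereditarily_lt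
  | |- psat _ _ (strongly_generic _ _ _ _ _) <-> _ => psby psat_strongly_generic
  end.

Lemma psat_uncountable_cardinal W (Z : zf W) e (He : in_class W e) n i : i < n ->
  (psat W e (uncountable_cardinal i n) <-> UCard W (e i)).
Proof.
  intros Hi. unfold uncountable_cardinal, UCard. ps. Qed.
Lemma psat_regular_cardinal W (Z : zf W) e (He : in_class W e) n i : i < n ->
  (psat W e (regular_cardinal i n) <-> Regular W (e i)).
Proof.
  intros Hi.
  etransitivity. { unfold regular_cardinal. ps. }
  unfold Regular. split.
  - intros (H1 & (w & _ & -> & H2) & H3). split; auto. split; auto. intros α Hα f Wf Ff.
    destruct (H3 α Hα f Wf Ff) as (β & Hβ & K). exists β. split; auto. intros x y Hxy.
    destruct (W_opr_inv Z (W_mem Z Wf Hxy)). eauto.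
  - intros (H1 & H2 & H3). split; auto. split.
    + exists omega. split; [apply Z|auto].
    + intros α Hα f Wf Ff. destruct (H3 α Hα f Wf Ff) as (β & Hβ & K). exists β. split; auto. intros. eauto.
Qed.
Lemma psat_is_H W (Z : zf W) e (He : in_class W e) n i j : i < n -> j < n ->
  (psat W e (is_H i j n) <-> IsH W (e i) (e j)).
Proof.
  intros Hi Hj. unfold is_H, IsH. ps. Qed.
Lemma psat_sub_H W (Z : zf W) e (He : in_class W e) n i j : i < n -> j < n ->
  (psat W e (sub_H i j n) <-> SubH W (e i) (e j)).
Proof.
  intros Hi Hj. unfold sub_H, SubH. ps. Qed.
Lemma psat_club W (Z : zf W) e (He : in_class W e) n i j : i < n -> j < n ->
  (psat W e (club i j n) <-> Club W (e i) (e j)).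
Proof.
  intros Hi Hj.
  etransitivity. { unfold club. ps. }
  unfold Club. split; intros (H1 & H2 & H3); (split; [auto|split; [auto|]]).
  - intros F WF HF CF [d Hd] K. apply (H3 F WF HF CF); auto.
    + exists d. split; auto. exact (W_mem Z WF Hd).
    + now apply Z.
  - intros F WF HF CF [d [_ Hd]] K u _ ->. apply H3; eauto.
Qed.
Lemma psat_usg W (Z : zf W) e (He : in_class W e) n i j k l : i < n -> j < n -> k < n -> l < n ->
  (psat W e (universal_strongly_generic i j k l n) <-> USG W (e i) (e j) (e k) (e l)).
Proof.
  intros Hi Hj Hk Hl. unfold universal_strongly_generic, USG. ps. Qed.
Lemma psat_is_quotient W (Z : zf W) e (He : in_class W e) n i j k l m : i < n -> j < n -> k < n -> l < n -> m < n ->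
  (psat W e (is_quotient i j k l m n) <-> IsQuot W (e i) (e j) (e k) (e l) (e m)).
Proof.
  intros Hi Hj Hk Hl Hm. unfold is_quotient, IsQuot. ps. Qed.

Ltac pshook ::=
  match goal with
  | |- psat _ _ (sub _ _ _) <-> _ => psby psat_sub
  | |- psat _ _ (uncountable_cardinal _ _) <-> _ => psby psat_uncountable_cardinal
  | |- psat _ _ (sub_H _ _ _) <-> _ => psby psat_sub_H
  end.

Lemma psat_is_lambda W (Z : zf W) e (He : in_class W e) n i j : i < n -> j < n ->
  (psat W e (is_lambda i j n) <-> Lambda W (e i) (e j)).
Proof. intros. unfold is_lambda, Lambda. ps. Qed.

Ltac pshook ::=
  match goal with
  | |- psat _ _ (is_lambda _ _ _) <-> _ => psby psat_is_lambda
  | |- psat _ _ (is_H _ _ _) <-> _ => psby psat_is_H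
  | |- psat _ _ (club _ _ _) <-> _ => psby psat_club
  | |- psat _ _ (universal_strongly_generic _ _ _ _ _) <-> _ => psby psat_usg
  end.

Lemma psat_has_usg W (Z : zf W) e (He : in_class W e) n i j : i < n -> j < n ->
  (psat W e (has_usg_stationary i j n) <-> HasUSG W (e i) (e j)).
Proof.
  intros. etransitivity. { unfold has_usg_stationary. ps. }
  unfold HasUSG. split.
  - intros (l & Wl & h & Wh & H1 & H2 & H3). exists l. split; auto. exists h. auto.
  - intros (l & Wl & h & Wh & H1 & H2 & H3). exists l. split; auto. exists h. auto.
Qed.

(** * Cardinality *)

Definition ite (Q : Prop) (x y : zset) : zset := if excluded_middle_informative Q then x else y.
Lemma ite_true (Q : Prop) x y : Q -> ite Q x y = x.
Proof. unfold ite. destruct (excluded_middle_informative Q); tauto. Qed.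
Lemma ite_false (Q : Prop) x y : ~ Q -> ite Q x y = y.
Proof. unfold ite. destruct (excluded_middle_informative Q); tauto. Qed.

Lemma TD_ite W C (X : dctx W C) Q t u : D W C Q -> TD W C t -> TD W C u -> TD W C (fun e => ite (Q e) (t e) (u e)).
Proof.
  intros H [T1 T2] [U1 U2]. split.
  - intros e He. unfold ite. destruct (excluded_middle_informative _); auto.
  - apply (D_ext X) with (Psi := fun e => (Q (fun k => e (S k)) /\ e 0 = t (fun k => e (S k))) \/
      (~ Q (fun k => e (S k)) /\ e 0 = u (fun k => e (S k)))).
    + intros e He. unfold ite. destruct (excluded_middle_informative _); tauto.
    + assert (D W C (fun e => Q (fun k => e (S k)))) by exact (D_ren X S H). dsolve.
Qed.

(** The component is isolated as the only element of a subset of [Un p], and the outer union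
    extracts it. *)
Definition fst_ p := Un (sep (Un p) (fun x => exists y, y ∈ Un p /\ p = opr x y)).
Definition snd_ p := Un (sep (Un p) (fun y => exists x, x ∈ Un p /\ p = opr x y)).

Lemma mem_Un_opr x y z : z ∈ Un (opr x y) <-> z = x \/ z = y.
Proof.
  rewrite mem_Un. unfold opr. split.
  - intros (w & Hw & Hz). apply mem_upair in Hw. destruct Hw as [-> | ->].
    + apply mem_sing in Hz. auto.
    + now apply mem_upair.
  - intro H. exists (upair x y). rewrite !mem_upair. auto.
Qed.

Lemma fst_opr x y : fst_ (opr x y) = x.
Proof.
  apply zset_ext. intro z. unfold fst_. rewrite mem_Un. split.
  - intros (w & Hw & Hz). apply mem_sep in Hw. destruct Hw as (_ & v & _ & E). apply opr_inj in E. destruct E; now subst.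
  - intro Hz. exists x. split; auto. apply mem_sep. rewrite mem_Un_opr. split; auto. exists y. rewrite mem_Un_opr. auto.
Qed.
Lemma snd_opr x y : snd_ (opr x y) = y.
Proof.
  apply zset_ext. intro z. unfold snd_. rewrite mem_Un. split.
  - intros (w & Hw & Hz). apply mem_sep in Hw. destruct Hw as (_ & v & _ & E). apply opr_inj in E. destruct E; now subst.
  - intro Hz. exists y. split; auto. apply mem_sep. rewrite mem_Un_opr. split; auto. exists x. rewrite mem_Un_opr. auto.
Qed.

(** * Definability of projections and of recursion along ω *)

Section Projections.
Variables W C : class.
Hypothesis Z : zf W.
Hypothesis X : dctx W C.

Lemma TD_fst : TD W C (fun e => fst_ (e 0)).
Proof.
  apply (TD_ap1 X (fun p => Un p) (TD_Un Z X)).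
  apply (TD_intro X) with (Phi := fun x e => x ∈ Un (e 0) /\ exists y, y ∈ Un (e 0) /\ e 0 = opr x y).
  - intros e He. pose proof (zf_ctx Z). pose proof (He 0). apply (W_sep Z); [dsolve|]. now apply Z.
  - intros. apply mem_sep.
  - dsolve.
Qed.
Lemma TD_snd : TD W C (fun e => snd_ (e 0)).
Proof.
  apply (TD_ap1 X (fun p => Un p) (TD_Un Z X)).
  apply (TD_intro X) with (Phi := fun y e => y ∈ Un (e 0) /\ exists x, x ∈ Un (e 0) /\ e 0 = opr x y).
  - intros e He. pose proof (zf_ctx Z). pose proof (He 0). apply (W_sep Z); [dsolve|]. now apply Z.
  - intros. apply mem_sep.
  - dsolve.
Qed.

(* [Un x ∈ x] says that the number [x] is a successor, and then [Un x] is its predecessor. *)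
Definition orec (x0 : zset) (S : zset -> zset -> zset) : zset -> zset :=
  trec (fun x g => ite (Un x ∈ x) (S (Un x) (ap g (Un x))) x0).

Lemma TD_orec x0 S : C x0 -> TD W C (fun e => S (e 0) (e 1)) -> TD W C (fun e => orec x0 S (e 0)).
Proof.
  intros Cx HS. apply (TD_trec0 Z X).
  - apply (TD_ite X); [dsolve| |dsolve]. apply (TD_ap2 X S HS); [dsolve|]. dsolve2.
  - intros x g g' H. destruct (classic (Un x ∈ x)) as [E|E]; [rewrite !ite_true; auto|rewrite !ite_false; auto].
    f_equal. unfold ap. f_equal. apply gim_local. intros y v Hy. apply mem_sing in Hy. subst y.
    apply H. now apply tc_sub.
Qed.
End Projections.

Lemma orec_zero x0 S : orec x0 S zempty = x0.
Proof. unfold orec. rewrite trec_eq. apply ite_false, not_mem_empty. Qed.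

Lemma Un_suc_ord x : trans x -> Un (suc x) = x.
Proof.
  intro T. apply zset_ext. intro z. rewrite mem_Un. split.
  - intros (y & Hy & Hz). rewrite mem_suc in Hy. destruct Hy as [Hy| ->]; auto. exact (T y Hy z Hz).
  - intro Hz. exists x. rewrite mem_suc. auto.
Qed.

Lemma orec_suc x0 S n : n ∈ omega -> orec x0 S (suc n) = S n (orec x0 S n).
Proof.
  intro H. apply mem_omega in H. destruct H as [m ->].
  assert (E : Un (suc (num m)) = num m) by (apply Un_suc_ord; exact (proj1 (num_ord m))).
  unfold orec at 1. rewrite trec_eq, E. rewrite ite_true by (apply mem_suc; auto).
  f_equal. apply ap_graph. apply tc_sub, mem_suc. auto.
Qed.

Lemma D_isfun W C (Z : zf W) (X : dctx W C) t u v : TD W C t -> TD W C u -> TD W C v ->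
  D W C (fun e => isfun (t e) (u e) (v e)).
Proof.
  intros. apply (D_rel3 X isfun); auto.
  apply (D_ext X) with (Psi := fun e =>
    (forall z, z ∈ e 0 -> exists x, x ∈ e 1 /\ exists y, y ∈ e 2 /\ z = opr x y) /\
    (forall x, x ∈ e 1 -> exists y, W y /\ opr x y ∈ e 0) /\
    (forall x, W x -> forall y, W y -> forall y', W y' -> opr x y ∈ e 0 -> opr x y' ∈ e 0 -> y = y')).
  - intros e He. unfold isfun. split; intros (H1' & H2' & H3'); (split; [auto|split]).
    + intros x Hx. destruct (H2' x Hx) as [y Hy]. exists y. split; auto. apply (W_opr_inv Z (W_mem Z (He 0) Hy)).
    + intros; eauto.
    + intros x Hx. destruct (H2' x Hx) as (y & _ & Hy). eauto.
    + intros x y y' Hy Hy'. destruct (W_opr_inv Z (W_mem Z (He 0) Hy)), (W_opr_inv Z (W_mem Z (He 0) Hy')). eauto.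
  - dsolve.
Qed.

Lemma D_Inj W C (Z : zf W) (X : dctx W C) t u : TD W C t -> TD W C u -> D W C (fun e => Inj W (t e) (u e)).
Proof.
  intros. apply (D_rel2 X (Inj W)); auto. unfold Inj. dstep. dstep; [apply (D_isfun Z X); dsolve|].
  apply (D_ext X) with (Psi := fun e => forall x, W x -> forall x', W x' -> forall y, W y ->
    opr x y ∈ e 0 -> opr x' y ∈ e 0 -> x = x').
  - intros e He. split; [eauto|]. intros K x x' y Hy Hy'.
    destruct (W_opr_inv Z (W_mem Z (He 0) Hy)), (W_opr_inv Z (W_mem Z (He 0) Hy')). eauto.
  - dsolve.
Qed.

Ltac dhook3 :=
  lazymatch goal with
  | |- TD _ _ (fun e => ite _ _ _) => eapply TD_ite; [eassumption| | |]
  | |- TD _ _ (fun e => fst_ _) => eapply (TD_ap1 ltac:(eassumption) fst_); [eapply TD_fst; eassumption|]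
  | |- TD _ _ (fun e => snd_ _) => eapply (TD_ap1 ltac:(eassumption) snd_); [eapply TD_snd; eassumption|]
  | |- D _ _ (fun e => isfun _ _ _) => eapply D_isfun; [eassumption|eassumption| | |]
  | |- D _ _ (fun e => Inj _ _ _) => eapply D_Inj; [eassumption|eassumption| |]
  | |- D _ _ (fun e => Ctbl _ _) => unfold Ctbl
  | |- D _ _ (fun e => Hlt _ _ _) => unfold Hlt
  | |- D _ _ (fun e => Cmp _ _ _ _) => unfold Cmp
  end.
Ltac ds := repeat first [dstep | dhook2 | dhook3].

(** * Injections, Hartogs numbers, the sets H(k) and the cardinal λ of a poset *)

Section Cardinals.
Variable W : class.
Hypothesis Z : zf W.
Let X := zf_ctx Z.

Lemma isfun_func f a b : isfun f a b <-> func f a /\ forall x y, opr x y ∈ f -> y ∈ b.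
Proof.
  split.
  - intros (H1 & H2 & H3). split; [split|].
    + intros p Hp. destruct (H1 p Hp) as (x & Hx & y & _ & E). eauto.
    + intros x Hx. destruct (H2 x Hx) as (y & Hy). exists y. split; auto. intros y' Hy'. eapply H3; eauto.
    + intros x y Hy. destruct (H1 _ Hy) as (x' & _ & y' & Hy' & E). apply opr_inj in E. now destruct E as [-> ->].
  - intros [F K]. split; [|split].
    + intros p Hp. destruct (proj1 F p Hp) as (x & Hx & y & ->). exists x. split; auto. exists y. split; eauto.
    + intros x Hx. destruct (proj2 F x Hx) as (y & Hy & _). eauto.
    + intros x y y' Hy Hy'. rewrite <- (ap_eq F Hy). now apply (ap_eq F).
Qed.

Lemma Inj_iff a b : Inj W a b <-> exists f, W f /\ func f a /\ (forall x, x ∈ a -> ap f x ∈ b) /\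
  forall x y, x ∈ a -> y ∈ a -> ap f x = ap f y -> x = y.
Proof.
  unfold Inj. split.
  - intros (f & Wf & Ff & K). apply isfun_func in Ff. destruct Ff as [Ff R]. exists f. split; auto. split; auto. split.
    + intros x Hx. apply (R x). now apply (ap_mem Ff).
    + intros x y Hx Hy E. apply (K x y (ap f x)); [now apply (ap_mem Ff)|]. rewrite E. now apply (ap_mem Ff).
  - intros (f & Wf & Ff & R & K). exists f. split; auto.
    assert (D0 : forall x y, opr x y ∈ f -> x ∈ a).
    { intros x y H. destruct (proj1 Ff _ H) as (x' & Hx & y' & E). apply opr_inj in E. now destruct E as [-> _]. }
    split.
    + apply isfun_func. split; auto. intros x y H. rewrite <- (ap_eq Ff H). apply R. eauto.
    + intros x x' y H H'. apply K; eauto. rewrite (ap_eq Ff H). symmetry. exact (ap_eq Ff H').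
Qed.

Lemma Inj_TD F a b : TD W W (fun e => F (e 0)) -> W a -> (forall x, x ∈ a -> F x ∈ b) ->
  (forall x y, x ∈ a -> y ∈ a -> F x = F y -> x = y) -> Inj W a b.
Proof.
  intros HF Wa H K. apply Inj_iff. exists (graph F a). split; [now apply W_graph_TD|]. split; [apply func_graph|].
  split; intros; rewrite !ap_graph in * by auto; auto.
Qed.

Lemma Inj_sub a b : W a -> subset a b -> Inj W a b.
Proof. intros Wa H. apply (@Inj_TD (fun x => x)); auto. apply (TD_var X 0). Qed.

Lemma Inj_trans a b c : W a -> Inj W a b -> Inj W b c -> Inj W a c.
Proof.
  rewrite (Inj_iff a b), (Inj_iff b c). intros Wa (f & Wf & Ff & f1 & f2) (g & Wg & Fg & g1 & g2).
  apply (@Inj_TD (fun x => ap g (ap f x))); auto. pose proof X. ds.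
Qed.

(* Each [y] is sent to the least code of an element of [a] related to it, so no choice is needed. *)
Lemma Inj_cover (R : zset -> zset -> Prop) x a α : W x -> W a -> W α -> ord α -> Inj W a α ->
  D W W (fun e => R (e 0) (e 1)) ->
  (forall y, y ∈ x -> exists u, u ∈ a /\ R u y) ->
  (forall u y y', u ∈ a -> y ∈ x -> y' ∈ x -> R u y -> R u y' -> y = y') -> Inj W x α.
Proof.
  intros Wx Wa Wα Oα Ha HR H1 H2. apply Inj_iff in Ha. destruct Ha as (j & Wj & Fj & j1 & j2). pose proof X as XX.
  set (T := fun y β => exists u, u ∈ a /\ ap j u = β /\ R u y).
  set (f := sep (prod x α) (fun p => exists y, y ∈ x /\ exists β, β ∈ α /\ p = opr y β /\ T y β /\ forall γ, γ ∈ β -> ~ T y γ)).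
  assert (mf : forall y β, opr y β ∈ f <-> y ∈ x /\ β ∈ α /\ T y β /\ forall γ, γ ∈ β -> ~ T y γ).
  { intros y β. unfold f. rewrite mem_sep, opr_in_prod. split.
    - intros (_ & y' & Hy & β' & Hβ & E & K). apply opr_inj in E. destruct E as [<- <-]. tauto.
    - intros (Hy & Hβ & K). split; auto. exists y. split; auto. exists β. auto. }
  assert (TT : D W W (fun e => T (e 0) (e 1))).
  { unfold T. ds; try (apply (D_rel2 XX R HR); ds). }
  assert (U : forall y β γ, opr y β ∈ f -> opr y γ ∈ f -> γ = β).
  { intros y β γ H K. apply mf in H, K. destruct H as (_ & Hβ & T1 & M1), K as (_ & Hγ & T2 & M2).
    destruct (ord_cmp (ord_mem Oα Hγ) (ord_mem Oα Hβ)) as [L|[L|L]]; auto; exfalso; [apply (M1 _ L)|apply (M2 _ L)]; auto. }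
  assert (Ff : func f x).
  { split.
    - intros p Hp. apply mem_sep in Hp. destruct Hp as (_ & y & Hy & β & _ & -> & _). eauto.
    - intros y Hy. destruct (H1 y Hy) as (u & Hu & K).
      destruct (@mem_minimal (fun β => β ∈ α /\ T y β)) as (β & (Hβ & Tβ) & Min).
      { exists (ap j u). split; auto. exists u. auto. }
      assert (Hf : opr y β ∈ f).
      { apply mf. split; auto. split; auto. split; auto. intros γ Hγ Tγ. apply (Min γ Hγ). split; auto.
        exact (ord_trans Oα Hβ Hγ). }
      exists β. split; auto. intros γ Hγ. eapply U; eauto. }
  apply Inj_iff. exists f. split; [|split; auto; split].
  - apply (W_sep Z); [|now apply W_prod]. ds; try (apply (D_rel2 XX T TT); ds).
  - intros y Hy. apply (ap_mem Ff), mf in Hy. tauto.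
  - intros y y' Hy Hy' E. apply (ap_mem Ff), mf in Hy. apply (ap_mem Ff), mf in Hy'. rewrite <- E in Hy'.
    destruct Hy as (Hy & _ & (u & Hu & Eu & Ru) & _), Hy' as (Hy' & _ & (u' & Hu' & Eu' & Ru') & _).
    assert (u = u') by (apply j2; congruence). subst u'. eapply H2; eauto.
Qed.

(** An ordinal injecting into [x] is the order type of a relation on [x], and by [Half] the relation
    determines the ordinal; replacement over the relations yields the set κ of all of them. An
    injection of κ into one of its elements would put κ into itself. *)
Lemma hartogs x : W x -> exists κ, W κ /\ Card W κ /\ forall α, W α -> (α ∈ κ <-> ord α /\ Inj W α x).
Proof.
  intro Wx. pose proof X as XX.
  set (B := fun f β => func f β /\ (forall γ, γ ∈ β -> ap f γ ∈ x) /\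
    forall γ, γ ∈ β -> forall δ, δ ∈ β -> ap f γ = ap f δ -> γ = δ).
  (* The copied order is reflexive, so that the relation also records the range of [f], even when
     that is a single point. *)
  set (O := fun f β r => forall u, u ∈ x -> forall v, v ∈ x -> (opr u v ∈ r <->
    exists γ, γ ∈ β /\ exists δ, δ ∈ β /\ u = ap f γ /\ v = ap f δ /\ (γ ∈ δ \/ γ = δ))).
  set (R := fun r β => ord β /\ exists f, W f /\ B f β /\ O f β r).
  (* By induction on γ: the point of [f] at γ is the point of [f'] at some γ', and γ and γ' have the
     same predecessors. *)
  assert (Half : forall r β β' f f', ord β -> ord β' -> B f β -> B f' β' -> O f β r -> O f' β' r ->
    forall γ, γ ∈ β -> γ ∈ β' /\ ap f' γ = ap f γ).
  { intros r β β' f f' Oβ Oβ' (F & f1 & f2) (F' & f1' & f2') HO HO' γ. induction γ as [γ IH] using mem_ind. intro Hγ.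
    assert (Q : opr (ap f γ) (ap f γ) ∈ r) by (apply HO; auto; exists γ; split; auto; exists γ; auto).
    apply HO' in Q; auto. destruct Q as (γ' & Hγ' & _ & _ & Eγ & _).
    enough (γ = γ') by (subst; auto).
    apply zset_ext. intro δ. split; intro Hδ.
    - assert (Hδβ := ord_trans Oβ Hγ Hδ). destruct (IH δ Hδ Hδβ) as [Hδ' Eδ].
      assert (Q : opr (ap f δ) (ap f γ) ∈ r) by (apply HO; auto; exists δ; split; auto; exists γ; auto).
      apply HO' in Q; auto. destruct Q as (u & Hu & v & Hv & Eu & Ev & Huv).
      assert (u = δ) by (apply f2'; congruence). assert (v = γ') by (apply f2'; congruence). subst u v.
      destruct Huv as [Huv|Huv]; auto. exfalso. assert (Q : δ = γ) by (apply f2; congruence). rewrite Q in Hδ. now apply mem_irrefl in Hδ.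
    - assert (Hδβ := ord_trans Oβ' Hγ' Hδ).
      assert (Q : opr (ap f' δ) (ap f' γ') ∈ r) by (apply HO'; auto; exists δ; split; auto; exists γ'; auto).
      apply HO in Q; auto. destruct Q as (u & Hu & v & Hv & Eu & Ev & Huv).
      assert (v = γ) by (apply f2; congruence). subst v.
      assert (N : u <> γ). { intros ->. assert (δ = γ') by (apply f2'; congruence). subst δ. now apply mem_irrefl in Hδ. }
      destruct Huv as [Huv|]; [|tauto]. destruct (IH u Huv Hu) as [Hu' Eu']. assert (u = δ) by (apply f2'; congruence).
      now subst. }
  assert (HB : D W W (fun e => B (e 0) (e 1))).
  { unfold B. dstep; [|ds]. unfold func.
    apply (D_ext XX) with (Psi := fun e => (forall p, p ∈ e 0 -> exists x, x ∈ e 1 /\ exists y, W y /\ p = opr x y) /\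
      forall x, x ∈ e 1 -> exists y, W y /\ opr x y ∈ e 0 /\ forall y', W y' -> opr x y' ∈ e 0 -> y' = y).
    - intros e He. split; intros [H1 H2]; split.
      + intros p Hp. destruct (H1 p Hp) as (u & Hu & y & ->). exists u. split; auto. exists y. split; auto.
        apply (W_opr_inv Z (W_mem Z (He 0) Hp)).
      + intros u Hu. destruct (H2 u Hu) as (y & Hy & K). exists y. split; auto. apply (W_opr_inv Z (W_mem Z (He 0) Hy)).
      + intros p Hp. destruct (H1 p Hp) as (u & Hu & y & _ & ->). eauto.
      + intros u Hu. destruct (H2 u Hu) as (y & _ & Hy & K). exists y. split; auto. intros y' Hy'. apply K; auto.
        apply (W_opr_inv Z (W_mem Z (He 0) Hy')).
    - ds. }
  destruct (@W_repl W Z R (sep (pow (prod x x)) W)) as (κ & Wκ & Hκ).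
  - unfold R, O. ds; try (apply (D_rel2 XX B HB); ds).
  - apply Z. now apply W_prod.
  - intros r β β' _ _ _ (Oβ & f & _ & Bf & Of) (Oβ' & f' & _ & Bf' & Of').
    apply zset_ext. intro γ. split; intro Hγ; [eapply (Half r β β' f f')|eapply (Half r β' β f' f)]; eauto.
  - assert (Hκ' : forall α, W α -> (α ∈ κ <-> ord α /\ Inj W α x)).
    { intros α Wα. rewrite Hκ. split.
      - intros (_ & r & _ & Oα & f & Wf & (Ff & f1 & f2) & _). split; auto. apply Inj_iff. exists f.
        split; auto.
      - intros (Oα & Hi). split; auto. apply Inj_iff in Hi. destruct Hi as (f & Wf & Ff & f1 & f2).
        set (r := sep (prod x x) (fun p => exists γ, γ ∈ α /\ exists δ, δ ∈ α /\ p = opr (ap f γ) (ap f δ) /\ (γ ∈ δ \/ γ = δ))).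
        exists r. split.
        + rewrite mem_sep, mem_pow. split; [intros p Hp; now apply mem_sep in Hp|].
          apply (W_sep Z); [ds|now apply W_prod].
        + split; auto. exists f. split; auto. split; [split; auto|].
          intros u Hu v Hv. unfold r. rewrite mem_sep, opr_in_prod. split.
          * intros (_ & γ & Hγ & δ & Hδ & E & K). apply opr_inj in E. destruct E. eauto 10.
          * intros (γ & Hγ & δ & Hδ & -> & -> & K). eauto 10. }
    exists κ. split; auto. split; auto.
    assert (Oκ : ord κ).
    { apply ord_intro.
      - intros α Hα β Hβ. assert (Wα := W_mem Z Wκ Hα). assert (Wβ := W_mem Z Wα Hβ).
        apply Hκ' in Hα; auto. destruct Hα as [Oα Hi]. apply Hκ'; auto. split; [eapply ord_mem; eauto|].
        eapply Inj_trans; [auto| |exact Hi]. apply Inj_sub; auto. exact (proj1 Oα β Hβ).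
      - intros α Hα. apply Hκ' in Hα; [tauto|]. exact (W_mem Z Wκ Hα). }
    split; auto. intros α Hα Hi. assert (Wα := W_mem Z Wκ Hα). apply Hκ' in Hα; auto.
    apply (@mem_irrefl κ). apply Hκ'; auto. split; auto. eapply Inj_trans; [auto|exact Hi|tauto].
Qed.

Lemma rank_tc x z : z ∈ rank x -> exists y, y ∈ tc x /\ z = rank y.
Proof.
  induction x as [x IH] using mem_ind. intro H. apply mem_rank in H. destruct H as (y & Hy & [Hz| ->]).
  - destruct (IH y Hy Hz) as (w & Hw & ->). exists w. split; auto. apply mem_tc. eauto.
  - exists y. split; auto. now apply tc_sub.
Qed.

(** H(k) is contained in level [k] of the hierarchy: if the rank of [x] were at least [k], the ranks
    of the elements of [tc x] would cover [k], and [k] would inject into a smaller ordinal. *)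
Lemma H_exists k : W k -> Card W k -> exists h, W h /\ IsH W h k.
Proof.
  intros Wk [Ok Ck]. pose proof X as XX. exists (sep (Vl W k) (fun x => Hlt W x k)). split.
  - apply (W_sep Z); [ds|now apply W_Vl].
  - intros x Wx. rewrite mem_sep. split; [tauto|]. intro H. split; auto. destruct H as (α & Hα & Hi).
    apply mem_Vl. split; auto. exists (rank x). split; [|apply sub_Vl_rank; auto; apply Z].
    destruct (ord_cmp (rank_ord x) Ok) as [L|L]; auto. exfalso. apply (Ck α Hα).
    assert (Wα := W_mem Z Wk Hα).
    apply (@Inj_cover (fun u y => y = rank u) k (tc x) α); auto; [now apply W_tc|eapply ord_mem; eauto|ds| |congruence].
    intros y Hy. destruct (@rank_tc x y) as (w & ? & ?); [|eauto].
    destruct L as [L|L]; [rewrite L; auto|]. exact (ord_trans (rank_ord x) L Hy).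
Qed.

Hypothesis AC : zchoice W.

(** The Hartogs number of a well-order of [tc P] together with ω is an uncountable cardinal whose H
    contains [P] as a subset; so there is a least such cardinal. *)
Lemma lambda_exists P : W P -> exists l, W l /\ Lambda W l P.
Proof.
  intro WP. pose proof X as XX. set (T := union2 (tc P) omega).
  assert (WT : W T) by (apply W_union2; auto; [now apply W_tc|apply Z]).
  destruct (@well_order W Z AC T WT) as (α & j & Wα & Oα & Wj & Fj & j1 & j2 & _).
  assert (Ti : Inj W T α) by (apply Inj_iff; eauto 10).
  destruct (hartogs Wα) as (κ & Wκ & Cκ & Hκ).
  assert (Hα : α ∈ κ) by (apply Hκ; auto; split; auto; apply Inj_sub; auto; intro; auto).
  destruct (@mem_minimal (fun m => W m /\ UCard W m /\ SubH W P m)) as (l & (Wl & Ul & Sl) & Min).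
  { exists κ. split; auto. split; [split; auto|].
    - intro N. apply (@mem_irrefl κ). apply Hκ; auto. split; [apply Cκ|]. eapply Inj_trans; [auto|exact N|].
      eapply Inj_trans; [apply Z| |exact Ti]. apply Inj_sub; [apply Z|]. intros z Hz. apply mem_union2. auto.
    - intros x Hx. exists α. split; auto. eapply Inj_trans; [| |exact Ti].
      + apply W_tc; auto. exact (W_mem Z WP Hx).
      + apply Inj_sub; [apply W_tc; auto; exact (W_mem Z WP Hx)|]. intros z Hz. apply mem_union2. left.
        exact (@tc_mono P x (@tc_sub P x Hx) z Hz). }
  exists l. split; auto. split; auto. split; auto. intros m Wm Um Sm. apply ord_le.
  - apply Ul.
  - apply Um.
  - intro H. apply (Min m H). auto.
Qed.
End Cardinals.

(** * Countable sets *)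

(** Moves along an antidiagonal from [(i, j+1)] to [(i+1, j)], and from its end [(i, 0)] to the
    start [(0, i+1)] of the next one; [Un] is the predecessor of a nonzero number. *)
Definition next_pair v := ite (snd_ v = zempty) (opr zempty (suc (fst_ v))) (opr (suc (fst_ v)) (Un (snd_ v))).
Definition pairs : zset -> zset := orec (opr zempty zempty) (fun _ v => next_pair v).

Lemma suc_neq_empty x : suc x <> zempty.
Proof. intro H. apply (@not_mem_empty x). rewrite <- H, mem_suc. auto. Qed.

(* Cantor's enumeration of the pairs, along the antidiagonals. *)
Lemma pairs_onto i j : exists n, pairs (num n) = opr (num i) (num j).
Proof.
  assert (H : forall s i j, i + j = s -> exists n, pairs (num n) = opr (num i) (num j)).
  { induction s as [s IHs] using lt_wf_ind. intro a. induction a as [|a IHa]; intros b E.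
    - destruct b as [|b]; [exists 0; apply orec_zero|].
      destruct (IHs b ltac:(lia) b 0 ltac:(lia)) as [n Hn]. exists (S n). cbn [num]. unfold pairs.
      rewrite orec_suc by apply num_in_omega. fold pairs. rewrite Hn. unfold next_pair.
      rewrite snd_opr, fst_opr, ite_true by reflexivity. reflexivity.
    - destruct (IHa (S b) ltac:(lia)) as [n Hn]. exists (S n). cbn [num]. unfold pairs.
      rewrite orec_suc by apply num_in_omega. fold pairs. rewrite Hn. unfold next_pair.
      rewrite snd_opr, fst_opr, ite_false by apply suc_neq_empty. cbn [num].
      rewrite Un_suc_ord by exact (proj1 (num_ord b)). reflexivity. }
  eauto.
Qed.

Section Countable.
Variable W : class.
Hypothesis Z : zf W.
Let X := zf_ctx Z.

Lemma TD_pairs : TD W W (fun e => pairs (e 0)).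
Proof.
  pose proof X as XX. apply (TD_orec Z XX).
  - apply W_opr; auto; apply Z.
  - unfold next_pair. ds.
Qed.

Lemma Ctbl_cover (R : zset -> zset -> Prop) x u : W x -> W u -> Ctbl W u ->
  D W W (fun e => R (e 0) (e 1)) -> (forall y, y ∈ x -> exists v, v ∈ u /\ R v y) ->
  (forall v y y', v ∈ u -> y ∈ x -> y' ∈ x -> R v y -> R v y' -> y = y') -> Ctbl W x.
Proof. intros. eapply (@Inj_cover W Z R x u omega); eauto; [apply Z|apply omega_ord]. Qed.

Lemma Ctbl_sub x y : W x -> subset x y -> Ctbl W y -> Ctbl W x.
Proof. intros Wx H K. eapply Inj_trans; eauto. now apply Inj_sub. Qed.

Lemma Ctbl_omega : Ctbl W omega.
Proof. apply Inj_sub; [exact Z|apply Z|intro; auto]. Qed.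

Lemma Ctbl_img F x : TD W W (fun e => F (e 0)) -> W x -> Ctbl W x -> Ctbl W (img x F).
Proof.
  intros HF Wx H. pose proof X as XX. apply (@Ctbl_cover (fun u y => y = F u) (img x F) x); auto.
  - now apply W_img_TD.
  - ds.
  - intros y Hy. apply mem_img in Hy. destruct Hy as (u & ? & ?). eauto.
  - congruence.
Qed.

Lemma Ctbl_prod x y : W x -> W y -> Ctbl W x -> Ctbl W y -> Ctbl W (prod x y).
Proof.
  intros Wx Wy Hx Hy. pose proof X as XX. apply (@Inj_iff W) in Hx, Hy.
  destruct Hx as (f & Wf & Ff & f1 & f2), Hy as (g & Wg & Fg & g1 & g2).
  apply (@Ctbl_cover (fun n p => p ∈ prod x y /\ pairs n = opr (ap f (fst_ p)) (ap g (snd_ p))) (prod x y) omega).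
  - now apply W_prod.
  - apply Z.
  - apply Ctbl_omega.
  - assert (W (prod x y)) by now apply W_prod. ds. apply (TD_ap1 XX pairs TD_pairs). ds.
  - intros p Hp. pose proof Hp as Hp'. apply mem_prod in Hp. destruct Hp as (u & v & Hu & Hv & ->).
    pose proof (f1 u Hu) as K. apply mem_omega in K. destruct K as [i Ei].
    pose proof (g1 v Hv) as K. apply mem_omega in K. destruct K as [j Ej].
    destruct (pairs_onto i j) as [n Hn]. exists (num n). split; [apply num_in_omega|]. split; auto.
    rewrite fst_opr, snd_opr, Hn. congruence.
  - intros n p p' _ _ _ [Hp E] [Hp' E']. apply mem_prod in Hp, Hp'.
    destruct Hp as (u & v & Hu & Hv & ->), Hp' as (u' & v' & Hu' & Hv' & ->).
    rewrite fst_opr, snd_opr in *. rewrite E in E'. apply opr_inj in E'. destruct E' as [E1 E2].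
    f_equal; auto.
Qed.

Lemma Ctbl_upair x y : W x -> W y -> Ctbl W (upair x y).
Proof.
  intros Wx Wy. pose proof X as XX.
  apply (@Ctbl_cover (fun n z => z = ite (n = zempty) x y) (upair x y) omega).
  - now apply W_upair.
  - apply Z.
  - apply Ctbl_omega.
  - ds.
  - intros z Hz. apply mem_upair in Hz. destruct Hz as [-> | ->].
    + exists zempty. split; [apply (num_in_omega 0)|]. now rewrite ite_true.
    + exists (suc zempty). split; [apply (num_in_omega 1)|]. now rewrite ite_false by apply suc_neq_empty.
  - congruence.
Qed.

Hypothesis AC : zchoice W.

(** Choice fixes injections into ω for all members at once; a member and a number then address at
    most one element of the union. *)
Lemma Ctbl_Un F : W F -> Ctbl W F -> (forall y, y ∈ F -> Ctbl W y) -> Ctbl W (Un F).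
Proof.
  intros WF HF HC. pose proof X as XX.
  set (R := fun y f => isfun f y omega /\ forall x, W x -> forall x', W x' -> forall n, W n -> opr x n ∈ f -> opr x' n ∈ f -> x = x').
  destruct (@choice_function W Z AC R F) as (c & Wc & Fc & Hc); auto.
  - unfold R. ds.
  - intros y Hy. destruct (HC y Hy) as (f & Wf & Ff & K). exists f. split; auto. split; auto. intros; eauto.
  - apply (@Ctbl_cover (fun p z => z ∈ fst_ p /\ opr z (snd_ p) ∈ ap c (fst_ p)) (Un F) (prod F omega)).
    + now apply Z.
    + apply W_prod; auto. apply Z.
    + apply Ctbl_prod; auto; [apply Z|apply Ctbl_omega].
    + ds.
    + intros z Hz. apply mem_Un in Hz. destruct Hz as (y & Hy & Hz). destruct (Hc y Hy) as [Ff _].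
      apply isfun_func in Ff. destruct Ff as [Ff R']. destruct (proj2 Ff z Hz) as (n & Hn & _).
      exists (opr y n). rewrite opr_in_prod, fst_opr, snd_opr. split; eauto.
    + intros p z z' Hp _ _ [Hz K] [Hz' K']. apply mem_prod in Hp. destruct Hp as (y & n & Hy & Hn & ->).
      rewrite fst_opr, snd_opr in *. assert (Wy := W_mem Z WF Hy). destruct (Hc y Hy) as [_ Q].
      apply (Q z (W_mem Z Wy Hz) z' (W_mem Z Wy Hz') n); auto. exact (W_mem Z (zf_omega Z) Hn).
Qed.

Lemma Ctbl_union2 x y : W x -> W y -> Ctbl W x -> Ctbl W y -> Ctbl W (union2 x y).
Proof.
  intros. apply Ctbl_Un; [now apply W_upair|now apply Ctbl_upair|].
  intros z Hz. apply mem_upair in Hz. destruct Hz as [-> | ->]; auto.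
Qed.

(** Skolem functions take one argument here, so several arguments are packed into pairs and the
    ambient set has to be closed under pairing. *)
Lemma pair_closure x : W x -> exists B, W B /\ subset x B /\ forall u v, u ∈ B -> v ∈ B -> opr u v ∈ B.
Proof.
  intro Wx. pose proof X as XX. set (s := orec x (fun _ v => union2 v (prod v v))).
  assert (Ts : TD W W (fun e => s (e 0))) by (apply (TD_orec Z XX); [auto|ds]).
  assert (Mono : forall m n, m <= n -> subset (s (num m)) (s (num n))).
  { intros m n H. induction H; intros z Hz; auto. cbn [num]. unfold s. rewrite orec_suc by apply num_in_omega.
    apply mem_union2. left. now apply IHle. }
  exists (Un (img omega s)). split; [apply Z, W_img_TD; auto; apply Z|]. split.
  - intros z Hz. apply mem_Un. exists x. split; auto. apply mem_img. exists zempty.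
    split; [apply (num_in_omega 0)|]. symmetry. apply orec_zero.
  - intros u v Hu Hv. apply mem_Un in Hu, Hv. destruct Hu as (a & Ha & Hu), Hv as (b & Hb & Hv).
    apply mem_img in Ha, Hb. destruct Ha as (m & Hm & ->), Hb as (n & Hn & ->).
    apply mem_omega in Hm, Hn. destruct Hm as [i ->], Hn as [j ->].
    apply mem_Un. exists (s (num (S (Nat.max i j)))). split; [apply mem_img; exists (num (S (Nat.max i j))); split; auto; apply num_in_omega|].
    cbn [num]. unfold s. rewrite orec_suc by apply num_in_omega. fold s. apply mem_union2. right. apply opr_in_prod.
    split; [apply (Mono i)|apply (Mono j)]; auto; lia.
Qed.

(** * Countable closed sets with stationary trace *)

Section Closure.
Variables B h X0 : zset.
Variable F : zset -> zset.
Hypothesis WB : W B.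
Hypothesis Wh : W h.
Hypothesis WX0 : W X0.
Hypothesis HF : TD W W (fun e => F (e 0)).
Hypothesis BF : forall x, x ∈ B -> F x ∈ B.
Hypothesis Bpair : forall x y, x ∈ B -> y ∈ B -> opr x y ∈ B.
Hypothesis hB : subset h B.
Hypothesis X0B : subset X0 B.
Hypothesis CX0 : Ctbl W X0.

Let closed K := (forall x, x ∈ K -> F x ∈ K) /\ forall x, x ∈ K -> forall y, y ∈ K -> opr x y ∈ K.
(** Taken as an intersection of closed sets, for easy definability and leastness; generation in ω
    stages is used for countability. *)
Let cl Y := sep B (fun z => forall K, W K -> subset K B -> subset Y K -> closed K -> z ∈ K).

Let D_closed t : TD W W t -> D W W (fun e => closed (t e)).
Proof.
  intro H. pose proof X as XX. apply (D_rel1 XX closed); auto. unfold closed. ds.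
Qed.

Let D_cl z Y : TD W W z -> TD W W Y -> D W W (fun e => z e ∈ cl (Y e)).
Proof.
  intros H K. pose proof X as XX. apply (D_rel2 XX (fun z Y => z ∈ cl Y)); auto. unfold cl.
  apply (D_ext XX) with (Psi := fun e => e 0 ∈ B /\ forall K, W K -> subset K B -> subset (e 1) K -> closed K -> e 0 ∈ K).
  - intros. apply mem_sep.
  - ds. apply D_closed. ds.
Qed.

Let W_cl Y : W Y -> W (cl Y).
Proof.
  intro WY. pose proof X as XX. unfold cl. apply (W_sep Z); auto. ds. apply D_closed. ds.
Qed.

Let TD_cl : TD W W (fun e => cl (e 0)).
Proof.
  pose proof X as XX. apply (TD_intro XX) with (Phi := fun z e => z ∈ cl (e 0)).
  - intros e He. apply W_cl, He.
  - tauto.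
  - apply D_cl; ds.
Qed.


Let cl_sup Y : subset Y B -> subset Y (cl Y).
Proof. intros H z Hz. apply mem_sep. split; auto. Qed.

Let cl_closed Y : closed (cl Y).
Proof.
  split.
  - intros x Hx. apply mem_sep in Hx. destruct Hx as [Hx K]. apply mem_sep. split; auto.
    intros L WL HL HY CL. apply CL. now apply K.
  - intros x Hx y Hy. apply mem_sep in Hx, Hy. destruct Hx as [Hx K], Hy as [Hy K']. apply mem_sep. split; auto.
    intros L WL HL HY CL. apply CL; [now apply K|now apply K'].
Qed.

Let cl_least Y K : W K -> subset K B -> subset Y K -> closed K -> subset (cl Y) K.
Proof. intros WK HK HY CK z Hz. apply mem_sep in Hz. now apply Hz. Qed.

Let cl_sub Y : subset (cl Y) B.
Proof. intros z Hz. now apply mem_sep in Hz. Qed.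

Let cl_Ctbl Y : W Y -> subset Y B -> Ctbl W Y -> Ctbl W (cl Y).
Proof.
  intros WY HY CY. pose proof X as XX.
  set (st := fun v => union2 v (union2 (img v F) (prod v v))). set (s := orec Y (fun _ v => st v)).
  assert (Timg : TD W W (fun e => img (e 0) F)).
  { apply (TD_intro XX) with (Phi := fun z e => exists x, x ∈ e 0 /\ z = F x).
    - intros e He. now apply W_img_TD.
    - intros. apply mem_img.
    - ds. }
  assert (Ts : TD W W (fun e => s (e 0))).
  { apply (TD_orec Z XX); auto. unfold st. ds. apply (TD_ap1 XX (fun v => img v F) Timg); ds. }
  assert (Hs : forall n, W (s (num n)) /\ subset (s (num n)) B /\ Ctbl W (s (num n))).
  { induction n as [|n (IH1 & IH2 & IH3)].
    - cbn [num]. unfold s. rewrite orec_zero. auto.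
    - cbn [num]. unfold s. rewrite orec_suc by apply num_in_omega. fold s. unfold st.
      assert (W (img (s (num n)) F)) by now apply W_img_TD.
      assert (W (prod (s (num n)) (s (num n)))) by now apply W_prod.
      split; [now repeat apply W_union2|]. split.
      + intros z Hz. rewrite !mem_union2, mem_img, mem_prod in Hz.
        destruct Hz as [Hz|[(x & Hx & ->)|(x & y & Hx & Hy & ->)]]; auto.
      + apply Ctbl_union2; auto; [now apply W_union2|]. apply Ctbl_union2; auto; [now apply Ctbl_img|now apply Ctbl_prod]. }
  assert (Mono : forall m n, m <= n -> subset (s (num m)) (s (num n))).
  { intros m n H. induction H; intros z Hz; auto. cbn [num]. unfold s. rewrite orec_suc by apply num_in_omega.
    apply mem_union2. left. now apply IHle. }
  assert (Wi : W (img omega s)) by (apply W_img_TD; auto; apply Z).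
  assert (mU : forall z, z ∈ Un (img omega s) <-> exists n, z ∈ s (num n)).
  { intro z. rewrite mem_Un. split.
    - intros (y & Hy & Hz). apply mem_img in Hy. destruct Hy as (n & Hn & ->). apply mem_omega in Hn. destruct Hn as [i ->]. eauto.
    - intros [n Hn]. exists (s (num n)). split; auto. apply mem_img. exists (num n). split; auto. apply num_in_omega. }
  apply (@Ctbl_sub (cl Y) (Un (img omega s))); [now apply W_cl| |].
  - apply cl_least.
    + now apply Z.
    + intros z Hz. apply mU in Hz. destruct Hz as [n Hn]. now apply (Hs n).
    + intros z Hz. apply mU. exists 0. cbn [num]. unfold s. now rewrite orec_zero.
    + split.
      * intros x Hx. apply mU in Hx. destruct Hx as [n Hn]. apply mU. exists (S n). cbn [num]. unfold s.
        rewrite orec_suc by apply num_in_omega. fold s. unfold st. rewrite !mem_union2, mem_img. eauto.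
      * intros x Hx y Hy. apply mU in Hx, Hy. destruct Hx as [i Hi], Hy as [j Hj]. apply mU.
        exists (S (Nat.max i j)). cbn [num]. unfold s. rewrite orec_suc by apply num_in_omega. fold s. unfold st.
        rewrite !mem_union2, opr_in_prod. right. right. split; [apply (Mono i)|apply (Mono j)]; auto; lia.
  - apply Ctbl_Un; auto.
    + apply Ctbl_img; auto; [apply Z|apply Ctbl_omega].
    + intros y Hy. apply mem_img in Hy. destruct Hy as (n & Hn & ->). apply mem_omega in Hn. destruct Hn as [i ->]. apply Hs.
Qed.

(** Stationarity concerns subsets of [h], whereas closure is wanted in the larger set [B]. The
    countable [Y] that contain the part of [cl (union2 Y X0)] inside [h] form a club, and any such
    [Y] is the trace on [h] of the closed set [cl (union2 Y X0)]. *)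
Lemma closure_stationary (Q : zset -> Prop) :
  (forall E, W E -> Club W E h -> exists M, M ∈ E /\ Q M) ->
  exists M, W M /\ subset M B /\ Ctbl W M /\ subset X0 M /\
    (forall x, x ∈ M -> F x ∈ M) /\ (forall x, x ∈ M -> forall y, y ∈ M -> opr x y ∈ M) /\
    Q (sep M (fun x => x ∈ h)).
Proof.
  intro St. pose proof X as XX.
  set (E := sep (sep (pow h) W) (fun Y => Ctbl W Y /\ forall z, z ∈ h -> z ∈ cl (union2 Y X0) -> z ∈ Y)).
  assert (mE : forall Y, Y ∈ E <-> W Y /\ subset Y h /\ Ctbl W Y /\ forall z, z ∈ h -> z ∈ cl (union2 Y X0) -> z ∈ Y).
  { intro Y. unfold E. rewrite !mem_sep, mem_pow. tauto. }
  assert (WE : W E).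
  { apply (W_sep Z); [|now apply Z]. ds. apply (TD_ap1 XX cl TD_cl); ds. }
  assert (SB : forall Y, subset Y h -> subset (union2 Y X0) B).
  { intros Y H z Hz. apply mem_union2 in Hz. destruct Hz; auto. }
  assert (CE : Club W E h).
  { split; [|split].
    - intros c Hc. apply mE in Hc. tauto.
    - intros Y WY HY CY. set (Y1 := sep (cl (union2 Y X0)) (fun z => z ∈ h)).
      assert (W2 : W (union2 Y X0)) by now apply W_union2.
      assert (WY1 : W Y1) by (apply (W_sep Z); [ds|now apply W_cl]).
      exists Y1. split.
      + apply mE. split; auto. split; [intros z Hz; now apply mem_sep in Hz|]. split.
        * apply (@Ctbl_sub Y1 (cl (union2 Y X0))); auto; [intros z Hz; now apply mem_sep in Hz|].
          apply cl_Ctbl; auto. now apply Ctbl_union2.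
        * intros z Hz K. apply mem_sep. split; auto. revert z K Hz. 
          assert (L : subset (cl (union2 Y1 X0)) (cl (union2 Y X0))).
          { apply cl_least; auto. intros z Hz. apply mem_union2 in Hz. destruct Hz as [Hz|Hz]; [now apply mem_sep in Hz|].
            apply cl_sup; auto. apply mem_union2. auto. }
          auto.
      + intros z Hz. apply mem_sep. split; auto. apply cl_sup; auto. apply mem_union2. auto.
    - intros G WG HG CG [d Hd] Ch. apply mE. split; [now apply Z|]. split; [|split].
      + intros z Hz. apply mem_Un in Hz. destruct Hz as (y & Hy & Hz). apply HG, mE in Hy. now apply Hy.
      + apply Ctbl_Un; auto. intros y Hy. apply HG, mE in Hy. tauto.
      (* Along a chain the closures form a directed union, which is itself closed and so contains
         the closure of the union. *)
      + set (K := sep B (fun z => exists Y, Y ∈ G /\ z ∈ cl (union2 Y X0))).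
        assert (mK : forall z, z ∈ K <-> exists Y, Y ∈ G /\ z ∈ cl (union2 Y X0)).
        { intro z. unfold K. rewrite mem_sep. split; [tauto|]. intros (Y & HY & Hz). split; eauto. now apply cl_sub in Hz. }
        assert (MonoK : forall Y Y', subset Y Y' -> Y' ∈ G -> subset (cl (union2 Y X0)) (cl (union2 Y' X0))).
        { intros Y Y' L HY'. pose proof HY' as H'. apply HG, mE in H'. destruct H' as (WY' & SY' & _).
          apply cl_least; auto; [apply W_cl; now apply W_union2|]. intros z Hz. apply cl_sup; auto.
          rewrite mem_union2 in *. destruct Hz; auto. }
        assert (Two : forall x y, x ∈ K -> y ∈ K -> exists Y, Y ∈ G /\ x ∈ cl (union2 Y X0) /\ y ∈ cl (union2 Y X0)).
        { intros x y Hx Hy. apply mK in Hx, Hy. destruct Hx as (Y & HY & Hx), Hy as (Y' & HY' & Hy).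
          destruct (Ch Y HY Y' HY') as [L|L]; [exists Y'|exists Y]; split; auto; split; auto.
          - now apply (MonoK Y Y').
          - now apply (MonoK Y' Y). }
        assert (L : subset (cl (union2 (Un G) X0)) K).
        { apply cl_least.
          - apply (W_sep Z); auto. ds. apply (TD_ap1 XX cl TD_cl); ds.
          - intros z Hz. now apply mem_sep in Hz.
          - intros z Hz. apply mK. apply mem_union2 in Hz. destruct Hz as [Hz|Hz].
            + apply mem_Un in Hz. destruct Hz as (y & Hy & Hz). exists y. split; auto. pose proof Hy as Hy'.
              apply HG, mE in Hy'. apply cl_sup; [apply SB; tauto|]. apply mem_union2. auto.
            + exists d. split; auto. apply HG, mE in Hd. apply cl_sup; [apply SB; tauto|]. apply mem_union2. auto.
          - split.
            + intros x Hx. apply mK in Hx. destruct Hx as (Y & HY & Hx). apply mK. exists Y. split; auto. now apply cl_closed.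
            + intros x Hx y Hy. destruct (Two x y Hx Hy) as (Y & HY & Hx' & Hy'). apply mK. exists Y. split; auto.
              now apply cl_closed. }
        intros z Hz Hc. apply L, mK in Hc. destruct Hc as (Y & HY & Hc). apply mem_Un. exists Y. split; auto.
        apply HG, mE in HY. now apply HY. }
  destruct (St E WE CE) as (Y & HY & HQ). apply mE in HY. destruct HY as (WY & SY & CY & KY).
  assert (W2 : W (union2 Y X0)) by now apply W_union2.
  exists (cl (union2 Y X0)). split; [now apply W_cl|]. split; [apply cl_sub|].
  split; [apply cl_Ctbl; auto; now apply Ctbl_union2|]. split; [|split; [|split]].
  - intros z Hz. apply cl_sup; auto. apply mem_union2. auto.
  - apply cl_closed.
  - apply cl_closed.
  - replace (sep _ _) with Y; auto. apply zset_ext. intro z. rewrite mem_sep. split.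
    + intro Hz. split; auto. apply cl_sup; auto. apply mem_union2. auto.
    + intros [Hz Hh]. auto.
Qed.
End Closure.

(** Choice turns [R] into a single Skolem function on [B]. Several closure requirements are combined
    into one [R] by tagging the arguments with numerals. *)
Lemma skolem_stationary B h X0 (R : zset -> zset -> Prop) (Q : zset -> Prop) :
  W B -> W h -> W X0 -> (forall x y, x ∈ B -> y ∈ B -> opr x y ∈ B) -> subset h B -> subset X0 B -> Ctbl W X0 ->
  D W W (fun e => R (e 0) (e 1)) ->
  (forall E, W E -> Club W E h -> exists M, M ∈ E /\ Q M) ->
  exists M, W M /\ subset M B /\ Ctbl W M /\ subset X0 M /\
    (forall x, x ∈ M -> forall y, y ∈ M -> opr x y ∈ M) /\
    (forall x, x ∈ M -> (exists y, y ∈ B /\ R x y) -> exists y, y ∈ M /\ R x y) /\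
    Q (sep M (fun x => x ∈ h)).
Proof.
  intros WB Wh WX0 BP hB XB CX HR St. pose proof X as XX.
  destruct (@choice_function W Z AC (fun x y => y ∈ B /\ ((exists z, z ∈ B /\ R x z) -> R x y)) B) as (f & Wf & Ff & Hf); auto.
  { ds; try (apply (D_rel2 XX R HR); ds). }
  { intros x Hx. destruct (classic (exists z, z ∈ B /\ R x z)) as [(z & Hz & K)|N].
    - exists z. split; [exact (W_mem Z WB Hz)|]. auto.
    - exists x. split; [exact (W_mem Z WB Hx)|]. split; auto. tauto. }
  destruct (@closure_stationary B h X0 (ap f)) with (Q := Q) as (M & WM & MB & CM & XM & MF & MP & QM); auto.
  { ds. }
  { intros x Hx. now apply Hf. }
  exists M. split; auto. split; auto. split; auto. split; auto. split; auto. split; auto.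
  intros x Hx K. exists (ap f x). split; auto. apply Hf; auto.
Qed.
End Countable.

(** * The quotient forcing *)

Definition isglb (P le w x y : zset) : Prop :=
  w ∈ P /\ opr w x ∈ le /\ opr w y ∈ le /\ forall u, u ∈ P -> opr u x ∈ le -> opr u y ∈ le -> opr u w ∈ le.

(** The hypotheses in a form that the collapse of an elementary submodel inherits. Elementarity of
    [N] is present as [su_Nglb]. *)
Record setup (V : class) (P le N q : zset) : Prop := {
  su_zf : zf V;
  su_ac : zchoice V;
  su_P : V P; su_le : V le; su_N : V N;
  su_dom : forall x y, opr x y ∈ le -> x ∈ P /\ y ∈ P;
  su_refl : forall x, x ∈ P -> opr x x ∈ le;
  su_trans : forall x y z, opr x y ∈ le -> opr y z ∈ le -> opr x z ∈ le;
  su_glb : forall x y, Cmp P le x y -> exists w, isglb P le w x y;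
  su_star : forall x y z, Cmp P le x y -> Cmp P le x z -> Cmp P le y z ->
    forall w, isglb P le w y z -> Cmp P le x w;
  su_Nglb : forall x y, x ∈ N -> y ∈ N -> Cmp P le x y -> exists w, w ∈ N /\ isglb P le w x y;
  su_usg : USG V N P le q;
  su_st : HasUSG V P le }.

Section Quotient.
Variable V : class.
Variables P le N q : zset.
Hypothesis SU : setup V P le N q.

Let Z := su_zf SU.
Notation "p ⪯ r" := (opr p r ∈ le) (at level 70).
Notation "p ∥ r" := (Cmp P le p r) (at level 70).

Lemma le_tr x y z : x ⪯ y -> y ⪯ z -> x ⪯ z.
Proof. apply (su_trans SU). Qed.
Local Ltac lec := solve [eauto 4 using le_tr | eauto 7 using le_tr].

Definition below_set := sep P (fun x => x ∈ N).
Let a := below_set.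

Lemma mem_a x : x ∈ a <-> x ∈ N /\ x ∈ P.
Proof. unfold a, below_set. rewrite mem_sep. tauto. Qed.

Lemma W_a : V a.
Proof.
  pose proof (zf_ctx Z). pose proof (su_N SU). apply (W_sep Z); [dsolve|apply SU].
Qed.

Lemma a_preorder : preorder a le.
Proof.
  split.
  - intros p Hp. apply mem_a in Hp. now apply (su_refl SU).
  - intros p r s _ _ _. apply (su_trans SU).
Qed.

Lemma Vq : V q.
Proof. destruct (su_usg SU) as [[H _] _]. exact (W_mem Z (su_P SU) H). Qed.
Lemma Pq : q ∈ P.
Proof. apply (su_usg SU). Qed.

Lemma Cmp_sym x y : x ∥ y -> y ∥ x.
Proof. intros (z & ? & ? & ?). exists z. auto. Qed.
Lemma Cmp_up x y x' y' : x ∥ y -> x ⪯ x' -> y ⪯ y' -> x' ∥ y'.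
Proof.
  intros (z & Hz & H1 & H2) L1 L2. exists z. split; auto. split; lec.
Qed.
Lemma Cmp_up_r x y y' : x ∥ y -> y ⪯ y' -> x ∥ y'.
Proof. intros (z & Hz & H1 & H2) L. exists z. split; auto. split; auto. lec. Qed.
Lemma star3 x y z : x ∥ y -> x ∥ z -> y ∥ z -> exists u, u ⪯ x /\ u ⪯ y /\ u ⪯ z.
Proof.
  intros H1 H2 H3. destruct (su_glb SU H3) as (w & Hw). destruct (su_star SU H1 H2 H3 Hw) as (u & _ & L1 & L2).
  destruct Hw as (_ & K1 & K2 & _). exists u. split; auto. split; lec.
Qed.

Lemma a_glb x y : x ∈ a -> y ∈ a -> x ∥ y -> exists w, w ∈ a /\ w ⪯ x /\ w ⪯ y.
Proof.
  rewrite !mem_a. intros [Nx Px] [Ny Py] H. destruct (su_Nglb SU Nx Ny H) as (w & Nw & Pw & L1 & L2 & _).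
  exists w. rewrite mem_a. auto.
Qed.

Definition res (M u r : zset) : Prop := u ∈ M /\ u ∈ P /\ forall t, t ∈ M -> t ∈ P -> t ⪯ u -> t ∥ r.

Lemma res_le M u r t : res M u r -> t ∈ M -> t ⪯ u -> res M t r.
Proof.
  intros (Mu & Pu & H) Mt L. split; auto. split; [apply (su_dom SU L)|]. intros s Ms Ps Ls. apply H; auto.
  lec.
Qed.
Lemma res_up M u r r' : res M u r -> r ⪯ r' -> res M u r'.
Proof. intros (Mu & Pu & H) L. split; auto. split; auto. intros. eapply Cmp_up_r; eauto. Qed.
Lemma res_Cmp M u r : res M u r -> u ∥ r.
Proof. intros (Mu & Pu & H). apply H; auto. now apply (su_refl SU). Qed.

(** Otherwise the conditions in [M] incompatible with [r] are dense in [M], and strong genericity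
    makes one of them compatible with [r]. *)
Lemma residue M p r : V M -> SG V M P le p -> r ⪯ p -> exists u, res M u r.
Proof.
  intros VM [Pp H] L. apply NNPP. intro N0. pose proof (zf_ctx Z) as X. destruct (su_dom SU L) as [Pr _].
  assert (Vr := W_mem Z (su_P SU) Pr). pose proof (su_P SU) as VP. pose proof (su_le SU) as Vle.
  set (F := sep P (fun t => t ∈ M /\ ~ t ∥ r)).
  destruct (H F) with (r := r) as (d & Hd & K); auto.
  - apply (W_sep Z); auto. ds.
  - intros d Hd. apply mem_sep in Hd. tauto.
  - intros u Pu Mu. apply NNPP. intro N1. apply N0. exists u. split; auto. split; auto.
    intros t Mt Pt Lt. apply NNPP. intro N2. apply N1. exists t. split; auto. apply mem_sep. auto.
  - apply mem_sep in Hd. destruct Hd as (_ & _ & Hd). apply Hd, Cmp_sym, K.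
Qed.

Lemma residueN r : r ⪯ q -> exists u, u ∈ a /\ res N u r.
Proof.
  intro L. destruct (@residue N q r (su_N SU) (proj1 (su_usg SU)) L) as (u & Hu). exists u. split; auto.
  apply mem_a. destruct Hu. tauto.
Qed.

Lemma residueN_below r s : r ⪯ q -> s ∈ a -> r ⪯ s -> exists u, u ∈ a /\ u ⪯ s /\ res N u r.
Proof.
  intros L As Ls. destruct (residueN L) as (u & Au & Hu).
  destruct (@a_glb u s) as (w & Aw & L1 & L2); auto.
  - eapply Cmp_up_r; [exact (res_Cmp Hu)|auto].
  - exists w. split; auto. split; auto. eapply res_le; eauto. now apply mem_a in Aw.
Qed.

(** A residue of an extension of [r] is a residue of [r], so it can be sought below any compatible
    [s]. *)
Lemma residueN_meet r s : r ⪯ q -> s ∈ a -> s ∥ r -> exists u, u ∈ a /\ u ⪯ s /\ res N u r.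
Proof.
  intros L As (r' & Pr' & L1 & L2). destruct (@residueN_below r' s) as (u & Au & Lu & Hu); auto.
  - lec.
  - exists u. split; auto. split; auto. eapply res_up; eauto.
Qed.

(** * Conditions of the quotient and their residues in G *)

Variable G : class.
Hypothesis HG : generic V (fun p => p ∈ a) le G.
Let g := sep a G.

Let Vle : V le := su_le SU.
Let Va : V a := W_a.

Lemma g_a p : p ∈ g -> p ∈ a.
Proof. intro H. now apply mem_sep in H. Qed.
Lemma g_dir' p r : p ∈ g -> r ∈ g -> exists s, s ∈ g /\ s ⪯ p /\ s ⪯ r.
Proof. apply (g_dir HG). Qed.
Definition quot := sep P (fun r => r ⪯ q /\ forall s, s ∈ g -> r ∥ s).

Lemma mem_quot r : r ∈ quot <-> r ⪯ q /\ forall s, s ∈ g -> r ∥ s.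
Proof. unfold quot. rewrite mem_sep. split; [tauto|]. intros [H K]. split; auto. apply (su_dom SU H). Qed.

(** With [quot_residue] this gives the working criterion: a condition below [q] is in the quotient
    exactly when G contains a residue of it. Any [t] in G has with [s] a common extension in G,
    which the residue makes compatible with [r]. *)
Lemma quot_intro r s : r ⪯ q -> s ∈ g -> res N s r -> r ∈ quot.
Proof.
  intros L Hs Hr. apply mem_quot. split; auto. intros t Ht. destruct (g_dir' Hs Ht) as (u & Hu & L1 & L2).
  apply Cmp_sym. apply Cmp_up with (x := u) (y := r); auto.
  - destruct (proj1 (mem_a u) (g_a Hu)). apply (proj2 (proj2 Hr)); auto.
  - apply (su_refl SU). apply (su_dom SU L).
Qed.

Lemma D_res C (X : dctx V C) t u : C P -> C le -> C N -> TD V C t -> TD V C u -> D V C (fun e => res N (t e) (u e)).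
Proof. intros. pose proof Z as Z'. apply (D_rel2 X (fun t u => res N t u)); auto. unfold res. ds. Qed.

(** If G contained no residue, some [s] in G would have none below it; but [s] is compatible with
    [r], so [residueN_meet] finds one. *)
Lemma quot_residue r : r ∈ quot -> exists s, s ∈ g /\ res N s r.
Proof.
  intro H. apply mem_quot in H. destruct H as [L H]. pose proof (zf_ctx Z) as X.
  destruct (su_dom SU L) as [Pr _]. assert (Vr := W_mem Z (su_P SU) Pr).
  destruct (decide_ext Z Va Vle a_preorder HG (fun s => res N s r)) as [K|(s & Hs & K)]; auto.
  - apply D_res; auto; try apply SU; ds.
  - exfalso. destruct (@residueN_meet r s) as (u & Au & Lu & Hu); auto.
    + now apply g_a.
    + now apply Cmp_sym, H.
    + exact (K u Au Lu Hu).
Qed.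

Lemma quot_residue_below r s : r ∈ quot -> s ∈ g -> exists t, t ∈ g /\ t ⪯ s /\ res N t r.
Proof.
  intros H Hs. destruct (quot_residue H) as (u & Hu & K). destruct (g_dir' Hs Hu) as (t & Ht & L1 & L2).
  exists t. split; auto. split; auto. eapply res_le; eauto. now apply mem_a, g_a.
Qed.

Lemma truth_chk x s : V x -> V s -> (x ∈ vl g s <-> exists p, p ∈ g /\ fmem a le p (chk a x) s).
Proof.
  intros Vx Vs. assert (Vc : V (chk a x)) by now apply (W_chk Z).
  pose proof (@truth_mem_ext V Z a le Va Vle a_preorder G HG (chk a x) s Vc Vs) as E. fold g in E. rewrite <- E.
  rewrite vl_chk; [reflexivity| |].
  - exact (g_inh HG).
  - exact g_a.
Qed.

(* [w = pM ∧ q] will be universal strongly generic for [M] in the quotient. *)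
Section Strong.
Variables M pM w : zset.
Hypothesis VM : V M.
Hypothesis HM : USG V M P le pM.
Hypothesis qM : q ∈ M.
Hypothesis Mglb : forall x y, x ∈ M -> y ∈ M -> x ∥ y -> exists z, z ∈ M /\ isglb P le z x y.
Hypothesis Hw : isglb P le w pM q.
Hypothesis wQ : w ∈ quot.

(** [q] lies in [M], so a residue can be met with [q] inside [M]. *)
Lemma residueM r : r ⪯ w -> exists u, res M u r /\ u ⪯ q.
Proof.
  intro L. assert (Lp : r ⪯ pM) by (eapply (su_trans SU); [exact L|apply Hw]).
  assert (Lq : r ⪯ q) by (eapply (su_trans SU); [exact L|apply Hw]).
  destruct (residue VM (proj1 HM) Lp) as (u & Hu).
  destruct (@Mglb u q) as (v & Mv & Pv & L1 & L2 & _); auto; [apply Hu| |].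
  - eapply Cmp_up_r; [exact (res_Cmp Hu)|auto].
  - exists v. split; auto. eapply res_le; eauto.
Qed.

(** Some [s] in G is a residue of both [w] and [r]; by [su_star] each extension of [s] in [N] is
    compatible with the meet of [w] and [r], which is therefore in the quotient. The meet exists
    because [pM] is universal and a common extension of [pM] and [r] is below [q], hence below
    [w]. *)
Lemma strong_universal r : r ∈ M -> r ∈ quot -> Cmp quot le w r.
Proof.
  intros Mr Qr. pose proof Qr as Qr'. apply mem_quot in Qr'. destruct Qr' as [Lr _].
  destruct (quot_residue wQ) as (s1 & Hs1 & R1). destruct (quot_residue_below Qr Hs1) as (s & Hs & Ls & R2).
  assert (Ns : s ∈ N /\ s ∈ P) by now apply mem_a, g_a.
  assert (R1' : res N s w) by (eapply res_le; [exact R1|tauto|auto]).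
  assert (K : pM ∥ r) by (apply HM; auto; apply (su_dom SU Lr)).
  assert (wr : w ∥ r).
  { destruct K as (z & Pz & L1 & L2). exists z. split; auto. split; auto. apply Hw; auto. lec. }
  destruct (su_glb SU wr) as (v & Hv). exists v. split; [|split; apply Hv].
  apply (@quot_intro v s); auto.
  - destruct Hv as (_ & _ & Lv & _). lec.
  - split; [tauto|]. split; [tauto|]. intros t Nt Pt Lt.
    apply (su_star SU (x := t) (y := w) (z := r)); auto; [apply R1'|apply R2]; auto.
Qed.

(** Density of [F] is a fact about V[G]; it is reflected to a condition of G that excludes its
    failure [E1]. If the conclusion were false, another condition of G would exclude its success
    [E2]. Below both, residues for [M] and for [N] of extensions of [r] are combined and [star3]
    produces a condition satisfying [E2]. *)
Lemma strong_generic D0 : V D0 -> forall F, F = vl g D0 ->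
  (forall d, d ∈ F -> d ∈ M /\ d ∈ quot) ->
  (forall p, p ∈ quot -> p ∈ M -> exists d, d ∈ F /\ d ⪯ p) ->
  forall r, r ∈ quot -> r ⪯ w -> exists d, d ∈ F /\ Cmp quot le r d.
Proof.
  intros VD F EF HF1 HF2 r Qr Lr. apply NNPP. intro NO. pose proof (zf_ctx Z) as X.
  pose proof (su_P SU) as VP. pose proof (su_N SU) as VN. pose proof Vq as Vq'.
  destruct (su_dom SU Lr) as [Pr _]. assert (Vr := W_mem Z VP Pr).
  pose proof Vle as Vle'. pose proof Va as Va'.
  (* [t] is a residue of some [u] in [M] below [q], yet no extension of [t] both forces some [d] of
     [M] below [u] into the dense set and is a residue of [d]. *)
  set (E1 := fun t => exists u, u ∈ P /\ u ∈ M /\ u ⪯ q /\ res N t u /\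
    ~ exists d, d ∈ P /\ d ∈ M /\ d ⪯ u /\ exists t', t' ∈ a /\ t' ⪯ t /\ fmem a le t' (chk a d) D0 /\ res N t' d).
  (* [t] forces some [d] of [M] into the dense set and is a residue of a common extension of [d] and
     [r]. *)
  set (E2 := fun t => exists v, v ∈ P /\ v ⪯ q /\ v ⪯ r /\ exists d, d ∈ M /\ v ⪯ d /\ res N t v /\ fmem a le t (chk a d) D0).
  destruct (decide_ext Z Va Vle a_preorder HG E1) as [(t & Ht & u & Pu & Mu & Lu & Ru & K)|(s1 & Hs1 & K1)].
  { unfold E1, res. ds. }
  { apply K. fold g in Ht. destruct (HF2 u) as (d & Hd & Ld); auto.
    { apply (quot_intro Lu Ht Ru). }
    destruct (HF1 d Hd) as [Md Qd]. destruct (su_dom SU Ld) as [Pd _]. assert (Vd := W_mem Z VP Pd).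
    exists d. split; auto. split; auto. split; auto.
    rewrite EF in Hd. apply truth_chk in Hd; auto. destruct Hd as (p & Hp & Kp).
    destruct (g_dir' Ht Hp) as (t1 & Ht1 & L1 & L2). destruct (quot_residue_below Qd Ht1) as (t2 & Ht2 & L3 & R2).
    exists t2. split; [now apply g_a|]. split; [lec|]. split; auto.
    apply fmem_mono with (p := p); auto; [apply a_preorder|now apply g_a|lec]. }
  fold g in Hs1.
  destruct (decide_ext Z Va Vle a_preorder HG E2) as [(t & Ht & v & Pv & Lvq & Lvr & d & Md & Lvd & Rv & K)|(s2 & Hs2 & K2)].
  { unfold E2, res. ds. }
  { apply NO. fold g in Ht. exists d. destruct (su_dom SU Lvd) as [_ Pd]. assert (Vd := W_mem Z VP Pd). split.
    - rewrite EF. apply truth_chk; eauto.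
    - exists v. split; auto. apply (quot_intro Lvq Ht Rv). }
  fold g in Hs2. destruct (g_dir' Hs1 Hs2) as (s & Hs & Ls1 & Ls2).
  assert (As := g_a Hs). pose proof Qr as Qr'. apply mem_quot in Qr'. destruct Qr' as [Lrq Cr].
  destruct (Cr s Hs) as (r1 & Pr1 & L1 & L2).
  (* [u] is a residue of [r1] for [M]. Passing to [r2] below [r1] and [u] before taking the residue
     [s0] for [N] makes [s0] a residue of both [u] and [r1]. *)
  destruct (@residueM r1) as (u & Ru & Luq); [lec|].
  destruct (Cmp_sym (res_Cmp Ru)) as (r2 & Pr2 & L3 & L4).
  destruct (@residueN_below r2 s) as (s0 & As0 & Ls0 & R0); auto.
  { lec. }
  { lec. }
  assert (H1 : exists d, d ∈ P /\ d ∈ M /\ d ⪯ u /\ exists t', t' ∈ a /\ t' ⪯ s0 /\ fmem a le t' (chk a d) D0 /\ res N t' d).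
  { apply NNPP. intro B. apply (K1 s0); auto; [lec|]. exists u.
    split; [apply Ru|]. split; [apply Ru|]. split; auto. split; auto. eapply res_up; eauto. }
  destruct H1 as (d & Pd & Md & Ldu & t' & At' & Lt' & Kt' & Rt').
  assert (Nt' : t' ∈ N /\ t' ∈ P) by now apply mem_a.
  (* The three pairs are compatible, in the order of the goals, because [t'] is a residue of [d] for
     [N], [s0] one of [r2] for [N], and [u] one of [r1] for [M]. *)
  destruct (@star3 t' d r1) as (v & Lv1 & Lv2 & Lv3).
  - exact (res_Cmp Rt').
  - apply Cmp_up_r with (y := r2); auto. apply (proj2 (proj2 R0)); tauto.
  - apply (proj2 (proj2 Ru)); auto.
  - assert (Lvq : v ⪯ q) by (eapply (su_trans SU); [exact Lv3|]; lec).
    destruct (@residueN_below v t') as (s3 & As3 & Ls3 & R3); auto.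
    apply (K2 s3); auto.
    + eapply (su_trans SU); [exact Ls3|]. eapply (su_trans SU); [exact Lt'|]. lec.
    + exists v. split; [apply (su_dom SU Lv3)|]. split; auto. split; [lec|].
      exists d. split; auto. split; auto. split; auto.
      apply fmem_mono with (p := t'); auto. apply a_preorder.
Qed.
End Strong.

Lemma USG_ext M M' p : (forall x, x ∈ P -> (x ∈ M <-> x ∈ M')) -> USG V M P le p -> USG V M' P le p.
Proof.
  intros E ((Pp & H) & K). split; [split; auto|].
  - intros F WF H1 H2 r Pr Lr. apply (H F); auto.
    + intros d Hd. destruct (H1 d Hd). split; auto. now apply E.
    + intros x Px Mx. apply H2; auto. now apply E.
  - intros x Px Mx. apply K; auto. now apply E.
Qed.

(** * Making M closed under a function of V[G] *)

Section Capture.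
Variables B h X0 τ : zset.
Hypothesis VB : V B.
Hypothesis Vh : V h.
Hypothesis VX0 : V X0.
Hypothesis Vτ : V τ.
Hypothesis Bpair : forall x y, x ∈ B -> y ∈ B -> opr x y ∈ B.
Hypothesis Ph : subset P h.
Hypothesis hB : subset h B.
Hypothesis XB : subset X0 B.
Hypothesis CX : Ctbl V X0.
Hypothesis omegaX : subset omega X0.
Hypothesis St : forall E, V E -> Club V E h -> exists M, M ∈ E /\ exists p, V p /\ USG V M P le p.
Let f := vl g τ.
Hypothesis Ff : func f B.
Hypothesis fB : forall x, x ∈ B -> ap f x ∈ B.

Let glbcl M := forall x, x ∈ M -> forall y, y ∈ M -> x ∥ y -> exists z, z ∈ M /\ isglb P le z x y.
Let paircl M := forall x, x ∈ M -> forall y, y ∈ M -> opr x y ∈ M.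
(** [b] is a condition of [N] below [t0], compatible with [t], that forces the value of the function
    at [x] to be [y]. [Sk] asks [M] to contain such [b] and [y] whenever there are any, for [t] and
    [x] from [M]. *)
Let Phi t0 t x b y := b ∈ a /\ t ∥ b /\ b ⪯ t0 /\ fmem a le b (chk a (opr x y)) τ.
Let Sk M t0 := forall t, t ∈ M -> forall x, x ∈ M -> (exists b, b ∈ B /\ exists y, y ∈ B /\ Phi t0 t x b y) ->
  exists b, b ∈ M /\ exists y, y ∈ M /\ Phi t0 t x b y.
(** A statement about V alone, so that its density in [N ∩ P] is proved in V and G contains an [s]
    satisfying it. *)
Let Good s0 s := exists M, V M /\ exists pM, pM ∈ P /\ exists w, w ∈ P /\ exists t0, t0 ∈ a /\
  subset M B /\ Ctbl V M /\ subset X0 M /\ paircl M /\ USG V M P le pM /\ q ∈ M /\ glbcl M /\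
  isglb P le w pM q /\ t0 ⪯ s0 /\ t0 ∈ M /\ s ⪯ t0 /\ res N s w /\ Sk M t0.

Let PB : subset P B.
Proof. intros x Hx. auto. Qed.

Lemma good_dense s0 t0 : t0 ∈ a -> t0 ⪯ s0 -> exists s, s ∈ a /\ s ⪯ t0 /\ Good s0 s.
Proof.
  intros At0 Lt0. pose proof (zf_ctx Z) as X. pose proof Z as Z'.
  pose proof (su_P SU) as VP. pose proof (su_N SU) as VN. pose proof Vq as Vq'. pose proof Vle as Vle'. pose proof Va as Va'.
  assert (Nt0 : t0 ∈ N /\ t0 ∈ P) by now apply mem_a. assert (Vt0 := W_mem Z VP (proj2 Nt0)).
  (* Tag 0 asks for greatest lower bounds, tag 1 for witnesses of [Phi] packed as a pair, and tags 2
     and 3 for the components of pairs. *)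
  set (R := fun x z => (exists u, u ∈ P /\ exists v, v ∈ P /\ x = opr (num 0) (opr u v) /\ isglb P le z u v) \/
    (exists t, t ∈ B /\ exists y, y ∈ B /\ x = opr (num 1) (opr t y) /\ exists b, b ∈ B /\ exists v, v ∈ B /\
       z = opr b v /\ Phi t0 t y b v) \/
    (exists u, u ∈ B /\ exists v, v ∈ B /\ x = opr (num 2) (opr u v) /\ z = u) \/
    (exists u, u ∈ B /\ exists v, v ∈ B /\ x = opr (num 3) (opr u v) /\ z = v)).
  destruct (@skolem_stationary V Z (su_ac SU) B h (union2 X0 (upair q t0)) R (fun M => exists p, V p /\ USG V M P le p))
    as (M & VM & MB & CM & XM & Mp & MS & (pM & VpM & HM)); auto.
  - apply W_union2; auto. now apply W_upair.
  - intros z Hz. apply mem_union2 in Hz. destruct Hz as [Hz|Hz]; auto. apply mem_upair in Hz.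
    destruct Hz as [-> | ->]; apply PB; [apply Pq|tauto].
  - apply Ctbl_union2; auto; [apply SU|now apply W_upair|now apply Ctbl_upair].
  - pose proof (W_num Z 0). pose proof (W_num Z 1). pose proof (W_num Z 2). pose proof (W_num Z 3).
    unfold R, isglb, Phi. ds.
  - assert (qM : q ∈ M) by (apply XM; rewrite mem_union2, mem_upair; auto).
    assert (tM : t0 ∈ M) by (apply XM; rewrite mem_union2, mem_upair; auto).
    assert (XM' : subset X0 M) by (intros z Hz; apply XM, mem_union2; auto).
    assert (nM : forall n, num n ∈ M) by (intro n; apply XM', omegaX, num_in_omega).
    assert (proj : forall u v, opr u v ∈ M -> u ∈ B -> v ∈ B -> u ∈ M /\ v ∈ M).
    { intros u v H Hu Hv. split.
      - destruct (MS (opr (num 2) (opr u v))) as (z & Hz & K).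
        + apply Mp; auto.
        + exists u. split; auto. right. right. left. exists u. split; auto. exists v. auto.
        + destruct K as [(u' & _ & v' & _ & E & _)|[(u' & _ & v' & _ & E & _)|[(u' & _ & v' & _ & E & K)|(u' & _ & v' & _ & E & _)]]];
            apply opr_inj in E; destruct E as [E E']; try (apply num_inj in E; discriminate).
          apply opr_inj in E'. destruct E' as [<- <-]. now subst.
      - destruct (MS (opr (num 3) (opr u v))) as (z & Hz & K).
        + apply Mp; auto.
        + exists v. split; auto. right. right. right. exists u. split; auto. exists v. auto.
        + destruct K as [(u' & _ & v' & _ & E & _)|[(u' & _ & v' & _ & E & _)|[(u' & _ & v' & _ & E & _)|(u' & _ & v' & _ & E & K)]]];
            apply opr_inj in E; destruct E as [E E']; try (apply num_inj in E; discriminate).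
          apply opr_inj in E'. destruct E' as [<- <-]. now subst. }
    assert (Mglb : glbcl M).
    { intros u Mu v Mv Huv. destruct (su_glb SU Huv) as (z0 & Hz0).
      assert (Pu : u ∈ P) by (destruct Huv as (? & _ & L & _); apply (su_dom SU L)).
      assert (Pv : v ∈ P) by (destruct Huv as (? & _ & _ & L); apply (su_dom SU L)).
      destruct (MS (opr (num 0) (opr u v))) as (z & Hz & K).
      - apply Mp; auto.
      - exists z0. split; [apply PB, Hz0|]. left. exists u. split; auto. exists v. auto.
      - destruct K as [(u' & _ & v' & _ & E & K)|[(u' & _ & v' & _ & E & _)|[(u' & _ & v' & _ & E & _)|(u' & _ & v' & _ & E & _)]]];
            apply opr_inj in E; destruct E as [E E']; try (apply num_inj in E; discriminate).
        apply opr_inj in E'. destruct E' as [<- <-]. eauto. }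
    assert (HSk : Sk M t0).
    { intros t Mt x Mx (b & Bb & y & By & K). destruct (MS (opr (num 1) (opr t x))) as (z & Hz & K').
      - apply Mp; auto.
      - exists (opr b y). split; auto. right. left. exists t. split; auto. exists x. split; auto. split; auto.
        exists b. split; auto. exists y. auto.
      - destruct K' as [(u' & _ & v' & _ & E & _)|[(u' & _ & v' & _ & E & K')|[(u' & _ & v' & _ & E & _)|(u' & _ & v' & _ & E & _)]]];
            apply opr_inj in E; destruct E as [E E']; try (apply num_inj in E; discriminate).
        apply opr_inj in E'. destruct E' as [<- <-]. destruct K' as (b' & Bb' & y' & By' & -> & K').
        destruct (proj b' y' Hz Bb' By'). exists b'. split; auto. exists y'. auto. }
    assert (HM' : USG V M P le pM).
    { apply USG_ext with (M := sep M (fun x => x ∈ h)); auto. intros x Px. rewrite mem_sep. split; [tauto|auto]. }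
    (* Universality of [q] for [N] and of [pM] for [M] gives a common extension [r0] of [pM], [q]
       and [t0]. A residue [s] of it below [t0] puts [w] into the quotient once [s] is in G. *)
    assert (qt : q ∥ t0) by (apply (su_usg SU); tauto).
    destruct (Mglb q qM t0 tM qt) as (v0 & Mv0 & Pv0 & L1 & L2 & _).
    assert (pv : pM ∥ v0) by (apply HM'; auto). destruct pv as (r0 & Pr0 & L3 & L4).
    assert (pq : pM ∥ q) by (apply HM'; auto; apply Pq). destruct (su_glb SU pq) as (w & Hw).
    assert (r0w : r0 ⪯ w) by (apply Hw; auto; lec).
    destruct (@residueN_below r0 t0) as (s & As & Ls & Rs); auto; try lec.
    exists s. split; auto. split; auto. exists M. split; auto. exists pM. split; [apply HM'|].
    exists w. split; [apply Hw|]. exists t0. split; auto. do 11 (split; [assumption|]).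
    split; [exact (res_up Rs r0w)|assumption].
Qed.

(** Below a suitable condition of G the name τ is total and single-valued on [B]. The elements of
    [M] lying under a condition of [M] that decides the value at [x] within [M] are dense in [M]
    below [q] and [t0]; strong genericity makes one of them compatible with a condition carrying the
    true value, so the two values agree. *)
Lemma capture : exists M pM w, V M /\ subset M B /\ Ctbl V M /\ subset X0 M /\ paircl M /\ USG V M P le pM /\
  q ∈ M /\ (forall x y, x ∈ M -> y ∈ M -> x ∥ y -> exists z, z ∈ M /\ isglb P le z x y) /\
  isglb P le w pM q /\ w ∈ quot /\ forall x, x ∈ M -> ap f x ∈ M.
Proof.
  pose proof (zf_ctx Z) as X. pose proof Z as Z'.
  pose proof (su_P SU) as VP. pose proof (su_N SU) as VN. pose proof Vq as Vq'. pose proof Vle as Vle'. pose proof Va as Va'.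
  (* [E1] says that no extension of [t] forces a value in [B] at a certain [x], [E2] that [t] forces
     two values there; G excludes both. *)
  set (E1 := fun t => exists x, x ∈ B /\ ~ exists y, y ∈ B /\ exists t', t' ∈ a /\ t' ⪯ t /\ fmem a le t' (chk a (opr x y)) τ).
  set (E2 := fun t => exists x, x ∈ B /\ exists y, y ∈ B /\ exists y', y' ∈ B /\ ~ y = y' /\
    fmem a le t (chk a (opr x y)) τ /\ fmem a le t (chk a (opr x y')) τ).
  assert (Vopr : forall x y, x ∈ B -> y ∈ B -> V (opr x y)) by (intros; exact (W_mem Z VB (Bpair H H0))).
  destruct (decide_ext Z Va Vle a_preorder HG E1) as [(t & Ht & x & Bx & K)|(s1 & Hs1 & K1)].
  { unfold E1. ds. }
  { exfalso. apply K. fold g in Ht. exists (ap f x). split; auto.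
    assert (Q : opr x (ap f x) ∈ f) by now apply (ap_mem Ff). unfold f in Q at 2. apply truth_chk in Q; auto.
    destruct Q as (p & Hp & Kp). destruct (g_dir' Ht Hp) as (t' & Ht' & L1 & L2). exists t'.
    split; [now apply g_a|]. split; auto. apply fmem_mono with (p := p); auto; [apply a_preorder|now apply g_a]. }
  fold g in Hs1.
  destruct (decide_ext Z Va Vle a_preorder HG E2) as [(t & Ht & x & Bx & y & By & y' & By' & Ne & K & K')|(s2 & Hs2 & K2)].
  { unfold E2. ds. }
  { exfalso. apply Ne. fold g in Ht.
    assert (Q : opr x y ∈ f) by (apply truth_chk; eauto). assert (Q' : opr x y' ∈ f) by (apply truth_chk; eauto).
    rewrite <- (ap_eq Ff Q). exact (ap_eq Ff Q'). }
  fold g in Hs2. destruct (g_dir' Hs1 Hs2) as (s0 & Hs0 & Ls1 & Ls2).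
  assert (Vs0 : V s0) by (apply (W_mem Z Va); now apply g_a).
  destruct (@below_ext V Z a le Va Vle a_preorder G HG (Good s0) s0) as (s & Hs & HGood).
  { exact Hs0. }
  { unfold Good, paircl, USG, SG, glbcl, isglb, res, Sk, Phi. ds. }
  { intros r Ar Lr. destruct (good_dense Ar Lr) as (s & As & Ls & K). exists s. auto. }
  fold g in Hs.
  destruct HGood as (M & VM & pM & PpM & w & Pw & t0 & At0 & MB & CM & XM & Mp & HM & qM & Mglb & Hw & Lt0 & Mt0 & Lst & Rs & HSk).
  exists M, pM, w. do 7 (split; [assumption|]). split; [intros; now apply Mglb|]. split; auto.
  split; [apply (@quot_intro w s); auto; apply Hw|].
  intros x Mx. assert (Bx := MB x Mx).
  assert (Nt0 : t0 ∈ N /\ t0 ∈ P) by now apply mem_a.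
  assert (qt : q ∥ t0) by (apply (su_usg SU); tauto).
  destruct (Mglb q qM t0 Mt0 qt) as (v0 & Mv0 & Pv0 & L1 & L2 & Gv0).
  (* Elements of [M] incompatible with the meet [v0] of [q] and [t0] are included to make the set
     dense in all of [M]; they drop out later because [r] is below [v0]. *)
  set (F := sep P (fun t => t ∈ M /\ (~ t ∥ v0 \/ exists b, b ∈ M /\ b ∈ a /\ t ⪯ b /\ exists y, y ∈ M /\
    fmem a le b (chk a (opr x y)) τ))).
  assert (Vx := W_mem Z VM Mx). assert (Vv0 := W_mem Z VM Mv0).
  assert (VF : V F) by (apply (W_sep Z); auto; ds).
  assert (Q : opr x (ap f x) ∈ f) by now apply (ap_mem Ff). unfold f in Q at 2. apply truth_chk in Q; auto.
  destruct Q as (p & Hp & Kp). destruct (g_dir' Hs Hp) as (p' & Hp' & Lp1 & Lp2).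
  assert (Np' : p' ∈ N /\ p' ∈ P) by now apply mem_a, g_a.
  assert (pw : p' ∥ w) by (apply Rs; tauto). destruct pw as (r & Pr & Lr1 & Lr2).
  assert (LrpM : r ⪯ pM) by (destruct Hw as (_ & ? & ? & _); lec).
  assert (Lrq : r ⪯ q) by (destruct Hw as (_ & ? & ? & _); lec).
  destruct (proj2 (proj1 HM) F VF) with (r := r) as (d & Hd & Hrd); auto.
  - intros d Hd. apply mem_sep in Hd. tauto.
  - intros t Pt Mt. destruct (classic (t ∥ v0)) as [C|C].
    + destruct (Mglb t Mt v0 Mv0 C) as (t1 & Mt1 & Pt1 & K3 & K4 & _).
      (* A residue of [t1] can be extended to decide the value while staying compatible with [t1];
         [HSk] then pulls such a condition into [M]. *)
      destruct (@residueN t1) as (b0 & Ab0 & Rb0); [lec|].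
      destruct (@a_glb b0 t0) as (b1 & Ab1 & K5 & K6); auto.
      { apply Cmp_up_r with (y := t1); [exact (res_Cmp Rb0)|lec]. }
      assert (H1 : exists y, y ∈ B /\ exists t', t' ∈ a /\ t' ⪯ b1 /\ fmem a le t' (chk a (opr x y)) τ).
      { apply NNPP. intro NO. apply (K1 b1 Ab1); [lec|]. exists x. auto. }
      destruct H1 as (y & By & b & Ab & Lb & Kb).
      assert (Nb : b ∈ N /\ b ∈ P) by now apply mem_a.
      destruct (HSk t1 Mt1 x Mx) as (b' & Mb' & y' & My' & Ab' & Cb' & Lb' & Kb').
      { exists b. split; [apply PB; tauto|]. exists y. split; auto. split; auto. split; [|split; auto; lec].
        apply Cmp_sym, Rb0; try tauto. lec. }
      destruct (Mglb t1 Mt1 b' Mb' Cb') as (t2 & Mt2 & Pt2 & K7 & K8 & _).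
      exists t2. split; [|lec]. apply mem_sep. split; auto. split; auto. right. exists b'. split; auto. split; auto.
      split; auto. exists y'. auto.
    + exists t. split; [|now apply (su_refl SU)]. apply mem_sep. auto.
  - apply mem_sep in Hd. destruct Hd as (Pd & Md & [Hd|(b & Mb & Ab & Ldb & y & My & Kb)]).
    + exfalso. apply Hd. apply Cmp_up_r with (y := r); [now apply Cmp_sym|]. apply Gv0; auto. lec.
    + destruct (@a_glb p' b) as (c & Ac & Lc1 & Lc2); auto; [now apply g_a|apply (Cmp_up Hrd); auto|].
      destruct (classic (ap f x = y)) as [->|Ne]; auto. exfalso.
      apply (K2 c Ac); [lec|]. exists x. split; auto. exists (ap f x). split; auto. exists y. split; auto. split; auto.
      split; [apply fmem_mono with (p := p)|apply fmem_mono with (p := b)]; auto; try apply a_preorder. lec.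
Qed.
End Capture.
End Quotient.

Lemma Inj_mono (W W' : class) a b : (forall x, W x -> W' x) -> Inj W a b -> Inj W' a b.
Proof. intros H (f & Wf & K). exists f. auto. Qed.

(** * Meeting a club of V[G] in the quotient *)

Section QuotientUSG.
Variable V : class.
Variables P le N q : zset.
Hypothesis SU : setup V P le N q.
Let a := below_set P N.
Variable G : class.
Hypothesis HG : generic V (fun p => p ∈ a) le G.
Let g := sep a G.
Let M1 := extension V G.
Let Q := quot P le N q G.

Let Z := su_zf SU.
Let Va : V a := W_a SU.
Let Vle : V le := su_le SU.

Lemma ext_zf' : zf M1.
Proof. exact (ext_zf Z Va Vle (a_preorder SU) HG). Qed.
Lemma ext_choice' : zchoice M1.
Proof. exact (ext_choice Z Va Vle (a_preorder SU) HG (su_ac SU)). Qed.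
Lemma ground_sub' x : V x -> M1 x.
Proof. exact (@ground_sub V Z a le Va G HG x). Qed.
Lemma M_g' : M1 g.
Proof. exact (M_g Z Va HG). Qed.

Lemma M_quot : M1 Q.
Proof.
  pose proof ext_zf' as Z1. pose proof (zf_ctx Z1) as X1.
  assert (M1 P) by (apply ground_sub', SU). assert (M1 le) by (apply ground_sub', SU).
  assert (M1 q) by (apply ground_sub', (Vq SU)). pose proof M_g'.
  unfold Q, quot. fold a. fold g. apply (W_sep Z1); auto. ds.
Qed.

(** Members of the club [E] need not be in V, so [M] works with names for them, collected in the
    ground model set [B]. A function [f] of V[G] on [B] lets [M] build a chain in [E] whose union
    has the same trace on the quotient as [M], and strong genericity depends on that trace alone. *)
Theorem quotient_usg : HasUSG M1 Q le.
Proof.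
  pose proof ext_zf' as Z1. pose proof ext_choice' as AC1. pose proof (zf_ctx Z1) as X1. pose proof M_quot as MQ.
  pose proof M_g' as Mg.
  destruct (@lambda_exists M1 Z1 AC1 Q MQ) as (l & Ml & Hl).
  destruct (@H_exists M1 Z1 l Ml) as (h & Mh & Hh); [apply Hl|].
  exists l. split; auto. exists h. split; auto. split; auto. split; auto.
  intros E ME CE.
  assert (Qh : subset Q h).
  { intros x Hx. apply Hh; [exact (W_mem Z1 MQ Hx)|]. now apply Hl. }
  pose proof ME as ME'. apply (ext_iff HG) in ME'. fold a in ME'. fold g in ME'. destruct ME' as (D0 & VD & ED).
  set (T := Un (Un D0)). assert (VT : V T) by now apply Z, Z.
  assert (inE : forall c, c ∈ E -> exists τ, τ ∈ T /\ c = vl g τ).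
  { intros c Hc. rewrite ED in Hc. apply mem_vl in Hc. destruct Hc as (r & p & Hp & Hr & ->). exists r. split; auto.
    eapply opr_left; eauto. }
  assert (Ex0 : exists τ0, τ0 ∈ T /\ vl g τ0 ∈ E).
  { destruct CE as (_ & CE & _). destruct (CE zempty) as (c & Hc & _).
    - apply Z1.
    - intros z Hz. now apply not_mem_empty in Hz.
    - apply Inj_sub; auto; [apply Z1|]. intros z Hz. now apply not_mem_empty in Hz.
    - destruct (inE c Hc) as (τ & Hτ & ->). eauto. }
  destruct Ex0 as (τ0 & Tτ0 & Eτ0).
  destruct (su_st SU) as (l0 & Vl0 & h0 & Vh0 & L0 & H0 & St).
  assert (Ph : subset P h0).
  { intros x Hx. apply H0; [exact (W_mem Z (su_P SU) Hx)|]. now apply L0. }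
  destruct (@pair_closure V Z (union2 (union2 P T) (union2 omega h0))) as (B & VB & SB & Bp).
  { repeat apply W_union2; auto; apply Z || apply SU. }
  assert (PB : subset P B) by (intros z Hz; apply SB; rewrite !mem_union2; auto).
  assert (TB : subset T B) by (intros z Hz; apply SB; rewrite !mem_union2; auto).
  assert (oB : subset omega B) by (intros z Hz; apply SB; rewrite !mem_union2; auto).
  assert (hB : subset h0 B) by (intros z Hz; apply SB; rewrite !mem_union2; auto).
  assert (QP : subset Q P) by (intros z Hz; now apply mem_sep in Hz).
  assert (MT : M1 T) by now apply ground_sub'. assert (MB : M1 B) by now apply ground_sub'.
  (* An injection into ω is fixed for each member of [E] named in [T], so that its elements are
     addressed by numbers, and these belong to [M]. *)
  destruct (@choice_function M1 Z1 AC1 (fun τ j => vl g τ ∈ E -> isfun j (vl g τ) omega /\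
    forall x, M1 x -> forall x', M1 x' -> forall n, M1 n -> opr x n ∈ j -> opr x' n ∈ j -> x = x') T) as (jf & Mj & Fj & Hj); auto.
  { ds. }
  { intros τ Hτ. destruct (classic (vl g τ ∈ E)) as [K|K].
    - destruct (proj1 CE _ K) as [_ (j & Mj & Fj & Ij)]. exists j. split; auto. intros _. split; auto. intros; eauto.
    - exists τ. split; [exact (W_mem Z1 MT Hτ)|tauto]. }
  (* Tag 0 enlarges the member of [E] named by τ so that it contains [m]; tag 1 returns the element
     of the quotient with number [n] in the member named by τ. *)
  set (Rho := fun x y => (exists τ, τ ∈ T /\ exists m, m ∈ Q /\ x = opr (num 0) (opr τ m) /\
      y ∈ T /\ vl g y ∈ E /\ subset (vl g τ) (vl g y) /\ m ∈ vl g y) \/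
    (exists τ, τ ∈ T /\ exists n, n ∈ omega /\ x = opr (num 1) (opr τ n) /\
      vl g τ ∈ E /\ y ∈ Q /\ y ∈ vl g τ /\ opr y n ∈ ap jf τ)).
  assert (DR : D M1 M1 (fun e => Rho (e 0) (e 1))).
  { pose proof (W_num Z1 0). pose proof (W_num Z1 1). unfold Rho. ds. }
  destruct (@choice_function M1 Z1 AC1 (fun x y => y ∈ B /\ ((exists z, z ∈ B /\ Rho x z) -> Rho x y)) B) as (f & Mf & Ff & Hf); auto.
  { dstep; [ds|]. dstep; [|exact DR]. dstep; [ds|]. apply (D_rel2 X1 Rho DR); ds. }
  { intros x Hx. destruct (classic (exists z, z ∈ B /\ Rho x z)) as [(z & Hz & K)|N0].
    - exists z. split; [exact (W_mem Z1 MB Hz)|]. auto.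
    - exists x. split; [exact (W_mem Z1 MB Hx)|]. split; auto. tauto. }
  pose proof Mf as Mf'. apply (ext_iff HG) in Mf'. fold a in Mf'. fold g in Mf'. destruct Mf' as (τf & Vτf & Ef).
  set (X0 := union2 omega (sing τ0)).
  assert (Vτ0 := W_mem Z VT Tτ0).
  destruct (@capture V P le N q SU G HG B h0 X0 τf) as (M & pM & w & VM & SMB & CM & XM & Mp & HM & qM & Mglb & Hw & Qw & Mfcl); auto.
  { apply W_union2; auto; [apply Z|now apply W_sing]. }
  { intros z Hz. apply mem_union2 in Hz. destruct Hz as [Hz|Hz]; auto. apply mem_sing in Hz. subst z. auto. }
  { apply Ctbl_union2; auto; [apply SU|apply Z|now apply W_sing|now apply Ctbl_omega|now apply Ctbl_upair]. }
  { intros z Hz. apply mem_union2. auto. }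
  { fold a. fold g. rewrite <- Ef. exact Ff. }
  { fold a. fold g. rewrite <- Ef. intros x Hx. now apply Hf. }
  fold a in Mfcl. fold g in Mfcl. rewrite <- Ef in Mfcl. fold Q in Qw.
  assert (oM : forall n, num n ∈ M) by (intro n; apply XM, mem_union2; left; apply num_in_omega).
  assert (τ0M : τ0 ∈ M) by (apply XM, mem_union2; right; now apply mem_sing).
  assert (MM : M1 M) by now apply ground_sub'.
  (* The trace of [M] on the quotient is countable in V[G] and is absorbed element by element along
     an injection [k] into ω, with [pre] as its inverse. *)
  set (MQ' := sep M (fun x => x ∈ Q)).
  assert (WMQ : M1 MQ') by (apply (W_sep Z1); auto; ds).
  assert (CMQ : Ctbl M1 MQ').
  { apply (@Ctbl_sub M1 Z1 MQ' M); auto; [intros z Hz; now apply mem_sep in Hz|].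
    apply (@Inj_mono V M1 M omega ground_sub' CM). }
  apply Inj_iff in CMQ. destruct CMQ as (k & Wk & Fk & k1 & k2).
  set (pre := fun n => Un (sep MQ' (fun m => ap k m = n))).
  assert (Epre : forall m, m ∈ MQ' -> pre (ap k m) = m).
  { intros m Hm. apply zset_ext. intro z. unfold pre. rewrite mem_Un. split.
    - intros (m' & Hm' & Hz). apply mem_sep in Hm'. destruct Hm' as [Hm' E']. apply k2 in E'; auto. now subst.
    - intro Hz. exists m. split; auto. now apply mem_sep. }
  assert (Tpre : TD M1 M1 (fun e => pre (e 0))).
  { apply (TD_intro X1) with (Phi := fun z e => exists m, m ∈ MQ' /\ ap k m = e 0 /\ z ∈ m).
    - intros e He. pose proof (He 0). apply Z1. apply (W_sep Z1); auto. ds.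
    - intros e z _ _. unfold pre. rewrite mem_Un. split.
      + intros (m & Hm & Hz). apply mem_sep in Hm. destruct Hm. eauto.
      + intros (m & Hm & Em & Hz). exists m. split; auto. now apply mem_sep.
    - ds. }
  (* Step [n] absorbs the element with number [n], and keeps the name unchanged when there is
     none. *)
  set (stp := fun n v => ite (exists m, m ∈ MQ' /\ ap k m = n) (ap f (opr (num 0) (opr v (pre n)))) v).
  set (s := orec τ0 stp).
  assert (Tstp : TD M1 M1 (fun e => stp (e 0) (e 1))).
  { pose proof (W_num Z1 0). unfold stp. ds. }
  assert (Ts : TD M1 M1 (fun e => s (e 0))).
  { apply (TD_orec Z1 X1); auto. now apply ground_sub'. }
  assert (EB : forall c, c ∈ E -> subset c h /\ Ctbl M1 c) by apply CE.
  assert (RhoStep : forall τ m, τ ∈ M -> τ ∈ T -> vl g τ ∈ E -> m ∈ MQ' ->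
    let y := ap f (opr (num 0) (opr τ m)) in y ∈ M /\ y ∈ T /\ vl g y ∈ E /\ subset (vl g τ) (vl g y) /\ m ∈ vl g y).
  { intros τ m Hτ Tτ Eτ Hm y. apply mem_sep in Hm. destruct Hm as [Hm Qm].
    assert (Hx : opr (num 0) (opr τ m) ∈ M) by (apply Mp; auto).
    split; [now apply Mfcl|]. destruct (Hf _ (SMB _ Hx)) as [_ K]. fold y in K.
    destruct K as [(τ' & _ & m' & _ & E' & K)|(τ' & _ & n' & _ & E' & _)].
    - destruct (EB _ Eτ) as [S1 C1]. destruct CE as (_ & CE & _).
      assert (Mc : M1 (vl g τ)) by exact (W_mem Z1 ME Eτ). assert (Mm : M1 m) by exact (W_mem Z1 MQ Qm).
      destruct (CE (union2 (vl g τ) (sing m))) as (c & Hc & Sc).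
      + apply W_union2; auto. now apply W_sing.
      + intros z Hz. apply mem_union2 in Hz. destruct Hz as [Hz|Hz]; auto. apply mem_sing in Hz. subst z. auto.
      + apply Ctbl_union2; auto; [now apply W_sing|now apply Ctbl_upair].
      + destruct (inE c Hc) as (y' & Hy' & ->). exists y'. split; auto. left. exists τ. split; auto. exists m.
        split; auto. split; auto. split; auto. split; auto. split; [intros z Hz|]; apply Sc, mem_union2; auto.
        right. now apply mem_sing.
    - apply opr_inj in E'. destruct E' as [_ E']. apply opr_inj in E'. destruct E' as [<- <-]. exact K.
    - apply opr_inj in E'. destruct E' as [E' _]. apply num_inj in E'. discriminate. }
  assert (Hs : forall n, s (num n) ∈ M /\ s (num n) ∈ T /\ vl g (s (num n)) ∈ E).
  { induction n as [|n (I1 & I2 & I3)].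
    - cbn [num]. unfold s. rewrite orec_zero. auto.
    - cbn [num]. unfold s. rewrite orec_suc by apply num_in_omega. fold s. unfold stp.
      destruct (classic (exists m, m ∈ MQ' /\ ap k m = num n)) as [(m & Hm & Em)|N0].
      + rewrite ite_true by eauto. rewrite <- Em at 1 3 5. rewrite <- Em, Epre by auto. rewrite Em.
        destruct (RhoStep (s (num n)) m) as (? & ? & ? & _); auto.
      + rewrite ite_false by auto. auto. }
  assert (Hs1 : forall n, subset (vl g (s (num n))) (vl g (s (num (S n))))).
  { intro n. destruct (Hs n) as (I1 & I2 & I3). cbn [num]. unfold s at 2. rewrite orec_suc by apply num_in_omega. fold s. unfold stp.
    destruct (classic (exists m, m ∈ MQ' /\ ap k m = num n)) as [(m & Hm & Em)|N0].
    - rewrite ite_true by eauto. rewrite <- Em, Epre by auto. rewrite Em. now apply RhoStep.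
    - rewrite ite_false by auto. intro; auto. }
  assert (Mono : forall m n, m <= n -> subset (vl g (s (num m))) (vl g (s (num n)))).
  { intros m n H. induction H; intros z Hz; auto. apply Hs1. auto. }
  set (F := img omega (fun n => vl g (s n))).
  assert (TF : TD M1 M1 (fun e => vl g (s (e 0)))) by ds.
  assert (MF : M1 F) by (apply W_img_TD; auto; apply Z1).
  assert (mF : forall c, c ∈ F -> exists n, c = vl g (s (num n))).
  { intros c Hc. apply mem_img in Hc. destruct Hc as (n & Hn & ->). apply mem_omega in Hn. destruct Hn as [i ->]. eauto. }
  assert (Fm : forall n, vl g (s (num n)) ∈ F).
  { intro n. apply mem_img. exists (num n). split; auto. apply num_in_omega. }
  assert (UE : Un F ∈ E).
  { destruct CE as (_ & _ & CE). apply CE; auto.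
    - intros c Hc. destruct (mF c Hc) as [n ->]. apply Hs.
    - apply Ctbl_img; auto; [apply Z1|now apply Ctbl_omega].
    - exists (vl g (s (num 0))). apply Fm.
    - intros c Hc d Hd. destruct (mF c Hc) as [m ->], (mF d Hd) as [n ->].
      destruct (Nat.le_ge_cases m n); [left|right]; now apply Mono. }
  (* From left to right, [x] has a number in some member of the chain, and [f] recovers it from the
     name and the number, both in [M]. From right to left, [x] was absorbed at the step given by
     [k]. *)
  assert (XQ : forall x, x ∈ Q -> (x ∈ Un F <-> x ∈ M)).
  { intros x Qx. split.
    - intro Hx. apply mem_Un in Hx. destruct Hx as (c & Hc & Hx). destruct (mF c Hc) as [n ->].
      destruct (Hs n) as (I1 & I2 & I3). set (τ := s (num n)) in *. destruct (Hj τ I2 I3) as [Fx Ix].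
      destruct (proj1 (proj2 Fx) x Hx) as (i & Hi).
      assert (Oi : i ∈ omega) by (apply isfun_func in Fx; now apply (proj2 Fx) in Hi).
      assert (Mi : i ∈ M) by (apply mem_omega in Oi; destruct Oi as [i' ->]; auto).
      assert (Hx' : opr (num 1) (opr τ i) ∈ M) by (apply Mp; auto).
      destruct (Hf _ (SMB _ Hx')) as [_ K].
      destruct K as [(τ' & _ & m' & _ & E' & _)|(τ' & _ & n' & _ & E' & _ & Qy & Hy & K)].
      + exists x. split; [auto|]. right. exists τ. split; auto. exists i. auto 10.
      + apply opr_inj in E'. destruct E' as [E' _]. apply num_inj in E'. discriminate.
      + apply opr_inj in E'. destruct E' as [_ E']. apply opr_inj in E'. destruct E' as [<- <-].
        assert (x = ap f (opr (num 1) (opr τ i))).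
        { apply (Ix x (W_mem Z1 MQ Qx) _ (W_mem Z1 MQ Qy) i); auto. exact (W_mem Z1 (zf_omega Z1) Oi). }
        rewrite H. now apply Mfcl.
    - intro Hx. assert (Hm : x ∈ MQ') by (apply mem_sep; auto).
      pose proof (k1 x Hm) as K. apply mem_omega in K. destruct K as [n En].
      apply mem_Un. exists (vl g (s (num (S n)))). split; auto.
      cbn [num]. unfold s. rewrite orec_suc by apply num_in_omega. fold s. unfold stp.
      rewrite ite_true by eauto. rewrite <- En, Epre by auto. rewrite En. destruct (Hs n) as (I1 & I2 & I3).
      now apply RhoStep. }
  exists (Un F). split; auto. exists w.
  assert (Mw : M1 w) by exact (W_mem Z1 MQ Qw).
  split; auto. split; [split; auto|].
  - intros F0 MF0 HF1 HF2 r Qr Lr. apply (ext_iff HG) in MF0. destruct MF0 as (D1 & VD1 & EF).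
    apply (@strong_generic V P le N q SU G HG M pM w) with (D0 := D1); auto.
    + intros d Hd. destruct (HF1 d Hd) as [H1 H2]. split; auto. now apply XQ.
    + intros p Qp Hp. apply HF2; auto. now apply XQ.
  - intros p Qp Hp. apply (@strong_universal V P le N q SU G HG M pM w); auto. now apply XQ.
Qed.
End QuotientUSG.

(** * The approximation property *)

Section Approximation.
Variable W : class.
Hypothesis Z : zf W.
Hypothesis AC : zchoice W.
Variables Q le : zset.
Hypothesis WQ : W Q.
Hypothesis Wle : W le.
Hypothesis Hpre : preorder Q le.
Hypothesis HQ : HasUSG W Q le.
Variable K : class.
Hypothesis HK : generic W (fun p => p ∈ Q) le K.
Let k := sep Q K.
Notation "p ⪯ r" := (opr p r ∈ le) (at level 70).

Let ltr x y z : x ∈ Q -> y ∈ Q -> z ∈ Q -> x ⪯ y -> y ⪯ z -> x ⪯ z.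
Proof. apply Hpre. Qed.
Let kQ p : p ∈ k -> p ∈ Q.
Proof. intro H. now apply mem_sep in H. Qed.
Let kW p : p ∈ k -> W p.
Proof. intro H. exact (W_mem Z WQ (kQ H)). Qed.
Let kdir p r : p ∈ k -> r ∈ k -> exists s, s ∈ k /\ s ⪯ p /\ s ⪯ r.
Proof. apply (g_dir HK). Qed.

Lemma truth_check x s : W x -> W s -> (x ∈ vl k s <-> exists p, p ∈ k /\ fmem Q le p (chk Q x) s).
Proof.
  intros Wx Ws. assert (Wc : W (chk Q x)) by now apply (W_chk Z).
  pose proof (@truth_mem_ext W Z Q le WQ Wle Hpre K HK (chk Q x) s Wc Ws) as E. fold k in E. rewrite <- E.
  rewrite vl_chk; [reflexivity|exact (g_inh HK)|exact kQ].
Qed.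

Variable τ β : zset.
Hypothesis Wτ : W τ.
Hypothesis Wβ : W β.
Let d := vl k τ.
Hypothesis dβ : subset d β.

(** A condition may force ξ into [d] ([pos]), out of [d] ([neg]), or neither; [dec s x b] means that
    [s] forces [d] and [b] to agree on [x]. *)
Let pos s ξ := fmem Q le s (chk Q ξ) τ.
Let neg s ξ := forall s', s' ∈ Q -> s' ⪯ s -> ~ pos s' ξ.
Let dec s x b := forall ξ, ξ ∈ x -> (ξ ∈ b -> pos s ξ) /\ (~ ξ ∈ b -> neg s ξ).

Let pos_mono s t ξ : t ∈ Q -> t ⪯ s -> pos s ξ -> pos t ξ.
Proof. intros. apply fmem_mono with (p := s); auto. Qed.
Let neg_mono s t ξ : s ∈ Q -> t ∈ Q -> t ⪯ s -> neg s ξ -> neg t ξ.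
Proof. intros Hs Ht L H u Hu Lu. apply H; auto. exact (ltr Hu Ht Hs Lu L). Qed.
Let dec_mono s t x b : s ∈ Q -> t ∈ Q -> t ⪯ s -> dec s x b -> dec t x b.
Proof. intros Hs Ht L H ξ Hξ. destruct (H ξ Hξ). split; intro; [apply (@pos_mono s)|apply (@neg_mono s)]; auto. Qed.
Let not_pos s ξ : s ∈ Q -> ~ pos s ξ -> exists t, t ∈ Q /\ t ⪯ s /\ neg t ξ.
Proof.
  intros Hs N. apply NNPP. intro B. apply N. apply fmem_dense; auto. intros r Hr Lr. apply NNPP. intro B'.
  apply B. exists r. split; auto. split; auto. intros t Ht Lt Pt. apply B'. exists t. auto.
Qed.
Let not_neg s ξ : ~ neg s ξ -> exists t, t ∈ Q /\ t ⪯ s /\ pos t ξ.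
Proof. intro N. apply NNPP. intro B. apply N. intros t Ht Lt Pt. apply B. eauto. Qed.

Let pos_true s ξ : W ξ -> s ∈ k -> pos s ξ -> ξ ∈ d.
Proof. intros. apply truth_check; eauto. Qed.
Let neg_true s ξ : W ξ -> s ∈ k -> neg s ξ -> ~ ξ ∈ d.
Proof.
  intros Wξ Hs H B. apply truth_check in B; auto. destruct B as (p & Hp & Kp).
  destruct (kdir Hs Hp) as (t & Ht & L1 & L2). apply (H t (kQ Ht) L1). exact (pos_mono (kQ Ht) L2 Kp).
Qed.

Lemma D_pos t u : TD W W t -> TD W W u -> D W W (fun e => pos (t e) (u e)).
Proof. intros. pose proof (zf_ctx Z) as X. unfold pos. ds. Qed.
Lemma D_neg t u : TD W W t -> TD W W u -> D W W (fun e => neg (t e) (u e)).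
Proof.
  intros. pose proof (zf_ctx Z) as X. apply (D_rel2 X neg); auto. unfold neg. ds. apply D_pos; ds.
Qed.
Lemma D_dec t u v : TD W W t -> TD W W u -> TD W W v -> D W W (fun e => dec (t e) (u e) (v e)).
Proof.
  intros. pose proof (zf_ctx Z) as X. apply (D_rel3 X dec); auto. unfold dec. ds; (apply D_pos || apply D_neg); ds.
Qed.

(** The true piece of [d] on a countable [x] is decided by some condition of K, so no condition of K
    can have an [x] left undecided by all its extensions. Genericity turns this into a condition
    below which all countable pieces can be decided. *)
Lemma pieces_decided : (forall b, W b -> Ctbl W b -> exists c, W c /\ forall x, x ∈ c <-> x ∈ b /\ x ∈ d) ->
  exists p, p ∈ k /\ forall s, s ∈ Q -> s ⪯ p -> forall x, W x -> subset x β -> Ctbl W x ->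
    exists t, t ∈ Q /\ t ⪯ s /\ exists b, W b /\ dec t x b.
Proof.
  intro HA. pose proof (zf_ctx Z) as X.
  destruct (decide_ext Z WQ Wle Hpre HK (fun s => exists x, W x /\ subset x β /\ Ctbl W x /\
    forall t, t ∈ Q -> t ⪯ s -> ~ exists b, W b /\ dec t x b)) as [(s & Hs & x & Wx & xβ & Cx & N)|(p & Hp & H)].
  - ds. apply D_dec; ds.
  - exfalso. fold k in Hs. destruct (HA x Wx Cx) as (c & Wc & Hc).
    assert (T : exists t, t ∈ k /\ dec t x c).
    { destruct (decide_ext Z WQ Wle Hpre HK (fun t => dec t x c)) as [|(t & Ht & H)]; auto.
      - apply D_dec; ds.
      (* If no extension of [t] decides the piece as [c], then densely below [t] some ξ of [x] is
         forced to contradict [c], and K contains such a condition. *)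
      - exfalso. destruct (@below_ext W Z Q le WQ Wle Hpre K HK (fun r => exists ξ, ξ ∈ x /\
          ((ξ ∈ c /\ neg r ξ) \/ (~ ξ ∈ c /\ pos r ξ))) t) as (r & Hr & ξ & Hξ & C); auto.
        + ds; (apply D_pos || apply D_neg); ds.
        + intros r Qr Lr. apply NNPP. intro B. apply (H r Qr Lr). intros ξ Hξ. split; intro Hc'.
          * apply NNPP. intro NP. destruct (not_pos Qr NP) as (r' & Hr' & L' & K'). apply B. eauto 10.
          * apply NNPP. intro NP. apply not_neg in NP. destruct NP as (r' & Hr' & L' & K'). apply B. eauto 10.
        + assert (Wξ := W_mem Z Wx Hξ). destruct C as [[C1 C2]|[C1 C2]].
          * apply (@neg_true r ξ Wξ Hr C2). now apply Hc.
          * apply C1, Hc. split; auto. exact (pos_true Wξ Hr C2). }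
    destruct T as (t & Ht & Dt). destruct (kdir Hs Ht) as (u & Hu & L1 & L2).
    apply (N u (kQ Hu) L1). exists c. split; auto. exact (dec_mono (kQ Ht) (kQ Hu) L2 Dt).
  - fold k in Hp. exists p. split; auto. intros s Qs Ls x Wx xβ Cx. apply NNPP. intro B. apply (H s Qs Ls).
    exists x. split; auto. split; auto. split; auto. intros t Qt Lt E. apply B. exists t. auto.
Qed.

(** If a condition of K decided all of [d], separation would put [d] into W; so some [p] in K has no
    extension doing so. Below [p], the set of ξ that [s] forces into [d] is not a correct decision,
    and a ξ where it fails is forced neither in nor out. *)
Lemma splitting : ~ W d -> exists p, p ∈ k /\ forall s, s ∈ Q -> s ⪯ p ->
    exists ξ, ξ ∈ β /\ exists s0, s0 ∈ Q /\ exists s1, s1 ∈ Q /\ s0 ⪯ s /\ s1 ⪯ s /\ pos s0 ξ /\ neg s1 ξ.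
Proof.
  intro ND. pose proof (zf_ctx Z) as X.
  destruct (decide_ext Z WQ Wle Hpre HK (fun s => exists b, W b /\ dec s β b)) as [(s & Hs & b & Wb & H)|(p & Hp & H)].
  - ds. apply D_dec; ds.
  - exfalso. fold k in Hs. apply ND. replace d with (sep β (fun ξ => ξ ∈ b)); [apply (W_sep Z); auto; ds|].
    apply zset_ext. intro ξ. rewrite mem_sep. split.
    + intros [Hξ Hb]. apply (@pos_true s); auto; [exact (W_mem Z Wβ Hξ)|]. now apply H.
    + intro Hd. assert (Hξ := dβ Hd). split; auto. apply NNPP. intro B.
      apply (@neg_true s ξ); auto; [exact (W_mem Z Wβ Hξ)|]. now apply H.
  - fold k in Hp. exists p. split; auto. intros s Qs Ls. apply NNPP. intro B. apply (H s Qs Ls).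
    assert (Ws := W_mem Z WQ Qs).
    exists (sep β (fun ξ => pos s ξ)). split; [apply (W_sep Z); auto; apply D_pos; ds|].
    intros ξ Hξ. rewrite mem_sep. split; [tauto|]. intro NP. apply NNPP. intro NN.
    destruct (not_pos Qs (fun P => NP (conj Hξ P))) as (s1 & Hs1 & L1 & K1).
    apply not_neg in NN. destruct NN as (s0 & Hs0 & L0 & K0). apply B. exists ξ. split; auto.
    exists s0. split; auto. exists s1. auto.
Qed.

Lemma approximation : (forall b, W b -> Ctbl W b -> exists c, W c /\ forall x, x ∈ c <-> x ∈ b /\ x ∈ d) -> W d.
Proof.
  intro HA. apply NNPP. intro ND. pose proof (zf_ctx Z) as X.
  destruct (pieces_decided HA) as (p1 & Hp1 & H1). destruct (splitting ND) as (p2 & Hp2 & H2).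
  destruct (kdir Hp1 Hp2) as (p & Hp & Lp1 & Lp2).
  pose proof (kQ Hp) as Qp. pose proof (kQ Hp1) as Qp1. pose proof (kQ Hp2) as Qp2. pose proof (kW Hp) as Wp.
  destruct HQ as (l & Wl & h & Wh & Hl & Hh & St).
  assert (Qh : subset Q h).
  { intros x Hx. apply Hh; [exact (W_mem Z WQ Hx)|]. now apply Hl. }
  destruct (@pair_closure W Z (union2 (union2 omega β) h)) as (B & WB & SB & Bp).
  { repeat apply W_union2; auto. apply Z. }
  assert (oB : subset omega B) by (intros z Hz; apply SB; rewrite !mem_union2; auto).
  assert (βB : subset β B) by (intros z Hz; apply SB; rewrite !mem_union2; auto).
  assert (hB : subset h B) by (intros z Hz; apply SB; rewrite !mem_union2; auto).
  assert (QB : subset Q B) by (intros z Hz; auto).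
  (* Tag 0 asks for common extensions, as [Q] is merely a preorder here; tag 1 asks for a splitting,
     packed as a triple; tags 2 and 3 unpack pairs. *)
  set (R := fun x z => (exists u, u ∈ Q /\ exists v, v ∈ Q /\ x = opr (num 0) (opr u v) /\ z ∈ Q /\ z ⪯ u /\ z ⪯ v) \/
    (exists s, s ∈ Q /\ x = opr (num 1) s /\ exists ξ, ξ ∈ β /\ exists s0, s0 ∈ Q /\ exists s1, s1 ∈ Q /\
       s0 ⪯ s /\ s1 ⪯ s /\ pos s0 ξ /\ neg s1 ξ /\ z = opr ξ (opr s0 s1)) \/
    (exists u, u ∈ B /\ exists v, v ∈ B /\ x = opr (num 2) (opr u v) /\ z = u) \/
    (exists u, u ∈ B /\ exists v, v ∈ B /\ x = opr (num 3) (opr u v) /\ z = v)).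
  destruct (@skolem_stationary W Z AC B h (union2 omega (sing p)) R (fun M => exists q, W q /\ USG W M Q le q))
    as (M & WM & MB & CM & XM & Mp & MS & (r0 & Wr0 & HM)); auto.
  - apply W_union2; auto; [apply Z|now apply W_sing].
  - intros z Hz. apply mem_union2 in Hz. destruct Hz as [Hz|Hz]; auto. apply mem_sing in Hz. subst z. auto.
  - apply Ctbl_union2; auto; [apply Z|now apply W_sing|now apply Ctbl_omega|now apply Ctbl_upair].
  - pose proof (W_num Z 0). pose proof (W_num Z 1). pose proof (W_num Z 2). pose proof (W_num Z 3).
    unfold R. ds; (apply D_pos || apply D_neg); ds.
  - assert (pM : p ∈ M) by (apply XM, mem_union2; right; now apply mem_sing).
    assert (nM : forall n, num n ∈ M) by (intro n; apply XM, mem_union2; left; apply num_in_omega).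
    assert (proj : forall u v, opr u v ∈ M -> u ∈ B -> v ∈ B -> u ∈ M /\ v ∈ M).
    { intros u v H Hu Hv. split.
      - destruct (MS (opr (num 2) (opr u v))) as (z & Hz & E).
        + apply Mp; auto.
        + exists u. split; auto. right. right. left. exists u. split; auto. exists v. auto.
        + destruct E as [(u' & _ & v' & _ & E & _)|[(u' & _ & E & _)|[(u' & _ & v' & _ & E & E2)|(u' & _ & v' & _ & E & _)]]];
            apply opr_inj in E; destruct E as [E E']; try (apply num_inj in E; discriminate).
          apply opr_inj in E'. destruct E' as [<- <-]. now subst.
      - destruct (MS (opr (num 3) (opr u v))) as (z & Hz & E).
        + apply Mp; auto.
        + exists v. split; auto. right. right. right. exists u. split; auto. exists v. auto.
        + destruct E as [(u' & _ & v' & _ & E & _)|[(u' & _ & E & _)|[(u' & _ & v' & _ & E & _)|(u' & _ & v' & _ & E & E2)]]];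
            apply opr_inj in E; destruct E as [E E']; try (apply num_inj in E; discriminate).
          apply opr_inj in E'. destruct E' as [<- <-]. now subst. }
    assert (Mcmp : forall u v, u ∈ M -> v ∈ M -> u ∈ Q -> v ∈ Q -> Cmp Q le u v -> exists z, z ∈ M /\ z ∈ Q /\ z ⪯ u /\ z ⪯ v).
    { intros u v Mu Mv Qu Qv (z0 & Qz0 & L1 & L2). destruct (MS (opr (num 0) (opr u v))) as (z & Hz & E).
      + apply Mp; auto.
      + exists z0. split; auto. left. exists u. split; auto. exists v. auto 10.
      + destruct E as [(u' & _ & v' & _ & E & K')|[(u' & _ & E & _)|[(u' & _ & v' & _ & E & _)|(u' & _ & v' & _ & E & _)]]];
            apply opr_inj in E; destruct E as [E E']; try (apply num_inj in E; discriminate).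
          apply opr_inj in E'. destruct E' as [<- <-]. eauto. }
    assert (Msplit : forall s, s ∈ M -> s ∈ Q -> s ⪯ p -> exists ξ, ξ ∈ M /\ ξ ∈ β /\ exists s0, s0 ∈ M /\ s0 ∈ Q /\
      exists s1, s1 ∈ M /\ s1 ∈ Q /\ s0 ⪯ s /\ s1 ⪯ s /\ pos s0 ξ /\ neg s1 ξ).
    { intros s Ms Qs Ls. destruct (MS (opr (num 1) s)) as (z & Hz & E).
      + apply Mp; auto.
      + destruct (H2 s Qs) as (ξ & Hξ & s0 & Hs0 & s1 & Hs1 & L0 & L1 & K0 & K1); [exact (ltr Qs Qp Qp2 Ls Lp2)|].
        exists (opr ξ (opr s0 s1)). split; [auto|]. right. left. exists s. split; auto. split; auto.
        exists ξ. split; auto. exists s0. split; auto. exists s1. auto 10.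
      + destruct E as [(u' & _ & v' & _ & E & _)|[(u' & _ & E & E2)|[(u' & _ & v' & _ & E & _)|(u' & _ & v' & _ & E & _)]]];
            apply opr_inj in E; destruct E as [E E']; try (apply num_inj in E; discriminate).
        subst u'. destruct E2 as (ξ & Hξ & s0 & Hs0 & s1 & Hs1 & L0 & L1 & K0 & K1 & ->).
        destruct (proj _ _ Hz) as [Mξ M01]; auto. destruct (proj _ _ M01) as [M0 M1]; auto.
        exists ξ. split; auto. split; auto. exists s0. split; auto. split; auto. exists s1. auto 10. }
    assert (HM' : USG W M Q le r0).
    { destruct HM as ((Qr0 & S1) & S2). split; [split; auto|].
      - intros F WF F1 F2 r Qr Lr. apply (S1 F); auto.
        + intros x Hx. destruct (F1 x Hx). split; auto. apply mem_sep. auto.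
        + intros x Qx Hx. apply mem_sep in Hx. apply F2; tauto.
      - intros x Qx Mx. apply S2; auto. apply mem_sep. auto. }
    destruct (proj2 HM' p Qp pM) as (r1 & Qr1 & L1 & L2).
    pose proof (proj1 (proj1 HM')) as Qr0.
    set (x := sep M (fun ξ => ξ ∈ β)).
    assert (Wx : W x) by (apply (W_sep Z); auto; ds).
    (* The elements of [M] in β form a countable set of W, so the piece of [d] on it can be decided
       below [r1]. *)
    destruct (H1 r1 Qr1 (ltr Qr1 Qp Qp1 L2 Lp1) x) as (r & Qr & Lr & b & Wb & Db); auto.
    { intros ξ Hξ. now apply mem_sep in Hξ. }
    { apply (@Ctbl_sub W Z x M); auto. intros ξ Hξ. now apply mem_sep in Hξ. }
    set (F := sep Q (fun t => t ∈ M /\ (~ Cmp Q le t p \/ exists ξ, ξ ∈ x /\ ((pos t ξ /\ ~ ξ ∈ b) \/ (neg t ξ /\ ξ ∈ b))))).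
    assert (WF : W F) by (apply (W_sep Z); auto; ds; (apply D_pos || apply D_neg); ds).
    destruct (proj2 (proj1 HM') F WF) with (r := r) as (f & Hf & z & Qz & Lz1 & Lz2); auto.
    + intros t Ht. apply mem_sep in Ht. tauto.
    + intros t Qt Mt. destruct (classic (Cmp Q le t p)) as [C|C].
      * destruct (Mcmp t p) as (t' & Mt' & Qt' & Lt1 & Lt2); auto.
        destruct (Msplit t') as (ξ & Mξ & Hξ & s0 & M0 & Q0 & s1 & M1 & Q1 & L0' & L1' & K0 & K1); auto.
        assert (xξ : ξ ∈ x) by (apply mem_sep; auto).
        (* Of the two halves of the splitting, the one that disagrees with [b] is taken. *)
        destruct (classic (ξ ∈ b)) as [Hb|Hb].
        -- exists s1. split; [|exact (ltr Q1 Qt' Qt L1' Lt1)]. apply mem_sep. split; auto. split; auto. right. eauto.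
        -- exists s0. split; [|exact (ltr Q0 Qt' Qt L0' Lt1)]. apply mem_sep. split; auto. split; auto. right. eauto.
      * exists t. split; [apply mem_sep; auto|]. now apply Hpre.
    + exact (ltr Qr Qr1 Qr0 Lr L1).
    + apply mem_sep in Hf. destruct Hf as (Qf & Mf & [C|(ξ & Hξ & [[K1 Hb]|[K1 Hb]])]).
      * apply C. exists z. split; auto. split; auto. apply (@ltr z r p); auto. exact (ltr Qr Qr1 Qp Lr L2).
      * apply (proj2 (Db ξ Hξ) Hb z Qz Lz1). exact (pos_mono Qz Lz2 K1).
      * apply (K1 z Qz Lz2). apply (@pos_mono r); auto. now apply Db.
Qed.
End Approximation.

Theorem omega1_approx W : zf W -> zchoice W -> forall Q le, W Q -> W le -> preorder Q le -> HasUSG W Q le ->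
  forall K, generic W (fun p => p ∈ Q) le K -> omega1_approximation W (extension W K).
Proof.
  intros Z AC Q le WQ Wle Hpre HQ K HK d Hd _ (β & Wβ & _ & dβ) HA.
  apply (ext_iff HK) in Hd. destruct Hd as (τ & Wτ & ->).
  apply (@approximation W Z AC Q le WQ Wle Hpre HQ K HK τ β Wτ Wβ dβ).
  intros b Wb Cb. apply HA; auto. unfold Sat. apply (@psat_countable W Z); auto.
  intros [|[|i]]; cbn; auto; apply Z.
Qed.

(** * Factoring a generic filter *)

Lemma restr_below N P : restr N P = fun p => p ∈ below_set P N.
Proof.
  extensionality p. apply propositional_extensionality. unfold restr, below_set. rewrite mem_sep. tauto.
Qed.

Lemma compatible_Cmp P le x y : compatible P le x y <-> Cmp P le x y.
Proof. unfold compatible, Cmp. rewrite rel_eq. tauto. Qed.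

Section Factor.
Variable V : class.
Variables P le N q : zset.
Hypothesis SU : setup V P le N q.
Variable H : class.
Hypothesis HH : generic V (fun p => p ∈ P) le H.
Hypothesis Hq : H q.
Let HN : class := fun p => H p /\ p ∈ N.
Let a := below_set P N.
Let Z := su_zf SU.
Notation "p ⪯ r" := (opr p r ∈ le) (at level 70).
Notation "p ∥ r" := (Cmp P le p r) (at level 70).

Let H_P p : H p -> p ∈ P.
Proof. apply HH. Qed.
Let H_up p r : H p -> p ⪯ r -> H r.
Proof.
  intros Hp L. destruct HH as (_ & _ & U & _). apply (U p); auto; [apply (su_dom SU L)|now apply rel_opr].
Qed.
Let H_dir p r : H p -> H r -> exists s, H s /\ s ⪯ p /\ s ⪯ r.
Proof.
  intros Hp Hr. destruct HH as (_ & _ & _ & U & _). destruct (U p r Hp Hr) as (s & Hs & ? & ?).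
  exists s. rewrite <- !rel_opr. auto.
Qed.
Let H_Cmp p r : H p -> H r -> p ∥ r.
Proof. intros Hp Hr. destruct (H_dir Hp Hr) as (s & Hs & ? & ?). exists s. auto. Qed.
Let H_meets (F : zset -> Prop) : D V V (fun e => F (e 0)) ->
  (forall r, r ∈ P -> exists s, s ⪯ r /\ F s) -> exists r, H r /\ F r.
Proof.
  intros HD HF. destruct HH as (_ & _ & _ & _ & U). destruct (U (sep P F)) as (d & Hd & K).
  - apply (W_sep Z); auto. apply SU.
  - intros d Hd. now apply mem_sep in Hd.
  - intros p Pp. destruct (HF p Pp) as (s & L & Fs). exists s. rewrite mem_sep, rel_opr. split; auto. split; auto.
    apply (su_dom SU L).
  - apply mem_sep in Hd. exists d. tauto.
Qed.

(** A set dense in [N ∩ P] is predense below [q], so the conditions below one of its elements,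
    together with those incompatible with [q], are dense in [P]; since [q] is in H, H meets the
    former. *)
Lemma HN_meets D0 : V D0 -> (forall d, d ∈ D0 -> d ∈ a) -> (forall p, p ∈ a -> exists d, d ∈ D0 /\ d ⪯ p) ->
  exists d, d ∈ D0 /\ H d.
Proof.
  intros VD S1 S2. pose proof (zf_ctx Z) as X. pose proof (su_P SU) as VP. pose proof (su_le SU) as Vle. pose proof (Vq SU) as Vq'.
  destruct (@H_meets (fun r => (exists d, d ∈ D0 /\ r ⪯ d) \/ ~ r ∥ q)) as (r & Hr & [(d & Hd & L)|C]).
  - ds.
  - intros r Pr. destruct (classic (r ∥ q)) as [(z & Pz & L1 & L2)|C].
    + destruct (proj2 (proj1 (su_usg SU)) D0 VD) with (r := z) as (d & Hd & z' & Pz' & L3 & L4); auto.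
      * intros d Hd. now apply (mem_a P N d), S1.
      * intros p Pp Np. apply S2. now apply (mem_a P N p).
      * exists z'. split; [exact (le_tr SU L3 L1)|]. left. eauto.
    + exists r. split; auto. now apply (su_refl SU).
  - exists d. split; auto. exact (H_up Hr L).
  - exfalso. apply C. now apply H_Cmp.
Qed.

Lemma HN_generic : generic V (fun p => p ∈ a) le HN.
Proof.
  split; [|split; [|split; [|split]]].
  - intros p [Hp Np]. apply (mem_a P N p). auto.
  - destruct (@HN_meets a) as (d & Hd & K); auto.
    + exact (W_a SU).
    + intros p Hp. exists p. split; auto. apply (su_refl SU). now apply (mem_a P N p).
    + exists d. split; auto. now apply (mem_a P N d).
  - intros p r [Hp Np] Ar L. apply rel_opr in L. split; [exact (H_up Hp L)|]. now apply (mem_a P N r).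
  (* A common extension in H need not be in [N], but it lies below the greatest lower bound found in
     [N], which is therefore in H. *)
  - intros p r [Hp Np] [Hr Nr]. destruct (su_Nglb SU Np Nr (H_Cmp Hp Hr)) as (w & Nw & Pw & L1 & L2 & U).
    destruct (H_dir Hp Hr) as (s & Hs & L3 & L4). exists w. rewrite !rel_opr. split; [split; auto|auto].
    apply (@H_up s); auto.
  - intros D0 VD S1 S2. destruct (@HN_meets D0) as (d & Hd & K); auto.
    + intros p Ap. destruct (S2 p Ap) as (d & Hd & L). apply rel_opr in L. eauto.
    + exists d. split; auto. split; auto. now apply (mem_a P N d), S1.
Qed.

Let g := sep a HN.
Let M1 := extension V HN.
Let Q := quot P le N q HN.
Let K : class := fun r => H r /\ r ⪯ q.
Let Va : V a := W_a SU.
Let Vle : V le := su_le SU.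

Let g_H p : p ∈ g <-> H p /\ p ∈ N.
Proof.
  unfold g. rewrite mem_sep. split; [intros [_ []]; auto|]. intros [Hp Np]. split; [|split; auto]. apply (mem_a P N p). auto.
Qed.

Lemma K_quot r : K r -> r ∈ Q.
Proof.
  intros [Hr L]. apply (mem_quot SU HN). split; auto. intros s Hs. apply H_Cmp; auto. now apply g_H.
Qed.

Lemma quotient_quot : quotient P le q HN = fun r => r ∈ Q.
Proof.
  extensionality r. apply propositional_extensionality. unfold Q. rewrite (mem_quot SU HN).
  unfold quotient. rewrite rel_opr. split.
  - intros (Pr & L & C). split; auto. intros s Hs. apply compatible_Cmp, C. now apply g_H.
  - intros (L & C). split; [apply (su_dom SU L)|]. split; auto. intros s Hs. apply compatible_Cmp, C. now apply g_H.
Qed.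

(** A dense subset of the quotient is the value of a name [D0]. Its density makes some [s] in H ∩ N
    exclude the failure [E1]; then, below [s] and [q], the conditions lying under some [d] and under
    a condition of [N] forcing [d] into [D0] are dense in [P]. This set belongs to V, so H meets
    it. *)
Lemma K_generic : generic M1 (fun r => r ∈ Q) le K.
Proof.
  pose proof (zf_ctx Z) as X. pose proof (su_P SU) as VP. pose proof (su_N SU) as VN. pose proof (Vq SU) as Vq'.
  pose proof Vle as Vle'. pose proof Va as Va'.
  split; [|split; [|split; [|split]]].
  - exact K_quot.
  - exists q. split; auto. apply (su_refl SU). exact (Pq SU).
  - intros p r [Hp _] Qr L. apply rel_opr in L. split; [exact (H_up Hp L)|].
    now apply (mem_quot SU HN) in Qr.
  - intros p r [Hp Lp] [Hr Lr]. destruct (H_dir Hp Hr) as (s & Hs & L3 & L4). exists s. rewrite !rel_opr.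
    split; auto. split; auto. exact (le_tr SU L3 Lp).
  - intros F MF S1 S2. apply (ext_iff HN_generic) in MF. fold a in MF. fold g in MF. destruct MF as (D0 & VD & EF).
    set (E1 := fun t => exists r, r ∈ P /\ r ⪯ q /\ res P le N t r /\
      ~ exists d, d ∈ P /\ d ⪯ r /\ exists t', t' ∈ a /\ t' ⪯ t /\ fmem a le t' (chk a d) D0 /\ res P le N t' d).
    destruct (decide_ext Z Va Vle (a_preorder SU) HN_generic E1) as [(t & Ht & r & Pr & Lr & Rr & C)|(s & Hs & C)].
    { unfold E1, res. ds. }
    { exfalso. apply C. destruct (S2 r) as (d & Hd & Ld).
      { exact (quot_intro SU HN_generic Lr Ht Rr). }
      apply rel_opr in Ld. pose proof (S1 d Hd) as Qd. destruct (su_dom SU Ld) as [Pd _]. assert (Vd := W_mem Z VP Pd).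
      exists d. split; auto. split; auto. rewrite EF in Hd. apply (truth_chk SU HN_generic) in Hd; auto.
      destruct Hd as (p & Hp & Kp). destruct (g_dir' HN_generic Ht Hp) as (t1 & Ht1 & L1 & L2).
      destruct (quot_residue_below SU HN_generic Qd Ht1) as (t2 & Ht2 & L3 & R2).
      exists t2. split; [exact (g_a Ht2)|]. split; [exact (le_tr SU L3 L1)|]. split; auto.
      apply fmem_mono with (p := p); auto; [apply (a_preorder SU)|exact (g_a Ht2)|exact (le_tr SU L3 L2)]. }
    assert (As : s ∈ a) by exact (g_a Hs). assert (Vs := W_mem Z Va As).
    destruct (@H_meets (fun w => ~ w ∥ q \/ ~ w ∥ s \/ exists d, d ∈ P /\ w ⪯ d /\ exists t, t ∈ a /\ w ⪯ t /\ fmem a le t (chk a d) D0))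
      as (w & Hw & [Cw|[Cw|(d & Pd & Ld & t & At & Lt & Kt)]]).
    + ds.
    + intros r Pr. destruct (classic (r ∥ q)) as [(r1 & Pr1 & L1 & L2)|Cr]; [|exists r; split; auto; now apply (su_refl SU)].
      destruct (classic (r1 ∥ s)) as [(r2 & Pr2 & L3 & L4)|Cr]; [|exists r1; auto].
      destruct (@residueN_below V P le N q SU r2 s) as (u & Au & Lu & Ru); auto; [exact (le_tr SU L3 L2)|].
      assert (H1 : exists d, d ∈ P /\ d ⪯ r2 /\ exists t', t' ∈ a /\ t' ⪯ u /\ fmem a le t' (chk a d) D0 /\ res P le N t' d).
      { apply NNPP. intro B. apply (C u); auto. exists r2. split; auto. split; [exact (le_tr SU L3 L2)|]. auto. }
      destruct H1 as (d & Pd & Ld & t' & At' & Lt' & Kt' & Rt').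
      destruct (res_Cmp SU Rt') as (w & Pw & L5 & L6). exists w.
      split; [exact (le_tr SU L6 (le_tr SU Ld (le_tr SU L3 L1)))|]. right. right. exists d. split; auto. split; auto. eauto.
    + exfalso. apply Cw. now apply H_Cmp.
    + exfalso. apply Cw. apply H_Cmp; auto. now apply g_H.
    + assert (Vd := W_mem Z VP Pd). exists d.
      assert (Hd : d ∈ F).
      { rewrite EF. apply (truth_chk SU HN_generic); auto. exists t. split; auto. apply g_H.
        split; [exact (H_up Hw Lt)|]. now apply (mem_a P N t). }
      split; auto. split; [exact (H_up Hw Ld)|]. apply S1 in Hd. now apply (mem_quot SU HN) in Hd.
Qed.

Lemma quot_preorder : preorder Q le.
Proof.
  split.
  - intros p Hp. apply (mem_quot SU HN) in Hp. apply (su_refl SU). apply (su_dom SU (proj1 Hp)).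
  - intros p r s _ _ _. apply (su_trans SU).
Qed.

Lemma P_preorder : preorder P le.
Proof. split; [apply (su_refl SU)|intros p r s _ _ _; apply (su_trans SU)]. Qed.

(** By [ext_least] each model is contained in any other that has its ground model and its filter, so
    each filter only has to be found in the other model. *)
Lemma factor x : extension V H x <-> extension M1 K x.
Proof.
  pose proof (su_P SU) as VP.
  assert (Z1 : zf M1) by exact (ext_zf' SU HN_generic).
  assert (MQ : M1 Q) by exact (M_quot SU HN_generic).
  assert (Mle : M1 le) by exact (ground_sub' SU HN_generic le Vle).
  assert (V1 : forall y, V y -> M1 y) by exact (ground_sub' SU HN_generic).
  assert (ZH : zf (extension V H)) by exact (ext_zf Z VP Vle P_preorder HH).
  assert (ZK : zf (extension M1 K)) by exact (ext_zf Z1 MQ Mle quot_preorder K_generic).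
  assert (VH : forall y, V y -> extension V H y) by exact (ground_sub Z VP HH).
  assert (VK : forall y, M1 y -> extension M1 K y) by exact (ground_sub Z1 MQ K_generic).
  assert (Hh : extension V H (sep P H)) by exact (M_g Z VP HH).
  assert (Hk : extension M1 K (sep Q K)) by exact (M_g Z1 MQ K_generic).
  split.
  - apply (ext_least HH ZK); [auto|]. 
    (* H is recovered as the upward closure of K, because [q] is in H. *)
    replace (sep P H) with (sep P (fun p => exists r, r ∈ sep Q K /\ r ⪯ p)).
    + pose proof (zf_ctx ZK) as XK. assert (extension M1 K le) by auto. apply (W_sep ZK); [ds|auto].
    + apply zset_ext. intro p. rewrite !mem_sep. split; intros [Pp Hp]; split; auto.
      * destruct Hp as (r & Hr & L). apply mem_sep in Hr. destruct Hr as [_ [Hr _]]. exact (H_up Hr L).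
      * destruct (H_dir Hp Hq) as (r & Hr & L1 & L2). exists r. split; auto. apply mem_sep.
        assert (Kr : K r) by (split; auto). split; auto. now apply K_quot.
  - pose proof (zf_ctx ZH) as XH. assert (Hle : extension V H le) by auto.
    assert (HVq : extension V H q) by (apply VH, (Vq SU)). assert (HVN : extension V H N) by (apply VH, SU).
    apply (ext_least K_generic ZH).
    + apply (ext_least HN_generic ZH); auto.
      replace (sep _ HN) with (sep (sep P H) (fun p => p ∈ N)); [apply (W_sep ZH); auto; ds|].
      apply zset_ext. intro p. fold a. fold g. rewrite !mem_sep, g_H. split; [tauto|]. intros []. auto.
    + replace (sep Q K) with (sep (sep P H) (fun p => p ⪯ q)); [apply (W_sep ZH); auto; ds|].
      apply zset_ext. intro p. rewrite !mem_sep. split.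
      * intros [[Pp Hp] L]. assert (Kp : K p) by (split; auto). split; auto. now apply K_quot.
      * intros [_ [Hp L]]. auto.
Qed.

Theorem generic_factor : generic V (restr N P) le HN /\
  (exists K : class, generic (extension V HN) (quotient P le q HN) le K /\
     (forall x, extension V H x <-> extension (extension V HN) K x)) /\
  omega1_approximation (extension V HN) (extension V H).
Proof.
  split; [rewrite restr_below; exact HN_generic|]. split.
  - exists K. rewrite quotient_quot. split; [exact K_generic|exact factor].
  - replace (extension V H) with (extension M1 K).
    + apply (@omega1_approx M1) with (Q := Q) (le := le).
      * exact (ext_zf' SU HN_generic).
      * exact (ext_choice' SU HN_generic).
      * exact (M_quot SU HN_generic).
      * exact (ground_sub' SU HN_generic le Vle).
      * exact quot_preorder.
      * exact (quotient_usg SU HN_generic).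
      * exact K_generic.
    + extensionality x. apply propositional_extensionality. symmetry. apply factor.
Qed.
End Factor.

(** * Countable elementary submodels *)

(** Finite lists increasing to all formulas; together with [tuples] they present the hull as a
    countable union of finite stages. *)
Fixpoint formulas (n : nat) : list pure :=
  match n with
  | 0 => []
  | S m => formulas m ++ [Bot] ++
      flat_map (fun i => flat_map (fun j => [Mem i j; Equ i j]) (seq 0 m)) (seq 0 m) ++
      flat_map (fun f => map (Imp f) (formulas m)) (formulas m) ++
      flat_map (fun i => map (All i) (formulas m)) (seq 0 m)
  end.

Lemma formulas_S m : formulas (S m) = formulas m ++ [Bot] ++
  flat_map (fun i => flat_map (fun j => [Mem i j; Equ i j]) (seq 0 m)) (seq 0 m) ++
  flat_map (fun f => map (Imp f) (formulas m)) (formulas m) ++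
  flat_map (fun i => map (All i) (formulas m)) (seq 0 m).
Proof. reflexivity. Qed.

Lemma formulas_mono m n : m <= n -> incl (formulas m) (formulas n).
Proof. intro H. induction H; intros f Hf; auto. cbn. apply in_or_app. left. now apply IHle. Qed.

Lemma formulas_all (f : pure) : exists n, In f (formulas n).
Proof.
  induction f as [i j|i j|s| |f1 [n1 H1] f2 [n2 H2]|i f [n H]].
  - exists (S (S (i + j))). rewrite formulas_S. do 2 (apply in_or_app; right). apply in_or_app. left.
    apply in_flat_map. exists i. split; [apply in_seq; lia|]. apply in_flat_map. exists j. split; [apply in_seq; lia|].
    cbn. auto.
  - exists (S (S (i + j))). rewrite formulas_S. do 2 (apply in_or_app; right). apply in_or_app. left.
    apply in_flat_map. exists i. split; [apply in_seq; lia|]. apply in_flat_map. exists j. split; [apply in_seq; lia|].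
    cbn. auto.
  - destruct s.
  - exists 1. cbn. auto.
  - exists (S (n1 + n2)). rewrite formulas_S. do 3 (apply in_or_app; right). apply in_or_app. left.
    apply in_flat_map. exists f1. split; [apply (@formulas_mono n1); auto; lia|]. apply in_map.
    apply (@formulas_mono n2); auto; lia.
  - exists (S (S (n + i))). rewrite formulas_S. do 4 (apply in_or_app; right).
    apply in_flat_map. exists i. split; [apply in_seq; lia|]. apply in_map. apply (@formulas_mono n); auto; lia.
Qed.

Fixpoint tuples (l : list zset) (n : nat) : list (list zset) :=
  match n with 0 => [[]] | S m => flat_map (fun x => map (cons x) (tuples l m)) l end.

Lemma tuples_all l xs : incl xs l -> In xs (tuples l (length xs)).
Proof.
  induction xs as [|x xs IH]; intro H; cbn; auto. apply in_flat_map. exists x. split; [apply H; cbn; auto|].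
  apply in_map, IH. intros y Hy. apply H. cbn. auto.
Qed.

Section Lowenheim.
Variable V : class.
Hypothesis Z : zf V.
Variable seeds : list zset.
Hypothesis Vseeds : forall x, In x seeds -> V x.

(** A Skolem function chosen in the background, outside V. Variable 0 is the one to be witnessed,
    whatever entry the list has for it. *)
Definition witness (f : pure) (xs : list zset) : zset :=
  epsilon (inhabits zempty) (fun x => V x /\
    ((exists y, V y /\ psat V (upd (fun k => nth k xs zempty) 0 y) f) -> psat V (upd (fun k => nth k xs zempty) 0 x) f)).

Lemma witness_spec f xs : V (witness f xs) /\
  ((exists y, V y /\ psat V (upd (fun k => nth k xs zempty) 0 y) f) ->
   psat V (upd (fun k => nth k xs zempty) 0 (witness f xs)) f).
Proof.
  unfold witness. apply epsilon_spec.
  destruct (classic (exists y, V y /\ psat V (upd (fun k => nth k xs zempty) 0 y) f)) as [(y & Vy & H)|N].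
  - exists y. auto.
  - exists zempty. split; [apply Z|tauto].
Qed.

Fixpoint stage (n : nat) : list zset :=
  match n with
  | 0 => zempty :: seeds
  | S m => stage m ++ flat_map (fun f => map (witness f) (tuples (stage m) (bound f))) (formulas m)
  end.

Definition hull : class := fun x => exists n, In x (stage n).

Lemma stage_mono m n : m <= n -> incl (stage m) (stage n).
Proof. intro H. induction H; intros x Hx; auto. cbn. apply in_or_app. left. now apply IHle. Qed.

Lemma hull_sub x : hull x -> V x.
Proof.
  intros [n H]. revert x H. induction n as [|n IH]; intros x H.
  - cbn in H. destruct H as [<-|H]; auto. apply Z.
  - cbn in H. apply in_app_or in H. destruct H as [H|H]; auto. apply in_flat_map in H. destruct H as (f & _ & H).
    apply in_map_iff in H. destruct H as (xs & <- & _). apply witness_spec.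
Qed.

Lemma hull_seeds x : In x seeds -> hull x.
Proof. intro H. exists 0. cbn. auto. Qed.

Lemma hull_empty : hull zempty.
Proof. exists 0. cbn. auto. Qed.

Lemma hull_list (c : nat -> zset) n : (forall k, hull (c k)) -> exists m, incl (map c (seq 0 n)) (stage m).
Proof.
  intro H. induction n as [|n [m IH]].
  - exists 0. intros x [].
  - destruct (H n) as [m' Hm']. exists (m + m'). rewrite seq_S, map_app. intros x Hx. apply in_app_or in Hx.
    destruct Hx as [Hx|[<-|[]]].
    + apply (@stage_mono m); auto; lia.
    + cbn. apply (@stage_mono m'); auto; lia.
Qed.

Lemma hull_ctx : dctx V hull.
Proof. split; [apply Z|exact hull_sub|exists zempty; exact hull_empty]. Qed.

Lemma hull_elem (P : zset -> Prop) : D V hull (fun e => P (e 0)) -> (exists x, V x /\ P x) -> exists x, hull x /\ P x.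
Proof.
  intros (f & c & Hc & H) (y & Vy & Py).
  (* The parameters of the formula, with [zempty] at the remaining places, become a finite list once
     cut off at [bound f]. *)
  set (c' := mix (fun _ => zempty) c).
  assert (Hc' : forall k, hull (c' k)).
  { intro k. unfold c', mix. destruct (Nat.even k); auto. apply hull_empty. }
  assert (E : forall x, V x -> (psat V (upd (fun k => nth k (map c' (seq 0 (bound f))) zempty) 0 x) f <-> P x)).
  { intros x Vx. rewrite (H (upd (fun _ => zempty) 0 x)) by (apply in_class_upd; auto; intro; apply Z).
    apply sat_ext. intros k Hk.
    assert (Ek : nth k (map c' (seq 0 (bound f))) zempty = c' k).
    { rewrite (nth_indep _ zempty (c' 0)) by (rewrite length_map, length_seq; auto).
      rewrite (map_nth c'), seq_nth by auto. reflexivity. }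
    unfold upd at 1. rewrite Ek. unfold c'. induction k as [k|k] using even_odd_ind.
    - rewrite !mix_even. unfold upd. destruct k; reflexivity.
    - rewrite !mix_odd. reflexivity. }
  destruct (@hull_list c' (bound f) Hc') as [m Hm]. destruct (formulas_all f) as [n Hn].
  destruct (@witness_spec f (map c' (seq 0 (bound f)))) as [Vw Hw].
  exists (witness f (map c' (seq 0 (bound f)))). split.
  - exists (S (m + n)). cbn [stage]. apply in_or_app. right. apply in_flat_map. exists f.
    split; [apply (@formulas_mono n); auto; lia|]. apply in_map.
    assert (Len : bound f = length (map c' (seq 0 (bound f)))) by (rewrite length_map, length_seq; auto).
    rewrite Len at 2. apply tuples_all. intros x Hx. apply (@stage_mono m); [lia|auto].
  - apply E; auto. apply Hw. exists y. split; auto. now apply E.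
Qed.

(** Each number codes a stage and a position in that finite list. *)
Lemma hull_enum : exists u : nat -> zset, forall x, hull x -> exists n, u n = x.
Proof.
  exists (fun n => nth (snd (of_nat n)) (stage (fst (of_nat n))) zempty). intros x [n H].
  apply (In_nth _ _ zempty) in H. destruct H as (k & _ & E). exists (to_nat (n, k)). rewrite cancel_of_to. exact E.
Qed.
End Lowenheim.

(** * The transitive collapse of an elementary submodel *)

Section Collapse.
Variables V C : class.
Hypothesis Z : zf V.
Hypothesis X : dctx V C.
Hypothesis elem : forall P : zset -> Prop, D V C (fun e => P (e 0)) -> (exists x, V x /\ P x) -> exists x, C x /\ P x.

Definition collapse (C0 : class) : zset -> zset := trec (fun x g => gim g (sep x C0)).
Local Notation π := (collapse C).
Definition collapse_class (C0 : class) : class := fun y => exists x, C0 x /\ y = collapse C0 x.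
Let W := collapse_class C.

Lemma mem_collapse x z : z ∈ π x <-> exists y, y ∈ x /\ C y /\ z = π y.
Proof.
  unfold collapse at 1. rewrite trec_eq, gim_graph by (intros y Hy; apply mem_sep in Hy; now apply tc_sub).
  fold (collapse C). rewrite mem_img. split.
  - intros (y & Hy & ->). apply mem_sep in Hy. exists y. tauto.
  - intros (y & Hy & Cy & ->). exists y. rewrite mem_sep. auto.
Qed.

Let CV x : C x -> V x := @dctx_sub V C X x.
Let CTD c : TD V C (fun _ => c) -> C c.
Proof. exact (@C_TD V C X elem c). Qed.

(** Sets of [C] that differ at all differ at an element of [C], by elementarity; this makes the
    collapse injective. *)
Lemma C_ext x y : C x -> C y -> (forall z, C z -> (z ∈ x <-> z ∈ y)) -> x = y.
Proof.
  intros Cx Cy H. apply NNPP. intro N.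
  destruct (@elem (fun z => ~ (z ∈ x <-> z ∈ y))) as (z & Cz & K); [ds| |exact (K (H z Cz))].
  apply NNPP. intro B. apply N. apply zset_ext. intro z. apply NNPP. intro K. apply B. exists z. split; auto.
  destruct (classic (z ∈ x)) as [L|L]; [exact (W_mem Z (CV Cx) L)|].
  destruct (classic (z ∈ y)) as [L'|L']; [exact (W_mem Z (CV Cy) L')|tauto].
Qed.

Lemma collapse_inj x : forall y, C x -> C y -> π x = π y -> x = y.
Proof.
  induction x as [x IH] using mem_ind. intros y Cx Cy E. apply C_ext; auto. intros z Cz. split; intro Hz.
  - assert (K : π z ∈ π y) by (rewrite <- E; apply mem_collapse; eauto).
    apply mem_collapse in K. destruct K as (z' & Hz' & Cz' & E'). apply IH in E'; auto. now subst.
  - assert (K : π z ∈ π x) by (rewrite E; apply mem_collapse; eauto).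
    apply mem_collapse in K. destruct K as (z' & Hz' & Cz' & E'). symmetry in E'. apply IH in E'; auto. now subst.
Qed.

Lemma collapse_mem x y : C x -> C y -> (π x ∈ π y <-> x ∈ y).
Proof.
  intros Cx Cy. rewrite mem_collapse. split.
  - intros (z & Hz & Cz & E). apply collapse_inj in E; auto. now subst.
  - intro H. eauto.
Qed.

Lemma W_π x : C x -> W (π x).
Proof. intro H. exists x. auto. Qed.

Lemma collapse_names e : in_class W e -> exists ε, in_class C ε /\ e = fun i => π (ε i).
Proof.
  intro He. exists (fun i => proj1_sig (constructive_indefinite_description _ (He i))). split.
  - intro i. destruct (constructive_indefinite_description _ (He i)) as (s & ? & ?). auto.
  - extensionality i. destruct (constructive_indefinite_description _ (He i)) as (s & ? & ?). auto.
Qed.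

Lemma upd_π e i s : upd (fun j => π (e j)) i (π s) = fun j => π (upd e i s j).
Proof. extensionality j. unfold upd. now destruct (Nat.eqb j i). Qed.

Lemma D_psat_upd f e i : in_class C e -> D V C (fun e' => psat V (upd e i (e' 0)) f).
Proof.
  intro He. apply (D_ext X) with (Psi := fun e' => psat V (fun j => match (if Nat.eqb j i then inl 0 else inr (e j)) with inl k => e' k | inr c => c end) f).
  - intros e' _. match goal with |- psat _ ?u _ <-> psat _ ?v _ => replace u with v; [reflexivity|] end.
    extensionality j. unfold upd. now destruct (Nat.eqb j i).
  - apply (D_psat X). intros j c. destruct (Nat.eqb j i); intro Q; inversion Q; subst; auto.
Qed.

Lemma collapse_sat f : forall e, in_class C e -> (psat W (fun i => π (e i)) f <-> psat V e f).
Proof.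
  induction f as [i j|i j|s| |f1 IH1 f2 IH2|i f IH]; intros e He; unfold psat in *; cbn [sat].
  - apply collapse_mem; auto.
  - split; [apply collapse_inj; auto|congruence].
  - destruct s.
  - reflexivity.
  - rewrite IH1, IH2 by auto. reflexivity.
  - split.
    + intro H. apply NNPP. intro N. destruct (@elem (fun x => ~ psat V (upd e i x) f)) as (x & Cx & K).
      * pose proof (D_psat_upd f i He). ds.
      * apply NNPP. intro B. apply N. intros x Vx. apply NNPP. intro K. apply B. eauto.
      * apply K. apply (IH (upd e i x)); [now apply in_class_upd|]. rewrite <- upd_π. apply H. now apply W_π.
    + intros H x (x0 & Cx & ->). rewrite upd_π. apply IH; [now apply in_class_upd|]. apply H. auto.
Qed.

Lemma collapse_upair x y : C x -> C y -> C (upair x y) /\ π (upair x y) = upair (π x) (π y).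
Proof.
  intros Cx Cy. split; [apply CTD; ds|]. apply zset_ext. intro z. rewrite mem_collapse, mem_upair. split.
  - intros (u & Hu & _ & ->). apply mem_upair in Hu. destruct Hu as [-> | ->]; auto.
  - intros [-> | ->]; [exists x|exists y]; rewrite mem_upair; auto.
Qed.

Lemma collapse_opr x y : C x -> C y -> C (opr x y) /\ π (opr x y) = opr (π x) (π y).
Proof.
  intros Cx Cy. destruct (collapse_upair Cx Cx) as [C1 E1], (collapse_upair Cx Cy) as [C2 E2].
  destruct (collapse_upair C1 C2) as [C3 E3]. split; [exact C3|]. unfold opr, sing. rewrite E3, E1, E2. reflexivity.
Qed.

Lemma collapse_sep P x : D V C (fun e => P (e 0)) -> C x -> C (sep x P) /\ forall z, z ∈ π (sep x P) <-> exists y, y ∈ x /\ C y /\ P y /\ z = π y.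
Proof.
  intros HP Cx. split; [exact (@C_sep V C Z X elem P x HP Cx)|]. intro z. rewrite mem_collapse. split.
  - intros (y & Hy & Cy & ->). apply mem_sep in Hy. exists y. tauto.
  - intros (y & Hy & Cy & Py & ->). exists y. rewrite mem_sep. auto.
Qed.

Lemma num_C n : C (num n).
Proof. induction n as [|n IH]; cbn; apply CTD; ds. Qed.

Lemma collapse_num n : π (num n) = num n.
Proof.
  induction n as [n IH] using lt_wf_ind. apply zset_ext. intro z. rewrite mem_collapse, mem_num. split.
  - intros (y & Hy & _ & ->). apply mem_num in Hy. destruct Hy as (m & Hm & ->). exists m. auto.
  - intros (m & Hm & ->). exists (num m). rewrite mem_num, IH by auto. split; eauto. split; auto. apply num_C.
Qed.

Lemma collapse_tr : transitive_class W.
Proof.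
  intros x y (y0 & Cy & ->) Hx. apply mem_collapse in Hx. destruct Hx as (x0 & _ & Cx & ->). now apply W_π.
Qed.

(** Each operation is computed in V, stays in [C] by definability and commutes with the collapse;
    elementarity supplies the elements of [C] that witness unions, failures of inclusion and values
    for replacement. *)
Lemma collapse_zf : zf W.
Proof.
  split.
  - exact collapse_tr.
  - change (W (num 0)). rewrite <- collapse_num. apply W_π, num_C.
  - intros x y (x0 & Cx & ->) (y0 & Cy & ->). destruct (collapse_upair Cx Cy) as [C1 E]. rewrite <- E. now apply W_π.
  - intros x (x0 & Cx & ->). assert (C1 : C (Un x0)) by (apply CTD; ds).
    replace (Un (π x0)) with (π (Un x0)); [now apply W_π|]. apply zset_ext. intro z. rewrite mem_collapse, mem_Un. split.
    + intros (y & Hy & Cy & ->). destruct (@elem (fun u => u ∈ x0 /\ y ∈ u)) as (u & Cu & Hu & Hyu).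
      * ds.
      * apply mem_Un in Hy. destruct Hy as (u & Hu & Hyu). exists u. split; auto. exact (W_mem Z (CV Cx) Hu).
      * exists (π u). split; now apply collapse_mem.
    + intros (u & Hu & Hz). apply mem_collapse in Hu. destruct Hu as (u0 & Hu & Cu & ->).
      apply mem_collapse in Hz. destruct Hz as (y & Hy & Cy & ->). exists y. split; auto. apply mem_Un. eauto.
  - intros x (x0 & Cx & ->). assert (C1 : C (sep (pow x0) V)) by (apply CTD; ds).
    replace (sep (pow (π x0)) W) with (π (sep (pow x0) V)); [now apply W_π|].
    apply zset_ext. intro z. rewrite mem_collapse, mem_sep, mem_pow. split.
    + intros (y & Hy & Cy & ->). rewrite mem_sep, mem_pow in Hy. split; [|now apply W_π]. intros u Hu.
      apply mem_collapse in Hu. destruct Hu as (u0 & Hu & Cu & ->). apply collapse_mem; auto. now apply Hy.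
    + intros (Hz & y & Cy & ->). exists y. split; auto. rewrite mem_sep, mem_pow. split; auto.
      intros u Hu. apply NNPP. intro N. destruct (@elem (fun u => u ∈ y /\ ~ u ∈ x0)) as (v & Cv & Hv & Nv).
      * ds.
      * exists u. split; auto. exact (W_mem Z (CV Cy) Hu).
      * apply Nv. apply (collapse_mem Cv Cx). apply Hz. now apply collapse_mem.
  - assert (C1 : C omega) by (apply CTD; ds). replace omega with (π omega); [now apply W_π|].
    apply zset_ext. intro z. rewrite mem_collapse, mem_omega. split.
    + intros (y & Hy & _ & ->). apply mem_omega in Hy. destruct Hy as [n ->]. exists n. apply collapse_num.
    + intros [n ->]. exists (num n). rewrite collapse_num. split; [apply num_in_omega|]. split; auto. apply num_C.
  - intros f e x He (x0 & Cx & ->). destruct (collapse_names He) as (ε & Cε & Ee). rewrite Ee. clear e He Ee.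
    destruct (@collapse_sep (fun y => psat V (upd ε 0 y) f) x0 (D_psat_upd f 0 Cε) Cx) as [C1 E].
    replace (sep (π x0) _) with (π (sep x0 (fun y => psat V (upd ε 0 y) f))); [now apply W_π|].
    apply zset_ext. intro z. rewrite E, mem_sep, mem_collapse. split.
    + intros (y & Hy & Cy & K & ->). split; eauto. rewrite upd_π. apply collapse_sat; auto. now apply in_class_upd.
    + intros ((y & Hy & Cy & ->) & K). exists y. split; auto. split; auto. split; auto. rewrite upd_π in K.
      apply collapse_sat in K; auto. now apply in_class_upd.
  - intros f e x He (x0 & Cx & ->) HF. destruct (collapse_names He) as (ε & Cε & Ee).
    rewrite Ee in HF. rewrite Ee. clear e He Ee.
    set (R := fun u v => psat V (upd (upd ε 0 u) 1 v) f).
    assert (DR : D V C (fun e => R (e 0) (e 1))).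
    { unfold R. apply (D_ext X) with (Psi := fun e' => psat V (fun j => match (match j with 0 => inl 0 | 1 => inl 1 | _ => inr (ε j) end) with inl k => e' k | inr c => c end) f).
      - intros e' _. match goal with |- psat _ ?u _ <-> psat _ ?v _ => replace u with v; [reflexivity|] end.
        extensionality j. destruct j as [|[|j]]; reflexivity.
      - apply (D_psat X). intros [|[|j]] c Q; inversion Q; subst; auto. }
    assert (ER : forall u v, C u -> C v -> (psat W (upd (upd (fun i => π (ε i)) 0 (π u)) 1 (π v)) f <-> R u v)).
    { intros u v Cu Cv. rewrite !upd_π. apply collapse_sat. now repeat apply in_class_upd. }
    assert (FV : forall u v v', u ∈ x0 -> V v -> V v' -> R u v -> R u v' -> v = v').
    { intros u v v' Hu Vv Vv' H1 H2. apply NNPP. intro N.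
      (* Functionality is known over the collapse. A counterexample in V would give one in [C], its
         three components being moved into [C] one at a time. *)
      destruct (@elem (fun u => u ∈ x0 /\ exists v, V v /\ exists v', V v' /\ R u v /\ R u v' /\ ~ v = v')) as (u1 & Cu1 & Hu1 & Hex).
      { ds; apply (D_rel2 X R DR); ds. }
      { exists u. split; [exact (W_mem Z (CV Cx) Hu)|]. eauto 10. }
      destruct (@elem (fun v => exists v', V v' /\ R u1 v /\ R u1 v' /\ ~ v = v')) as (v1 & Cv1 & Hex'); [ds; apply (D_rel2 X R DR); ds|auto|].
      destruct (@elem (fun v' => R u1 v1 /\ R u1 v' /\ ~ v1 = v')) as (v2 & Cv2 & K1 & K2 & K3); [ds; apply (D_rel2 X R DR); ds|auto|].
      apply K3. apply collapse_inj; auto. apply (HF (π u1)); try (now apply W_π).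
      - now apply collapse_mem.
      - now apply ER.
      - now apply ER. }
    assert (HE : exists b, V b /\ forall y, V y -> (y ∈ b <-> exists u, u ∈ x0 /\ R u y)).
    { destruct (@W_repl V Z R x0 (D_weaken X DR) (CV Cx) FV) as (b & Vb & Hb). exists b. split; auto.
      intros y Vy. rewrite Hb. tauto. }
    apply elem in HE; [|ds; apply (D_rel2 X R DR); ds]. destruct HE as (b & Cb & Hb).
    exists (π b). split; [now apply W_π|]. intros y (y0 & Cy & ->). rewrite (collapse_mem Cy Cb), Hb by auto. split.
    + intros Hex. destruct (@elem (fun u => u ∈ x0 /\ R u y0)) as (u & Cu & Hu & K).
      * ds. apply (D_rel2 X R DR); ds.
      * destruct Hex as (u & Hu & K). exists u. split; auto. exact (W_mem Z (CV Cx) Hu).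
      * exists (π u). split; [now apply W_π|]. split; [now apply collapse_mem|]. now apply ER.
    + intros (u & (u0 & Cu & ->) & Hu & K). exists u0. split; [now apply (collapse_mem Cu Cx)|]. now apply ER in K.
Qed.

Lemma collapse_choice : zchoice V -> zchoice W.
Proof.
  intros AC x (x0 & Cx & ->) HI HD.
  assert (HE : exists c, V c /\ forall u, u ∈ x0 -> exists y, y ∈ c /\ y ∈ u /\ forall y', y' ∈ c -> y' ∈ u -> y' = y).
  { destruct (AC x0 (CV Cx)) as (c & Vc & Hc).
    - intros u Vu Hu. apply NNPP. intro N.
      destruct (@elem (fun u => u ∈ x0 /\ ~ exists y, V y /\ y ∈ u)) as (u1 & Cu1 & Hu1 & N1); [ds|eauto|].
      destruct (HI (π u1)) as (y & _ & Hy); [now apply W_π|now apply collapse_mem|].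
      apply mem_collapse in Hy. destruct Hy as (y0 & Hy & Cy & ->). apply N1. eauto.
    - intros u u' y Vu Vu' Vy Hu Hu' Hy Hy'. apply NNPP. intro N.
      destruct (@elem (fun u => u ∈ x0 /\ exists u', u' ∈ x0 /\ exists y, y ∈ u /\ y ∈ u' /\ ~ u = u')) as (u1 & Cu1 & Hu1 & Hex); [ds|eauto 10|].
      destruct (@elem (fun u' => u' ∈ x0 /\ exists y, y ∈ u1 /\ y ∈ u' /\ ~ u1 = u')) as (u2 & Cu2 & Hu2 & Hex2).
      { ds. }
      { destruct Hex as (u2 & Hu2 & K). exists u2. split; auto. exact (W_mem Z (CV Cx) Hu2). }
      destruct (@elem (fun y => y ∈ u1 /\ y ∈ u2 /\ ~ u1 = u2)) as (y1 & Cy1 & K1 & K2 & K3).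
      { ds. }
      { destruct Hex2 as (y1 & K1 & K). exists y1. split; auto. exact (W_mem Z (CV Cu1) K1). }
      apply K3, collapse_inj; auto. apply (HD (π u1) (π u2) (π y1)); try (now apply W_π); now apply collapse_mem.
    - exists c. split; auto. intros u Hu. destruct (Hc u (W_mem Z (CV Cx) Hu) Hu) as (y & _ & H1 & H2 & H3).
      exists y. split; auto. split; auto. intros y' Hy' Hy'u. apply H3; auto. exact (W_mem Z Vc Hy'). }
  apply elem in HE; [|ds]. destruct HE as (c & Cc & Hc). exists (π c). split; [now apply W_π|].
  intros u (u0 & Cu & ->) Hu. apply (collapse_mem Cu Cx) in Hu.
  destruct (@elem (fun y => y ∈ c /\ y ∈ u0 /\ forall y', y' ∈ c -> y' ∈ u0 -> y' = y)) as (y & Cy & H1 & H2 & H3).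
  - ds.
  - destruct (Hc u0 Hu) as (y & H1 & K). exists y. split; auto. exact (W_mem Z (CV Cc) H1).
  - exists (π y). split; [now apply W_π|]. split; [now apply collapse_mem|]. split; [now apply collapse_mem|].
    intros y' (y0 & Cy0 & ->) K1 K2. apply (collapse_mem Cy0 Cc) in K1. apply (collapse_mem Cy0 Cu) in K2. f_equal. auto.
Qed.
End Collapse.

(** * Reflection to a countable model *)

Lemma rasiowa_sikorski (W : class) (u : nat -> zset) a le p0 : (forall x, W x -> exists n, u n = x) ->
  preorder a le -> p0 ∈ a -> exists G, generic W (fun p => p ∈ a) le G /\ G p0.
Proof.
  intros Hu [Hr Ht] Hp0.
  (* All elements of the model are enumerated, dense or not; the implication lets the descending
     sequence idle at those that cannot be met densely. *)
  set (good := fun d p r => r ∈ a /\ opr r p ∈ le /\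
    ((forall p, p ∈ a -> exists s, s ∈ a /\ s ∈ d /\ opr s p ∈ le) -> r ∈ d)).
  set (next := fun n p => epsilon (inhabits p0) (good (u n) p)).
  set (c := fix c n := match n with 0 => p0 | S m => next m (c m) end).
  assert (step : forall n p, p ∈ a -> good (u n) p (next n p)).
  { intros n p Hp. unfold next. apply epsilon_spec.
    destruct (classic (forall p, p ∈ a -> exists s, s ∈ a /\ s ∈ u n /\ opr s p ∈ le)) as [H|H].
    - destruct (H p Hp) as (s & ? & ? & ?). exists s. split; auto.
    - exists p. split; auto. split; auto. tauto. }
  assert (ca : forall n, c n ∈ a) by (induction n as [|n IH]; [exact Hp0|apply (step n _ IH)]).
  assert (dec : forall m n, m <= n -> opr (c n) (c m) ∈ le).
  { intros m n H. induction H as [|n H IH]; [now apply Hr|]. apply (Ht _ (c n)); auto. apply (step n _ (ca n)). }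
  exists (fun p => p ∈ a /\ exists n, opr (c n) p ∈ le). split; [|split; auto; exists 0; now apply Hr].
  split; [tauto|]. split; [exists p0; split; auto; exists 0; now apply Hr|]. split; [|split].
  - intros p r (Hp & n & Hn) Hra L. apply rel_opr in L. split; auto. exists n. now apply (Ht _ p).
  - intros p r (Hp & m & Hm) (Hra & n & Hn). exists (c (m + n)). rewrite !rel_opr. split; [|split].
    + split; auto. exists (m + n). now apply Hr.
    + apply (Ht _ (c m)); auto. apply dec. lia.
    + apply (Ht _ (c n)); auto. apply dec. lia.
  - intros d Wd Hd Hdense. destruct (Hu d Wd) as (n & <-). exists (c (S n)). split.
    + apply (step n _ (ca n)). intros p Hp. destruct (Hdense p Hp) as (s & Hs & L). rewrite rel_opr in L. exists s. auto.
    + split; auto. exists (S n). now apply Hr.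
Qed.

(** * The order hypotheses as a formula *)

Definition glb_form (P le w x y : nat) : bform :=
  (w ∈ P /\ Defs.app le w x /\ Defs.app le w y /\
   ALL u ∈ P, (Defs.app le u x ⇒ Defs.app le u y ⇒ Defs.app le u w))%fml.
(** With the order-theoretic fields of [setup] in one formula, [collapse_sat] carries them to the
    collapse. *)
Definition order_form (P le N : nat) : bform :=
  ((ALL x, ALL y, (Defs.app le x y ⇒ (x ∈ P /\ y ∈ P))) /\
   (ALL x ∈ P, Defs.app le x x) /\
   (ALL x, ALL y, ALL z, (Defs.app le x y ⇒ Defs.app le y z ⇒ Defs.app le x z)) /\
   (ALL x, ALL y, (compat P le x y ⇒ EX w, glb_form P le w x y)) /\
   (ALL x, ALL y, ALL z, (compat P le x y ⇒ compat P le x z ⇒ compat P le y z ⇒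
      ALL w, (glb_form P le w y z ⇒ compat P le x w))) /\
   (ALL x ∈ N, ALL y ∈ N, (compat P le x y ⇒ EX w ∈ N, glb_form P le w x y)))%fml.

Ltac pshook ::=
  match goal with
  | |- psat _ _ (Defs.app _ _ _ _) <-> _ => psby psat_app
  | |- psat _ _ (compat _ _ _ _ _) <-> _ => psby psat_compat
  end.
Lemma psat_glb W (Z : zf W) e (He : in_class W e) n i j k l m : i < n -> j < n -> k < n -> l < n -> m < n ->
  (psat W e (glb_form i j k l m n) <-> isglb (e i) (e j) (e k) (e l) (e m)).
Proof. intros. unfold glb_form, isglb. ps. Qed.
Ltac pshook ::=
  match goal with
  | |- psat _ _ (Defs.app _ _ _ _) <-> _ => psby psat_app
  | |- psat _ _ (compat _ _ _ _ _) <-> _ => psby psat_compat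
  | |- psat _ _ (glb_form _ _ _ _ _ _) <-> _ => psby psat_glb
  end.

Lemma psat_order W (Z : zf W) e (He : in_class W e) n i j k : i < n -> j < n -> k < n ->
  let P := e i in let le := e j in let N := e k in
  (psat W e (order_form i j k n) <->
   (forall x y, opr x y ∈ le -> x ∈ P /\ y ∈ P) /\
   (forall x, x ∈ P -> opr x x ∈ le) /\
   (forall x y z, opr x y ∈ le -> opr y z ∈ le -> opr x z ∈ le) /\
   (forall x y, Cmp P le x y -> exists w, isglb P le w x y) /\
   (forall x y z, Cmp P le x y -> Cmp P le x z -> Cmp P le y z ->
     forall w, isglb P le w y z -> Cmp P le x w) /\
   (forall x y, x ∈ N -> y ∈ N -> Cmp P le x y -> exists w, w ∈ N /\ isglb P le w x y)).
Proof.
  intros Hi Hj Hk P le N. etransitivity. { unfold order_form. ps. }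
  fold P le N.
  assert (WL : forall x y, opr x y ∈ le -> W x /\ W y) by (intros x y H; exact (W_opr_inv Z (W_mem Z (He j) H))).
  assert (WC : forall x y, Cmp P le x y -> W x /\ W y).
  { intros x y (z & _ & H1 & H2). split; [apply (WL _ _ H1)|apply (WL _ _ H2)]. }
  assert (WP : forall x, x ∈ P -> W x) by (intros x; exact (W_mem Z (He i))).
  split; intros (H1 & H2 & H3 & H4 & H5 & H6).
  - split; [intros x y H; destruct (WL _ _ H); auto|]. split; auto.
    split; [intros x y z L1 L2; destruct (WL _ _ L1), (WL _ _ L2); eauto|].
    split; [intros x y K; destruct (WC _ _ K) as [Wx Wy]; destruct (H4 x Wx y Wy K) as (w & _ & ?); eauto|].
    split; [|intros x y Nx Ny; now apply H6].
    intros x y z K1 K2 K3 w Hw. destruct (WC _ _ K1) as [Wx Wy], (WC _ _ K2) as [_ Wz].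
    exact (H5 x Wx y Wy z Wz K1 K2 K3 w (WP w (proj1 Hw)) Hw).
  - split; auto. split; auto. split; [intros; eauto|]. split; [|split; [intros; eauto|auto]].
    intros x _ y _ K. destruct (H4 x y K) as (w & Hw). exists w. split; auto. apply WP, Hw.
Qed.

(** * Forcing over the collapse of an elementary submodel *)

Section Reflection.
Variables V C : class.
Hypothesis Z : zf V.
Hypothesis X : dctx V C.
Hypothesis elem : forall P : zset -> Prop, D V C (fun e => P (e 0)) -> (exists x, V x /\ P x) -> exists x, C x /\ P x.
Variables P le N q : zset.
Hypothesis SU : setup V P le N q.
Hypothesis C0 : C zempty.
Hypothesis CP : C P.
Hypothesis Cle : C le.
Hypothesis CN : C N.
Hypothesis Cq : C q.
Local Notation π := (collapse C).
Local Notation W := (collapse_class C).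
Local Notation a := (below_set P N).
Let ZW : zf W := collapse_zf Z X elem.
Let cmem1 x y (Cx : C x) (Cy : C y) : π x ∈ π y -> x ∈ y := proj1 (collapse_mem Z X elem x y Cx Cy).
Let cmem2 x y (Cx : C x) (Cy : C y) : x ∈ y -> π x ∈ π y := proj2 (collapse_mem Z X elem x y Cx Cy).
Let copr := @collapse_opr V C Z X elem.

Let Ca : C a.
Proof. apply (C_sep Z X elem); auto. ds. Qed.

Lemma collapse_setup : setup W (π P) (π le) (π N) (π q).
Proof.
  set (e := env [P; le; N; q]).
  assert (He : in_class C e) by (intros [|[|[|[|[|]]]]]; assumption).
  assert (HeV : in_class V e) by (intro i; apply (dctx_sub X), He).
  assert (HeW : in_class W (fun i => π (e i))) by (intro i; now apply W_π).
  pose proof (collapse_sat Z X elem (order_form 0 1 2 4) He) as H1.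
  rewrite (psat_order ZW HeW), (psat_order Z HeV) in H1 by lia. cbn in H1.
  pose proof (collapse_sat Z X elem (universal_strongly_generic 2 0 1 3 4) He) as H2.
  rewrite (psat_usg ZW HeW), (psat_usg Z HeV) in H2 by lia. cbn in H2.
  pose proof (collapse_sat Z X elem (has_usg_stationary 0 1 4) He) as H3.
  rewrite (psat_has_usg ZW HeW), (psat_has_usg Z HeV) in H3 by lia. cbn in H3.
  destruct SU as [_ AC _ _ _ S1 S2 S3 S4 S5 S6 S7 S8].
  destruct (proj2 H1) as (T1 & T2 & T3 & T4 & T5 & T6); [exact (conj S1 (conj S2 (conj S3 (conj S4 (conj S5 S6)))))|].
  apply Build_setup; auto.
  - exact (collapse_choice Z X elem AC).
  - now apply W_π.
  - now apply W_π.
  - now apply W_π.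
  - now apply H2.
  - now apply H3.
Qed.

Lemma collapse_below : π a = below_set (π P) (π N).
Proof.
  apply zset_ext. intro z. rewrite mem_collapse. unfold below_set. rewrite mem_sep. split.
  - intros (y & Hy & Cy & ->). unfold a, below_set in Hy. apply mem_sep in Hy. destruct Hy. split; apply cmem2; auto.
  - intros [H1 H2]. apply mem_collapse in H1. destruct H1 as (y & Hy & Cy & ->). exists y. split; auto.
    apply mem_sep. split; auto.
Qed.

Variable G : class.
Hypothesis HG : generic W (fun p => p ∈ π a) (π le) G.
(** The preimage of the filter under the collapse: a filter on the conditions in [C], to which the
    truth lemma for [C] applies. *)
Definition lifted : zset := sep a (fun p => C p /\ G (π p)).
Local Notation g := lifted.
Let g1 := sep (π a) G.

Lemma mem_lifted p : p ∈ g <-> C p /\ p ∈ a /\ π p ∈ g1.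
Proof.
  unfold lifted, g1. rewrite !mem_sep. split; [|tauto]. intros (Hp & Cp & Gp). split; auto.
Qed.
Lemma lifted_intro p' : G p' -> exists p, p ∈ g /\ p' = π p.
Proof.
  intro H. assert (Hp : p' ∈ π a) by now apply HG. apply mem_collapse in Hp. destruct Hp as (p & Hp & Cp & ->).
  exists p. split; auto. apply mem_sep. auto.
Qed.
(** [vlc] skips the names outside [C], which are exactly those that the collapse removes. *)
Lemma vlc_collapse s : C s -> vlc C g s = vl g1 (π s).
Proof.
  induction s as [s IH] using tc_ind. intro Cs. apply zset_ext. intro z. rewrite mem_vlc, mem_vl. split.
  - intros (r & p & Hp & Hr & Cr & ->). apply mem_lifted in Hp. destruct Hp as (Cp & _ & Hp).
    exists (π r), (π p). split; auto. split; [|apply IH; auto; eapply opr_left_tc; eauto].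
    destruct (copr Cr Cp) as [C1 E]. rewrite <- E. apply cmem2; auto.
  - intros (r' & p' & Hp & Hr & ->). assert (Ws : W (π s)) by now apply W_π.
    destruct (W_opr_inv ZW (W_mem ZW Ws Hr)) as [(r & Cr & ->) (p & Cp & ->)].
    destruct (copr Cr Cp) as [C1 E]. rewrite <- E in Hr. apply cmem1 in Hr; auto. exists r, p.
    split; [|split; auto; split; auto; symmetry; apply IH; auto; eapply opr_left_tc; eauto].
    apply mem_lifted. split; auto. split; auto. apply mem_sep in Hp. destruct Hp as [Hp _]. apply cmem1 in Hp; auto.
Qed.
Lemma gext_collapse : gext C g = extension W G.
Proof.
  extensionality x. apply propositional_extensionality. rewrite (ext_iff HG). fold g1. unfold gext. split.
  - intros (s & Cs & ->). exists (π s). split; [now apply W_π|]. now apply vlc_collapse.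
  - intros (s' & (s & Cs & ->) & ->). exists s. split; auto. symmetry. now apply vlc_collapse.
Qed.

Let C_chk x : C x -> C (chk a x).
Proof. intro Cx. apply (C_TD X elem). ds. Qed.

Lemma vlc_chk x : C x -> vlc C g (chk a x) = π x.
Proof.
  induction x as [x IH] using mem_ind. intro Cx. apply zset_ext. intro z. rewrite mem_vlc, mem_collapse. split.
  - intros (r & p & Hp & Hr & Cr & ->). apply opr_chk in Hr. destruct Hr as [_ (y & Hy & ->)].
    remember (chk a y) as r eqn:Er.
    (* [y] is only known to be in V; elementarity finds an element of [C] with the same canonical
       name. *)
    destruct (@elem (fun y' => y' ∈ x /\ r = chk a y')) as (y' & Cy' & Hy' & E); [ds| |].
    + exists y. split; auto. exact (W_mem Z (dctx_sub X _ Cx) Hy).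
    + exists y'. rewrite E. auto.
  - intros (y & Hy & Cy & ->). destruct HG as (_ & (p' & Hp') & _). destruct (lifted_intro Hp') as (p & Hp & _).
    exists (chk a y), p. split; auto. rewrite opr_chk. apply mem_lifted in Hp. split; [split; [tauto|eauto]|]. split; auto.
    symmetry. auto.
Qed.
Lemma vlc_gname : vlc C g (gname a) = g1.
Proof.
  apply zset_ext. intro z. rewrite mem_vlc. split.
  - intros (r & p & Hp & Hr & Cr & ->). unfold gname in Hr. apply mem_img in Hr. destruct Hr as (p1 & Hp1 & E).
    apply opr_inj in E. destruct E as [-> <-]. apply mem_lifted in Hp. destruct Hp as (Cp & _ & Hp). now rewrite vlc_chk.
  - intro Hz. apply mem_sep in Hz. destruct Hz as [_ Hz]. destruct (lifted_intro Hz) as (p & Hp & ->).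
    assert (K := Hp). apply mem_lifted in K. destruct K as (Cp & Hpa & _). exists (chk a p), p. split; auto. split; [|split; auto].
    + unfold gname. apply mem_img. eauto.
    + now rewrite vlc_chk.
Qed.

Definition forced_form : bform :=
  fAll (fun Q => fImp (is_quotient Q 0 1 2 3) (has_usg_stationary Q 1)).

(** By the truth lemma it suffices that the extension of the collapse satisfies the formula, and
    there [quotient_usg] applies, the collapse being a [setup] as well. *)
Lemma lifted_forces : exists p, p ∈ g /\ frc V a le (env [chk a P; chk a le; chk a q; gname a]) (forced_form 4) p.
Proof.
  set (e := env [chk a P; chk a le; chk a q; gname a]).
  assert (He : in_class C e).
  { intros [|[|[|[|i]]]]; [now apply C_chk|now apply C_chk|now apply C_chk| |destruct i; exact C0].
    cbn. apply (C_TD X elem). apply (TD_intro X) with (Phi := fun z _ => exists p, p ∈ a /\ z = opr (chk a p) p).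
    - intros _ _. apply (W_gname Z), (W_a SU).
    - intros. apply mem_img.
    - ds. }
  assert (Hpre : preorder a le) by exact (a_preorder SU).
  pose proof collapse_setup as SW.
  assert (HG' := HG). rewrite collapse_below in HG'.
  apply (@truth V C Z X elem a le Ca Cle Hpre g); auto.
  - intros p Hp. apply mem_lifted in Hp. tauto.
  - destruct HG as (_ & (p' & Hp') & _). destruct (lifted_intro Hp') as (p & Hp & _). eauto.
  - intros p r Hp Hr Cr L. apply mem_lifted in Hp. destruct Hp as (Cp & _ & Hp). apply mem_lifted. split; auto. split; auto.
    unfold g1 in *. rewrite mem_sep in *. split; [apply cmem2; auto|]. destruct HG as (_ & _ & U & _). apply (U (π p)); [tauto|apply cmem2; auto|].
    apply rel_opr. destruct (copr Cp Cr) as [C1 E]. rewrite <- E. apply cmem2; auto.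
  - intros p r Hp Hr. apply mem_lifted in Hp, Hr. destruct Hp as (Cp & _ & Hp), Hr as (Cr & _ & Hr).
    apply mem_sep in Hp, Hr. destruct HG as (_ & _ & _ & U & _). destruct (U (π p) (π r)) as (s' & Hs & L1 & L2); [tauto|tauto|].
    destruct (lifted_intro Hs) as (s & Hs' & ->). exists s. split; auto. apply mem_lifted in Hs'. destruct Hs' as (Cs & _).
    rewrite rel_opr in L1, L2. destruct (copr Cs Cp) as [C1 E1], (copr Cs Cr) as [C2 E2]. rewrite <- E1 in L1. rewrite <- E2 in L2.
    split; [apply cmem1 in L1; auto|apply cmem1 in L2; auto].
  - intros d Cd Hd Hdense. destruct HG as (_ & _ & _ & _ & U). destruct (U (π d)) as (p' & Hp' & K).
    + now apply W_π.
    + intros p' Hp'. apply mem_collapse in Hp'. destruct Hp' as (p & Hp & Cp & ->). apply cmem2; auto.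
    + intros p' Hp'. apply mem_collapse in Hp'. destruct Hp' as (p & Hp & Cp & ->).
      destruct (@elem (fun s => s ∈ d /\ opr s p ∈ le)) as (s & Cs & Hs & L); [ds| |].
      * destruct (Hdense p Hp) as (s & Hs & L). exists s. split; auto. exact (W_mem Z (dctx_sub X _ Cd) Hs).
      * exists (π s). rewrite rel_opr. split; [apply cmem2; auto|]. destruct (copr Cs Cp) as [C1 E]. rewrite <- E. apply cmem2; auto.
    + destruct (lifted_intro K) as (p & Hp & ->). exists p. split; auto. apply mem_lifted in Hp. apply cmem1 in Hp'; tauto.
  - rewrite gext_collapse. set (M := extension W G).
    assert (ZM : zf M) by exact (ext_zf' SW HG').
    assert (HeM : in_class M (fun i => vlc C g (e i))).
    { intro i. unfold M. rewrite <- gext_collapse. exists (e i). auto. }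
    assert (E0 : vlc C g (e 0) = π P) by now apply vlc_chk.
    assert (E1 : vlc C g (e 1) = π le) by now apply vlc_chk.
    assert (E2 : vlc C g (e 2) = π q) by now apply vlc_chk.
    assert (E3 : vlc C g (e 3) = g1) by exact vlc_gname.
    unfold forced_form. unfold psat. cbn [fAll fImp sat]. intros Q MQ HQ.
    assert (He' : in_class M (upd (fun i => vlc C g (e i)) 4 Q)) by now apply in_class_upd.
    apply (psat_is_quotient ZM He') in HQ; try lia. apply (psat_has_usg ZM He'); try lia.
    unfold upd in *. cbn [Nat.eqb] in *. rewrite E0, E1, E2, E3 in HQ. rewrite E1.
    replace Q with (quot (π P) (π le) (π N) (π q) G); [exact (quotient_usg SW HG')|].
    apply zset_ext. intro r. rewrite (mem_quot SW), <- collapse_below. fold g1. split.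
    + intros [L K]. apply HQ; [|split; auto; apply (su_dom SW L)]. destruct (su_dom SW L) as [Hr _].
      rewrite <- E0 in Hr. exact (W_mem ZM (HeM 0) Hr).
    + intro Hr. apply HQ in Hr; [tauto|]. exact (W_mem ZM MQ Hr).
Qed.
End Reflection.

Section Forced.
Variable V : class.
Variables P le N q : zset.
Hypothesis SU : setup V P le N q.
Local Notation a := (below_set P N).

Theorem forces_quotient_usg P' le' q' G' :
  check (restr N P) P P' -> check (restr N P) le le' -> check (restr N P) q q' -> gen_name (restr N P) G' ->
  Forced V (restr N P) le [P'; le'; q'; G'] forced_form.
Proof.
  rewrite restr_below. fold a. rewrite !check_chk, gen_name_gname. intros -> -> -> -> p Hp.
  pose proof (su_zf SU) as Z.
  assert (Hpre : preorder a le) by exact (a_preorder SU).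
  apply NNPP. intro B.
  assert (Ex : exists r, r ∈ a /\ opr r p ∈ le /\ forall r', r' ∈ a -> opr r' r ∈ le ->
    ~ frc V a le (env [chk a P; chk a le; chk a q; gname a]) (forced_form 4) r').
  { apply NNPP. intro B'. apply B. refine (proj2 (@frc_dense V a le Hpre (forced_form 4) _ p Hp _)).
    intros r Hr L. apply NNPP. intro B2. apply B'. exists r. split; auto. split; auto. intros r' Hr' L' K. apply B2. eauto. }
  destruct Ex as (r & Hr & _ & No).
  set (seeds := [P; le; N; q; r]).
  assert (Vs : forall x, List.In x seeds -> V x).
  { intros x [<-|[<-|[<-|[<-|[<-|[]]]]]]; try apply SU; [exact (Vq SU)|exact (W_mem Z (W_a SU) Hr)]. }
  set (C := hull V seeds).
  pose proof (hull_ctx Z seeds Vs) as X. fold C in X.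
  pose proof (@hull_elem V Z seeds) as elem. fold C in elem.
  assert (Cs : forall x, List.In x seeds -> C x) by (intros; now apply hull_seeds).
  assert (C0 : C zempty) by apply hull_empty.
  assert (CP : C P) by (apply Cs; cbn; auto). assert (Cle : C le) by (apply Cs; cbn; auto).
  assert (CN : C N) by (apply Cs; cbn; auto). assert (Cq : C q) by (apply Cs; cbn; auto 6).
  assert (Cr : C r) by (apply Cs; cbn; auto 7).
  destruct (hull_enum V seeds) as (u & Hu). fold C in Hu.
  pose proof (collapse_setup Z X elem SU C0 CP Cle CN Cq) as SW.
  pose proof (collapse_below Z X elem P N CP CN) as EB.
  destruct (@rasiowa_sikorski (collapse_class C) (fun n => collapse C (u n)) (collapse C a) (collapse C le) (collapse C r)) as (G & HG & Gr).
  - intros x (y & Cy & ->). destruct (Hu y Cy) as (n & <-). eauto.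
  - rewrite EB. exact (a_preorder SW).
  - apply mem_collapse. eauto.
  - destruct (lifted_forces Z X elem SU C0 CP Cle CN Cq HG) as (s & Hs & K).
    apply (@mem_lifted V C Z X elem P N CP CN G) in Hs. destruct Hs as (Cs' & Has & Gs). apply mem_sep in Gs. destruct Gs as [_ Gs].
    destruct HG as (GA & _ & _ & U & _). destruct (U _ _ Gr Gs) as (t & Ht & L1 & L2).
    apply GA in Ht. apply mem_collapse in Ht. destruct Ht as (t' & Ht & Ct & ->). rewrite rel_opr in L1, L2.
    destruct (collapse_opr Z X elem t' r Ct Cr) as [C1 E1], (collapse_opr Z X elem t' s Ct Cs') as [C2 E2].
    rewrite <- E1 in L1. rewrite <- E2 in L2. apply (collapse_mem Z X elem _ _ C1 Cle) in L1. apply (collapse_mem Z X elem _ _ C2 Cle) in L2.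
    apply (No t'); auto. apply (@frc_mono V a le Hpre _ _ s); auto.
Qed.
End Forced.

(** * Sets hereditarily smaller than a regular cardinal *)

Section Regular.
Variable V : class.
Hypothesis Z : zf V.
Hypothesis AC : zchoice V.
Variable k : zset.
Hypothesis Vk : V k.
Hypothesis Rk : Regular V k.
Let Ok : ord k := proj1 (proj1 Rk).

Definition small (x : zset) : Prop := exists α, α ∈ k /\ Inj V x α.

Lemma small_sub x y : V x -> subset x y -> small y -> small x.
Proof. intros Vx H (α & Hα & K). exists α. split; auto. eapply Inj_trans; eauto. now apply Inj_sub. Qed.

Lemma small_sing x : V x -> small (sing x).
Proof.
  intro Vx. pose proof (zf_ctx Z) as X. exists (num 1). split; [apply Rk, num_in_omega|].
  apply (@Inj_TD V Z (fun _ => zempty)); [pose proof (zf_empty Z); ds|now apply W_sing| |].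
  - intros. cbn. apply mem_suc. auto.
  - intros y z Hy Hz _. apply mem_sing in Hy, Hz. congruence.
Qed.

(** Regularity is applied to the map sending the index of [x] in α to the value of [h] at [x]. *)
Lemma small_bounded a h : V a -> V h -> small a -> exists β, β ∈ k /\ forall x, x ∈ a -> ap h x ∈ k -> ap h x ∈ β.
Proof.
  intros Va Vh (α & Hα & Hi). pose proof (zf_ctx Z) as X. apply Inj_iff in Hi. destruct Hi as (j & Vj & Fj & j1 & j2).
  assert (Vα := W_mem Z Vk Hα).
  (* The union has at most one member, the value at the element with index [i]; the result is 0 when
     there is no such value in [k]. *)
  set (F := fun i => Un (sep k (fun ξ => exists x, x ∈ a /\ ap j x = i /\ ap h x = ξ))).
  assert (TF : TD V V (fun e => F (e 0))).
  { unfold F. apply (TD_ap1 X Un (TD_Un Z X)).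
    apply (TD_intro X) with (Phi := fun ξ e => ξ ∈ k /\ exists x, x ∈ a /\ ap j x = e 0 /\ ap h x = ξ).
    - intros e He. pose proof (He 0). apply (W_sep Z); auto. ds.
    - intros. apply mem_sep.
    - ds. }
  assert (F1 : forall x, x ∈ a -> ap h x ∈ k -> F (ap j x) = ap h x).
  { intros x Hx Hk. apply zset_ext. intro z. unfold F. rewrite mem_Un. split.
    - intros (ξ & Hξ & Hz). apply mem_sep in Hξ. destruct Hξ as (_ & x' & Hx' & E & <-). now apply j2 in E; [subst| |].
    - intro Hz. exists (ap h x). split; auto. apply mem_sep. eauto. }
  destruct (proj2 (proj2 Rk) α Hα (graph F α)) as (β & Hβ & K).
  - now apply W_graph_TD.
  - apply isfun_func. split; [apply func_graph|]. intros i v Hv. apply mem_graph in Hv. destruct Hv as [Hi ->].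
    destruct (classic (exists x, x ∈ a /\ ap j x = i /\ ap h x ∈ k)) as [(x & Hx & <- & Hk)|N].
    + rewrite F1; auto.
    + replace (F i) with zempty; [apply Rk, (num_in_omega 0)|]. apply zset_ext. intro z. split; intro Hz.
      * now apply not_mem_empty in Hz.
      * unfold F in Hz. apply mem_Un in Hz. destruct Hz as (ξ & Hξ & _). apply mem_sep in Hξ.
        destruct Hξ as (Hξ & x & Hx & E & <-). exfalso. eauto.
  - exists β. split; auto. intros x Hx Hk. rewrite <- F1 by auto. apply (K (ap j x)). apply mem_graph. eauto.
Qed.

(** If the order type θ of the union reached [k], the positions below [k] occupied by either part
    would be bounded in [k] by regularity, and the larger bound would be a position occupied by
    neither. *)
Lemma small_union a b : V a -> V b -> small a -> small b -> small (union2 a b).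
Proof.
  intros Va Vb Sa Sb. assert (VT : V (union2 a b)) by now apply W_union2.
  destruct (@well_order V Z AC _ VT) as (θ & h & Vθ & Oθ & Vh & Fh & h1 & h2 & h3).
  destruct (classic (θ ∈ k)) as [Hθ|N].
  - exists θ. split; auto. apply Inj_iff. exists h. auto.
  - exfalso. destruct (small_bounded Va Vh Sa) as (β & Hβ & K1). destruct (small_bounded Vb Vh Sb) as (γ & Hγ & K2).
    assert (Hm : exists m, m ∈ k /\ subset β m /\ subset γ m).
    { destruct (ord_cmp (ord_mem Ok Hβ) (ord_mem Ok Hγ)) as [L|[->|L]].
      - exists γ. split; auto. split; [|intro; auto]. exact (proj1 (ord_mem Ok Hγ) β L).
      - exists γ. split; auto. split; intro; auto.
      - exists β. split; auto. split; [intro; auto|]. exact (proj1 (ord_mem Ok Hβ) γ L). }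
    destruct Hm as (m & Hm & S1 & S2). destruct (h3 m) as (x & Hx & E); [apply (ord_le Ok Oθ N); auto|].
    apply (@mem_irrefl m). rewrite <- E in Hm. apply mem_union2 in Hx. destruct Hx as [Hx|Hx].
    + apply S1. rewrite <- E at 1. auto.
    + apply S2. rewrite <- E at 1. auto.
Qed.

(* The order of [P] is a set of pairs, which [N] sees only if they are in H(χ). *)
Lemma Hlt_opr x y : V x -> V y -> Hlt V x k -> Hlt V y k -> Hlt V (opr x y) k.
Proof.
  intros Vx Vy Hx Hy. change (small (tc (opr x y))).
  assert (Vsx : V (sing x)) by now apply W_sing. assert (Vp : V (upair x y)) by now apply W_upair.
  assert (Vsy : V (sing y)) by now apply W_sing. assert (Vtx : V (tc x)) by now apply W_tc. assert (Vty : V (tc y)) by now apply W_tc.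
  set (t := union2 (union2 (sing (sing x)) (sing (upair x y))) (union2 (union2 (sing x) (tc x)) (union2 (sing y) (tc y)))).
  assert (Vt : V t) by (repeat apply W_union2; auto; now apply W_sing).
  apply (@small_sub _ t).
  - apply (W_tc Z). now apply W_opr.
  - apply tc_least.
    + intros z Hz. unfold t. rewrite !mem_union2, !mem_sing. unfold opr in Hz. apply mem_upair in Hz. tauto.
    + intros z Hz w Hw. unfold t in *. rewrite !mem_union2, !mem_sing in *.
      destruct Hz as [[-> | ->]|[[-> |Hz]|[-> |Hz]]].
      * apply mem_sing in Hw. subst. auto.
      * apply mem_upair in Hw. tauto.
      * assert (w ∈ tc x) by now apply tc_sub. auto.
      * assert (w ∈ tc x) by exact (@tc_trans x z Hz w Hw). auto.
      * assert (w ∈ tc y) by now apply tc_sub. auto.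
      * assert (w ∈ tc y) by exact (@tc_trans y z Hz w Hw). auto.
  - repeat apply small_union; auto; try (repeat apply W_union2; auto; now apply W_sing); apply small_sing; auto.
Qed.
End Regular.

(** * Greatest lower bounds in an elementary submodel *)

Section Glb.
Variables P le : zset.
Let I : bool -> class := fun b x => if b then x ∈ P else x ∈ le.
Let neg (f : fml bool) := Imp f Bot.
Let conj f g := neg (Imp f (neg g)).
Let ex i f := neg (All i (neg f)).
(** [elementary_sub] concerns a language with predicates for [P] and [le], so the formulas here
    cannot be of type [bform]. *)
Let upr z x y := All 23 (conj (Imp (Mem 23 z) (Imp (neg (Equ 23 x)) (Equ 23 y))) (Imp (Imp (neg (Equ 23 x)) (Equ 23 y)) (Mem 23 z))).
Let ordered x y := ex 20 (conj (Prd false 20) (ex 21 (ex 22 (conj (upr 21 x x) (conj (upr 22 x y) (upr 20 21 22)))))).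
(* Variable 2 is the greatest lower bound of variables 0 and 1; variables 20 to 23 are bound. *)
Let glb := conj (Prd true 2) (conj (ordered 2 0) (conj (ordered 2 1)
  (All 3 (Imp (Prd true 3) (Imp (ordered 3 0) (Imp (ordered 3 1) (ordered 3 2))))))).

Variable M : class.
Hypothesis Mtr : transitive_class M.
Hypothesis Mle : forall z, z ∈ le -> M z.
Hypothesis MP : forall x, x ∈ P -> M x.

Let sat_conj W e f g : sat I W e (conj f g) <-> sat I W e f /\ sat I W e g.
Proof. cbn. tauto. Qed.
Let sat_ex W e i f : sat I W e (ex i f) <-> exists x, W x /\ sat I W (upd e i x) f.
Proof.
  cbn. split.
  - intro H. apply NNPP. intro B. apply H. intros x Wx K. eauto.
  - intros (x & Wx & H) K. exact (K x Wx H).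
Qed.
Let sat_upr e i j l : i < 23 -> j < 23 -> l < 23 -> M (e i) -> M (e j) -> M (e l) ->
  (sat I M e (upr i j l) <-> e i = upair (e j) (e l)).
Proof.
  intros Hi Hj Hl Mi Mj Ml. unfold upr. cbn [sat].
  assert (E : forall x m, m < 23 -> upd e 23 x m = e m) by (intros; now rewrite upd_lt).
  assert (E' : forall x, upd e 23 x 23 = x) by (intro; apply upd_same). split.
  - intro H. apply zset_ext. intro z. rewrite mem_upair. split; intro Hz.
    + specialize (H z (Mtr Mi Hz)). rewrite sat_conj in H. cbn [sat neg] in H. rewrite E', !E in H by auto.
      apply NNPP. tauto.
    + assert (Mz : M z) by (destruct Hz as [-> | ->]; auto).
      specialize (H z Mz). rewrite sat_conj in H. cbn [sat neg] in H. rewrite E', !E in H by auto.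
      apply H. tauto.
  - intros H x Mx. rewrite sat_conj. cbn [sat neg]. rewrite E', !E by auto. rewrite H, mem_upair.
    split; [tauto|]. intro K. apply NNPP. tauto.
Qed.
Let sat_ordered e i j : i < 20 -> j < 20 -> M (e i) -> M (e j) -> (sat I M e (ordered i j) <-> opr (e i) (e j) ∈ le).
Proof.
  intros Hi Hj Mi Mj. unfold ordered. rewrite sat_ex. split.
  - intros (u & Mu & H). rewrite sat_conj, sat_ex in H. destruct H as (H & s & Ms & H'). rewrite sat_ex in H'.
    destruct H' as (t & Mt & H'). rewrite !sat_conj in H'. rewrite !sat_upr in H' by (upds; auto with arith; lia).
    cbn [sat I] in H. rewrite upd_same in H. revert H'. upds. intros (-> & -> & ->). exact H.
  - intro H. assert (Mo := Mle H). exists (opr (e i) (e j)). split; auto. rewrite sat_conj. split; [cbn [sat I]; now rewrite upd_same|].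
    assert (Ms : M (sing (e i))) by (apply (Mtr Mo); unfold opr; apply mem_upair; auto).
    assert (Mt : M (upair (e i) (e j))) by (apply (Mtr Mo); unfold opr; apply mem_upair; auto).
    rewrite sat_ex. exists (sing (e i)). split; auto. rewrite sat_ex. exists (upair (e i) (e j)). split; auto.
    rewrite !sat_conj. rewrite !sat_upr by (upds; auto; lia). upds. auto.
Qed.
Let sat_glb e : M (e 0) -> M (e 1) -> M (e 2) -> (sat I M e glb <-> isglb P le (e 2) (e 0) (e 1)).
Proof.
  intros M0 M1 M2. unfold glb, isglb. rewrite !sat_conj, !sat_ordered by (auto; lia). cbn [sat I].
  split; intros (H1 & H2 & H3 & H4); split; auto; split; auto; split; auto.
  - intros u Pu. specialize (H4 u (MP Pu)). pose proof (MP Pu). rewrite !sat_ordered in H4 by (upds; auto; lia). revert H4. upds. auto.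
  - intros u Mu. rewrite !sat_ordered by (upds; auto; lia). upds. auto.
Qed.

(** [M] is transitive and contains [P] and the pairs of [le], hence the formula has its intended
    meaning in [M], and elementarity brings a solution into [N]. *)
Lemma elementary_glb N x y : elementary I N M -> N x -> N y -> (exists w, isglb P le w x y) ->
  exists w, N w /\ isglb P le w x y.
Proof.
  intros (NM & _ & El) Nx Ny (w & Hw).
  set (e := upd (fun _ => x) 1 y).
  assert (He : forall i, N (e i)) by (intro i; unfold e, upd; now destruct (Nat.eqb i 1)).
  assert (He2 : forall w, N w -> forall i, N (upd e 2 w i)) by (intros v Nv i; unfold upd at 1; now destruct (Nat.eqb i 2)).
  assert (K : sat I M e (ex 2 glb)).
  { apply sat_ex. exists w. assert (M w) by apply (MP (proj1 Hw)). split; auto. apply sat_glb; cbn; auto. }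
  apply El, sat_ex in K; auto. destruct K as (v & Nv & K). exists v. split; auto. apply El in K; auto.
  apply sat_glb in K; cbn; auto.
Qed.
End Glb.

Theorem theorem4p3 :
  forall (V : class) (P le lam chi Hchi N q : zset),
  transitive_class V -> ZFC V ->
  V P -> V le -> V lam -> V chi -> V Hchi -> V N ->
  poset P le -> has_glbs P le -> star P le ->
  Sat V [lam; P] (is_lambda 0 1) ->
  Sat V [chi] (regular_cardinal 0) ->
  Sat V [lam; chi] (sub 0 1) ->
  Sat V [Hchi; chi] (is_H 0 1) ->
  elementary_sub N Hchi P le ->
  Sat V [P; le] (has_usg_stationary 0 1) ->
  Sat V [N; P; le; q] (universal_strongly_generic 0 1 2 3) ->
  (* N ∩ P forces that (P/q)/G has universal strongly generic conditions on a
     stationary set *)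
  (forall P' le' q' G' : zset,
     check (restr N P) P P' -> check (restr N P) le le' ->
     check (restr N P) q q' -> gen_name (restr N P) G' ->
     Forced V (restr N P) le [P'; le'; q'; G']
       (fAll (fun Q => fImp (is_quotient Q 0 1 2 3) (has_usg_stationary Q 1)))) /\
  (forall H : class,
     generic V (fun p => p ∈ P) le H -> H q ->
     let HN : class := fun p => H p /\ p ∈ N in
     generic V (restr N P) le HN /\
     (exists K : class,
        generic (extension V HN) (quotient P le q HN) le K /\
        (forall x, extension V H x <-> extension (extension V HN) K x)) /\
     omega1_approximation (extension V HN) (extension V H)).
Proof.
  intros V P le lam chi Hchi N q Vtr ZV VP Vle Vlam Vchi VHchi VN Po Gl St Hlam Hchir Hsub HH El Hst Hq.
  pose proof (zfc_zf Vtr ZV) as Z. assert (AC : zchoice V) by exact (zfc_choice ZV).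
  assert (HE : forall xs, (forall x, List.In x xs -> V x) -> in_class V (env xs)).
  { intros xs H i. unfold env. destruct (nth_in_or_default i xs zempty) as [K|K]; [now apply H|]. rewrite K. apply Z. }
  unfold Sat in *. cbn [length] in *.
  assert (Hqq : V q -> USG V N P le q).
  { intro Vq. apply (psat_usg Z (e := env [N; P; le; q])) in Hq; auto; try lia. apply HE. cbn. intuition congruence. }
  (* The translation lemmas require parameters in V, so membership of [q] in [P] is first read off
     the raw formula. *)
  assert (Vq : V q).
  { assert (Hq' := Hq). apply (@psat_and V _ _ _ _ _ _ (iff_refl _) (iff_refl _)) in Hq'. destruct Hq' as [Hq' _].
    apply (@psat_and V _ _ _ _ _ _ (iff_refl _) (iff_refl _)) in Hq'. destruct Hq' as [Hq' _].
    exact (W_mem Z VP Hq'). }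
  apply (psat_is_lambda Z (e := env [lam; P])) in Hlam; try lia; [|apply HE; cbn; intuition congruence].
  apply (psat_regular_cardinal Z (e := env [chi])) in Hchir; try lia; [|apply HE; cbn; intuition congruence].
  apply (psat_sub Z (e := env [lam; chi])) in Hsub; try lia; [|apply HE; cbn; intuition congruence].
  apply (psat_is_H Z (e := env [Hchi; chi])) in HH; try lia; [|apply HE; cbn; intuition congruence].
  apply (psat_has_usg Z (e := env [P; le])) in Hst; try lia; [|apply HE; cbn; intuition congruence].
  cbn in Hlam, Hchir, Hsub, HH, Hst.
  assert (SU : setup V P le N q).
  { destruct Po as (Po1 & Po2 & Po3 & _).
    assert (Cc : forall x y, Cmp P le x y <-> compatible P le x y) by (intros; symmetry; apply compatible_Cmp).
    assert (Gg : forall w x y, isglb P le w x y <-> is_glb P le w x y).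
    { intros. unfold isglb, is_glb. rewrite !rel_opr. split; intros (H1 & H2 & H3 & H4); repeat split; auto; intros u; specialize (H4 u); rewrite !rel_opr in *; auto. }
    assert (Dom : forall x y, opr x y ∈ le -> x ∈ P /\ y ∈ P).
    { intros x y H. destruct (Po1 _ H) as (x' & y' & Hx & Hy & E). apply opair_opr in E. apply opr_inj in E. destruct E as [-> ->]. auto. }
    assert (DomC : forall x y, Cmp P le x y -> x ∈ P /\ y ∈ P).
    { intros x y (z & _ & H1 & H2). split; [apply (Dom _ _ H1)|apply (Dom _ _ H2)]. }
    assert (Glb : forall x y, Cmp P le x y -> exists w, isglb P le w x y).
    { intros x y H. destruct (DomC _ _ H) as [Px Py]. destruct (Gl x y) as (w & Hw); auto; [now apply Cc|]. exists w. now apply Gg. }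
    (* [P] is contained in H(λ), and λ is at most χ. *)
    assert (PH : forall x, x ∈ P -> Hlt V x chi).
    { intros x Hx. destruct Hlam as (_ & S & _). destruct (S x Hx) as (α & Hα & K). exists α. auto. }
    apply Build_setup; auto.
    - intros x Hx. apply rel_opr. auto.
    - intros x y z. rewrite <- !rel_opr. apply Po3.
    - intros x y z K1 K2 K3 w Hw. destruct (DomC _ _ K1), (DomC _ _ K2). rewrite Cc in *. apply Gg in Hw.
      now apply (St x y z) with (w := w).
    (* The three side conditions, in order: H(χ) is transitive, it contains the pairs of [le], and
       it contains the conditions. *)
    - intros x y Nx Ny H. apply (@elementary_glb P le (fun x => x ∈ Hchi)) with (N := fun x => x ∈ N); auto.
      + intros u v Hv Hu. assert (Vv := W_mem Z VHchi Hv). assert (Vu := W_mem Z Vv Hu).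
        apply HH; auto. apply HH in Hv; auto. destruct Hv as (α & Hα & K). exists α. split; auto.
        eapply Inj_trans; eauto; [now apply W_tc|]. apply Inj_sub; auto; [now apply W_tc|].
        apply tc_mono. now apply tc_sub.
      + intros z Hz. destruct (Po1 _ Hz) as (u & v & Pu & Pv & E). apply opair_opr in E. subst z.
        apply HH; [exact (W_mem Z Vle Hz)|]. apply (@Hlt_opr V Z AC chi Vchi Hchir); auto; [exact (W_mem Z VP Pu)|exact (W_mem Z VP Pv)].
      + intros u Pu. apply HH; auto. exact (W_mem Z VP Pu). }
  split.
  - exact (forces_quotient_usg SU).
  - intros H HH' Hq'. exact (generic_factor SU HH' Hq').
Qed.
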